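(* For each integer $k\ge2$ let $c_k>0$ be implicitly defined by $$\inf_{T>0}\min\Big\{T+c_k\int_0^T|v^{(k)}|^2\,dt:\ v\in H^k(0,T),\ v(0)=0,\ v(T)=1,\ v^{(\ell)}(0)=v^{(\ell)}(T)=0\text{ for }\ell\in\{1,\dots,k-1\}\Big\}=1,$$ and let $f_\varepsilon(z)=\min\{z^2,\frac1\varepsilon\}$. Then there exists a family of positive numbers $\overline\varepsilon_k$ tending to $0$ as $k\to+\infty$ such that if $0<\varepsilon_k\le\overline\varepsilon_k$ for all $k$, then the functionals $G_k$ ($k\ge3$) defined by $$G_k(u)=\int_0^1f_{\varepsilon_k}(u'')\,dt+c_{k-1}\,\varepsilon_k^{2k-3}\int_0^1|u^{(k)}|^2\,dt$$ on $H^k(0,1)$ $\Gamma$-converge as $k\to+\infty$, with respect to the $L^2(0,1)$-convergence, to the functional $$F^{BZ}(u)=\int_0^1|u''|^2\,dt+2\,\#(S(u))+\#(S(u')\setminus S(u))$$ defined on piecewise-$H^2$ functions.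
   Context: A function $u$ on $(0,1)$ is piecewise-$H^2$ if there is a finite partition of $(0,1)$ into intervals such that $u$ is $H^2$ on each of them. For such $u$, $u'$ and $u''$ are the almost-everywhere defined first and second weak derivatives, and $S(u)$, $S(u')$ are the sets of discontinuity points of $u$ and $u'$ respectively. Functionals are understood to be extended to $L^2(0,1)$ by $+\infty$ outside their stated domain. *)

(* Defs.v *)
From HB Require Import structures.
From mathcomp Require Import all_boot all_order all_algebra.
From mathcomp Require Import all_classical all_reals all_analysis.

Set Implicit Arguments.
Unset Strict Implicit.
Unset Printing Implicit Defensive.

Import Order.TTheory GRing.Theory Num.Theory.
Import numFieldNormedType.Exports.

Local Open Scope classical_set_scope.
Local Open Scope ring_scope.

(* Elements of L^2(a, b) are represented by functions R -> R; every functional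
   below depends only on the almost everywhere class of its argument on (a, b). *)

Section sobolev.
Context {R : realType}.
Implicit Types (a b : R) (u v g h phi : R -> R) (n k : nat).

(* u \_ D is the extension of u|_D by zero. *)
Definition L2 a b : {pred R -> R} :=
  [pred u | u \_ `]a, b[%classic \in Lfun (@lebesgue_measure R) 2%:E].

Definition test_function a b phi :=
  [/\ forall n x, derivable (derive1n n phi) x 1,
      compact (closure [set x | phi x != 0]) &
      closure [set x | phi x != 0] `<=` `]a, b[%classic].

Definition is_weak_derivative a b n u g :=
  g \in L2 a b /\ forall phi, test_function a b phi ->
    \int[lebesgue_measure]_(x in `]a, b[%classic) (u x * derive1n n phi x) =
    (-1) ^+ n * \int[lebesgue_measure]_(x in `]a, b[%classic) (g x * phi x).

Definition sobolev a b k u :=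
  u \in L2 a b /\
  forall j, (j <= k)%N -> exists g, is_weak_derivative a b j u g.

(* A choice of representative; the default value 0 is only taken when u has no
   n-th weak derivative in L^2(a, b). *)
Definition weak_derivative a b n u : R -> R :=
  xget (cst 0) [set g | is_weak_derivative a b n u g].

Definition continuous_representative a b g h :=
  {within `[a, b]%classic, continuous h} /\
  g = h %[ae (@lebesgue_measure R) in `]a, b[%classic].

End sobolev.

Section cell_problem.
Context {R : realType}.
Implicit Types (k : nat) (c T : R) (v : R -> R).

(* Boundary values are those of the continuous representatives of v and of its
   derivatives of order < k. *)
Definition admissible k T v :=
  sobolev 0 T k v /\
  forall l, (l < k)%N -> exists h,
    [/\ continuous_representative 0 T (weak_derivative 0 T l v) h,
        h 0 = 0 & h T = if l == 0%N then 1 else 0].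

Definition cell_energy k c T v : \bar R :=
  (T%:E + c%:E *
    \int[lebesgue_measure]_(x in `]0%R, T[%classic)
      ((weak_derivative 0 T k v x) ^+ 2)%:E)%E.

Definition is_minimum (A : set (\bar R)) (m : \bar R) := A m /\ lbound A m.

Definition solves_cell_problem k c :=
  exists2 m : R -> \bar R,
    forall T, 0 < T ->
      is_minimum [set cell_energy k c T v | v in admissible k T] (m T) &
    ereal_inf [set m T | T in [set T | 0 < T]] = 1%E.

End cell_problem.

Section functionals.
Context {R : realType}.
Implicit Types (u g : R -> R) (s : seq R) (k n : nat) (e z : R).

Definition truncated_square e z : R := Num.min (z ^+ 2) e^-1.

Definition G (c eps : nat -> R) k u : \bar R :=
  if `[< sobolev 0 1 k u >] then
    (\int[lebesgue_measure]_(x in `]0%R, 1%R[%classic)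
       (truncated_square (eps k) (weak_derivative 0 1 2 u x))%:E +
     (c k.-1 * eps k ^+ (2 * k - 3))%:E *
       \int[lebesgue_measure]_(x in `]0%R, 1%R[%classic)
         ((weak_derivative 0 1 k u x) ^+ 2)%:E)%E
  else +oo%E.

(* 0 :: s lists the endpoints of the pieces, the i-th piece being the open
   interval (nth 0 (0 :: s) i, nth 0 s i). *)
Definition pw_H2_on s u :=
  itv_partition 0 1 s /\
  forall i, (i < size s)%N -> sobolev (nth 0 (0 :: s) i) (nth 0 s i) 2 u.

Definition piecewise_H2 u := exists s, pw_H2_on s u.

Definition is_pw_derivative n u g :=
  exists2 s, pw_H2_on s u &
    forall i, (i < size s)%N ->
      is_weak_derivative (nth 0 (0 :: s) i) (nth 0 s i) n u g.

(* The derivative on the pieces: no Dirac masses at the jump points. It does not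
   depend on the partition, up to null sets. *)
Definition pw_derivative n u : R -> R :=
  xget (cst 0) [set g | is_pw_derivative n u g].

(* Points of (0, 1) at which no almost everywhere representative of u is
   continuous; for a piecewise H^1 function these are the points where the two
   one-sided limits of the piecewise continuous representative differ. *)
Definition disc u : set R :=
  [set x | 0 < x < 1 /\
    ~ exists w : R -> R,
        u = w %[ae (@lebesgue_measure R) in `]0%R, 1%R[%classic] /\
        {for x, continuous w}].

Definition FBZ u : \bar R :=
  if `[< piecewise_H2 u >] then
    (\int[lebesgue_measure]_(x in `]0%R, 1%R[%classic)
       ((pw_derivative 2 u x) ^+ 2)%:E +
     2%:E * counting (disc u) +
     counting (disc (pw_derivative 1 u) `\` disc u))%E
  else +oo%E.

Definition L2_cvg (u_ : nat -> R -> R) u :=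
  ('N[@lebesgue_measure R]_2%:E[EFin \o ((u_ k \- u) \_ `]0, 1[%classic)%R])%E
    @[k --> \oo] --> 0%E.

Definition Gamma_cvg_L2 (F_ : nat -> (R -> R) -> \bar R)
    (F : (R -> R) -> \bar R) :=
  forall u, u \in L2 0 1 ->
    (forall u_ : nat -> R -> R, (forall k, u_ k \in L2 0 1) -> L2_cvg u_ u ->
      (F u <= limn_einf (fun k => F_ k (u_ k)))%E) /\
    (exists u_ : nat -> R -> R,
      [/\ forall k, u_ k \in L2 0 1, L2_cvg u_ u &
          (limn_esup (fun k => F_ k (u_ k)) <= F u)%E]).

End functionals.

(* Main.v *)
(* Lower bound. On [0, 1] cut into cells of length h << eps_k, a cell on which
   |u''| <= eps_k^(-1/2) at 2^(k-3) spaced points satisfies bounds on u'', ..., u^(k-1) (mean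
   value theorem and the bound on u^(k)); any other cell is almost filled by the set E where
   |u''| > eps_k^(-1/2), which has measure O(eps_k). In a run of the latter cells u' performs
   a transition between nearly affine functions. By the cell problem, the increment of u'
   over a run shorter than (1 - tau) eps_k is negligible for large k, since c_{k-1} times the
   minimal transition energy on (0, 1) dominates T^(2k-3) for every T < 1; so only the runs
   longer than (1 - tau) eps_k matter, and each contributes almost 1 to the energy. Hence u is
   uniformly close to p plus a sum of N ramps z (x - y)_+, with p'' = u'' outside E and p'' = 0
   on E, and (1 - tau)^2 N + |p''|^2 is at most the energy. For a fixed k this
   holds once eps_k is small, which defines the thresholds. Along an ultrafilter the
   p'' converge weakly and so do the positions y; a limit discontinuity of u' needs at
   least one ramp, and one of u at least two ramps, whose slopes tend to infinity.

   Upper bound. Approximate the absolutely continuous part of u'' by Kantorovich polynomials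
   of degree <= k - 3, whose (k-2)-nd derivative vanishes. Replace each kink by an optimal
   polynomial transition of width eps_k and each jump by two kinks at distance
   spread = (k - 2)^(-1/4); as c_{k-1} times the minimal transition energy is O(1/k), the
   term with u^(k) vanishes, and every kink costs 1. *)

Require Import Defs.
From HB Require Import structures.
From mathcomp Require Import all_boot all_order all_algebra.
From mathcomp Require Import all_classical all_reals all_analysis.
From mathcomp Require Import measurable_realfun ring lra.

Set Implicit Arguments.
Unset Strict Implicit.
Unset Printing Implicit Defensive.

Import Order.TTheory GRing.Theory Num.Theory.
Import numFieldNormedType.Exports.

Local Open Scope classical_set_scope.
Local Open Scope ring_scope.

(** * Square integrable functions and integrals over intervals *)

Section calculus.
Context {R : realType}.
Notation mu := (@lebesgue_measure R).
Implicit Types (a b c x y t : R) (f g h : R -> R).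

(** The exponent 2k - 3 makes the cost of a kink independent of eps. With n = k - 2, a unit change
    of slope over a width T eps pays T for the set where u'' is large and at least c_{k-1} [acoef n]
    / T^(2n+1) for the top derivative. That the infimum of the cell problem is 1 puts c_{k-1}
    [acoef n] above (1 - T) T^(2n+1) for every T > 0 and below 1/(n+1). As k grows, the penalty thus
    rules out widths below eps and becomes free at width eps. The obstacle is that the interpolation
    constants depend on k in an uncontrolled way. All estimates between u'' and u^(k) are therefore
    made at fixed k, where a small eps_k absorbs the constants; only c_{k-1} [acoef n] is followed
    as k grows. The slopes of the ramps need not stay bounded. What is controlled is the affine
    function on each interval between limit positions: it converges in L^1, and its coefficients are
    linear in its integrals. A ramp alone at a node then has a convergent slope and leaves no jump;
    hence a jump costs 2. *)

Definition locint f :=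
  forall a b, mu.-integrable `[a, b] (EFin \o f).

(* Local square integrability on the whole line, not only on (0, 1). *)
Definition l2 f := measurable_fun [set: measurableTypeR R] f /\ locint (fun x => f x ^+ 2).

Definition Int a b f := \int[mu]_(x in `[a, b]) f x.

Lemma eq_locint f g : f =1 g -> locint f -> locint g.
Proof. by move=> /funext ->. Qed.

Lemma locintD f g : locint f -> locint g -> locint (fun x => f x + g x).
Proof.
move=> lf lg a b.
have mab : measurable (`[a, b] : set (measurableTypeR R)) by exact: measurable_itv.
exact: (integrableD mab (lf a b) (lg a b)).
Qed.

Lemma locintZ c f : locint f -> locint (fun x => c * f x).
Proof.
move=> lf a b; 
have mab : measurable (`[a, b] : set (measurableTypeR R)) by exact: measurable_itv.
exact: (integrableZl mab c (lf a b)).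
Qed.

Lemma locintB f g : locint f -> locint g -> locint (fun x => f x - g x).
Proof.
move=> lf lg; apply: eq_locint (locintD lf (locintZ (-1) lg)) => x.
by rewrite mulN1r.
Qed.

Lemma locint_bounded f M : measurable_fun [set: measurableTypeR R] f -> (forall x, `|f x| <= M) ->
  locint f.
Proof.
move=> mf fM a b; apply: measurable_bounded_integrable => //.
- by rewrite /= lebesgue_measure_itv/=; case: ifP => _; rewrite ?ltry.
- exact: measurable_funTS.
- exists M; split; first exact: num_real.
  by move=> N MN x _ /=; rewrite (le_trans (fM x))// ltW.
Qed.

Lemma locint_le f g : measurable_fun [set: measurableTypeR R] f -> locint g ->
  (forall x, `|f x| <= g x) -> locint f.
Proof.
move=> mf lg fg a b; apply: le_integrable (lg a b) => //.
  by apply/measurable_EFinP; exact: measurable_funTS.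
by move=> x _ /=; rewrite lee_fin (le_trans (fg x))// ler_norm.
Qed.

Lemma continuous_locint f : continuous f -> locint f.
Proof.
move=> cf a b; apply: continuous_compact_integrable; first exact: segment_compact.
exact: continuous_subspaceT.
Qed.

Lemma locint_cst c : locint (fun=> c).
Proof. by apply: continuous_locint => x; exact: cvg_cst. Qed.

Lemma l2_meas f : l2 f -> measurable_fun [set: measurableTypeR R] f. Proof. by case. Qed.

Lemma l2_mul f g : l2 f -> l2 g -> locint (fun x => f x * g x).
Proof.
move=> [mf f2] [mg g2]; apply: locint_le (locintD f2 g2) _.
  exact: measurable_funM.
move=> x; rewrite normrM -[f x ^+ 2]real_normK ?num_real//.
rewrite -[g x ^+ 2]real_normK ?num_real//.
have : 0 <= (`|f x| - `|g x|) ^+ 2 by exact: sqr_ge0.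
have := normr_ge0 (f x); have := normr_ge0 (g x); nra.
Qed.

Lemma continuous_l2 f : continuous f -> l2 f.
Proof.
move=> cf; split; first exact: continuous_measurable_fun.
apply: continuous_locint => x; apply: cvgM; exact: cf.
Qed.

Lemma l2_cst c : l2 (fun=> c).
Proof. by apply: continuous_l2 => x; exact: cvg_cst. Qed.

Lemma l2_locint f : l2 f -> locint f.
Proof.
move=> l2f; apply: eq_locint (l2_mul l2f (l2_cst 1)) => x; exact: mulr1.
Qed.

Lemma l2Z c f : l2 f -> l2 (fun x => c * f x).
Proof.
move=> [mf f2]; split; first exact: measurable_funM.
by apply: eq_locint (locintZ (c ^+ 2) f2) => x; rewrite exprMn.
Qed.

Lemma l2D f g : l2 f -> l2 g -> l2 (fun x => f x + g x).
Proof.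
move=> lf lg; have lfg := l2_mul lf lg; case: lf lg => mf f2 [mg g2].
split; first exact: measurable_funD.
apply: eq_locint (locintD f2 (locintD (locintZ 2 lfg) g2)) => x.
ring.
Qed.

Lemma l2B f g : l2 f -> l2 g -> l2 (fun x => f x - g x).
Proof.
move=> lf lg; have := l2D lf (l2Z (-1) lg).
by congr l2; apply/funext => x; rewrite mulN1r.
Qed.

Lemma l2_sum (I : Type) (s : seq I) (F : I -> R -> R) :
  (forall i, l2 (F i)) -> l2 (fun x => \sum_(i <- s) F i x).
Proof.
move=> lF; elim: s => [|i s IH].
  by have := l2_cst 0; congr l2; apply/funext => x; rewrite big_nil.
have := l2D (lF i) IH; congr l2; apply/funext => x; rewrite big_cons//.
Qed.

Lemma l2_restrict f (D : set R) : measurable D -> l2 f -> l2 (f \_ D).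
Proof.
move=> mD [mf f2]; have mfD : measurable_fun [set: measurableTypeR R] (f \_ D).
  by apply/(measurable_restrictT _ _).1 => //; exact: measurable_funTS.
split => //; apply: locint_le f2 _; first exact: measurable_funX.
move=> x; rewrite patchE; case: ifP => _; rewrite ?expr0n/= ?normr0 ?sqr_ge0//.
by rewrite ger0_norm ?sqr_ge0.
Qed.

Lemma l2_bounded_mul f g M : l2 f -> measurable_fun [set: measurableTypeR R] g ->
  (forall x, `|g x| <= M) -> l2 (fun x => g x * f x).
Proof.
move=> [mf f2] mg gM; split; first exact: measurable_funM.
apply: locint_le (locintZ (M ^+ 2) f2) _.
  by apply: measurable_funX; exact: measurable_funM.
move=> x; rewrite ger0_norm ?sqr_ge0// exprMn ler_wpM2r ?sqr_ge0//.
by rewrite -[g x ^+ 2]real_normK ?num_real// ler_sqr ?nnegrE ?(le_trans _ (gM x)).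
Qed.

Lemma IntD a b f g : locint f -> locint g ->
  Int a b (fun x => f x + g x) = Int a b f + Int a b g.
Proof. by move=> lf lg; exact: RintegralD. Qed.

Lemma IntB a b f g : locint f -> locint g ->
  Int a b (fun x => f x - g x) = Int a b f - Int a b g.
Proof. by move=> lf lg; exact: RintegralB. Qed.

Lemma IntZ a b c f : locint f -> Int a b (fun x => c * f x) = c * Int a b f.
Proof. by move=> lf; apply: RintegralZl => //; exact: lf. Qed.

Lemma eq_Int a b f g : (forall x, a <= x <= b -> f x = g x) ->
  Int a b f = Int a b g.
Proof. by move=> fg; apply: eq_Rintegral => x; rewrite inE/= in_itv/=; exact: fg. Qed.

Lemma Int_cst a b c : a <= b -> Int a b (fun=> c) = c * (b - a).
Proof.
move=> ab; rewrite /Int Rintegral_cst//.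
rewrite (_ : fine _ = fine (if (a%:E < b%:E)%E then (b%:E - a%:E)%E else 0%E)); last exact: congr1 (lebesgue_measure_itv `[a, b]).
rewrite lte_fin.
by move: ab; rewrite le_eqVlt => /predU1P[->|->]//; rewrite ltxx subrr.
Qed.

Lemma Int_xx a f : Int a a f = 0.
Proof. by rewrite /Int set_itv1 Rintegral_set1. Qed.

Lemma Int_chasles a b c f : locint f -> a <= b -> b <= c ->
  Int a c f = Int a b f + Int b c f.
Proof.
move=> lf ab bc; rewrite /Int.
have := @Rintegral_itvB R f (BLeft a) (BRight c) b (lf a c).
rewrite !bnd_simp => /(_ ab bc).
rewrite (@Rintegral_itv_obnd_cbnd _ b (BRight c)); last first.
  by apply: integrableS (lf b c) => //; exact: subset_itv_oc_cc.
by move=> <-; rewrite addrC subrK.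
Qed.

Lemma Int_le a b f g : locint f -> locint g ->
  (forall x, a <= x <= b -> f x <= g x) -> Int a b f <= Int a b g.
Proof.
by move=> lf lg fg; apply: le_Rintegral.
Qed.

Lemma Int_ge0 a b f : (forall x, a <= x <= b -> 0 <= f x) -> 0 <= Int a b f.
Proof.
by move=> f0; apply: Rintegral_ge0 => x /=; rewrite in_itv/=; exact: f0.
Qed.

Lemma locint_norm f : locint f -> locint (fun x => `|f x|).
Proof. by move=> lf a b; apply: (integrable_norm (lf a b)). Qed.

Lemma Int_norm a b f : locint f -> `|Int a b f| <= Int a b (fun x => `|f x|).
Proof. by move=> lf; apply: le_normr_Rintegral => //; exact: lf. Qed.

Lemma Int_norm_le a b f M : a <= b -> locint f ->
  (forall x, a <= x <= b -> `|f x| <= M) -> `|Int a b f| <= M * (b - a).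
Proof.
move=> ab lf fM; apply: (le_trans (Int_norm _ _ lf)).
rewrite -Int_cst//; apply: Int_le => //; [exact: locint_norm|exact: locint_cst].
Qed.

Lemma Int_sub a b c d f : locint f -> (forall x, 0 <= f x) -> a <= c -> c <= d -> d <= b ->
  Int c d f <= Int a b f.
Proof.
move=> lf f0 ac cd db; rewrite (@Int_chasles a c b)// ?(le_trans cd)//.
rewrite (@Int_chasles c d b)//.
have := @Int_ge0 a c f (fun x _ => f0 x); have := @Int_ge0 d b f (fun x _ => f0 x).
lra.
Qed.

Lemma discriminant_le (A B C : R) : 0 <= A -> 0 <= C ->
  (forall t : R, 0 <= A + 2 * t * B + t ^+ 2 * C) -> B ^+ 2 <= A * C.
Proof.
move=> A0 C0 H; have [C1|] := ltP 0 C.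
  have := H (- B / C).
  have -> : A + 2 * (- B / C) * B + (- B / C) ^+ 2 * C = (A * C - B ^+ 2) / C.
    by field; rewrite gt_eqF.
  by rewrite pmulr_lge0 ?invr_gt0// subr_ge0.
move=> C0'; have C0'' : C = 0 by apply/eqP; rewrite eq_le C0 C0'.
rewrite C0'' mulr0; have [->|B0] := eqVneq B 0; first by rewrite expr0n.
(* For C = 0 the form is affine in t, and this t gives it the value -1. *)
exfalso; have := H (- (A + 1) / (2 * B)).
have -> : A + 2 * (- (A + 1) / (2 * B)) * B + (- (A + 1) / (2 * B)) ^+ 2 * C = -1
  by rewrite C0''; field.
lra.
Qed.

Lemma Int_CS a b f g : l2 f -> l2 g ->
  Int a b (fun x => f x * g x) ^+ 2 <=
  Int a b (fun x => f x ^+ 2) * Int a b (fun x => g x ^+ 2).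
Proof.
move=> lf lg; apply: discriminant_le.
- by apply: Int_ge0 => x _; exact: sqr_ge0.
- by apply: Int_ge0 => x _; exact: sqr_ge0.
move=> t; rewrite -[2 * t * _]mulrA.
have fg := l2_mul lf lg; have f2 := lf.2; have g2 := lg.2.
rewrite -!IntZ//; last exact: locintZ.
have ? := locintZ t fg; have ? := locintZ 2 (locintZ t fg).
have ? := locintZ (t ^+ 2) g2; have ? := locintD f2 (locintZ 2 (locintZ t fg)).
rewrite -!IntD//.
apply: Int_ge0 => x _.
have -> : f x ^+ 2 + 2 * (t * (f x * g x)) + t ^+ 2 * g x ^+ 2 = (f x + t * g x) ^+ 2 by ring.
exact: sqr_ge0.
Qed.

Lemma Int_sqr_le a b f : a <= b -> l2 f ->
  Int a b f ^+ 2 <= (b - a) * Int a b (fun x => f x ^+ 2).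
Proof.
move=> ab lf; have := Int_CS a b lf (l2_cst 1).
rewrite [X in _ * X](_ : _ = b - a); last first.
  by under eq_Int do rewrite expr1n; rewrite Int_cst// mul1r.
by under eq_Int do rewrite mulr1; rewrite mulrC.
Qed.

Lemma l2_norm f : l2 f -> l2 (fun x => `|f x|).
Proof.
move=> [mf f2]; split; first exact: measurableT_comp.
by apply: eq_locint f2 => x; rewrite real_normK ?num_real.
Qed.

Lemma Int_norm_sqr_le a b f : a <= b -> l2 f ->
  Int a b (fun x => `|f x|) ^+ 2 <= (b - a) * Int a b (fun x => f x ^+ 2).
Proof.
move=> ab lf; apply: (le_trans (Int_sqr_le ab (l2_norm lf))).
by under eq_Int do rewrite real_normK ?num_real//.
Qed.

End calculus.

(** * Primitives *)

Section primitives.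
Context {R : realType}.
Notation mu := (@lebesgue_measure R).
Implicit Types (a b c x y t : R) (f g h F H : R -> R).

(** Absolute continuity in integrated form. All weak derivatives are handled through such
    identities, so that differentiation almost everywhere is avoided. *)
Definition primitive a b F f :=
  forall x y, a <= x -> x <= y -> y <= b -> F y - F x = Int x y f.

(* The signed integral from a to x: Int a x f is 0 when x < a. *)
Definition SI a f x := Int a x f - Int x a f.

Lemma Int_gt a b f : b < a -> Int a b f = 0.
Proof. by move=> ba; rewrite /Int set_itv_ge ?Rintegral_set0// bnd_simp -ltNge. Qed.

Lemma SIE a f x : a <= x -> SI a f x = Int a x f.
Proof.
rewrite /SI le_eqVlt => /predU1P[->|ax]; first by rewrite Int_xx subr0.
by rewrite (@Int_gt x a)// subr0.
Qed.

Lemma SIaa a f : SI a f a = 0.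
Proof. by rewrite SIE// Int_xx. Qed.

Lemma SI_sub a f x y : locint f -> x <= y -> SI a f y - SI a f x = Int x y f.
Proof.
move=> lf xy; have [ax|xa] := leP a x.
  by rewrite !SIE ?(le_trans ax)// (Int_chasles lf ax xy) addrC addKr.
have [ay|ya] := leP a y.
  rewrite SIE// /SI (@Int_gt a x)// sub0r opprK addrC.
  by rewrite -Int_chasles// ltW.
rewrite /SI !(@Int_gt a)// !sub0r opprK (Int_chasles lf xy (ltW ya)).
by rewrite [X in _ + X]addrC addrA addrC addNr addr0 || ring.
Qed.

Lemma SI_primitive a c d f : locint f -> primitive c d (SI a f) f.
Proof. by move=> lf x y _ xy _; exact: SI_sub. Qed.

Lemma primitive_sqr a b F f x y : l2 f -> primitive a b F f ->
  a <= x -> x <= y -> y <= b ->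
  (F y - F x) ^+ 2 <= (y - x) * Int x y (fun x => f x ^+ 2).
Proof. by move=> lf pF ax xy yb; rewrite pF//; exact: Int_sqr_le. Qed.

Lemma SI_continuous a f : l2 f -> continuous (SI a f).
Proof.
move=> lf x; apply/cvgrPdist_lt => e e0.
pose C := Int (x - 1) (x + 1) (fun x => f x ^+ 2) + 1.
have C0 : 0 < C by rewrite ltr_pwDr// Int_ge0// => z _; exact: sqr_ge0.
have key z y : z <= y -> x - 1 <= z -> y <= x + 1 -> y - z < e ^+ 2 / C ->
    `|SI a f z - SI a f y| < e.
  move=> zy xz yx d; rewrite -ltr_sqr ?nnegrE ?normr_ge0 ?ltW//.
  rewrite real_normK ?num_real// -sqrrN opprB.
  have P : primitive z y (SI a f) f by apply: SI_primitive; exact: l2_locint.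
  apply: le_lt_trans (primitive_sqr lf P (lexx z) zy (lexx y)) _.
  apply: (@le_lt_trans _ _ ((y - z) * C)).
    apply: ler_wpM2l; first by rewrite subr_ge0.
    apply: (@le_trans _ _ (Int (x - 1) (x + 1) (fun x => f x ^+ 2))); last by rewrite lerDl.
    by apply: Int_sub => //; [exact: lf.2|move=> ?; exact: sqr_ge0].
  by rewrite -ltr_pdivlMr.
have d0 : 0 < Num.min 1 (e ^+ 2 / C).
  by rewrite lt_min ltr01 divr_gt0// exprn_gt0.
near=> y.
have : `|x - y| < Num.min 1 (e ^+ 2 / C).
  by near: y; exact: cvgr_dist_lt.
rewrite lt_min => /andP[D1 D2].
move: (D1); rewrite ltr_norml => /andP[y1 y2].
move: (D2); rewrite ltr_norml => /andP[y3 y4].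
have [xy|yx] := leP x y.
  by apply: (key x y) => //; lra.
by rewrite distrC; apply: (key y x); [exact: ltW|lra|lra|lra].
Unshelve. all: by end_near. Qed.

Lemma SI_l2 a f : l2 f -> l2 (SI a f).
Proof. by move=> lf; apply: continuous_l2; exact: SI_continuous. Qed.

(* Telescoping: the increment over n equal cells is at most
   (b - a) / n times the total variation of Psi. *)
Lemma const_of_product_increments a b (Phi Psi : R -> R) : a <= b ->
  (forall x y, a <= x -> x <= y -> y <= b ->
    `|Phi y - Phi x| <= (y - x) * (Psi y - Psi x)) ->
  Phi b = Phi a.
Proof.
move=> ab H; apply/eqP; rewrite -subr_eq0 -normr_le0.
apply/ler_addgt0Pl => e e0; rewrite addr0.
pose D := (b - a) * (Psi b - Psi a).
have D0 : 0 <= D by apply: le_trans (H a b _ _ _).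
pose n := (Num.truncn (D / e)).+1.
have n0 : 0 < n%:R :> R by rewrite ltr0n.
have Dn : D / n%:R <= e.
  rewrite ler_pdivrMr// mulrC -ler_pdivrMr// ltW//.
  by apply: truncnS_gt.
pose p i := a + i%:R * ((b - a) / n%:R).
have d0 : 0 <= (b - a) / n%:R by rewrite divr_ge0// ?subr_ge0// ltW.
have pn : p n = b by rewrite /p mulrC divfK ?gt_eqF// addrC subrK.
have ple i : (i <= n)%N -> p i <= b.
  by move=> i_n; rewrite -pn /p lerD2l ler_wpM2r// ler_nat.
have pge i : a <= p i by rewrite /p lerDl mulr_ge0.
have pS i : p i.+1 - p i = (b - a) / n%:R by rewrite /p -natr1; ring.
have main i : (i <= n)%N ->
    `|Phi (p i) - Phi a| <= ((b - a) / n%:R) * (Psi (p i) - Psi a).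
  elim: i => [_|i IH i_n]; first by rewrite /p mul0r addr0 !subrr normr0 mulr0.
  have -> : Phi (p i.+1) - Phi a = (Phi (p i.+1) - Phi (p i)) + (Phi (p i) - Phi a) by ring.
  apply: (le_trans (ler_normD _ _)).
  have pSle : p i <= p i.+1 by rewrite -subr_ge0 pS.
  have := H (p i) (p i.+1) (pge i) pSle (ple _ i_n).
  have := IH (ltnW i_n); rewrite pS.
  set u := (b - a) / _ => I1 I2; apply: (le_trans (lerD I2 I1)).
  by rewrite -mulrDr addrA subrK.
have := main n (leqnn _); rewrite pn => /le_trans; apply.
by rewrite mulrAC.
Qed.

Lemma primitive_sub a b c d F f : primitive a b F f -> a <= c -> d <= b -> primitive c d F f.
Proof.
move=> pF ac db x y cx xy yd; apply: pF => //; [exact: le_trans cx|exact: le_trans db].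
Qed.

Lemma primitive_osc a b F f x y t : l2 f -> primitive a b F f -> a <= x -> y <= b ->
  x <= t <= y -> (F t - F x) ^+ 2 <= (y - x) * Int x y (fun x => f x ^+ 2) /\
                 (F y - F t) ^+ 2 <= (y - x) * Int x y (fun x => f x ^+ 2).
Proof.
move=> lf pF ax yb /andP[xt ty].
have f20 s : 0 <= f s ^+ 2 by exact: sqr_ge0.
split.
  apply: (le_trans (primitive_sqr lf pF ax xt (le_trans ty yb))).
  apply: ler_pM; rewrite ?subr_ge0// ?lerB//; first exact: Int_ge0.
  by apply: Int_sub => //; exact: lf.2.
apply: (le_trans (primitive_sqr lf pF (le_trans ax xt) ty yb)).
apply: ler_pM; rewrite ?subr_ge0// ?lerB//; first exact: Int_ge0.
by apply: Int_sub => //; exact: lf.2.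
Qed.

(** Cauchy-Schwarz gives (b - a) times the geometric mean of the energy of f and A. Their sum is a
    weaker bound, but with A an energy it is additive over adjacent intervals, the form that
    [const_of_product_increments] asks for. *)
Lemma Int_prod_le a b f g (A : R) : a <= b -> l2 f -> l2 g -> 0 <= A ->
  (forall t, a <= t <= b -> g t ^+ 2 <= (b - a) * A) ->
  `|Int a b (fun t => f t * g t)| <=
  (b - a) * (Int a b (fun x => f x ^+ 2) + A).
Proof.
move=> ab lf lg A0 gA.
rewrite -ler_sqr ?nnegrE ?normr_ge0//; last first.
  by rewrite mulr_ge0 ?subr_ge0// addr_ge0// Int_ge0// => ? _; exact: sqr_ge0.
rewrite real_normK ?num_real//; apply: (le_trans (Int_CS _ _ lf lg)).
set J := Int a b (fun x => f x ^+ 2).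
have J0 : 0 <= J by apply: Int_ge0 => ? _; exact: sqr_ge0.
apply: (@le_trans _ _ (J * ((b - a) * A * (b - a)))).
  apply: ler_wpM2l => //; rewrite -Int_cst//; apply: Int_le => //; [exact: lg.2|exact: locint_cst].
have : 0 <= b - a by rewrite subr_ge0.
set d := b - a => d0.
have -> : J * (d * A * d) = d ^+ 2 * (J * A) by ring.
rewrite exprMn ler_wpM2l ?sqr_ge0//; nra.
Qed.

(** The difference [Phi] between F H and the two indefinite integrals is constant, because its
    increments are bounded by the length times an increment of [Psi2]; the product F H is never
    differentiated. *)
Lemma IBP a b F f H h : a <= b -> l2 f -> l2 h -> l2 F -> l2 H ->
  primitive a b F f -> primitive a b H h ->
  F b * H b - F a * H a =
  Int a b (fun x => f x * H x) + Int a b (fun x => F x * h x).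
Proof.
move=> ab lf lh lF lH pF pH.
have l1 := l2_mul lf lH; have l3 := l2_mul lF lh.
pose Phi x := F x * H x - SI a (fun x => f x * H x) x - SI a (fun x => F x * h x) x.
pose Psi x := SI a (fun x => f x ^+ 2) x + SI a (fun x => h x ^+ 2) x.
suff : Phi b = Phi a.
  by rewrite /Phi !SIaa !SIE//; lra.
pose Psi2 x := 2 * Psi x.
apply: (@const_of_product_increments _ _ _ Psi2) => // x y ax xy yb.
have -> : Psi2 y - Psi2 x = 2 * (Int x y (fun x => f x ^+ 2) + Int x y (fun x => h x ^+ 2)).
  rewrite -(SI_sub a lf.2 xy) -(SI_sub a lh.2 xy) /Psi2 /Psi; ring.
(* In the increment of [Phi] each density meets only the oscillation of the other function over
   [[x, y]], whose square is at most the length times an energy. *)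
have -> : Phi y - Phi x = Int x y (fun t => f t * (H y - H t)) + Int x y (fun t => h t * (F x - F t)).
  have -> : Int x y (fun t => f t * (H y - H t)) = H y * Int x y f - Int x y (fun t => f t * H t).
    rewrite -IntZ; last exact: l2_locint.
    rewrite -IntB//; last by apply: locintZ; exact: l2_locint.
    by apply: eq_Int => t _; rewrite mulrBr [f t * H y]mulrC.
  have -> : Int x y (fun t => h t * (F x - F t)) = F x * Int x y h - Int x y (fun t => F t * h t).
    rewrite -IntZ; last exact: l2_locint.
    rewrite -IntB//; last by apply: locintZ; exact: l2_locint.
    by apply: eq_Int => t _; rewrite mulrBr [h t * F x]mulrC [h t * F t]mulrC.
  rewrite -(pF x y)// -(pH x y)// -(SI_sub a l1 xy) -(SI_sub a l3 xy) /Phi; ring.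
apply: (le_trans (ler_normD _ _)).
have J1 : 0 <= Int x y (fun x => f x ^+ 2) by apply: Int_ge0 => ? _; exact: sqr_ge0.
have J2 : 0 <= Int x y (fun x => h x ^+ 2) by apply: Int_ge0 => ? _; exact: sqr_ge0.
have A2 := @Int_prod_le x y f (fun t => H y - H t) _ xy lf (l2B (l2_cst _) lH) J2.
have A1 := @Int_prod_le x y h (fun t => F x - F t) _ xy lh (l2B (l2_cst _) lF) J1.
apply: le_trans (lerD (A2 _) (A1 _)) _.
- by move=> t txy; have [_] := primitive_osc lh pH ax yb txy.
- move=> t txy; have [+ _] := primitive_osc lf pF ax yb txy.
  by rewrite -sqrrN opprB.
set d := y - x; set u := Int _ _ _; set v := Int _ _ _; lra.
Qed.

Lemma continuous_derive_SI a f x : continuous f -> is_derive x 1 (SI a f) (f x).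
Proof.
(* The base point [a] may lie to the right of [x]. Moving it to [x - 1] puts [x] strictly inside the
   interval of the fundamental theorem. *)
move=> cf; pose c := x - 1.
have lf := continuous_locint cf.
have E : SI a f = (fun y => SI c f y + SI a f c).
  apply/funext => y; have [cy|yc] := leP c y.
    by have := SI_sub a lf cy; have := SI_sub c lf cy; rewrite SIaa; lra.
  by have := SI_sub a lf (ltW yc); have := SI_sub c lf (ltW yc); rewrite SIaa; lra.
rewrite E.
have xx1 : x < x + 1 by rewrite ltrDl.
have cx : c < x by rewrite /c ltrBlDr ltrDl.
have [d1 d2] := @continuous_FTC1_closed R f c x (x + 1) xx1 (lf _ _) cx (cf x).
have dI : is_derive x 1 (fun y => \int[mu]_(t in [set` `[c, y]]) f t) (f x).
  apply: DeriveDef; first exact: d1.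
  by rewrite -derive1E.
have dS : is_derive x 1 (SI c f) (f x).
  apply: near_eq_is_derive dI; near=> y.
  have : `|x - y| < 1 by near: y; apply: cvgr_dist_lt.
  rewrite ltr_norml => /andP[y1 y2]; rewrite SIE// /c; lra.
rewrite -[f x]addr0; apply: is_deriveD.
Unshelve. all: by end_near. Qed.

Lemma Int_FTC2 a b f F : a <= b -> continuous f ->
  (forall x, is_derive x 1 F (f x)) -> Int a b f = F b - F a.
Proof.
rewrite le_eqVlt => /predU1P[->|ab] cf dF; first by rewrite Int_xx subrr.
have cF : continuous F.
  by move=> x; apply: differentiable_continuous; apply/derivable1_diffP; case: (dF x).
rewrite /Int /Rintegral (@continuous_FTC2 R f F)//.
- exact: continuous_subspaceT.
- split.
  + by move=> x _; case: (dF x).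
  + by apply: cvg_at_right_filter; exact: cF.
  + by apply: cvg_at_left_filter; exact: cF.
- by move=> x _; rewrite derive1E; case: (dF x).
Qed.

End primitives.

(** * The fundamental lemma of the calculus of variations *)

Section test_functions.
Context {R : realType}.
Notation mu := (@lebesgue_measure R).
Implicit Types (a b c d x y t : R) (f g h phi psi : R -> R) (n j : nat).

(** Derivatives are exhibited rather than computed, so closure under sums, products and affine
    substitutions is an induction on n without a formula for iterated derivatives. *)
Fixpoint Cn n f : Prop :=
  if n is n'.+1 then exists g, (forall x, is_derive x (1 : R) f (g x)) /\ Cn n' g
  else True.

Lemma Cn_pred n f : Cn n.+1 f -> Cn n f.
Proof.
elim: n f => // n IH f [g [fg Cg]]; exists g; split => //; exact: IH.
Qed.

Lemma CnD n f g : Cn n f -> Cn n g -> Cn n (fun x => f x + g x).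
Proof.
elim: n f g => // n IH f g [f' [df Cf]] [g' [dg Cg]].
exists (fun x => f' x + g' x); split; last exact: IH.
by move=> x; apply: is_deriveD.
Qed.

Lemma CnM n f g : Cn n f -> Cn n g -> Cn n (fun x => f x * g x).
Proof.
elim: n f g => // n IH f g /[dup] Cf1 [f' [df Cf]] /[dup] Cg1 [g' [dg Cg]].
exists (fun x => f x * g' x + g x * f' x); split.
  by move=> x; apply: is_deriveM.
by apply: CnD; apply: IH => //; exact: Cn_pred.
Qed.

Lemma Cn_cst n c : Cn n (fun=> c).
Proof.
elim: n c => // n IH c; exists (fun=> 0); split => // x; exact: is_derive_cst.
Qed.

Lemma CnZ n c f : Cn n f -> Cn n (fun x => c * f x).
Proof. by move=> Cf; apply: CnM => //; exact: Cn_cst. Qed.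

Lemma is_derive_affine (p q : R) x : is_derive x 1 (fun x => p * x + q) p.
Proof.
have := is_deriveD (is_deriveZ p (is_derive_id x (1 : R))) (is_derive_cst q x 1).
by rewrite addr0 /GRing.scale/= mulr1.
Qed.

Lemma Cn_affine n f (p q : R) : Cn n f -> Cn n (fun x => f (p * x + q)).
Proof.
elim: n f => // n IH f [f' [df Cf]].
exists (fun x => p * f' (p * x + q)); split; last by apply: CnZ; exact: IH.
move=> x; rewrite mulrC.
have := @is_derive1_comp R f (fun x => p * x + q) x _ _ (df _) (is_derive_affine p q x).
by [].
Qed.

Definition smooth f := forall n, Cn n f.

Lemma Cn_derive1n n f : Cn n f <-> forall j x, (j < n)%N -> derivable (derive1n j f) x 1.
Proof.
elim: n f => // n IH f; split.
  move=> [g [fg Cg]] [|j] x jn; first by case: (fg x).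
  rewrite derive1Sn (_ : f^`()%classic = g); first by have /IH := Cg; exact.
  by apply/funext => y; rewrite derive1E; case: (fg y).
move=> H; exists (f^`()%classic); split.
  by move=> x; apply: DeriveDef; [exact: (H 0%N)|rewrite derive1E].
by apply/IH => j x jn; rewrite -derive1Sn; exact: H.
Qed.

Lemma smoothP f : smooth f <-> forall n x, derivable (derive1n n f) x 1.
Proof.
split => [sf n x|H n]; last by apply/Cn_derive1n => j x _; exact: H.
by have /Cn_derive1n := sf n.+1; apply.
Qed.

Lemma smooth_derive f : smooth f -> smooth (f^`()%classic).
Proof. by move=> /smoothP sf; apply/smoothP => n x; rewrite -derive1Sn. Qed.

Lemma smooth_is_derive f x : smooth f -> is_derive x (1 : R) f (f^`()%classic x).
Proof. by move=> /smoothP sf; apply: DeriveDef; [exact: (sf 0%N)|rewrite derive1E]. Qed.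

Lemma is_derive_continuous f g : (forall x, is_derive x (1 : R) f (g x)) -> continuous f.
Proof.
by move=> df x; apply: differentiable_continuous; apply/derivable1_diffP; case: (df x).
Qed.

Lemma smooth_continuous f : smooth f -> continuous f.
Proof. by move=> sf; apply: is_derive_continuous => x; exact: smooth_is_derive. Qed.

Lemma smooth_antiderivative f a : smooth f -> smooth (SI a f).
Proof.
move=> sf [|n]//; exists f; split; last exact: sf.
by move=> x; apply: continuous_derive_SI; exact: smooth_continuous.
Qed.

(** The flat function x^(-j) exp(-1/x) for x > 0. The index j closes the family under
    differentiation, so that all members are smooth by one induction. *)
Definition theta j x : R := if 0 < x then (x ^+ j)^-1 * expR (- x^-1) else 0.

Lemma theta_ge0 j x : 0 <= theta j x.
Proof.
rewrite /theta; case: ifP => // x0.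
by rewrite mulr_ge0 ?expR_ge0// invr_ge0 exprn_ge0// ltW.
Qed.

Lemma expR_ge_pow (y : R) n : 0 <= y -> (y / n.+1%:R) ^+ n.+1 <= expR y.
Proof.
move=> y0; have -> : expR y = expR (y / n.+1%:R) ^+ n.+1.
  by rewrite -expRM_natl mulrC divfK// pnatr_eq0.
have q0 : 0 <= y / n.+1%:R by rewrite divr_ge0// ler0n.
rewrite lerXn2r ?nnegrE ?expR_ge0//.
by apply: le_trans (expR_ge1Dx _); rewrite lerDr.
Qed.

(** The inequality exp y >= (y / m)^m at m = j + 2 leaves two powers of x after the factor x^(-j). A
    quadratic bound forces the derivative at 0 to vanish. *)
Lemma theta_bound j : exists2 C, 0 <= C & forall x, `|x| <= 1 -> theta j x <= C * x ^+ 2.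
Proof.
exists (j.+2%:R ^+ j.+2); first by rewrite exprn_ge0.
move=> x x1; rewrite /theta; case: ifP => x0; last first.
  by apply: mulr_ge0; [exact: exprn_ge0|exact: sqr_ge0].
have := @expR_ge_pow x^-1 j.+1; rewrite invr_ge0 (ltW x0) => /(_ isT).
set e := expR (x^-1) => He.
have e0 : 0 < e by exact: expR_gt0.
rewrite expRN -/e.
have He' : e^-1 <= (x * j.+2%:R) ^+ j.+2.
  rewrite -[leRHS]invrK lef_pV2 ?posrE ?invr_gt0//; last first.
    by rewrite exprn_gt0// mulr_gt0// ltr0n.
  by rewrite -exprVn invfM.
apply: (@le_trans _ _ ((x ^+ j)^-1 * (x * j.+2%:R) ^+ j.+2)).
  by rewrite ler_wpM2l// invr_ge0 exprn_ge0// ltW.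
have xj : x ^+ j != 0 by rewrite expf_neq0 ?gt_eqF.
rewrite exprMn (_ : x ^+ j.+2 = x ^+ j * x ^+ 2); last by rewrite -exprD addn2.
by rewrite mulrA mulKf// mulrC.
Qed.

Lemma is_derive0_quadratic f (C : R) : (forall x, `|x| <= 1 -> `|f x| <= C * x ^+ 2) ->
  is_derive (0 : R) (1 : R) f 0.
Proof.
move=> fC.
have f0 : f 0 = 0.
  by apply/eqP; rewrite -normr_le0; have := fC 0; rewrite normr0 ler01 expr0n mulr0; exact.
have H : h^-1 *: (f (h *: (1 : R) + 0) - f 0) @[h --> 0^'] --> (0 : R).
  apply/cvgr0Pnorm_lt => e e0.
  have C1 : 0 < `|C| + 1 by rewrite ltr_pwDr.
  have d0 : 0 < Num.min 1 (e / (`|C| + 1)) by rewrite lt_min ltr01 divr_gt0.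
  near=> h.
  have h0 : h != 0 by near: h; exact: nbhs_dnbhs_neq.
  have : `|0 - h| < Num.min 1 (e / (`|C| + 1)).
    by near: h; apply: nbhs_dnbhs; have := nbhsx_ballx (0 : R) _ d0; exact.
  rewrite sub0r normrN lt_min => /andP[h1 h2].
  rewrite f0 subr0 addr0 scaler1 normrM normfV.
  rewrite ltr_pdivrMl ?normr_gt0// (le_lt_trans (fC _ (ltW h1)))//.
  rewrite -[h ^+ 2]real_normK ?num_real// expr2 mulrA mulrC ltr_pM2l ?normr_gt0//.
  apply: (@le_lt_trans _ _ ((`|C| + 1) * `|h|)).
    by rewrite ler_wpM2r// (le_trans (ler_norm _))// lerDl.
  by rewrite -ltr_pdivlMl// mulrC.
apply: DeriveDef; first by apply/cvg_ex; exists 0.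
exact: cvg_lim.
Unshelve. all: by end_near. Qed.

Lemma is_derive_theta j x :
  is_derive x (1 : R) (theta j) (theta j.+2 x - j%:R * theta j.+1 x).
Proof.
have [x0|x0|->] := ltrgtP x 0.
- rewrite /theta !ltNge (ltW x0)/= mulr0 subr0.
  apply: near_eq_is_derive (is_derive_cst 0 x 1).
  near=> y; have : y < 0 by near: y; exact: lt_nbhsl.
  by move=> /ltW; rewrite leNgt => /negbTE ->.
- have dx : is_derive x (1 : R) (fun y => (y ^+ j)^-1 * expR (- y^-1))
      ((x ^+ j)^-1 * (expR (- x^-1) * (x ^- 2)) - expR (- x^-1) * (j%:R * x^-1 ^+ j.+1)).
    have dV : is_derive x (1 : R) (fun y : R => y^-1) (- x ^- 2).
      have := @is_deriveV R (fun y => y) x 1 1 _ (is_derive_id _ _).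
      by rewrite gt_eqF// scaler1 => /(_ isT).
    have dN : is_derive x (1 : R) (fun y : R => - y^-1) (x ^- 2).
      by have := is_deriveN dV; rewrite opprK.
    have dE : is_derive x (1 : R) (fun y : R => expR (- y^-1)) (expR (- x^-1) * x ^- 2).
      exact: (@is_derive1_comp R expR (fun y => - y^-1) x _ _ (is_derive_expR _) dN).
    have dX : is_derive x (1 : R) (fun y : R => (y ^+ j)^-1) (- (j%:R * x^-1 ^+ j.+1)).
      have := is_deriveX j dV.
      have -> : (fun y : R => y^-1) ^+ j = (fun y : R => (y ^+ j)^-1).
        by apply/funext => y; rewrite exprfctE exprVn.
      move=> h; apply: is_derive_eq h _.
      case: j => [|j]; first by rewrite !mul0r scale0r oppr0.
      by rewrite /= /GRing.scale/= -!exprVn !exprS; ring.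
    have := is_deriveM dX dE; rewrite /GRing.scale/=.
    by move=> h; apply: is_derive_eq h _; ring.
  apply: is_derive_eq.
    apply: near_eq_is_derive dx; near=> y.
    by rewrite /theta ifT//; near: y; exact: lt_nbhsr.
  rewrite /theta x0 -!exprVn !exprS expr0; ring.
have [C C0 HC] := theta_bound j.
rewrite {2 3}/theta ltxx mulr0 subr0.
apply: (@is_derive0_quadratic _ C) => z z1.
by rewrite ger0_norm ?theta_ge0// HC.
Unshelve. all: by end_near. Qed.

Lemma theta_smooth j : smooth (theta j).
Proof.
move=> n; elim: n j => // n IH j.
exists (fun x => theta j.+2 x - j%:R * theta j.+1 x); split; first exact: is_derive_theta.
have := CnD (IH j.+2) (CnZ (-1) (CnZ j%:R (IH j.+1))).
by congr Cn; apply/funext => x; rewrite mulN1r.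
Qed.

(** Not a convolution kernel but a smooth function vanishing outside []c, d[], with values in
    [0, 1], which tends to the indicator of []c, d[] as n grows. *)
Definition mollifier n c d x : R := theta 0 (n%:R * (x - c)) * theta 0 (n%:R * (d - x)).

Lemma bump_smooth n c d : smooth (mollifier n c d).
Proof.
move=> m; apply: CnM.
  have := Cn_affine n%:R (- (n%:R * c)) (theta_smooth 0 m).
  by congr Cn; apply/funext => x; congr theta; ring.
have := Cn_affine (- n%:R) (n%:R * d) (theta_smooth 0 m).
by congr Cn; apply/funext => x; congr theta; ring.
Qed.

Lemma bump_ge0 n c d x : 0 <= mollifier n c d x.
Proof. by rewrite mulr_ge0 ?theta_ge0. Qed.

Lemma theta0_le1 x : theta 0 x <= 1.
Proof.
rewrite /theta; case: ifP => // x0.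
by rewrite expr0 invr1 mul1r -expR0 ler_expR oppr_le0 invr_ge0 ltW.
Qed.

Lemma bump_le1 n c d x : mollifier n c d x <= 1.
Proof. by rewrite -[leRHS]mulr1 ler_pM ?theta_ge0 ?theta0_le1. Qed.

Lemma bump_eq0 n c d x : ~~ (c < x < d) -> mollifier n c d x = 0.
Proof.
rewrite negb_and -!leNgt /mollifier /theta => /orP[xc|dx].
  by rewrite [X in X * _]ifF ?mul0r//; apply/negbTE; rewrite -leNgt mulr_ge0_le0// subr_le0.
by rewrite [X in _ * X]ifF ?mulr0//; apply/negbTE; rewrite -leNgt mulr_ge0_le0// subr_le0.
Qed.

Lemma bump_gt0 n c d x : (0 < n)%N -> c < x < d -> 0 < mollifier n c d x.
Proof.
move=> n0 /andP[cx xd]; rewrite /mollifier /theta !mulr_gt0 ?subr_gt0 ?ltr0n//.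
all: by rewrite ?expR_gt0// expr0 invr1.
Qed.

Lemma bump_cvg c d x : mollifier n c d x @[n --> \oo] --> (\1_(`]c, d[%classic) x : R).
Proof.
have [/andP[cx xd]|xcd] := boolP (c < x < d); last first.
  rewrite (_ : (fun n => mollifier n c d x) = fun=> 0); last by apply/funext => n; rewrite bump_eq0.
  rewrite indicE memNset//; first exact: cvg_cst.
  by rewrite /= in_itv/=; apply/negP.
rewrite indicE mem_set ?in_itv/= ?cx//; last by rewrite in_itv/= cx.
have key y : 0 < y -> theta 0 (n%:R * y) @[n --> \oo] --> (1 : R).
  move=> y0; rewrite -[X in _ --> X]expR0 -[X in expR X]oppr0.
  have H : (fun n : nat => - (n%:R * y)^-1) @ \oo --> - (0 : R).
    apply: cvgN; rewrite -[X in _ --> X](mul0r y^-1).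
    under eq_fun do rewrite invfM.
    apply: cvgM; last exact: cvg_cst.
    by apply/gtr0_cvgV0; [near=> n; rewrite ltr0n; near: n; exact: nbhs_infty_gt|exact: cvgr_idn].
  apply: (cvg_trans _ (continuous_cvg _ (@continuous_expR R (- 0)) H)).
  apply: near_eq_cvg; near=> n.
  rewrite /theta mulr_gt0 ?ltr0n//; last by near: n; exact: nbhs_infty_gt.
  by rewrite expr0 invr1 mul1r.
rewrite -[1%:R]mulr1 /mollifier; apply: cvgM; apply: key; rewrite subr_gt0//.
Unshelve. all: by end_near. Qed.

Definition supported c d phi := smooth phi /\ forall x, ~~ (c < x < d) -> phi x = 0.

(** Compact support in []a, b[] becomes vanishing outside a strictly smaller interval, the form in
    which integrations by parts lose their boundary terms. *)
Lemma test_functionP a b phi : a < b -> test_function a b phi <->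
  exists c d, [/\ a < c, c < d, d < b & supported c d phi].
Proof.
move=> ab; split.
  move=> [/smoothP sphi cK Kab].
  set K := closure _ in cK Kab.
  have [K0|/set0P[z Kz]] := eqVneq K set0.
    exists (a + (b - a) / 3), (b - (b - a) / 3); split; try lra.
    split => // x _; apply/eqP; apply: contrapT => /negP phi0.
    have : K x by apply: subset_closure.
    by rewrite K0.
  have K0 : K !=set0 by exists z.
  have cid : {within K, continuous (idfun : R -> R)}.
    by apply: continuous_subspaceT => x; exact: cvg_id.
  have [M KM HM] := compact_EVT_max K0 cK cid.
  have [m Km Hm] := compact_EVT_min K0 cK cid.
  rewrite !inE in KM Km.
  have /andP[am mb] : a < m < b by have := Kab _ Km; rewrite /= in_itv.
  have /andP[aM Mb] : a < M < b by have := Kab _ KM; rewrite /= in_itv.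
  have mM : m <= M by apply: (HM m); rewrite inE.
  exists ((a + m) / 2), ((M + b) / 2); split; try lra.
  split => // x xcd; apply/eqP; apply: contrapT => /negP phi0.
  have Kx : x \in K by rewrite inE; apply: subset_closure.
  have /= := HM x Kx; have /= := Hm x Kx; move: xcd; rewrite negb_and -!leNgt => /orP[]; lra.
move=> [c [d [ac cd db [sphi phi0]]]].
have sub : closure [set x | phi x != 0] `<=` `[c, d]%classic.
  rewrite [X in _ `<=` X](closure_id _).1; last exact: itv_closed.
  apply: closureS => x /= px; rewrite in_itv/=.
  by have [/andP[/ltW -> /ltW ->]//|/phi0 p0] := boolP (c < x < d); rewrite p0 eqxx in px.
split; first exact/smoothP.
- apply: subclosed_compact sub; [exact: closed_closure|exact: segment_compact].
- move=> x /sub /=; rewrite !in_itv/= => /andP[cx xd].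
  by rewrite (lt_le_trans ac)//= (le_lt_trans xd).
Qed.

Lemma supportedW c d c' d' phi : c' <= c -> d <= d' -> supported c d phi -> supported c' d' phi.
Proof.
move=> cc dd [sp p0]; split => // x xcd; apply: p0; apply: contra xcd.
by move=> /andP[cx xd]; rewrite (le_lt_trans cc)//= (lt_le_trans xd).
Qed.

Lemma supported_derive c d phi : supported c d phi -> supported c d (phi^`()%classic).
Proof.
move=> [sp p0]; split; first exact: smooth_derive.
move=> x; rewrite negb_and -!leNgt => xcd.
have cont := smooth_continuous (smooth_derive sp).
have zero y : (y < c) || (d < y) -> phi^`()%classic y = 0.
  move=> ycd; rewrite derive1E.
  rewrite (@near_eq_derive _ _ _ phi (cst 0) y 1) ?derive_cst//.
  case/orP: ycd => ycd; near=> z; rewrite p0// negb_and -!leNgt.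
    by apply/orP; left; apply: ltW; near: z; exact: lt_nbhsl.
  by apply/orP; right; apply: ltW; near: z; exact: lt_nbhsr.
case/orP: xcd; rewrite le_eqVlt => /orP[/eqP e|xc].
- have L := cvg_at_left_filter (cont x); apply: (cvg_unique _ L) => //=.
  apply: cvg_near_cst; near=> y; apply: zero; apply/orP; left; rewrite -e.
  by near: y; exact: nbhs_left_lt.
- by apply: zero; rewrite xc.
- have L := cvg_at_right_filter (cont x); apply: (cvg_unique _ L) => //=.
  apply: cvg_near_cst; near=> y; apply: zero; apply/orP; right; rewrite e.
  by near: y; exact: nbhs_right_gt.
- by apply: zero; rewrite xc orbT.
Unshelve. all: by end_near. Qed.

Lemma supported_derive1n n c d phi : supported c d phi -> supported c d (derive1n n phi).
Proof.
elim: n => // n IH sp; exact: supported_derive (IH sp).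
Qed.

Lemma supported_primitive c d phi a b n : supported c d phi ->
  a <= b -> primitive a b (derive1n n phi) (derive1n n.+1 phi).
Proof.
move=> sp _ x y _ xy _.
have [s1 _] := supported_derive1n n sp.
have [s2 _] := supported_derive1n n.+1 sp.
have cont := smooth_continuous s2.
have dv z := smooth_is_derive z s1.
exact/esym/(Int_FTC2 xy cont dv).
Qed.

Lemma supported_l2 c d phi n : supported c d phi -> l2 (derive1n n phi).
Proof.
by move=> /(supported_derive1n n)[s _]; apply: continuous_l2; exact: smooth_continuous.
Qed.

Lemma supported_bump c d n : supported c d (mollifier n c d).
Proof. by split; [exact: bump_smooth|exact: bump_eq0]. Qed.

Lemma Int_bump_gt0 c d : c < d -> 0 < Int c d (mollifier 1 c d).
Proof.
move=> cd; pose x := (c + d) / 2; pose B := mollifier 1 c d.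
have cB : continuous B by apply: smooth_continuous; exact: bump_smooth.
have Bx : 0 < B x by apply: bump_gt0 => //; rewrite /x; lra.
have lB := continuous_locint cB.
have /cvgr_dist_lt/(_ (B x / 2)) := cB x; rewrite divr_gt0// => /(_ isT).
move=> /nbhs_ballP[e/= e0 He].
pose m := Num.min (e / 2) ((d - c) / 2).
have m0 : 0 < m by rewrite lt_min !divr_gt0// subr_gt0.
have m1 : m <= e / 2 by rewrite ge_min lexx.
have m2 : m <= (d - c) / 2 by rewrite ge_min lexx orbT.
apply: (@lt_le_trans _ _ (Int x (x + m) B)); last first.
  apply: Int_sub => //; [by move=> ?; exact: bump_ge0|rewrite /x; lra|lra|rewrite /x; lra].
apply: (@lt_le_trans _ _ (Int x (x + m) (fun=> B x / 2))).
  by rewrite Int_cst ?lerDl ?ltW// mulr_gt0// ?divr_gt0//; lra.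
apply: Int_le => //; first exact: locint_cst.
move=> y /andP[xy yx]; have H := He y; rewrite /ball/= in H.
have : `|x - y| < e by rewrite ltr_norml; apply/andP; split; lra.
move=> /H; rewrite ltr_norml => /andP[]; lra.
Qed.

Lemma Int_supported a b c d f phi : locint (fun x => f x * phi x) -> supported c d phi ->
  a <= c -> c < d -> d <= b ->
  Int a b (fun x => f x * phi x) = Int c d (fun x => f x * phi x).
Proof.
move=> lf [_ p0] ac cd db.
rewrite (Int_chasles lf ac (le_trans (ltW cd) db)) (Int_chasles lf (ltW cd) db).
rewrite (_ : Int a c _ = 0) ?add0r; last first.
  rewrite (@eq_Int _ _ _ _ (cst 0)) ?Int_cst ?mul0r// => x /andP[_ xc].
  by rewrite p0 ?mulr0// negb_and -leNgt xc.
rewrite (_ : Int d b _ = 0) ?addr0//.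
rewrite (@eq_Int _ _ _ _ (cst 0)) ?Int_cst ?mul0r// => x /andP[dx _].
by rewrite p0 ?mulr0// negb_and -!leNgt dx orbT.
Qed.

(** Subtracting the multiple of [rho] that makes the total integral zero lets the antiderivative
    vanish beyond d as well: the device of du Bois-Reymond's lemma. *)
Lemma supported_antiderivative c d psi rho : c < d -> supported c d psi ->
  supported c d rho -> Int c d rho = 1 ->
  supported c d (SI c (fun x => psi x - Int c d psi * rho x)).
Proof.
move=> cd [spsi psi0] [srho rho0] Jrho.
pose f x := psi x - Int c d psi * rho x.
have sf : smooth f.
  move=> n; have := CnD (spsi n) (CnZ (-1) (CnZ (Int c d psi) (srho n))).
  by congr Cn; apply/funext => x; rewrite mulN1r.
have cf := continuous_locint (smooth_continuous sf).
have f0 x : ~~ (c < x < d) -> f x = 0.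
  by move=> xcd; rewrite /f psi0// rho0// !mulr0 subr0.
have Jf : Int c d f = 0.
  rewrite /f IntB; [|exact: continuous_locint (smooth_continuous spsi)|].
    by rewrite IntZ ?Jrho ?mulr1 ?subrr//; exact: continuous_locint (smooth_continuous srho).
  by apply: locintZ; exact: continuous_locint (smooth_continuous srho).
split; first exact: smooth_antiderivative.
move=> x; rewrite negb_and -!leNgt => /orP[xc|dx].
  have := SI_sub c cf xc; rewrite SIaa sub0r => /eqP; rewrite eqr_oppLR => /eqP ->.
  rewrite (@eq_Int _ _ _ _ (cst 0)) ?Int_cst ?mul0r ?oppr0// => y /andP[_ yc].
  by rewrite f0// negb_and -leNgt yc.
rewrite SIE ?(le_trans (ltW cd))// (Int_chasles cf (ltW cd) dx) Jf add0r.
rewrite (@eq_Int _ _ _ _ (cst 0)) ?Int_cst ?mul0r// => y /andP[dy _].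
by rewrite f0// negb_and -!leNgt dy orbT.
Qed.

Lemma derive1n_SI_sub n f g (K : R) a : smooth f -> smooth g ->
  derive1n n.+1 (SI a (fun x => f x - K * g x)) =
  (fun x => derive1n n f x - K * derive1n n g x).
Proof.
move=> sf sg; have sfg : smooth (fun x => f x - K * g x).
  move=> m; have := CnD (sf m) (CnZ (-1) (CnZ K (sg m))).
  by congr Cn; apply/funext => x; rewrite mulN1r.
elim: n => [|n IH].
  apply/funext => x; rewrite /= derive1E.
  by have [] := continuous_derive_SI a x (smooth_continuous sfg).
rewrite derive1nS IH; apply/funext => x; rewrite derive1E.
have /smoothP df := sf; have /smoothP dg := sg.
have d1 : is_derive x (1 : R) (derive1n n f) (derive1n n.+1 f x).
  by apply: DeriveDef; [exact: df|rewrite derive1nS derive1E].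
have d2 : is_derive x (1 : R) (derive1n n g) (derive1n n.+1 g x).
  by apply: DeriveDef; [exact: dg|rewrite derive1nS derive1E].
by have [] := is_deriveB d1 (is_deriveZ K d2).
Qed.

Lemma Int_cvg_dominated a b (F : nat -> R -> R) f h :
  (forall n, measurable_fun [set: measurableTypeR R] (F n)) ->
  measurable_fun [set: measurableTypeR R] f -> locint h ->
  (forall n x, `|F n x| <= h x) -> (forall x, F n x @[n --> \oo] --> f x) ->
  Int a b (F n) @[n --> \oo] --> Int a b f.
Proof.
move=> mF mf lh Fh Ff.
have mab : measurable (`[a, b] : set (measurableTypeR R)) by exact: measurable_itv.
have [| | | | |i1 _ i3] := @dominated_convergence _ _ _ mu `[a, b]%classic mab
  (fun n => EFin \o F n) (EFin \o f) (EFin \o h).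
- by move=> n; apply/measurable_EFinP; exact: measurable_funTS.
- by apply/measurable_EFinP; exact: measurable_funTS.
- by apply: aeW => x _ /=; apply: cvg_EFin; [exact: nearW|exact: Ff].
- exact: lh.
- by apply: aeW => x n _ /=; rewrite lee_fin.
rewrite /Int /Rintegral; apply: fine_cvg.
rewrite fineK//; exact: integrable_fin_num.
Qed.

Lemma ae_imp (P Q : R -> Prop) : (forall x, P x -> Q x) ->
  {ae mu, forall x, P x} -> {ae mu, forall x, Q x}.
Proof. move=> PQ; apply: filterS => //; exact: (ae_filter_ringOfSetsType mu). Qed.

Lemma ae_and (P Q : R -> Prop) : {ae mu, forall x, P x} -> {ae mu, forall x, Q x} ->
  {ae mu, forall x, P x /\ Q x}.
Proof. move=> aP aQ; apply: filterI => //; exact: (ae_filter_ringOfSetsType mu). Qed.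

Lemma ae_all (P : R -> Prop) : (forall x, P x) -> {ae mu, forall x, P x}.
Proof. by move=> aP; apply: aeW. Qed.

Lemma Int_oo a b f : locint f -> \int[mu]_(x in `]a, b[) f x = Int a b f.
Proof.
move=> lf; rewrite Rintegral_itv_bndo_bndc; last first.
  by apply: integrableS (lf a b) => //; exact: subset_itv_oo_cc.
rewrite Rintegral_itv_obnd_cbnd//.
by apply: integrableS (lf a b) => //; exact: subset_itv_oc_cc.
Qed.

(** By Lebesgue differentiation f is almost everywhere the derivative of its indefinite integral,
    which is constant inside []a, b[]. *)
Lemma ae_eq0_Int a b f : l2 f ->
  (forall c d, a < c -> c < d -> d < b -> Int c d f = 0) ->
  {ae mu, forall x, a < x < b -> f x = 0}.
Proof.
move=> lf H; have lff := l2_locint lf.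
pose fab := f \_ `[a, b]%classic.
have lfab : l2 fab by apply: l2_restrict => //; exact: measurable_itv.
have loc : locally_integrable [set: R] fab.
  by apply: integrable_locally; [exact: measurable_itv|exact: lff].
have := FTC1 (fun y => l2_locint lfab a y) loc.
apply: ae_imp => x /= + /andP[ax xb].
rewrite lte_fin => /(_ ax)[_].
rewrite /fab patchE mem_set; last by rewrite /= in_itv/= !ltW.
move=> <-; rewrite derive1E.
rewrite (@near_eq_derive _ _ _ _ (cst (Int a x fab)) x 1) ?derive_cst//.
have key c d : a < c -> c <= d -> d < b -> Int a d fab = Int a c fab.
  move=> ac; rewrite le_eqVlt => /predU1P[->//|cd] db.
  rewrite (Int_chasles (l2_locint lfab) (ltW ac) (ltW cd)).
  have -> : Int c d fab = Int c d f; last by rewrite H// addr0.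
  apply: eq_Int => y /andP[cy yd]; rewrite /fab patchE mem_set//= in_itv/=.
  by rewrite (le_trans (ltW ac) cy) (le_trans yd (ltW db)).
near=> y; rewrite /cst.
have ay : a < y by near: y; exact: lt_nbhsr.
have yb : y < b by near: y; exact: lt_nbhsl.
by have [xy|/ltW yx] := leP x y; [exact: key|exact/esym/key].
Unshelve. all: by end_near. Qed.

Lemma fundamental_lemma a b f : a < b -> l2 f ->
  (forall phi, test_function a b phi -> Int a b (fun x => f x * phi x) = 0) ->
  {ae mu, forall x, a < x < b -> f x = 0}.
Proof.
move=> ab lf H; apply: ae_eq0_Int => // c d ac cd db.
have lff := l2_locint lf.
have H0 n : Int a b (fun x => f x * mollifier n c d x) = 0.
  by apply: H; apply/test_functionP => //; exists c, d; split => //; exact: supported_bump.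
have mi : measurable (`]c, d[%classic : set (measurableTypeR R)) by exact: measurable_itv.
pose D := `]c, d[%classic : set R.
have lfi : l2 (f \_ D) by exact: l2_restrict.
have L : Int c d (fun x => f x * mollifier n c d x) @[n --> \oo] --> Int c d (f \_ D).
  apply: (@Int_cvg_dominated _ _ _ _ (fun x => `|f x|)).
  - move=> n; apply: measurable_funM; first exact: l2_meas.
    by apply: l2_meas; exact: supported_l2 0%N (supported_bump c d n).
  - exact: l2_meas.
  - exact: locint_norm.
  - by move=> n x; rewrite normrM [X in _ * X]ger0_norm ?bump_ge0// ler_piMr// ?bump_le1.
  - by move=> x; rewrite patch_indic; apply: cvgM; [exact: cvg_cst|exact: bump_cvg].
have E : Int c d (f \_ D) = 0.
  apply: (cvg_unique _ L) => //=; apply: cvg_near_cst; near=> n.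
  rewrite -(@Int_supported a b c d)//; [|exact: supported_bump|exact: ltW|exact: ltW].
  by apply: l2_mul => //; exact: supported_l2 0%N (supported_bump c d n).
rewrite -E /Int -Rintegral_mkcondr setIidr; last exact: subset_itv_oo_cc.
by rewrite Int_oo.
Unshelve. all: by end_near. Qed.

End test_functions.

(** * Weak derivatives and chains of primitives *)

Section weak_derivatives.
Context {R : realType}.
Notation mu := (@lebesgue_measure R).
Implicit Types (a b c d x y t : R) (u f g h phi psi : R -> R) (n j k : nat).

Lemma L2_l2 a b u : u \in L2 a b -> l2 (u \_ `]a, b[%classic).
Proof.
rewrite inE => /[dup] H /Lfun2_integrable_sqr iu.
have mu_ : measurable_fun [set: measurableTypeR R] (u \_ `]a, b[%classic).
  by move: H; rewrite inE => /andP[+ _]; rewrite inE.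
split => // c d; exact: integrableS iu.
Qed.

Lemma l2_L2 a b f : l2 f -> f \in L2 a b.
Proof.
move=> lf; have lfD : l2 (f \_ `]a, b[%classic).
  by apply: l2_restrict => //; exact: measurable_itv.
rewrite inE; apply/andP; split; rewrite inE/=; first exact: l2_meas.
rewrite /finite_norm unlock /Lnorm poweR_lty//.
have i1 := lfD.2 a b.
rewrite (_ : (fun x => _) = (fun x => ((f \_ `]a, b[%classic) x ^+ 2)%:E) \_ `[a, b]%classic).
  rewrite -integral_mkcond; have /integrableP[_] := i1.
  apply: le_lt_trans; rewrite le_eqVlt; apply/orP; left; apply/eqP.
  by apply: eq_integral => x _ /=; rewrite ger0_norm ?sqr_ge0.
apply/funext => x; rewrite patchE.
have -> : `|(EFin \o f \_ `]a, b[) x|%E = `|(f \_ `]a, b[%classic) x|%:E by [].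
rewrite poweR_EFin powR_mulrn// real_normK ?num_real//.
case: ifPn => // xab; rewrite patchE memNset ?expr0n//=.
rewrite inE => xab'; move/negP: xab; apply; rewrite inE; exact: subset_itv_oo_cc xab'.
Qed.

Lemma Int_oo_restrict a b u h : l2 (u \_ `]a, b[%classic) -> l2 h ->
  \int[mu]_(x in `]a, b[) (u x * h x) = Int a b (fun x => (u \_ `]a, b[%classic) x * h x).
Proof.
move=> lu lh; rewrite -Int_oo; last exact: l2_mul.
by apply: eq_Rintegral => x xab; rewrite patchE xab.
Qed.

Lemma test_l2 a b phi n : a < b -> test_function a b phi -> l2 (derive1n n phi).
Proof. by move=> ab /test_functionP-/(_ ab)[c [d [_ _ _ /supported_l2]]]; apply. Qed.

Lemma is_weak_derivativeP a b n u g : a < b -> u \in L2 a b ->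
  is_weak_derivative a b n u g <-> g \in L2 a b /\
    forall phi, test_function a b phi ->
      Int a b (fun x => (u \_ `]a, b[%classic) x * derive1n n phi x) =
      (-1) ^+ n * Int a b (fun x => (g \_ `]a, b[%classic) x * phi x).
Proof.
move=> ab uL; split=> -[gL H]; split => // phi tphi.
  by rewrite -!Int_oo_restrict ?H//; try exact: L2_l2; [exact: (test_l2 0 ab tphi)|exact: (test_l2 n ab tphi)].
by rewrite !Int_oo_restrict ?H//; try exact: L2_l2; [exact: (test_l2 0 ab tphi)|exact: (test_l2 n ab tphi)].
Qed.

Lemma weak_derivative_unique a b n u g g' : a < b ->
  is_weak_derivative a b n u g -> is_weak_derivative a b n u g' ->
  g = g' %[ae mu in `]a, b[%classic].
Proof.
move=> ab [gL H] [gL' H'].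
have lg := L2_l2 gL; have lg' := L2_l2 gL'.
have := @fundamental_lemma R a b _ ab (l2B lg lg').
have E phi : test_function a b phi ->
    Int a b (fun x => ((g \_ `]a, b[) x - (g' \_ `]a, b[) x) * phi x) = 0.
  move=> tphi; have lphi := test_l2 0 ab tphi.
  under eq_Int do rewrite mulrBl.
  rewrite IntB; [|exact: l2_mul|exact: l2_mul].
  rewrite -!Int_oo_restrict//; have := H _ tphi; rewrite H'// => /eqP.
  rewrite (inj_eq (mulfI _)) => [/eqP ->|]; first by rewrite subrr.
  by rewrite expf_neq0// oppr_eq0 oner_eq0.
move=> /(_ E); apply: ae_imp => x H0; rewrite /= in_itv/= => xab.
have := H0 xab; rewrite !patchE mem_set/= ?in_itv//= => /eqP.
by rewrite subr_eq0 => /eqP.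
Qed.

(** A Sobolev function as a sequence of successive primitives. Weak derivatives are translated into
    chains once, and all estimates are made on chains. *)
Definition chain a b n (U : nat -> R -> R) :=
  (forall j, l2 (U j)) /\ forall j, (j < n)%N -> primitive a b (U j) (U j.+1).

Lemma ae_Int a b f g : a <= b -> l2 f -> l2 g -> {ae mu, forall x, a < x < b -> f x = g x} ->
  Int a b f = Int a b g.
Proof.
move=> ab lf lg fg; rewrite -!Int_oo; try exact: l2_locint.
congr fine; apply: ae_eq_integral => //.
- by apply/measurable_EFinP; apply: measurable_funTS; exact: l2_meas.
- by apply/measurable_EFinP; apply: measurable_funTS; exact: l2_meas.
- by apply: ae_imp fg => x /= H; rewrite in_itv/= => /H ->.
Qed.

Lemma ae_locint a b f g : a <= b -> locint f -> locint g ->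
  {ae mu, forall x, a < x < b -> f x = g x} -> Int a b f = Int a b g.
Proof.
move=> ab lf lg fg; rewrite -!Int_oo//.
congr fine; apply: ae_eq_integral => //.
- by apply: measurable_int; apply: integrableS (lf a b) => //; exact: subset_itv_oo_cc.
- by apply: measurable_int; apply: integrableS (lg a b) => //; exact: subset_itv_oo_cc.
- by apply: ae_imp fg => x /= H; rewrite in_itv/= => /H ->.
Qed.

Lemma chain_Int_test a b n U phi j : a < b -> chain a b n U -> test_function a b phi ->
  (j <= n)%N ->
  Int a b (fun x => U 0%N x * derive1n j phi x) = (-1) ^+ j * Int a b (fun x => U j x * phi x).
Proof.
move=> ab [lU pU] tphi.
have [c [d [ac cd db sphi]]] := (test_functionP phi ab).1 tphi.
elim: j n U lU pU phi tphi sphi => [|j IH] [|n] U lU pU phi tphi sphi // jn.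
  by rewrite expr0 mul1r.
  by rewrite expr0 mul1r.
have sj := supported_derive1n j sphi.
have := @IBP R a b _ _ _ _ (ltW ab) (lU 1%N) (supported_l2 j.+1 sphi) (lU 0%N)
  (supported_l2 j sphi) (pU 0%N isT) (supported_primitive j sphi (ltW ab)).
rewrite [derive1n j phi b]sj.2 ?[derive1n j phi a]sj.2; last first.
- by rewrite negb_and -!leNgt (ltW db) orbT.
- by rewrite negb_and -leNgt (ltW ac).
rewrite !mulr0 subr0 => /esym/eqP; rewrite addrC addr_eq0 => /eqP ->.
rewrite (IH n (fun i => U i.+1))//.
  by rewrite exprS mulN1r mulNr.
by move=> i; exact: (pU i.+1).
Qed.

Lemma chain_weak a b n U u j : a < b -> chain a b n U -> u \in L2 a b ->
  u = U 0%N %[ae mu in `]a, b[%classic] -> (j <= n)%N ->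
  is_weak_derivative a b j u (U j).
Proof.
move=> ab cU uL uU jn; apply/is_weak_derivativeP => //.
have lU i : l2 (U i \_ `]a, b[) by apply: l2_restrict; [exact: measurable_itv|exact: cU.1].
split; first by apply: l2_L2; exact: cU.1.
move=> phi tphi; have lp i := test_l2 i ab tphi.
transitivity (Int a b (fun x => U 0%N x * derive1n j phi x)).
  apply: ae_locint; [exact: ltW|apply: l2_mul => //; exact: L2_l2|apply: l2_mul => //; exact: cU.1|].
  by apply: ae_imp uU => x /= H xab; rewrite patchE mem_set/= ?in_itv//= H.
rewrite (chain_Int_test ab cU tphi jn); congr (_ * _).
apply: ae_locint; [exact: ltW|apply: l2_mul; [exact: cU.1|exact: (lp 0%N)]|apply: l2_mul; [exact: lU|exact: (lp 0%N)]|].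
by apply: ae_all => x xab; rewrite patchE mem_set/= ?in_itv.
Qed.

(** Du Bois-Reymond's lemma by induction on the order: an (n+1)-st weak derivative g yields the n-th
    one G + C, where G is a primitive of g and C a constant to be found. *)
Lemma weak_chain_aux a b n u g : a < b -> l2 u -> l2 g ->
  (forall phi, test_function a b phi -> Int a b (fun x => u x * derive1n n phi x) =
      (-1) ^+ n * Int a b (fun x => g x * phi x)) ->
  exists U, [/\ chain a b n U, (forall j, (j < n)%N -> continuous (U j)), U n = g &
    {ae mu, forall x, a < x < b -> u x = U 0%N x}].
Proof.
move=> ab lu; elim: n g => [|n IH] g lg H.
  exists (fun=> g); split => //.
  have := @fundamental_lemma R a b _ ab (l2B lu lg).
  have E phi : test_function a b phi -> Int a b (fun x => (u x - g x) * phi x) = 0.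
    move=> tphi; have lphi := test_l2 0 ab tphi.
    under eq_Int do rewrite mulrBl.
    rewrite IntB; [|exact: l2_mul|exact: l2_mul].
    by have := H _ tphi; rewrite expr0 mul1r /= => ->; rewrite subrr.
  by move=> /(_ E); apply: ae_imp => x /[apply]/eqP; rewrite subr_eq0 => /eqP.
pose G := SI a g; have lG : l2 G by exact: SI_l2.
pose r := mollifier 1 a b; pose c1 := a + (b - a) / 3; pose d1 := b - (b - a) / 3.
have c1d1 : c1 < d1 by rewrite /c1 /d1; lra.
pose rho x := (Int c1 d1 (mollifier 1 c1 d1))^-1 * mollifier 1 c1 d1 x.
have srho : supported c1 d1 rho.
  split; last by move=> x xcd; rewrite /rho bump_eq0 ?mulr0.
  by move=> m; apply: CnZ; exact: bump_smooth.
(* The only possible constant: the identity of order n tested with [rho], whose integral is 1. *)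
pose C := (-1) ^+ n * Int a b (fun x => u x * derive1n n rho x) - Int a b (fun x => G x * rho x).
have lGC : l2 (fun x => G x + C) by apply: l2D => //; exact: l2_cst.
have [|U [[lU pU] cU Un uU]] := IH _ lGC; last first.
  exists (fun j => if (j <= n)%N then U j else g); split => //.
  - split=> j; first by case: ifP.
    rewrite ltnS => jn; rewrite jn; case: ltnP => [jn'|nj]; first exact: pU.
    have {jn nj} -> : j = n by apply/eqP; rewrite eqn_leq jn nj.
    rewrite Un => x y ax xy yb; rewrite -(SI_sub a (l2_locint lg) xy) /G; ring.
  - move=> j jn; rewrite -ltnS jn; have [|nj] := ltnP j n; first exact: cU.
    have -> : j = n by apply/eqP; rewrite eqn_leq nj -ltnS jn.
    rewrite Un => x; apply: cvgD; last exact: cvg_cst.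
    exact: SI_continuous.
  - by rewrite ltnn.
move=> psi tpsi.
have [c2 [d2 [ac2 cd2 db2 spsi]]] := (test_functionP psi ab).1 tpsi.
pose c := Num.min c1 c2; pose d := Num.max d1 d2.
have cc1 : c <= c1 by rewrite ge_min lexx.
have cc2 : c <= c2 by rewrite ge_min lexx orbT.
have dd1 : d1 <= d by rewrite le_max lexx.
have dd2 : d2 <= d by rewrite le_max lexx orbT.
have ac : a < c by rewrite lt_min ac2 /c1 andbT; lra.
have db : d < b by rewrite gt_max db2 /d1 andbT; lra.
have cd : c < d by lra.
have {}spsi := supportedW cc2 dd2 spsi.
have {}srho := supportedW cc1 dd1 srho.
have lpsi := supported_l2 0 spsi; have lrho := supported_l2 0 srho.
rewrite /= in lpsi lrho.
set K := Int c d psi.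
have lf0 : l2 (fun x => psi x - K * rho x) by apply: l2B => //; exact: l2Z.
have Int1 f c' d' : supported c' d' f -> a < c' -> c' < d' -> d' < b -> Int a b f = Int c' d' f.
  move=> sf ac' cd' db'; have lf := supported_l2 0 sf.
  rewrite -[LHS]mul1r -[RHS]mul1r -!IntZ; try exact: l2_locint.
  rewrite (@Int_supported _ a b c' d' (fun=> 1))//; [|exact: ltW|exact: ltW].
  by apply: locintZ; exact: l2_locint.
have Jrho : Int c d rho = 1.
  rewrite -(Int1 _ c d)// (Int1 _ c1 d1)//; last 3 first.
  - split; last by move=> x xcd; rewrite /rho bump_eq0 ?mulr0.
    by move=> m; apply: CnZ; exact: bump_smooth.
  - by rewrite /c1; lra.
  - by rewrite /d1; lra.
  rewrite IntZ ?mulVf ?gt_eqF ?Int_bump_gt0//.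
  by apply: l2_locint; exact: supported_l2 0%N (supported_bump c1 d1 1).
(* Every test function [psi] is [K * rho] plus the derivative of a test function [phi]. The first
   part is settled by the choice of [C], the second by the hypothesis of order n + 1. *)
have sphi := supported_antiderivative cd spsi srho Jrho.
set phi := SI c _ in sphi.
have tphi : test_function a b phi by apply/test_functionP => //; exists c, d.
have dphi := derive1n_SI_sub n K c spsi.1 srho.1.
have dphi0 := derive1n_SI_sub 0 K c spsi.1 srho.1.
have lp := supported_l2 n spsi; have lr := supported_l2 n srho.
have := H _ tphi; rewrite dphi.
have -> : Int a b (fun x => u x * (derive1n n psi x - K * derive1n n rho x)) =
  Int a b (fun x => u x * derive1n n psi x) - K * Int a b (fun x => u x * derive1n n rho x).
  rewrite -IntZ; last exact: l2_mul.
  rewrite -IntB; [|exact: l2_mul|by apply: locintZ; exact: l2_mul].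
  by apply: eq_Int => x _; ring.
have pG : primitive a b G g by apply: SI_primitive; exact: l2_locint.
have := @IBP R a b _ _ _ _ (ltW ab) lg (supported_l2 1 sphi) lG
  (supported_l2 0 sphi) pG (supported_primitive 0 sphi (ltW ab)).
rewrite dphi0 /= sphi.2 ?[phi a]sphi.2; last first.
- by rewrite negb_and -!leNgt (ltW db) orbT.
- by rewrite negb_and -leNgt (ltW ac).
rewrite !mulr0 subr0.
have -> : Int a b (fun x => G x * (psi x - K * rho x)) =
  Int a b (fun x => G x * psi x) - K * Int a b (fun x => G x * rho x).
  rewrite -IntZ; last exact: l2_mul.
  rewrite -IntB; [|exact: l2_mul|by apply: locintZ; exact: l2_mul].
  by apply: eq_Int => x _; ring.
have -> : Int a b (fun x => (G x + C) * psi x) = Int a b (fun x => G x * psi x) + C * K.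
  rewrite /K -(Int1 psi)// -IntZ; last exact: l2_locint.
  rewrite -IntD; [|exact: l2_mul|by apply: locintZ; exact: l2_locint].
  by apply: eq_Int => x _; ring.
rewrite /C exprS mulN1r.
have : (-1) ^+ n * (-1) ^+ n = 1 :> R by rewrite -exprMn mulrNN mulr1 expr1n.
set s := (-1) ^+ n; set A := Int a b (fun x => u x * derive1n n psi x).
set B := Int a b (fun x => u x * derive1n n rho x).
set D := Int a b (fun x => G x * psi x); set E := Int a b (fun x => G x * rho x).
set F := Int a b _ => ss h1 h2.
have -> : A = K * B - s * F by lra.
have -> : F = - (D - K * E) by lra.
transitivity (K * B * (s * s) + s * (D - K * E)); last by ring.
by rewrite ss; ring.
Qed.

Lemma weak_chain a b n u g : a < b -> u \in L2 a b -> is_weak_derivative a b n u g ->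
  exists U, [/\ chain a b n U, (forall j, (j < n)%N -> continuous (U j)),
    U n = g \_ `]a, b[%classic & u = U 0%N %[ae mu in `]a, b[%classic]].
Proof.
move=> ab uL /is_weak_derivativeP-/(_ ab uL)[gL H].
have [U [cU kU Un uU]] := weak_chain_aux ab (L2_l2 uL) (L2_l2 gL) H.
exists U; split => //; apply: ae_imp uU => x H0; rewrite /= in_itv/= => xab.
by rewrite -H0// patchE mem_set//= in_itv.
Qed.

Lemma xget_weak_derivative a b n u g : is_weak_derivative a b n u g ->
  is_weak_derivative a b n u (weak_derivative a b n u).
Proof. by move=> H; rewrite /weak_derivative; case: xgetP => [y -> //|/(_ g)]. Qed.

Lemma chain_sobolev a b n U u : a < b -> chain a b n U -> u \in L2 a b ->
  u = U 0%N %[ae mu in `]a, b[%classic] ->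
  sobolev a b n u /\ forall j, (j <= n)%N ->
    weak_derivative a b j u = U j %[ae mu in `]a, b[%classic].
Proof.
move=> ab cU uL uU; split.
  by split => // j jn; exists (U j); exact: chain_weak uU jn.
move=> j jn; have H := chain_weak ab cU uL uU jn.
exact: weak_derivative_unique ab (xget_weak_derivative H) H.
Qed.

Lemma sobolev_chain a b n u : a < b -> sobolev a b n u ->
  exists U, [/\ chain a b n U, (forall j, (j < n)%N -> continuous (U j)) &
    forall j, (j <= n)%N ->
      is_weak_derivative a b j u (U j) /\
      weak_derivative a b j u = U j %[ae mu in `]a, b[%classic]].
Proof.
move=> ab [uL /(_ n (leqnn n))[g wg]].
have [U [cU kU _ uU]] := weak_chain ab uL wg.
exists U; split => // j jn; split; first exact: chain_weak uU jn.
by have [_] := chain_sobolev ab cU uL uU; exact.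
Qed.

End weak_derivatives.

(** * Optimal polynomials and the cell problem *)

Section polynomials.
Context {R : realType}.
Notation mu := (@lebesgue_measure R).
Implicit Types (a b c d x y t T : R) (p q : {poly R}) (n m j k : nat).

Lemma horner_l2 p : l2 (horner p).
Proof. by apply: continuous_l2; exact: continuous_horner. Qed.

Lemma horner_primitive p a b : primitive a b (horner p) (horner p^`()).
Proof.
move=> x y _ xy _; apply/esym/Int_FTC2 => //; exact: continuous_horner.
Qed.

Lemma horner_derivn_primitive p j a b : primitive a b (horner p^`(j)) (horner p^`(j.+1)).
Proof. by rewrite derivnS; exact: horner_primitive. Qed.

Lemma Int_poly p a b : a <= b -> Int a b (horner p^`()) = p.[b] - p.[a].
Proof. by move=> ab; rewrite -(@horner_primitive p a b). Qed.

Lemma chain_IBP a b n (U : nat -> R -> R) q : a <= b -> chain a b n U ->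
  Int a b (fun x => U 0%N x * q^`(n).[x]) =
  \sum_(j < n) (-1) ^+ j * (U j b * q^`(n - j.+1).[b] - U j a * q^`(n - j.+1).[a]) +
  (-1) ^+ n * Int a b (fun x => U n x * q.[x]).
Proof.
move=> ab; elim: n U => [|n IH] U [lU pU].
  by rewrite big_ord0 add0r expr0 mul1r.
have := @IBP R a b _ _ _ _ ab (lU 1%N) (horner_l2 q^`(n.+1)) (lU 0%N) (horner_l2 q^`(n))
  (pU 0%N isT) (horner_derivn_primitive q n (a := a) (b := b)).
rewrite (IH (fun i => U i.+1)); last by split => // j jn; exact: (pU j.+1).
set Y := Int a b (fun x => U 0%N x * _); set X := Int a b _.
set S := \sum_(j < n) _; set s := (-1) ^+ n => h.
rewrite big_ord_recl expr0 mul1r subn1/=.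
have -> : \sum_(i < n) (-1) ^+ bump 0 i *
     (U (bump 0 i) b * q^`(n.+1 - (bump 0 i).+1).[b] -
      U (bump 0 i) a * q^`(n.+1 - (bump 0 i).+1).[a]) = - S.
  rewrite -sumrN; apply: eq_bigr => i _.
  by rewrite /bump/= add1n exprS mulN1r mulNr subSS.
rewrite exprS mulN1r mulNr -/s; lra.
Qed.

(* Up to a factor, the derivative of the optimal transition from 0 to 1 on [a, b] for the
   energy of the (n + 1)-st derivative, which is acoef n / (b - a)^(2n + 1). *)
Definition Vp n a b : {poly R} := ('X - a%:P) ^+ n * ('X - b%:P) ^+ n.

(** Euler's Beta integral of x^n (1 - x)^n over [0, 1]. *)
Definition beta n : R := (n`! ^ 2)%:R / (n.*2.+1`!)%:R.

Definition acoef n : R := (n.*2`!)%:R / beta n.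

Lemma beta_gt0 n : 0 < beta n.
Proof. by rewrite divr_gt0// ltr0n ?expn_gt0 ?fact_gt0. Qed.

Lemma acoef_gt0 n : 0 < acoef n.
Proof. by rewrite divr_gt0 ?beta_gt0// ltr0n fact_gt0. Qed.

Lemma deriv_pow_root n a q j : (j < n)%N -> ((('X - a%:P) ^+ n * q)^`(j)).[a] = 0.
Proof.
elim: j n q => [|j IH] [|n] q // jn.
  by rewrite hornerM horner_exp !hornerE subrr expr0n/= mul0r.
rewrite derivSn (_ : _^`() = ('X - a%:P) ^+ n * (n.+1%:R *: q + ('X - a%:P) * q^`())).
  exact: IH.
rewrite derivM deriv_exp derivXsubC /= -[_ *+ n.+1]mulr_natl ?mul1r ?mulr1.
rewrite mulrDr; congr (_ + _).
  by rewrite -mul_polyC polyC_natr; ring.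
by rewrite exprSr mulrA.
Qed.

Lemma Vp_root_a n a b j : (j < n)%N -> (Vp n a b)^`(j).[a] = 0.
Proof. exact: deriv_pow_root. Qed.

Lemma Vp_root_b n a b j : (j < n)%N -> (Vp n a b)^`(j).[b] = 0.
Proof. by rewrite /Vp mulrC; exact: deriv_pow_root. Qed.

Lemma Vp_monic n a b : Vp n a b \is monic.
Proof. by rewrite monicMl monic_exp ?monicXsubC. Qed.

Lemma size_Vp n a b : size (Vp n a b) = n.*2.+1.
Proof.
rewrite /Vp size_Mmonic ?monic_exp ?monicXsubC//; last first.
  by rewrite -size_poly_eq0 size_exp_XsubC.
by rewrite !size_exp_XsubC -addnn addnS.
Qed.

Lemma derivn_monic p m : p \is monic -> size p = m.+1 -> p^`(m) = (m`!%:R)%:P.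
Proof.
move=> mp sp; apply/polyP => i; rewrite coef_derivn coefC.
case: i => [|i]/=.
  rewrite addn0 ffactnn (_ : p`_m = 1) ?mulr_natr//.
  by move/monicP: mp; rewrite lead_coefE sp.
by rewrite nth_default ?mul0rn// sp addnS ltnS leq_addr.
Qed.

Lemma Vp_top n a b : (Vp n a b)^`(n)^`(n) = (n.*2`!%:R)%:P.
Proof.
by rewrite /derivn -iterD addnn; rewrite -[iter _ _ _]/((Vp n a b)^`(n.*2)) (derivn_monic (Vp_monic n a b))// size_Vp.
Qed.

(** Powers move from one factor to the other because (x - a)^(i+1) (x - b)^(j+1) vanishes at both
    ends, so its derivative has integral zero. *)
Lemma Int_beta i j a b : a <= b ->
  Int a b (horner (('X - a%:P) ^+ i * ('X - b%:P) ^+ j)) =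
  (-1) ^+ j * (i`! * j`!)%:R / ((i + j).+1`!)%:R * (b - a) ^+ (i + j).+1.
Proof.
move=> ab; elim: j i => [|j IH] i.
  have := Int_poly (('X - a%:P) ^+ i.+1) ab.
  rewrite deriv_exp derivXsubC mulr1 /= !horner_exp !hornerE subrr [0 ^+ _]expr0n/= subr0.
  rewrite -mulr_natl => H.
  have : i.+1%:R * Int a b (horner (('X - a%:P) ^+ i * ('X - b%:P) ^+ 0)) = (b - a) ^+ i.+1.
    rewrite -H -IntZ; last by apply: l2_locint; exact: horner_l2.
    by apply: eq_Int => x _; rewrite expr0 mulr1 hornerM hornerMn hornerC.
  rewrite expr0 mulr1 => <-; rewrite ?mul1r ?fact0 ?muln1 ?addn0 factS natrM.
  have p0 : i.+1%:R != 0 :> R by rewrite pnatr_eq0.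
  have q0 : i`!%:R != 0 :> R by rewrite pnatr_eq0 -lt0n fact_gt0.
  by move: p0 q0; move: (i.+1%:R : R) (i`!%:R : R) => p q p0 q0; field; rewrite p0 q0.
have H : Int a b (horner (('X - a%:P) ^+ i *+ i.+1 * ('X - b%:P) ^+ j.+1 +
          ('X - a%:P) ^+ i.+1 * (('X - b%:P) ^+ j *+ j.+1))) = 0.
  have := Int_poly (('X - a%:P) ^+ i.+1 * ('X - b%:P) ^+ j.+1) ab.
  rewrite !hornerM !horner_exp !hornerE !subrr !exprS ?mul0r ?mulr0 ?mul0r ?mulr0 subr0.
  by rewrite -!exprS derivM !deriv_exp !derivXsubC ?mul1r ?mulr1.
have : i.+1%:R * Int a b (horner (('X - a%:P) ^+ i * ('X - b%:P) ^+ j.+1)) +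
       j.+1%:R * Int a b (horner (('X - a%:P) ^+ i.+1 * ('X - b%:P) ^+ j)) = 0.
  rewrite -[RHS]H -!IntZ; try (by apply: l2_locint; exact: horner_l2).
  rewrite -IntD; try (by apply: l2_locint; apply: l2Z; exact: horner_l2).
  apply: eq_Int => x _; rewrite hornerD; congr (_ + _).
    by rewrite [in RHS]mulrnAl [in RHS]hornerMn mulr_natl.
  by rewrite [in RHS]mulrnAr [in RHS]hornerMn mulr_natl.
rewrite IH addSnnS !factS !natrM exprS => /eqP; rewrite addr_eq0 => /eqP E.
apply: (@mulfI _ i.+1%:R); first by rewrite pnatr_eq0.
rewrite E [(-1) ^+ j.+1]exprS mulN1r.
set D := (_ * _)^-1; move: D ((-1) ^+ j : R) (i.+1%:R : R) (j.+1%:R : R).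
move=> D s p q; ring.
Qed.

Lemma Int_Vp n a b : a <= b -> Int a b (horner (Vp n a b)) = (-1) ^+ n * beta n * (b - a) ^+ n.*2.+1.
Proof. by move=> ab; rewrite /Vp Int_beta// addnn /beta -!mulrA mulnn. Qed.

Lemma Vp_chain n a b a' b' : chain a' b' n (fun j => horner (Vp n a b)^`(j)).
Proof. by split=> [j|j _]; [exact: horner_l2|exact: horner_derivn_primitive]. Qed.

(** n integrations by parts move all derivatives onto one factor, where they leave the constant
    (2n)! since [Vp] is monic of degree 2n. The zeros of order n at both ends remove the boundary
    terms. *)
Lemma Int_Vp_sqr n a b : a <= b ->
  Int a b (fun x => (Vp n a b)^`(n).[x] ^+ 2) = n.*2`!%:R * beta n * (b - a) ^+ n.*2.+1.
Proof.
move=> ab; have := @chain_IBP a b n _ (Vp n a b)^`(n) ab (Vp_chain n a b a b).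
rewrite big1 ?add0r; last first.
  by move=> i _; rewrite Vp_root_a ?Vp_root_b ?mul0r ?subr0 ?mulr0.
rewrite derivn0 Vp_top.
have -> : Int a b (fun x => (Vp n a b).[x] * (n.*2`!%:R)%:P.[x]) =
    n.*2`!%:R * ((-1) ^+ n * beta n * (b - a) ^+ n.*2.+1).
  rewrite -Int_Vp// -IntZ; last by apply: l2_locint; exact: horner_l2.
  by apply: eq_Int => x _; rewrite hornerC mulrC.
have : (-1) ^+ n * (-1) ^+ n = 1 :> R by rewrite -exprMn mulrNN mulr1 expr1n.
have -> : Int a b (fun x => (Vp n a b)^`(n).[x] * (Vp n a b)^`(n).[x]) =
    Int a b (fun x => (Vp n a b)^`(n).[x] ^+ 2) by apply: eq_Int => x _; rewrite expr2.
set s := (-1) ^+ n; set X := Int _ _ _ => ss E.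
transitivity (s * (s * X)); first by rewrite mulrA ss mul1r.
transitivity (s * s * (n.*2`!%:R * beta n * (b - a) ^+ n.*2.+1)); last by rewrite ss mul1r.
rewrite -E; ring.
Qed.

(* The polynomial whose n-th derivative is 1 and which is orthogonal on [a, b] to all
   polynomials of degree < n: it minimizes the L2 norm. *)
Definition Qp n a b : {poly R} := (n.*2`!%:R)^-1 *: (Vp n a b)^`(n).

Lemma Qp_top n a b : (Qp n a b)^`(n) = 1.
Proof.
rewrite /Qp derivnZ Vp_top -mul_polyC -polyCM mulVf// pnatr_eq0 -lt0n fact_gt0//.
Qed.

Lemma Int_Qp_sqr n a b : a <= b ->
  Int a b (fun x => (Qp n a b).[x] ^+ 2) = (b - a) ^+ n.*2.+1 / acoef n.
Proof.
move=> ab; have f0 : n.*2`!%:R != 0 :> R by rewrite pnatr_eq0 -lt0n fact_gt0.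
have -> : Int a b (fun x => (Qp n a b).[x] ^+ 2) =
    (n.*2`!%:R)^-1 ^+ 2 * Int a b (fun x => (Vp n a b)^`(n).[x] ^+ 2).
  rewrite -IntZ; last exact: (horner_l2 _).2.
  by apply: eq_Int => x _; rewrite /Qp hornerZ exprMn.
rewrite Int_Vp_sqr// /acoef; field.
by rewrite f0 gt_eqF ?beta_gt0.
Qed.

(** Duality: [Qp] has n-th derivative 1, so n integrations by parts turn the integral of [U 0] into
    that of [U n] against [Qp] up to sign, and Cauchy-Schwarz applies. With [U 0] = v' it bounds the
    energy in the cell problem from below. *)
Lemma transition_bound a b n (U : nat -> R -> R) : a <= b -> chain a b n U ->
  (forall j, (j < n)%N -> U j a = 0 /\ U j b = 0) ->
  Int a b (U 0%N) ^+ 2 <= Int a b (fun x => U n x ^+ 2) * ((b - a) ^+ n.*2.+1 / acoef n).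
Proof.
move=> ab cU bd; have := chain_IBP (Qp n a b) ab cU.
rewrite big1 ?add0r; last first.
  by move=> i _; have [-> ->] := bd i (ltn_ord i); rewrite !mul0r subrr mulr0.
rewrite Qp_top; under eq_Int do rewrite hornerC mulr1.
move=> ->; rewrite exprMn -exprM mulnC exprM sqrrN expr1n expr1n mul1r.
by rewrite -Int_Qp_sqr//; apply: Int_CS; [exact: cU.1|exact: horner_l2].
Qed.

End polynomials.

Section cell.
Context {R : realType}.
Notation mu := (@lebesgue_measure R).
Implicit Types (a b x y t T c : R) (n m j k : nat).

Lemma EFin_Int a b f : locint f ->
  (\int[mu]_(x in `]a, b[%classic) (f x)%:E)%E = (Int a b f)%:E.
Proof.
move=> lf; rewrite -Int_oo// /Rintegral fineK//; apply: integrable_fin_num => //.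
by apply: integrableS (lf a b) => //; exact: subset_itv_oo_cc.
Qed.

Lemma L2_measurable a b (u : R -> R) : u \in L2 a b ->
  measurable_fun (`]a, b[%classic : set (measurableTypeR R)) u.
Proof.
by move=> /L2_l2/l2_meas; move/(measurable_restrictT _ _).2; apply.
Qed.

Lemma integral_ae_Int a b (F g U : R -> R) : g \in L2 a b -> l2 U ->
  measurable_fun [set: measurableTypeR R] F -> locint (F \o U) ->
  g = U %[ae mu in `]a, b[%classic] ->
  (\int[mu]_(x in `]a, b[%classic) (F (g x))%:E)%E = (Int a b (F \o U))%:E.
Proof.
move=> gL lU mF lFU gU; rewrite -EFin_Int//; apply: ae_eq_integral => //.
- apply/measurable_EFinP; apply: (measurableT_comp mF); exact: L2_measurable.
- by apply/measurable_EFinP; apply: (measurableT_comp mF); apply: measurable_funTS; exact: l2_meas.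
- by apply: ae_imp gU => x /= H /H ->.
Qed.

Lemma integral_sqr_ae a b (g U : R -> R) : g \in L2 a b -> l2 U ->
  g = U %[ae mu in `]a, b[%classic] ->
  (\int[mu]_(x in `]a, b[%classic) ((g x) ^+ 2)%:E)%E = (Int a b (fun x => U x ^+ 2))%:E.
Proof.
move=> gL lU gU; apply: (integral_ae_Int (F := fun x => x ^+ 2)) => //; exact: lU.2.
Qed.

Lemma ae_exists a b (P : R -> Prop) : a < b -> {ae mu, forall x, a < x < b -> P x} ->
  exists x, a < x < b /\ P x.
Proof.
move=> ab [B [mB B0 sub]]; apply: contrapT => nP.
have : (mu `]a, b[%classic <= mu B)%E.
  apply: le_measure; rewrite ?inE//.
  move=> x /=; rewrite in_itv/= => xab; apply: sub => /= H; apply: nP.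
  by exists x; split => //; exact: H.
have := lebesgue_measure_itv `]a, b[; rewrite /= lte_fin ab => E.
rewrite [X in (X <= _)%E -> _](_ : _ = (b - a)%:E); last exact: E.
by rewrite [X in (_ <= X)%E -> _](_ : _ = 0%E)// lee_fin subr_le0 leNgt ab.
Qed.

Lemma continuous_ae_unique a b (f g : R -> R) : a < b ->
  {within `[a, b]%classic, continuous f} -> {within `[a, b]%classic, continuous g} ->
  f = g %[ae mu in `]a, b[%classic] -> f a = g a /\ f b = g b.
Proof.
move=> ab /(continuous_within_itvP f ab)[_ fa fb] /(continuous_within_itvP g ab)[_ ga gb] fg.
have {}fg : {ae mu, forall x, a < x < b -> f x = g x}.
  by apply: ae_imp fg => x /= H xab; apply: H; rewrite in_itv.
split; apply/eqP; rewrite -subr_eq0 -normr_le0; apply/ler_addgt0Pl => e e0; rewrite addr0.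
- have e2 : 0 < e / 2 by rewrite divr_gt0.
  have /cvgr_dist_lt/(_ _ e2) := fa; have /cvgr_dist_lt/(_ _ e2) := ga.
  move=> [d1 /= d10 H1] [d2 /= d20 H2].
  pose d := Num.min (Num.min d1 d2) (b - a).
  have dp : a < a + d by rewrite ltrDl !lt_min d10 d20 subr_gt0.
  have fgd : {ae mu, forall x, a < x < a + d -> f x = g x}.
    apply: ae_imp fg => x H /andP[ax xd]; apply: H; rewrite ax/= (lt_le_trans xd)//.
    by rewrite -lerBrDl ge_min lexx orbT.
  have [x [/andP[ax xd] E]] := ae_exists dp fgd.
  have xd1 : x - a < d by rewrite ltrBlDl.
  have dd1 : d <= d1 by rewrite !ge_min lexx.
  have dd2 : d <= d2 by rewrite !ge_min lexx orbT.
  have axd : `|a - x| = x - a by rewrite distrC gtr0_norm ?subr_gt0.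
  have := H1 x; rewrite /= axd (lt_le_trans xd1 dd1) ax => /(_ isT isT) h1.
  have := H2 x; rewrite /= axd (lt_le_trans xd1 dd2) ax => /(_ isT isT) h2.
  rewrite (_ : f a - g a = (f a - f x) - (g a - g x)); last by rewrite E; ring.
  by rewrite (le_trans (ler_normB _ _))// [leRHS]splitr lerD// ltW.
- have e2 : 0 < e / 2 by rewrite divr_gt0.
  have /cvgr_dist_lt/(_ _ e2) := fb; have /cvgr_dist_lt/(_ _ e2) := gb.
  move=> [d1 /= d10 H1] [d2 /= d20 H2].
  pose d := Num.min (Num.min d1 d2) (b - a).
  have dp : b - d < b by rewrite ltrBlDr ltrDl !lt_min d10 d20 subr_gt0.
  have fgd : {ae mu, forall x, b - d < x < b -> f x = g x}.
    apply: ae_imp fg => x H /andP[xd xb]; apply: H; rewrite xb andbT (le_lt_trans _ xd)//.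
    by rewrite lerBrDl -lerBrDr ge_min lexx orbT.
  have [x [/andP[xd xb] E]] := ae_exists dp fgd.
  have xd1 : b - x < d by rewrite ltrBlDr -ltrBlDl.
  have dd1 : d <= d1 by rewrite !ge_min lexx.
  have dd2 : d <= d2 by rewrite !ge_min lexx orbT.
  have axd : `|b - x| = b - x by rewrite gtr0_norm ?subr_gt0.
  have := H1 x; rewrite /= axd (lt_le_trans xd1 dd1) xb => /(_ isT isT) h1.
  have := H2 x; rewrite /= axd (lt_le_trans xd1 dd2) xb => /(_ isT isT) h2.
  rewrite (_ : f b - g b = (f b - f x) - (g b - g x)); last by rewrite E; ring.
  by rewrite (le_trans (ler_normB _ _))// [leRHS]splitr lerD// ltW.
Qed.

(** The optimal competitor and its derivatives. Division by [J] normalizes the height and also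
    removes the sign (-1)^n of [Vp]. *)
Definition transition n T j : R -> R :=
  let J := Int 0 T (horner (Vp n 0 T)) in
  if j is j'.+1 then fun x => J^-1 * (Vp n 0 T)^`(j').[x]
  else SI 0 (fun x => J^-1 * (Vp n 0 T).[x]).

Lemma IntVp_neq0 n a b : a < b -> Int a b (horner (Vp n a b)) != 0.
Proof.
move=> ab; have b0 : beta n != 0 :> R by rewrite gt_eqF ?beta_gt0.
have s0 : (-1) ^+ n != 0 :> R by rewrite expf_neq0// oppr_eq0 oner_eq0.
rewrite Int_Vp 1?ltW// mulf_neq0// ?mulf_neq0//.
by rewrite expf_neq0// subr_eq0 gt_eqF.
Qed.

Lemma transition_l2 n T j : l2 (transition n T j).
Proof.
case: j => [|j]; last by apply: l2Z; exact: horner_l2.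
by apply: SI_l2; apply: l2Z; exact: horner_l2.
Qed.

Lemma transition_continuous n T j : continuous (transition n T j).
Proof.
case: j => [|j].
  by apply: SI_continuous; apply: l2Z; exact: horner_l2.
by move=> x; apply: cvgM; [exact: cvg_cst|exact: continuous_horner].
Qed.

Lemma transition_chain n m T : chain 0 T m (transition n T).
Proof.
split; first exact: transition_l2.
move=> [|j] _.
  rewrite /transition derivn0; apply: SI_primitive.
  by apply: l2_locint; apply: l2Z; exact: horner_l2.
move=> x y x0 xy yT; rewrite /transition IntZ; last by apply: l2_locint; exact: horner_l2.
rewrite -mulrBr; congr (_ * _); exact: (@horner_derivn_primitive R (Vp n 0 T) j 0 T).
Qed.

Lemma transition_bnd n T j : 0 < T -> (j < n.+1)%N ->
  transition n T j 0 = 0 /\ transition n T j T = if j == 0%N then 1 else 0.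
Proof.
move=> T0; case: j => [|j] jn /=.
  rewrite SIaa SIE ?ltW//; split=> //.
  by rewrite IntZ ?mulVf ?IntVp_neq0//; apply: l2_locint; exact: horner_l2.
by rewrite Vp_root_a ?Vp_root_b// mulr0.
Qed.

Lemma transition_energy n T : 0 < T ->
  Int 0 T (fun x => transition n T n.+1 x ^+ 2) = acoef n / T ^+ n.*2.+1.
Proof.
move=> T0; rewrite /transition.
under eq_Int do rewrite exprMn.
rewrite IntZ; last exact: (horner_l2 _).2.
rewrite Int_Vp_sqr 1?ltW// Int_Vp 1?ltW// subr0 /acoef.
have s1 : ((-1) ^+ n) ^+ 2 = 1 :> R by rewrite -exprM mulnC exprM sqrrN expr1n expr1n.
have b0 : beta n != 0 :> R by rewrite gt_eqF ?beta_gt0.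
have T1 : T ^+ n.*2.+1 != 0 by rewrite expf_neq0// gt_eqF.
rewrite exprVn; move: b0; move: (beta n : R) => b b0; rewrite !exprMn s1 mul1r.
set t := T ^+ _ in T1 *.
by field; rewrite b0 T1.
Qed.

Lemma transition_admissible n T : 0 < T -> admissible n.+1 T (transition n T 0).
Proof.
move=> T0; have uL : transition n T 0 \in L2 0 T by apply: l2_L2; exact: transition_l2.
have [|sU wU] := chain_sobolev T0 (transition_chain n n.+1 T) uL; first exact: ae_all.
split => // l ln; exists (transition n T l).
have [h0 hT] := transition_bnd T0 ln.
split => //; split; first by apply: continuous_subspaceT; exact: transition_continuous.
exact: wU (ltnW ln).
Qed.

Lemma weak_derivative_L2 a b n (u g : R -> R) : is_weak_derivative a b n u g ->
  weak_derivative a b n u \in L2 a b.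
Proof. by move=> /xget_weak_derivative []. Qed.

Lemma cell_energy_transition n T c : 0 < T ->
  cell_energy n.+1 c T (transition n T 0) = (T + c * (acoef n / T ^+ n.*2.+1))%:E.
Proof.
move=> T0; have uL : transition n T 0 \in L2 0 T by apply: l2_L2; exact: transition_l2.
have [|sU wU] := chain_sobolev T0 (transition_chain n n.+1 T) uL; first exact: ae_all.
have [g wg] := sU.2 n.+1 (leqnn _).
rewrite /cell_energy (integral_sqr_ae _ _ (wU _ (leqnn _))).
- by rewrite transition_energy.
- exact: weak_derivative_L2 wg.
- exact: transition_l2.
Qed.

Lemma cell_lower n c T : solves_cell_problem n.+1 c -> 0 < T ->
  1 <= T + c * (acoef n / T ^+ n.*2.+1).
Proof.
move=> [m mP mE] T0; rewrite -lee_fin -cell_energy_transition// -[1%:E]mE.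
apply: (@le_trans _ _ (m T)).
  by apply: ereal_inf_lbound; exists T.
by apply: (mP T T0).2; exists (transition n T 0) => //; exact: transition_admissible.
Qed.

Lemma admissible_bound n c T v (e : R) : 0 < T -> 0 < c -> admissible n.+1 T v ->
  (cell_energy n.+1 c T v < e%:E)%E -> c * acoef n <= (e - T) * T ^+ n.*2.+1.
Proof.
move=> T0 c0 [sv bv] En.
have [U [cU kU wU]] := sobolev_chain T0 sv.
have [w1 w2] := wU n.+1 (leqnn _).
move: En; rewrite /cell_energy (integral_sqr_ae (weak_derivative_L2 w1) (cU.1 _) w2).
rewrite -EFinM -EFinD lte_fin => En.
have bd l : (l < n.+1)%N -> U l 0 = 0 /\ U l T = if l == 0%N then 1 else 0.
  move=> ln; have [h [[ch wh] h0 hT]] := bv l ln.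
  have [_ wl] := wU l (ltnW ln).
  have [|<- <-] := continuous_ae_unique T0 ch (continuous_subspaceT (kU l ln)); last by rewrite h0.
  by have := ae_and wh wl; apply: ae_imp => x [H1 H2] xT; rewrite -H1// H2.
have cU' : chain 0 T n (fun j => U j.+1).
  by split => j; [exact: cU.1|move=> jn; exact: cU.2].
have := transition_bound (ltW T0) cU' _.
have [U00 U0T] := bd 0%N isT.
have E1 : Int 0 T (U 1%N) = 1.
  by rewrite -(cU.2 0%N isT 0 T)// 1?ltW// U00 U0T subr0.
rewrite E1 expr1n subr0 => H.
have {H} : 1 <= Int 0 T (fun x => U n.+1 x ^+ 2) * (T ^+ n.*2.+1 / acoef n).
  by apply: H => j jn; have [] := bd j.+1 jn.
have A0 := acoef_gt0 (R := R) n.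
set X := Int _ _ _ in En *; rewrite mulrA ler_pdivlMr// mul1r => H.
apply: (@le_trans _ _ (c * (X * T ^+ n.*2.+1))); first by rewrite ler_pM2l.
rewrite mulrA ler_pM2r ?exprn_gt0//; lra.
Qed.

Lemma pow_onem_le (y : R) N : 0 <= y -> y <= 1 -> N.+1%:R * ((1 - y) * y ^+ N) <= 1.
Proof.
move=> y0 y1.
apply: (@le_trans _ _ (1 - y ^+ N.+1)); last by rewrite lerBlDr lerDl exprn_ge0.
rewrite -[1 in leRHS](expr1n _ N.+1) subrXX mulrCA ler_wpM2l ?subr_ge0//.
rewrite mulr_natl -[in leLHS](card_ord N.+1) -sumr_const.
apply: ler_sum => i _; rewrite expr1n mul1r.
by apply: ler_wiXn2l => //; rewrite -ltnS.
Qed.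

(** A nearly optimal length T satisfies c [acoef n] <= (1 + i - T) T^(2n+1), and the maximum of (1 -
    y) y^(2n+1) on [0, 1] is at most 1/(2n+2). The slack i is there because the infimum over T need
    not be attained. *)
Lemma cell_upper n c : 0 < c -> solves_cell_problem n.+1 c -> c * acoef n <= n.+1%:R^-1.
Proof.
move=> c0 [m mP mE].
(* The slack 1/(2N) is small enough that (1 + i)^N <= 2, by Bernoulli's inequality for (1 - i)^N. *)
pose N := n.*2.+2; pose i : R := (2 * N%:R)^-1.
have N0 : 0 < N%:R :> R by rewrite ltr0n.
have i0 : 0 < i by rewrite invr_gt0 mulr_gt0.
have Ni : N%:R * i = 2^-1 by rewrite /i invfM; field; rewrite gt_eqF.
have : (ereal_inf [set m T | T in [set T : R | (0 < T)%R]] < (1 + i)%:E)%E.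
  by rewrite mE lte_fin ltrDl.
move=> /ereal_inf_lt[_ [T /= T0 <-]] mT.
have [[v va vE] _] := mP T T0.
have := admissible_bound T0 c0 va; rewrite vE => /(_ _ mT) H.
apply: (le_trans H).
have [Ti|iT] := leP T (1 + i); last first.
  apply: (@le_trans _ _ 0); last by rewrite invr_ge0.
  by rewrite mulr_le0_ge0 ?exprn_ge0 ?ltW// subr_lt0.
have i1 : 0 < 1 + i by rewrite addr_gt0.
(* Rescaling removes the slack at the price of the factor (1 + i)^N. *)
pose y := T / (1 + i).
have TE : T = y * (1 + i) by rewrite /y divfK ?gt_eqF.
have y0 : 0 <= y by rewrite divr_ge0// ltW.
have y1 : y <= 1 by rewrite ler_pdivrMr// mul1r.
have := @pow_onem_le y n.*2.+1 y0 y1.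
have ile1 : i <= 1 by rewrite invf_le1 ?mulr_gt0// -natrM ler1n muln_gt0.
have P2 : (1 + i) ^+ N <= 2.
  have p1 : (1 - i) ^+ N >= 2^-1.
    have B M : 1 - M%:R * i <= (1 - i) ^+ M.
      elim: M => [|M IHM]; first by rewrite mul0r subr0 expr0.
      rewrite exprS; have : (1 - i) * (1 - M%:R * i) <= (1 - i) * (1 - i) ^+ M.
        by rewrite ler_wpM2l// subr_ge0.
      apply: le_trans; rewrite -natr1.
      have : 0 <= M%:R * i ^+ 2 by rewrite mulr_ge0// sqr_ge0.
      rewrite expr2; lra.
    by apply: le_trans (B N); rewrite Ni; lra.
  have q0 : 0 <= (1 + i) ^+ N by rewrite exprn_ge0// addr_ge0// ltW.
  have : (1 + i) ^+ N * (1 - i) ^+ N <= 1.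
    rewrite -exprMn exprn_ile1//.
      by apply: mulr_ge0; [rewrite addr_ge0// ltW|rewrite subr_ge0; lra].
    by have := sqr_ge0 i; lra.
  nra.
have -> : (1 + i - T) * T ^+ n.*2.+1 = (1 + i) ^+ N * ((1 - y) * y ^+ n.*2.+1).
  by rewrite TE exprMn /N [(1 + i) ^+ n.*2.+2]exprS; ring.
set P := (1 + i) ^+ N in P2 *; set Y := _ * y ^+ _ => HY.
have Y0 : 0 <= Y by rewrite mulr_ge0 ?subr_ge0// exprn_ge0.
apply: (@le_trans _ _ (2 * Y)); first by rewrite ler_wpM2r.
rewrite -[leRHS]mul1r ler_pdivlMr ?ltr0n//.
have -> : 2 * Y * n.+1%:R = n.*2.+2%:R * Y.
  by rewrite -doubleS -muln2 natrM; ring.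
exact: HY.
Qed.

End cell.

Ltac nneg :=
  lazymatch goal with
  | |- is_true (0 <= _) => first
    [ assumption | (apply: ltW; assumption) | exact: sqrtr_ge0 | exact: sqr_ge0
    | exact: normr_ge0 | exact: ler0n | exact: ler01
    | (rewrite invr_ge0; nneg) | (apply: addr_ge0; nneg) | (apply: mulr_ge0; nneg)
    | (apply: exprn_ge0; nneg) | (apply: sumr_ge0 => ? _; nneg) | (rewrite subr_ge0; nneg) ]
  | |- is_true (_ <= _) => first [ assumption | (apply: ltW; assumption) ]
  end.

(** * The structure of functions of bounded energy *)

Section transitions.
Context {R : realType}.
Notation mu := (@lebesgue_measure R).
Implicit Types (a b x y t s h kappa : R) (n m j k N : nat) (f g : R -> R).

(* With kappa = eps^(-1/2), the indicators of the regions where the minimum in f_eps(f) is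
   f^2 and 1 / eps, respectively. *)
Definition low kappa f x : R := if `|f x| <= kappa then 1 else 0.
Definition high kappa f x : R := if `|f x| <= kappa then 0 else 1.

Lemma low_high kappa f x : low kappa f x = 1 - high kappa f x.
Proof. by rewrite /low /high; case: ifP; rewrite ?subr0 ?subrr. Qed.

Lemma measurable_high kappa f : continuous f ->
  measurable_fun [set: measurableTypeR R] (high kappa f).
Proof.
move=> cf; apply: measurable_fun_if => //.
apply: measurable_fun_ler => //; apply: measurableT_comp => //.
exact: continuous_measurable_fun.
Qed.

Lemma high_ge0 kappa f x : 0 <= high kappa f x.
Proof. by rewrite /high; case: ifP. Qed.

Lemma high_le1 kappa f x : high kappa f x <= 1.
Proof. by rewrite /high; case: ifP. Qed.

Lemma high_norm kappa f x : `|high kappa f x| <= 1.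
Proof. by rewrite ger0_norm ?high_ge0 ?high_le1. Qed.

Lemma low_norm kappa f x : `|low kappa f x| <= 1.
Proof. by rewrite /low; case: ifP; rewrite ?normr1 ?normr0. Qed.

Lemma high_locint kappa f : continuous f -> locint (high kappa f).
Proof.
by move=> cf; apply: locint_bounded (high_norm kappa f); exact: measurable_high.
Qed.

Lemma measurable_low kappa f : continuous f ->
  measurable_fun [set: measurableTypeR R] (low kappa f).
Proof.
move=> cf; rewrite (_ : low kappa f = fun x => 1 - high kappa f x); last first.
  by apply/funext => x; rewrite low_high.
by apply: measurable_funB => //; exact: measurable_high.
Qed.

Lemma low_locint kappa f : continuous f -> locint (low kappa f).
Proof.
by move=> cf; apply: locint_bounded (low_norm kappa f); exact: measurable_low.
Qed.

(** Greedy choice: take the first point where |f| <= kappa, move on by s and repeat. If this stops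
    before N points are found, intervals of length s after the chosen points cover the low set. *)
Lemma spaced_points f kappa s N a b : continuous f -> 0 < s -> a <= b ->
  (exists t : nat -> R,
     (forall i, (i < N)%N -> a <= t i <= b /\ `|f (t i)| <= kappa) /\
     (forall i, (i.+1 < N)%N -> t i + s <= t i.+1)) \/
  Int a b (low kappa f) <= N%:R * s.
Proof.
move=> cf s0; have lf := low_locint kappa cf.
elim: N a => [|N IH] a ab; first by left; exists (fun=> a).
pose A := [set t | a <= t <= b /\ `|f t| <= kappa].
have [A0|/set0P A0] := eqVneq A set0.
  right; have -> : Int a b (low kappa f) = Int a b (cst 0).
    apply: eq_Int => x xab; rewrite /low; case: ifPn => // fx.
    by have : A x by []; rewrite A0.
  by rewrite Int_cst// mul0r mulr_ge0// ltW.
have cA : compact A.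
  have -> : A = `[a, b]%classic `&` [set t | `|f t| <= kappa].
    by apply/seteqP; split => x /=; rewrite in_itv.
  apply: compact_closedI; first exact: segment_compact.
  have : closed ((fun t => `|f t|) @^-1` [set x | x <= kappa]).
    apply: closed_comp; last exact: closed_le.
    by move=> x _; apply: cvg_norm; exact: cf.
  by [].
have cid : {within A, continuous (idfun : R -> R)}.
  by apply: continuous_subspaceT => x; exact: cvg_id.
have [t0] := compact_EVT_min A0 cA cid.
rewrite inE => -[/andP[at0 t0b] ft0] Ht0.
have zero x : a <= x < t0 -> low kappa f x = 0.
  move=> /andP[ax xt]; rewrite /low; case: ifPn => // fx.
  have := Ht0 x; rewrite inE /=; rewrite leNgt xt => /(_ _)/negbTE.
  by move=> /(_ (conj _ fx)); rewrite ax (ltW (lt_le_trans xt t0b)) => /(_ isT).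
have Z : Int a t0 (low kappa f) = 0.
  rewrite -Int_oo// (@eq_Rintegral _ _ _ _ _ (cst 0)) ?Int_oo ?Int_cst ?mul0r//.
    exact: locint_cst.
  by move=> x; rewrite inE/= in_itv/= => /andP[/ltW ax xt]; rewrite zero// ax.
have le1 x : low kappa f x <= 1 by rewrite (le_trans (ler_norm _))// low_norm.
have [t0s|t0s] := leP (t0 + s) b; last first.
  right; rewrite (Int_chasles lf at0 t0b) Z add0r.
  apply: (@le_trans _ _ (Int t0 b (cst 1))).
    by apply: Int_le => //; exact: locint_cst.
  rewrite Int_cst// mul1r -natr1 mulrDl mul1r.
  have : 0 <= N%:R * s by rewrite mulr_ge0// ltW.
  lra.
case: (IH _ t0s) => [[t [t1 t2]]|H].
  left; exists (fun i => if i is i'.+1 then t i' else t0); split.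
    move=> [|i] iN; first by rewrite at0 t0b.
    have [/andP[h1 h2] h3] := t1 i iN; split => //.
    by rewrite h2 andbT (le_trans _ h1)// (le_trans at0)// lerDl ltW.
  by move=> [|i] iN; [have [/andP[]] := t1 0%N iN|exact: t2].
have tt0 : t0 <= t0 + s by rewrite lerDl ltW.
right; rewrite (Int_chasles lf at0 t0b) Z add0r (Int_chasles lf tt0 t0s).
rewrite -natr1 mulrDl mul1r addrC lerD//.
apply: (@le_trans _ _ (Int t0 (t0 + s) (cst 1))).
  by apply: Int_le => //; exact: locint_cst.
by rewrite Int_cst// mul1r addrC addKr.
Qed.

(** The interpolation constant produced by the recursion of [calm_interval]; 2/q is the loss of one
    mean value step between points at relative distance q. *)
Fixpoint Cw n (q : R) : R := if n is n'.+1 then 1 + Cw n' q * (1 + 2 / q) else 1.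

Lemma Cw_ge1 n q : 0 < q -> 1 <= Cw n q.
Proof.
move=> q0; elim: n => // n IH /=; rewrite lerDl mulr_ge0//; first by rewrite (le_trans _ IH).
by rewrite addr_ge0// divr_ge0 ?ltW.
Qed.

Lemma primitive_MVT a b f g x y : primitive a b f g -> continuous g -> a <= x -> x < y -> y <= b ->
  exists2 z, x <= z <= y & f y - f x = g z * (y - x).
Proof.
move=> pf cg ax xy yb.
have [z zxy E] : exists2 z, z \in `]x, y[%R & SI x g y - SI x g x = g z * (y - x).
  apply: MVT => //; first by move=> w _; exact: continuous_derive_SI.
  by apply: continuous_subspaceT; apply: SI_continuous; exact: continuous_l2.
exists z; first by move: zxy; rewrite in_itv/= => /andP[/ltW -> /ltW ->].
by rewrite -E SIaa subr0 SIE ?ltW// pf// ltW.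
Qed.

(* By the mean value theorem spaced points of smallness for g_0 yield spaced
   points of smallness for g_1, half as many; then induct. *)
Lemma calm_interval n (gs : nat -> R -> R) a b q kappa : a < b -> 0 < q -> 0 <= kappa ->
  chain a b n.+1 gs -> (forall j, (j < n.+1)%N -> continuous (gs j)) ->
  (exists t : nat -> R,
     (forall i, (i < 2 ^ n)%N -> a <= t i <= b /\ `|gs 0%N (t i)| <= kappa) /\
     (forall i, (i.+1 < 2 ^ n)%N -> t i + q * (b - a) <= t i.+1)) ->
  forall j x, (j < n.+1)%N -> a <= x <= b ->
  `|gs j x| * (b - a) ^+ j <=
    Cw n q * (kappa + (b - a) ^+ n * Int a b (fun x => `|gs n.+1 x|)).
Proof.
move=> ab q0; have h0 : 0 < b - a by rewrite subr_gt0.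
have qh : 0 < q * (b - a) by rewrite mulr_gt0.
elim: n gs kappa => [|n IH] gs kappa k0 [lg pg] cg [t [t1 t2]] j x jn /andP[ax xb].
  have {jn} -> : j = 0%N by case: j jn.
  rewrite !expr0 /= !mul1r mulr1.
  have [/andP[ta tb] gt] := t1 0%N isT.
  have ln := locint_norm (l2_locint (lg 1%N)).
  have key y z : a <= y -> y <= z -> z <= b ->
      `|gs 0%N z - gs 0%N y| <= Int a b (fun x => `|gs 1%N x|).
    move=> ay yz zb; rewrite (pg 0%N isT)//.
    apply: (le_trans (Int_norm _ _ (l2_locint (lg _)))).
    by apply: Int_sub.
  have -> : gs 0%N x = gs 0%N (t 0%N) + (gs 0%N x - gs 0%N (t 0%N)) by ring.
  apply: (le_trans (ler_normD _ _)); apply: lerD => //.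
  have [tx|/ltW xt] := leP (t 0%N) x; first exact: key.
  by rewrite distrC; exact: key.
pose kappa1 := 2 * kappa / (q * (b - a)).
have k10 : 0 <= kappa1 by rewrite divr_ge0 ?mulr_ge0// ltW.
have dbl i : (i < 2 ^ n)%N -> (i.*2.+1 < 2 ^ n.+1)%N.
  by move=> iN; rewrite expnS mul2n -doubleS leq_double || rewrite expnS mul2n ltn_Sdouble.
have pts i : (i < 2 ^ n)%N -> exists z, [/\ t i.*2 <= z, z <= t i.*2.+1 & `|gs 1%N z| <= kappa1].
  move=> iN; have d2 := dbl i iN; have d1 := ltnW d2.
  have [/andP[a1 b1] g1] := t1 _ d1; have [/andP[a2 b2] g2] := t1 _ d2.
  have sp := t2 _ d2.
  have lt12 : t i.*2 < t i.*2.+1 by apply: lt_le_trans sp; rewrite ltrDl.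
  have [z /andP[z1 z2] E] := primitive_MVT (pg 0%N isT) (cg 1%N isT) a1 lt12 b2.
  exists z; split => //.
  rewrite /kappa1 ler_pdivlMr//.
  apply: (@le_trans _ _ (`|gs 1%N z| * (t i.*2.+1 - t i.*2))).
    by rewrite ler_wpM2l//; lra.
  rewrite -[X in _ * X <= _]gtr0_norm ?subr_gt0// -normrM -E.
  apply: (le_trans (ler_normB _ _)); lra.
have /choice[z zP] : forall i, exists z, (i < 2 ^ n)%N -> [/\ t i.*2 <= z, z <= t i.*2.+1 & `|gs 1%N z| <= kappa1].
  move=> i; have [iN|iN] := ltnP i (2 ^ n); first by have [w ?] := pts i iN; exists w.
  by exists 0.
have H1 := IH (fun i => gs i.+1) kappa1 k10.
have {H1} H1 : forall j x, (j < n.+1)%N -> a <= x <= b -> `|gs j.+1 x| * (b - a) ^+ j <=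
    Cw n q * (kappa1 + (b - a) ^+ n * Int a b (fun x => `|gs n.+2 x|)).
  apply: H1.
  - by split => [i|i iN]; [exact: lg|exact: (pg i.+1)].
  - by move=> i iN; exact: (cg i.+1).
  exists z; split=> i iN.
    have [z1 z2 z3] := zP i iN; split => //.
    have [/andP[a1 _] _] := t1 _ (ltnW (dbl i iN)).
    have [/andP[_ b2] _] := t1 _ (dbl i iN).
    by rewrite (le_trans a1 z1) (le_trans z2 b2).
  have [_ z2 _] := zP i (ltnW iN); have [z1' _ _] := zP i.+1 iN.
  have := t2 i.*2.+1; rewrite -doubleS (ltnW (dbl _ iN)) => /(_ isT); lra.
set D := Int a b (fun x => `|gs n.+2 x|) in H1 *.
have D0 : 0 <= D by apply: Int_ge0.
have C1 := @Cw_ge1 n q q0; have C0 : 0 <= Cw n q by lra.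
pose h := b - a; rewrite -/h in h0 qh H1 *.
have hD0 : 0 <= h ^+ n.+1 * D by rewrite mulr_ge0// exprn_ge0// ltW.
have E1 : h * (kappa1 + h ^+ n * D) = 2 / q * kappa + h ^+ n.+1 * D.
  rewrite mulrDr mulrA -exprS; congr (_ + _).
  by rewrite /kappa1 -/h; field; rewrite !gt_eqF.
have q2 : 0 <= 2 / q by rewrite divr_ge0// ltW.
have bnd : Cw n q * (2 / q * kappa + h ^+ n.+1 * D) <= Cw n q * (1 + 2 / q) * (kappa + h ^+ n.+1 * D).
  rewrite -[leRHS]mulrA ler_wpM2l//.
  have : 0 <= 2 / q * (h ^+ n.+1 * D) by rewrite mulr_ge0.
  by nra.
have X0 : 0 <= kappa + h ^+ n.+1 * D by rewrite addr_ge0.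
case: j jn => [|j] jn; last first.
  rewrite exprS mulrCA; apply: (@le_trans _ _ (h * (Cw n q * (kappa1 + h ^+ n * D)))).
    by rewrite ler_pM2l//; apply: H1; rewrite ?ax.
  rewrite mulrCA E1; apply: (le_trans bnd) => /=.
  by rewrite [leRHS]mulrDl mul1r lerDr.
rewrite expr0 mulr1.
have n2 : (0 < 2 ^ n.+1)%N by rewrite expn_gt0.
have [/andP[ta tb] gt] := t1 0%N n2.
have key y z' : a <= y -> y <= z' -> z' <= b ->
    `|gs 0%N z' - gs 0%N y| <= Cw n q * (2 / q * kappa + h ^+ n.+1 * D).
  move=> ay yz zb; rewrite (pg 0%N isT)// -E1 mulrCA mulrC.
  apply: (@le_trans _ _ (Cw n q * (kappa1 + h ^+ n * D) * (z' - y))).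
    apply: Int_norm_le => //; first exact: l2_locint.
    move=> w /andP[w1 w2]; have := H1 0%N w isT; rewrite expr0 mulr1; apply.
    by rewrite (le_trans ay w1) (le_trans w2 zb).
  apply: ler_wpM2l; last by rewrite /h; lra.
  by rewrite mulr_ge0// addr_ge0// mulr_ge0// exprn_ge0// ltW.
have -> : gs 0%N x = gs 0%N (t 0%N) + (gs 0%N x - gs 0%N (t 0%N)) by ring.
apply: (le_trans (ler_normD _ _)).
have K : `|gs 0%N x - gs 0%N (t 0%N)| <= Cw n q * (2 / q * kappa + h ^+ n.+1 * D).
  have [tx|/ltW xt] := leP (t 0%N) x; first exact: key.
  by rewrite distrC; exact: key.
rewrite /= mulrDl mul1r; lra.
Qed.

Lemma comp_affine_derivn (p : {poly R}) (c a : R) m :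
  (p \Po (c *: ('X - a%:P)))^`(m) = c ^+ m *: (p^`(m) \Po (c *: ('X - a%:P))).
Proof.
elim: m => [|m IH]; first by rewrite !derivn0 expr0 scale1r.
rewrite derivnS IH derivZ deriv_comp derivZ derivXsubC -derivnS.
by rewrite -scalerAr mulr1 scalerA exprSr.
Qed.

Lemma Vp_affine n a b : a < b ->
  Vp n a b = (b - a) ^+ n.*2 *: (Vp n 0 1 \Po ((b - a)^-1 *: ('X - a%:P))).
Proof.
move=> ab; have h0 : b - a != 0 by rewrite subr_eq0 gt_eqF.
rewrite /Vp rmorphM !rmorphXn /= !comp_polyB comp_polyX !comp_polyC subr0.
have -> : (b - a)^-1 *: ('X - a%:P) - 1%:P = (b - a)^-1 *: ('X - b%:P).
  rewrite -!mul_polyC mulrBr mulrBr -addrA; congr (_ + _).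
  rewrite -!polyCM -!polyCN -polyCD; congr (_%:P); by field.
rewrite !exprZn -scalerAl -scalerAr !scalerA.
have -> : (b - a) ^+ n.*2 * (b - a)^-1 ^+ n * (b - a)^-1 ^+ n = 1.
  by rewrite -addnn exprD exprVn mulfK ?expf_neq0// mulfV ?expf_neq0.
by rewrite scale1r.
Qed.

(** A crude common bound for the derivatives of [Qp] at the ends of [0, 1]. Its growth in n is
    harmless, since eps is chosen after n. *)
Definition Kq n : R :=
  (n.*2`!%:R)^-1 *
  \sum_(m < n.*2.+1) (`|(Vp n (0 : R) 1)^`(m).[0]| + `|(Vp n (0 : R) 1)^`(m).[1]|).

Lemma Kq_ge0 n : 0 <= Kq n.
Proof. by rewrite mulr_ge0// ?invr_ge0// sumr_ge0// => i _; rewrite addr_ge0. Qed.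

Lemma Qp_bound n a b i : a < b -> (i <= n)%N ->
  `|(Qp n a b)^`(i).[a]| <= Kq n * (b - a) ^+ (n - i) /\
  `|(Qp n a b)^`(i).[b]| <= Kq n * (b - a) ^+ (n - i).
Proof.
move=> ab i_n; have h0 : 0 < b - a by rewrite subr_gt0.
have h1 : b - a != 0 by rewrite gt_eqF.
have E x : (Qp n a b)^`(i).[x] = (n.*2`!%:R)^-1 *
    ((b - a) ^+ (n - i) * (Vp n 0 1)^`(n + i).[(b - a)^-1 * (x - a)]).
  rewrite /Qp derivnZ hornerZ; congr (_ * _).
  rewrite /derivn -iterD -[iter _ _ _]/((Vp n a b)^`(i + n)) (Vp_affine _ ab).
  rewrite derivnZ comp_affine_derivn scalerA hornerZ horner_comp hornerZ !hornerE addnC.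
  congr (_ * _); rewrite exprVn -addnn.
  have {1}-> : (n = (n - i) + i)%N by rewrite subnK.
  rewrite -addnA addnC exprD [(i + n)%N]addnC mulrAC mulfV ?mul1r// expf_neq0//.
have bnd (x : R) : (x = 0) \/ (x = 1) -> `|(n.*2`!%:R)^-1 * ((b - a) ^+ (n - i) * (Vp n 0 1)^`(n + i).[x])|
   <= Kq n * (b - a) ^+ (n - i).
  move=> x01; rewrite !normrM ger0_norm ?invr_ge0// /Kq -mulrA ler_wpM2l ?invr_ge0//.
  have hn0 : 0 <= (b - a) ^+ (n - i) by rewrite exprn_ge0// ltW.
  rewrite (ger0_norm hn0) mulrC ler_wpM2r//.
  have nin : (n + i < n.*2.+1)%N by rewrite ltnS -addnn leq_add2l.
  rewrite (bigD1 (Ordinal nin))//=.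
  have S0 : 0 <= \sum_(m < n.*2.+1 | m != Ordinal nin)
      (`|(Vp n (0 : R) 1)^`(m).[0]| + `|(Vp n (0 : R) 1)^`(m).[1]|).
    by rewrite sumr_ge0// => j _; rewrite addr_ge0.
  by case: x01 => ->; [rewrite -addrA lerDl addr_ge0|rewrite addrAC lerDr addr_ge0].
split; rewrite E; apply: bnd; first by left; rewrite subrr mulr0.
by right; rewrite mulVf.
Qed.

Lemma sqr_le_sqrt (x y : R) : x ^+ 2 <= y -> `|x| <= Num.sqrt y.
Proof.
move=> xy; rewrite -sqrtr_sqr ler_sqrt//; exact: le_trans (sqr_ge0 _) xy.
Qed.

(* Integrate by parts n times against Qp, which has n-th derivative 1 and minimal L2 norm. *)
Lemma run_bound n (gs : nat -> R -> R) a b h B : a < b -> 0 < h -> chain a b n gs ->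
  (forall j, (j < n)%N -> `|gs j a| * h ^+ j <= B /\ `|gs j b| * h ^+ j <= B) ->
  `|Int a b (gs 0%N)| <= (\sum_(j < n) ((b - a) / h) ^+ j) * (2 * Kq n * B * (b - a)) +
    Num.sqrt (Int a b (fun x => gs n x ^+ 2) * ((b - a) ^+ n.*2.+1 / acoef n)).
Proof.
move=> ab h0 cU HB; have l0 : 0 < b - a by rewrite subr_gt0.
have := chain_IBP (Qp n a b) (ltW ab) cU.
rewrite Qp_top; under eq_Int do rewrite hornerC mulr1.
move=> ->; apply: (le_trans (ler_normD _ _)); apply: lerD; last first.
  rewrite normrM normrX normrN1 expr1n mul1r.
  apply: sqr_le_sqrt; rewrite -(@Int_Qp_sqr _ n a b (ltW ab)).
  exact: (Int_CS _ _ (cU.1 n) (horner_l2 _)).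
apply: (le_trans (ler_norm_sum _ _ _)); rewrite mulr_suml; apply: ler_sum => j _.
rewrite normrM normrX normrN1 expr1n mul1r.
have [Ba Bb] := HB j (ltn_ord j).
have nj : (n - j.+1 <= n)%N by exact: leq_subr.
have [Qa Qb] := Qp_bound ab nj.
rewrite subKn// in Qa Qb.
apply: (le_trans (ler_normB _ _)); rewrite !normrM.
have key (u v : R) : 0 <= u -> u * h ^+ j <= B -> 0 <= v -> v <= Kq n * (b - a) ^+ j.+1 ->
    u * v <= ((b - a) / h) ^+ j * (Kq n * B * (b - a)).
  move=> u0 uB v0 vK.
  have hj : 0 < h ^+ j by rewrite exprn_gt0.
  apply: (@le_trans _ _ (B / h ^+ j * (Kq n * (b - a) ^+ j.+1))).
    by rewrite ler_pM// ler_pdivlMr.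
  rewrite expr_div_n exprS le_eqVlt; apply/orP; left; apply/eqP; ring.
have := key _ _ (normr_ge0 _) Ba (normr_ge0 _) Qa.
have := key _ _ (normr_ge0 _) Bb (normr_ge0 _) Qb.
have -> : 2 * Kq n * B * (b - a) = 2 * (Kq n * B * (b - a)) by ring.
set X := Kq n * B * (b - a); set r := (_ / h) ^+ j; lra.
Qed.

(** Taylor's formula at the left end without the factorials: crude, but valid on runs of any
    length. *)
Lemma run_sup n (gs : nat -> R -> R) a b h B x : a <= b -> 0 < h -> chain a b n.+1 gs ->
  (forall j, (j < n.+1)%N -> `|gs j a| * h ^+ j <= B) -> a <= x <= b ->
  `|gs 0%N x| <= (\sum_(j < n.+1) ((b - a) / h) ^+ j) * B +
    (b - a) ^+ n * Int a b (fun x => `|gs n.+1 x|).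
Proof.
move=> ab h0; have l0 : 0 <= b - a by rewrite subr_ge0.
elim: n gs B x => [|n IH] gs B x [lg pg] HB /andP[ax xb].
  rewrite big_ord_recl big_ord0 !expr0 addr0 !mul1r.
  have := HB 0%N isT; rewrite expr0 mulr1 => B0.
  have -> : gs 0%N x = gs 0%N a + (gs 0%N x - gs 0%N a) by ring.
  apply: (le_trans (ler_normD _ _)); apply: lerD => //.
  rewrite (pg 0%N isT)//; apply: (le_trans (Int_norm _ _ (l2_locint (lg _)))).
  by apply: Int_sub => //; apply: locint_norm; exact: l2_locint.
have IH' z : a <= z <= b -> `|gs 1%N z| <= (\sum_(j < n.+1) ((b - a) / h) ^+ j) * (B / h) +
    (b - a) ^+ n * Int a b (fun x => `|gs n.+2 x|).
  move=> zab; apply: (IH (fun i => gs i.+1)) => //.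
    by split => [i|i iN]; [exact: lg|exact: (pg i.+1)].
  by move=> j jn; rewrite ler_pdivlMr// -mulrA -exprSr; exact: (HB j.+1).
have := HB 0%N isT; rewrite expr0 mulr1 => B0.
have -> : gs 0%N x = gs 0%N a + (gs 0%N x - gs 0%N a) by ring.
apply: (le_trans (ler_normD _ _)).
rewrite big_ord_recl expr0 mulrDl mul1r -addrA; apply: lerD => //.
rewrite (pg 0%N isT)//.
set D := Int a b (fun x => `|gs n.+2 x|) in IH' *.
set S := \sum_(j < n.+1) _ in IH'.
apply: (@le_trans _ _ ((S * (B / h) + (b - a) ^+ n * D) * (b - a))).
  apply: (@le_trans _ _ ((S * (B / h) + (b - a) ^+ n * D) * (x - a))).
    apply: Int_norm_le => //; first exact: l2_locint.
    by move=> z /andP[az zx]; apply: IH'; rewrite az (le_trans zx).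
  apply: ler_wpM2l; last by rewrite lerD2r.
  by apply: le_trans (IH' a _); rewrite ?lexx.
have -> : \sum_(i < n.+1) ((b - a) / h) ^+ fintype.bump 0 i = (b - a) / h * S.
  by rewrite mulr_sumr; apply: eq_bigr => i _; rewrite /fintype.bump add1n exprS.
rewrite exprS le_eqVlt; apply/orP; left; apply/eqP; ring.
Qed.

(** * Collecting kinks from left to right *)

Section scan.
Variables (w mE : R -> R) (eta B beta sigma x0 : R).
Hypotheses (lw : l2 w) (mono : forall x y, x <= y -> mE x <= mE y).
Hypotheses (eta0 : 0 <= eta) (B0 : 0 <= B).

Let m x := mE x - mE x0.

Definition ramp (Y : seq (R * R)) t := \sum_(p <- Y) p.2 * Num.max 0 (t - p.1).

Definition defect Y t := Int x0 t (fun s => w s - w x0) - ramp Y t.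

(* The invariant of a scan of [x0, 1] from left to right which collects in Y the kinks met
   before x; w is u' minus the integral of u'' over the set where |u''| <= kappa, and
   mE x the measure of the set where |u''| > kappa, to the left of x. *)
Definition scanned Y x :=
  [/\ x0 <= x, sigma * (size Y)%:R <= m x,
     (forall p, p \in Y -> x0 <= p.1 <= x),
     `|w x - w x0 - \sum_(p <- Y) p.2| <= eta * m x &
     forall t, x0 <= t <= x -> `|defect Y t| <= (t - x0) * (eta * m x) + 2 * B * beta * m x].

Lemma ramp_extend Y x t : (forall p, p \in Y -> x0 <= p.1 <= x) -> x <= t ->
  ramp Y t = ramp Y x + (\sum_(p <- Y) p.2) * (t - x).
Proof.
move=> HY xt; rewrite /ramp mulr_suml -big_split/= big_seq [RHS]big_seq.
apply: eq_bigr => p pY; have /andP[_ px] := HY p pY.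
rewrite !max_r ?subr_ge0 ?(le_trans px)//; ring.
Qed.

(** To the right of x all ramps of Y are affine with total slope the sum of the kinks, so the defect
    grows at the rate of the error in w. *)
Lemma defect_extend Y x t K : scanned Y x -> x <= t ->
  (forall s, x <= s <= t -> `|w s - w x| <= K) ->
  `|defect Y t| <= (x - x0) * (eta * m x) + 2 * B * beta * m x + (eta * m x + K) * (t - x).
Proof.
move=> [x0x _ HY Hw HD] xt HK.
have lw0 : locint (fun s => w s - w x0).
  by apply: l2_locint; apply: l2B => //; exact: l2_cst.
have -> : defect Y t = defect Y x + Int x t (fun s => w s - w x0 - \sum_(p <- Y) p.2).
  rewrite /defect (ramp_extend HY xt) (Int_chasles lw0 x0x xt) [Int x t (fun s => _ - _ - _)]IntB//; last exact: locint_cst.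
  rewrite Int_cst//; ring.
apply: (le_trans (ler_normD _ _)); apply: lerD; first by apply: HD; rewrite x0x lexx.
apply: Int_norm_le => //; first by apply: locintB => //; exact: locint_cst.
move=> s xs; have -> : w s - w x0 - \sum_(p <- Y) p.2 =
  (w x - w x0 - \sum_(p <- Y) p.2) + (w s - w x) by ring.
by apply: (le_trans (ler_normD _ _)); rewrite lerD// HK.
Qed.

Lemma m_mono x y : x <= y -> m x <= m y.
Proof. by move=> xy; rewrite lerD2r mono. Qed.

Lemma m_ge0 x : x0 <= x -> 0 <= m x.
Proof. by move=> xx; rewrite subr_ge0 mono. Qed.

Lemma scanned0 : scanned [::] x0.
Proof.
have m0 : m x0 = 0 by rewrite /m subrr.
split => //.
- by rewrite m0 mulr0.
- by rewrite big_nil !subrr normr0 m0 mulr0.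
- move=> t /andP[t0 t1]; have {t0 t1} -> : t = x0 by apply/eqP; rewrite eq_le t0 t1.
  by rewrite /defect /ramp big_nil Int_xx !subrr normr0 mul0r m0 mulr0 addr0.
Qed.

Lemma scanned_calm Y x y : 0 <= beta -> scanned Y x -> x <= y ->
  (forall t, x <= t <= y -> `|w t - w x| <= eta * (mE y - mE x)) -> scanned Y y.
Proof.
move=> be0 sc xy Hw; have [x0x Hs HY Hwx HD] := sc.
have mxy := m_mono xy; have mx0 := m_ge0 x0x.
have mE_ : mE y - mE x = m y - m x by rewrite /m; ring.
split.
- exact: le_trans xy.
- exact: le_trans mxy.
- by move=> p /HY /andP[-> px]/=; exact: le_trans px xy.
- have -> : w y - w x0 - \sum_(p <- Y) p.2 = (w x - w x0 - \sum_(p <- Y) p.2) + (w y - w x) by ring.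
  apply: (le_trans (ler_normD _ _)).
  have := Hw y; rewrite xy lexx mE_ => /(_ isT); lra.
move=> t /andP[t0 ty]; have BB : 0 <= 2 * B * beta by rewrite !mulr_ge0.
have mm : 2 * B * beta * m x <= 2 * B * beta * m y by rewrite ler_wpM2l.
have em : eta * m x <= eta * m y by rewrite ler_wpM2l.
have [tx|xt] := leP t x.
  apply: le_trans (HD t _) _; first by rewrite t0.
  by rewrite lerD// ler_wpM2l// subr_ge0.
apply: le_trans (defect_extend (K := eta * (mE y - mE x)) sc (ltW xt) _) _.
  by move=> s /andP[xs st]; apply: Hw; rewrite xs (le_trans st).
rewrite mE_; have : (x - x0) * (eta * m x) <= (x - x0) * (eta * m y).
  by rewrite ler_wpM2l// subr_ge0.
move: mm; set P := 2 * B * beta * m x; set Q := 2 * B * beta * m y; move: em.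
set e1 := eta * m x; set e2 := eta * m y; have -> : eta * (m y - m x) = e2 - e1 by rewrite mulrBr.
nra.
Qed.

(** For a run on which w may oscillate by B but ends close to where it began: the oscillation is
    paid by the length of the run, which is at most beta times its share of the high set. *)
Lemma scanned_short Y x y : scanned Y x -> x <= y ->
  (forall t, x <= t <= y -> `|w t - w x| <= B) -> y - x <= beta * (mE y - mE x) ->
  `|w y - w x| <= eta * (mE y - mE x) -> 0 <= beta -> scanned Y y.
Proof.
move=> sc xy HB Hb Hw be0; have [x0x Hs HY Hwx HD] := sc.
have mxy := m_mono xy; have mx0 := m_ge0 x0x.
have mE_ : mE y - mE x = m y - m x by rewrite /m; ring.
rewrite !mE_ in Hb Hw.
split.
- exact: le_trans xy.
- exact: le_trans mxy.
- by move=> p /HY /andP[-> px]/=; exact: le_trans px xy.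
- have -> : w y - w x0 - \sum_(p <- Y) p.2 = (w x - w x0 - \sum_(p <- Y) p.2) + (w y - w x) by ring.
  apply: (le_trans (ler_normD _ _)); lra.
move=> t /andP[t0 ty]; have BB : 0 <= 2 * B * beta by rewrite !mulr_ge0.
have mm : 2 * B * beta * m x <= 2 * B * beta * m y by rewrite ler_wpM2l.
have em : eta * m x <= eta * m y by rewrite ler_wpM2l.
have [tx|xt] := leP t x.
  apply: le_trans (HD t _) _; first by rewrite t0.
  by rewrite lerD// ler_wpM2l// subr_ge0.
apply: le_trans (defect_extend (K := B) sc (ltW xt) _) _.
  by move=> s /andP[xs st]; apply: HB; rewrite xs (le_trans st).
have h1 : B * (t - x) <= B * (beta * (m y - m x)).
  by rewrite ler_wpM2l// (le_trans _ Hb)// lerD2r.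
have h2 : (t - x0) * (eta * m x) <= (t - x0) * (eta * m y) by rewrite ler_wpM2l// subr_ge0.
have h3 : 0 <= B * beta * (m y - m x) by rewrite !mulr_ge0// subr_ge0.
lra.
Qed.

(** The whole change of w is concentrated in a kink at the left end of the run; the resulting
    misplacement is paid like an oscillation, and the kink uses up the amount sigma of the high
    set. *)
Lemma scanned_long Y x y : scanned Y x -> x <= y ->
  (forall t, x <= t <= y -> `|w t - w x| <= B) -> y - x <= beta * (mE y - mE x) ->
  sigma <= mE y - mE x -> 0 <= beta -> scanned ((x, w y - w x) :: Y) y.
Proof.
move=> sc xy HB Hb Hs1 be0; have [x0x Hs HY Hwx HD] := sc.
have mxy := m_mono xy; have mx0 := m_ge0 x0x.
have mE_ : mE y - mE x = m y - m x by rewrite /m; ring.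
rewrite !mE_ in Hb Hs1.
split.
- exact: le_trans xy.
- by rewrite /= -natr1 mulrDr mulr1; lra.
- move=> p; rewrite inE => /orP[/eqP -> /=|/HY /andP[-> px]/=]; first by rewrite x0x.
  exact: le_trans px xy.
- rewrite big_cons/=.
  have -> : w y - w x0 - (w y - w x + \sum_(p <- Y) p.2) = w x - w x0 - \sum_(p <- Y) p.2 by ring.
  by apply: (le_trans Hwx); rewrite ler_wpM2l.
move=> t /andP[t0 ty]; have BB : 0 <= 2 * B * beta by rewrite !mulr_ge0.
have mm : 2 * B * beta * m x <= 2 * B * beta * m y by rewrite ler_wpM2l.
have em : eta * m x <= eta * m y by rewrite ler_wpM2l.
have [tx|xt] := leP t x.
  have -> : defect ((x, w y - w x) :: Y) t = defect Y t.
    by rewrite /defect /ramp big_cons/= max_l ?subr_le0// mulr0 add0r.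
  apply: le_trans (HD t _) _; first by rewrite t0.
  by rewrite lerD// ler_wpM2l// subr_ge0.
have -> : defect ((x, w y - w x) :: Y) t = defect Y t - (w y - w x) * (t - x).
  by rewrite /defect /ramp big_cons/= max_r ?subr_ge0 ?ltW//; ring.
(* The oscillation of w and the new ramp contribute B each over the run, whence the factor 2 in the
   invariant. *)
apply: (le_trans (ler_normB _ _)).
have D1 : `|defect Y t| <= (x - x0) * (eta * m x) + 2 * B * beta * m x + (eta * m x + B) * (t - x).
  apply: (defect_extend (K := B) sc (ltW xt)).
  by move=> s /andP[xs st]; apply: HB; rewrite xs (le_trans st).
have D2 : `|(w y - w x) * (t - x)| <= B * (t - x).
  have tx0 : 0 <= t - x by rewrite subr_ge0 ltW.
  rewrite normrM (ger0_norm tx0) ler_wpM2r//.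
  by apply: HB; rewrite xy lexx.
have h1 : B * (t - x) <= B * (beta * (m y - m x)).
  by rewrite ler_wpM2l// (le_trans _ Hb)// lerD2r.
have h2 : (t - x0) * (eta * m x) <= (t - x0) * (eta * m y) by rewrite ler_wpM2l// subr_ge0.
have h3 : 0 <= B * beta * (m y - m x) by rewrite !mulr_ge0// subr_ge0.
lra.
Qed.

End scan.

End transitions.

(** * From energy bounds to ramps, at fixed k *)

Section structure.
Context {R : realType}.

(* Here k = d + 3, U is the chain u, u', u'', ..., u^(k), and Y lists the kinks of u as
   pairs (position, change of slope). The last error term is due to the transitions of
   length below (1 - tau) eps; it vanishes as d grows because c * acoef stays above a
   negative power of any T < 1. *)
Definition structured d (c C tau e eps : R) := forall U : nat -> R -> R,
  chain 0 1 d.+3 U -> (forall j, (j < d.+3)%N -> continuous (U j)) ->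
  let kappa := (Num.sqrt eps)^-1 in
  Int 0 1 (high kappa (U 2)) <= C * eps ->
  c * eps ^+ d.*2.+3 * Int 0 1 (fun x => U d.+3 x ^+ 2) <= C ->
  exists x0 x1 (Y : seq (R * R)) (al be : R),
  [/\ 0 <= x0 <= e, 1 - e <= x1 <= 1,
     (1 - tau) ^+ 2 * eps * (size Y)%:R <= Int 0 1 (high kappa (U 2)),
     (forall p, p \in Y -> x0 <= p.1 <= x1) &
     forall t, x0 <= t <= x1 ->
       `|U 0%N t - (al + be * t + Int 0 t (SI 0 (fun x => low kappa (U 2) x * U 2 x)) + ramp Y t)| <=
       e + C / (1 - tau) * Num.sqrt (C / (c * acoef d.+1) * (1 - tau) ^+ d.*2.+1)].

Variables (d : nat) (c C tau : R).
Hypotheses (c0 : 0 < c) (C0 : 0 < C) (tau0 : 0 < tau) (tau1 : tau < 1).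

(** [beta0] converts the measure of the high set into the length of black runs. [q] is the relative
    spacing at which 2^d intervals cover the fraction tau of a cell. [mu_] measures the L2 norm of
    u^(k) up to powers of eps, [K1] collects the boundary terms of [run_bound], and [S_] is the
    error of short runs that remains after eps tends to 0. *)
Let beta0 := (1 - tau)^-1.
Let q := tau / 2 ^+ d.
Let mu_ := Num.sqrt (C / c).
Let Cwd := Cw d q.
Let K1 := 2 * d.+1%:R * Kq d.+1 * Cwd.
Let S_ := Num.sqrt (C / (c * acoef d.+1) * (1 - tau) ^+ d.*2.+1).

Section fixed.
Variables (rho sg : R) (U : nat -> R -> R).
(* The parameters are square roots of eps and of the relative cell size h / eps, so that no
   root appears in the estimates. *)
Let eps := sg ^+ 2.
Let h := rho ^+ 2 * eps.
Let kappa := sg^-1.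
Hypotheses (rho0 : 0 < rho) (rho1 : rho <= 1) (sg0 : 0 < sg) (sg1 : sg <= 1).
Hypotheses (cU : chain 0 1 d.+3 U) (kU : forall j, (j < d.+3)%N -> continuous (U j)).
Hypotheses (HE : Int 0 1 (high kappa (U 2)) <= C * eps).
Hypotheses (HM : c * eps ^+ d.*2.+3 * Int 0 1 (fun x => U d.+3 x ^+ 2) <= C).
Hypotheses (small : (beta0 * C + 1) * eps < 1).

Let gs j := U j.+2.
Let phi x := low kappa (U 2) x * U 2 x.
Let w x := U 1%N x - SI 0 phi x.
Let mE := SI 0 (high kappa (U 2)).
(** [Bw] is the bound of [calm_interval] on a white cell: [sg / eps] is [kappa], and the other
    summand is the L1 norm of the top derivative, estimated by Cauchy-Schwarz on a cell of length
    [h]. *)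
Let lam := sg + rho ^+ d.*2.+1 * mu_.
Let Bw := Cwd * lam / eps.

Let eps0 : 0 < eps. Proof. by rewrite exprn_gt0. Qed.
Let h0 : 0 < h. Proof. by rewrite mulr_gt0// exprn_gt0. Qed.
Let h_eps : h <= eps.
Proof. by apply: ler_piMl; [nneg|apply: exprn_ile1; nneg]. Qed.
Let beta_gt0 : 0 < beta0. Proof. by rewrite invr_gt0 subr_gt0. Qed.
Let q0 : 0 < q. Proof. by rewrite divr_gt0// exprn_gt0. Qed.
Let mu0 : 0 <= mu_. Proof. exact: sqrtr_ge0. Qed.
Let mu_sq : mu_ ^+ 2 = C / c. Proof. by rewrite sqr_sqrtr// divr_ge0 ?ltW. Qed.
Let Cw1 : 1 <= Cwd. Proof. exact: Cw_ge1. Qed.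
Let Cw0 : 0 <= Cwd. Proof. exact: le_trans ler01 Cw1. Qed.
Let lam0 : 0 <= lam.
Proof. by rewrite /lam; nneg. Qed.
Let Bw0 : 0 <= Bw. Proof. by rewrite /Bw; nneg. Qed.
Let kappa0 : 0 <= kappa. Proof. by rewrite invr_ge0 ltW. Qed.
Let kappaE : kappa = sg / eps. Proof. by rewrite /kappa /eps; field; rewrite gt_eqF. Qed.

Let cU2 : continuous (U 2). Proof. exact: kU. Qed.
Let lhigh : locint (high kappa (U 2)). Proof. exact: high_locint. Qed.
Let llow : locint (low kappa (U 2)). Proof. exact: low_locint. Qed.
Let lphi : l2 phi.
Proof.
apply: (@l2_bounded_mul _ _ _ 1); [exact: cU.1|exact: measurable_low|exact: low_norm].
Qed.
Let lhu : l2 (fun x => high kappa (U 2) x * U 2 x).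
Proof.
apply: (@l2_bounded_mul _ _ _ 1); [exact: cU.1|exact: measurable_high|exact: high_norm].
Qed.
Let lw : l2 w. Proof. by apply: l2B; [exact: cU.1|exact: SI_l2]. Qed.

Let gs_chain a b : 0 <= a -> b <= 1 -> chain a b d.+1 gs.
Proof.
move=> a0 b1; split => [j|j jd]; first exact: cU.1.
exact: primitive_sub (cU.2 j.+2 jd) a0 b1.
Qed.

Let w_inc x y : 0 <= x -> x <= y -> y <= 1 ->
  w y - w x = Int x y (fun t => high kappa (U 2) t * U 2 t).
Proof.
move=> x0 xy y1; rewrite /w.
have -> : U 1%N y - SI 0 phi y - (U 1%N x - SI 0 phi x) =
  (U 1%N y - U 1%N x) - (SI 0 phi y - SI 0 phi x) by ring.
rewrite (cU.2 1%N isT)// (SI_sub _ (l2_locint lphi) xy) -IntB.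
- by apply: eq_Int => t _; rewrite /phi low_high; ring.
- by apply: l2_locint; exact: cU.1.
- exact: l2_locint.
Qed.

Let mE_inc x y : x <= y -> mE y - mE x = Int x y (high kappa (U 2)).
Proof. by move=> xy; exact: SI_sub. Qed.

Let mE_mono x y : x <= y -> mE x <= mE y.
Proof.
by move=> xy; rewrite -subr_ge0 mE_inc// Int_ge0// => t _; exact: high_ge0.
Qed.

Let mE_le x y : 0 <= x -> x <= y -> y <= 1 -> mE y - mE x <= C * eps.
Proof.
move=> x0 xy y1; rewrite mE_inc//; apply: le_trans HE.
by apply: Int_sub => // t; exact: high_ge0.
Qed.

Let w_le x y K : 0 <= x -> x <= y -> y <= 1 ->
  (forall t, x <= t <= y -> `|U 2 t| <= K) -> `|w y - w x| <= K * (mE y - mE x).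
Proof.
move=> x0 xy y1 HK; rewrite w_inc// mE_inc// -IntZ//.
apply: (le_trans (Int_norm _ _ (l2_locint lhu))); apply: Int_le.
- by apply: locint_norm; exact: l2_locint.
- exact: locintZ.
move=> t xt; rewrite normrM ger0_norm ?high_ge0// mulrC ler_wpM2r ?high_ge0//.
exact: HK.
Qed.

Let gn_sqr a b : 0 <= a -> a <= b -> b <= 1 ->
  Int a b (fun x => gs d.+1 x ^+ 2) <= mu_ ^+ 2 / eps ^+ d.*2.+3.
Proof.
move=> a0 ab b1; apply: (@le_trans _ _ (Int 0 1 (fun x => U d.+3 x ^+ 2))).
  by apply: Int_sub => //; [exact: (cU.1 _).2|move=> x; exact: sqr_ge0].
rewrite mu_sq ler_pdivlMr ?exprn_gt0// ler_pdivlMr//.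
by apply: le_trans HM; rewrite le_eqVlt; apply/orP; left; apply/eqP; ring.
Qed.

(** The length is measured as A^2 eps so that Cauchy-Schwarz returns the factor A without a root: A
    is [rho] on a cell and [Ab] on a run. *)
Let gn_norm a b (A : R) : 0 <= a -> a <= b -> b <= 1 -> 0 <= A -> b - a <= A ^+ 2 * eps ->
  Int a b (fun x => `|gs d.+1 x|) <= A * mu_ / eps ^+ d.+1.
Proof.
move=> a0 ab b1 A0 bA.
have e1 : 0 < eps ^+ d.+1 by rewrite exprn_gt0.
have rhs0 : 0 <= A * mu_ / eps ^+ d.+1 by nneg.
rewrite -ler_sqr ?nnegrE ?Int_ge0//.
apply: (le_trans (Int_norm_sqr_le ab (cU.1 _))).
apply: (@le_trans _ _ (A ^+ 2 * eps * (mu_ ^+ 2 / eps ^+ d.*2.+3))).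
  apply: ler_pM => //; [by rewrite subr_ge0|by apply: Int_ge0 => x _; exact: sqr_ge0|exact: gn_sqr].
rewrite le_eqVlt; apply/orP; left; apply/eqP.
have -> : eps ^+ d.*2.+3 = eps * (eps ^+ d.+1) ^+ 2.
  by rewrite -exprM -exprS muln2 doubleS.
by field; rewrite !gt_eqF.
Qed.

Let cell i : R := i%:R * h.
Let cellS i : cell i.+1 = cell i + h. Proof. by rewrite /cell -natr1 mulrDl mul1r. Qed.
Let cell_ge0 i : 0 <= cell i. Proof. by rewrite mulr_ge0// ltW. Qed.
Let cell_le i j : (i <= j)%N -> cell i <= cell j.
Proof. by move=> ij; rewrite ler_wpM2r ?ler_nat// ltW. Qed.

Let spaced i := exists t : nat -> R,
  (forall l, (l < 2 ^ d)%N -> cell i <= t l <= cell i.+1 /\ `|U 2 (t l)| <= kappa) /\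
  (forall l, (l.+1 < 2 ^ d)%N -> t l + q * (cell i.+1 - cell i) <= t l.+1).

(* A white cell carries good bounds on all derivatives, a black one is almost filled by
   |u''| > kappa. A maximal run of black cells is a kink if it is longer than
   (1 - tau) eps, in which case it costs almost 1, and otherwise changes w only a little. *)
Let white i : bool := `[< spaced i >].

(** When [spaced_points] finds too few points, the low set has measure at most 2^d q h = tau h. *)
Let black_cell i : ~~ white i -> (1 - tau) * h <= mE (cell i.+1) - mE (cell i).
Proof.
move=> /asboolP nw; have cc : cell i <= cell i.+1 by exact: cell_le.
have dh : cell i.+1 - cell i = h by rewrite cellS; ring.
have qh : 0 < q * (cell i.+1 - cell i) by rewrite dh mulr_gt0.
case: (@spaced_points R (U 2) kappa _ (2 ^ d) _ _ cU2 qh cc) => // H.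
rewrite mE_inc//.
have : Int (cell i) (cell i.+1) (low kappa (U 2)) + Int (cell i) (cell i.+1) (high kappa (U 2)) = h.
  rewrite -IntD// -dh -[RHS]mul1r -Int_cst//; apply: eq_Int => x _.
  by rewrite low_high subrK.
have qE : (2 ^ d)%:R * (q * h) = tau * h.
  by rewrite natrX mulrA /q [_ * (tau / _)]mulrC divfK// expf_neq0// pnatr_eq0.
rewrite dh qE in H; lra.
Qed.

Let black_run i j : (i <= j)%N -> (forall l, (i <= l < j)%N -> ~~ white l) ->
  cell j - cell i <= beta0 * (mE (cell j) - mE (cell i)).
Proof.
move=> /subnK <-; elim: (j - i)%N => [|m IH] H; first by rewrite add0n !subrr mulr0.
have H1 : cell (m + i) - cell i <= beta0 * (mE (cell (m + i)) - mE (cell i)).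
  by apply: IH => l /andP[il lm]; apply: H; rewrite il/= addSn ltnS ltnW.
have := @black_cell (m + i) _; rewrite H ?leq_addl ?addSn//= => /(_ isT) H2.
have : h <= beta0 * (mE (cell (m + i).+1) - mE (cell (m + i))).
  by rewrite /beta0 -ler_pdivrMl ?invr_gt0 ?subr_gt0// invrK.
move=> H3; rewrite [cell _.+1]cellS addrAC; apply: (le_trans (lerD H1 H3)).
by rewrite -mulrDr [X in _ * X <= _]addrC subrKA -cellS; exact: lexx.
Qed.

Let white_bound i j x : cell i.+1 <= 1 -> white i -> (j < d.+1)%N -> cell i <= x <= cell i.+1 ->
  `|gs j x| * h ^+ j <= Bw.
Proof.
move=> c1 /asboolP wi jd xc.
have cc : cell i < cell i.+1 by rewrite cellS ltrDl.
have dh : cell i.+1 - cell i = h by rewrite cellS; ring.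
have kg l : (l < d.+1)%N -> continuous (gs l) by move=> ld; exact: kU.
have := @calm_interval R d gs _ _ q kappa cc q0 kappa0 (gs_chain (cell_ge0 i) c1) kg wi j x jd xc.
rewrite dh => /le_trans; apply; rewrite /Bw -/Cwd -mulrA ler_wpM2l//.
have H : Int (cell i) (cell i.+1) (fun x => `|gs d.+1 x|) <= rho * mu_ / eps ^+ d.+1.
  by apply: gn_norm; rewrite ?dh//; nneg.
apply: (@le_trans _ _ (kappa + h ^+ d * (rho * mu_ / eps ^+ d.+1))).
  by rewrite lerD2l; apply: ler_wpM2l => //; nneg.
rewrite kappaE /lam /h exprMn -exprM mul2n.
have e1 : eps ^+ d != 0 by rewrite expf_neq0// gt_eqF.
rewrite [rho ^+ d.*2.+1]exprSr [eps ^+ d.+1]exprSr mulrDl lerD2l le_eqVlt; apply/orP; left; apply/eqP.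
by field; rewrite e1 gt_eqF.
Qed.

Let L := Num.truncn h^-1.

Let Lh : cell L <= 1 /\ 1 < cell L + h.
Proof.
have hV : 0 <= h^-1 by rewrite invr_ge0 ltW.
have /andP[L1 L2] := truncn_itv hV; split.
  by rewrite /cell -ler_pdivlMr// mul1r.
by rewrite -cellS /cell -ltr_pdivrMr// mul1r.
Qed.

Let cell_le1 i : (i <= L)%N -> cell i <= 1.
Proof. by move=> /cell_le/le_trans; apply; exact: Lh.1. Qed.

(** [B_] bounds the oscillation of w along any black run between white cells. It may blow up as
    [rho] tends to 0, but it enters the final error only multiplied by eps, and [rho] is fixed
    before eps. *)
Let Sb := \sum_(j < d.+1) (beta0 * C / rho ^+ 2) ^+ j.
Let Ab := Num.sqrt (beta0 * C).
Let B_ := (Sb * Cwd * (1 + mu_) + (beta0 * C) ^+ d * (Ab * mu_)) * (beta0 * C).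

Let bC0 : 0 <= beta0 * C. Proof. by nneg. Qed.

Let Sb0 : 0 <= Sb.
Proof. by rewrite /Sb; nneg. Qed.

Let lam_le : lam <= 1 + mu_.
Proof.
by apply: lerD => //; apply: ler_piMl => //; apply: exprn_ile1 => //; nneg.
Qed.

(** The white neighbours control the derivatives at both ends of a run. Taylor's formula then bounds
    the oscillation on any run, and [run_bound] shows that a run shorter than (1 - tau) eps changes
    w by little in total. *)
Let run_short a b : 0 <= a -> a < b -> b <= 1 ->
  b - a <= beta0 * (mE b - mE a) ->
  (forall j, (j < d.+1)%N -> `|gs j a| * h ^+ j <= Bw /\ `|gs j b| * h ^+ j <= Bw) ->
  (forall t, a <= t <= b -> `|w t - w a| <= B_) /\
  (b - a <= (1 - tau) * eps ->
   `|w b - w a| <= (K1 * (sg / rho ^+ d.*2 + rho * mu_) + sg + S_) / eps * (b - a)).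
Proof.
move=> a0 ab b1 bE HB; have l0 : 0 < b - a by rewrite subr_gt0.
have lC : b - a <= beta0 * C * eps.
  apply: (le_trans bE); rewrite -mulrA; apply: ler_wpM2l; first by nneg.
  exact: mE_le a0 (ltW ab) b1.
split.
  move=> t /andP[at_ tb].
  have t1 : t <= 1 by exact: le_trans b1.
  have sup x : a <= x <= b -> `|U 2 x| <= (Sb * Cwd * (1 + mu_) + (beta0 * C) ^+ d * (Ab * mu_)) / eps.
    move=> xab; have := @run_sup R d gs a b h Bw x (ltW ab) h0 (gs_chain a0 b1) (fun j jd => (HB j jd).1) xab.
    move=> /le_trans; apply; rewrite [leRHS]mulrDl; apply: lerD.
      apply: (@le_trans _ _ (Sb * Bw)).
        apply: ler_wpM2r => //; apply: ler_sum => j _.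
        apply: lerXn2r; rewrite ?nnegrE; try nneg.
        by rewrite ler_pdivrMr// /h mulrA divfK// expf_neq0// gt_eqF.
      rewrite /Bw -!mulrA; do 2 (apply: ler_wpM2l => //).
      by apply: ler_wpM2r => //; nneg.
    have H : Int a b (fun x => `|gs d.+1 x|) <= Ab * mu_ / eps ^+ d.+1.
      by apply: gn_norm; rewrite ?sqr_sqrtr//; nneg.
    apply: (@le_trans _ _ ((beta0 * C * eps) ^+ d * (Ab * mu_ / eps ^+ d.+1))).
      apply: ler_pM => //; [nneg|exact: Int_ge0|].
      by apply: lerXn2r; rewrite ?nnegrE//; nneg.
    have e1 : eps ^+ d != 0 by rewrite expf_neq0// gt_eqF.
    rewrite [(_ * eps) ^+ d]exprMn [eps ^+ d.+1]exprSr le_eqVlt; apply/orP; left; apply/eqP.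
    by field; rewrite e1 gt_eqF.
  apply: le_trans (w_le a0 at_ t1 _) _.
    by move=> x /andP[ax xt]; apply: sup; rewrite ax (le_trans xt).
  have mC := mE_le a0 at_ t1.
  have X0 : 0 <= (Sb * Cwd * (1 + mu_) + (beta0 * C) ^+ d * (Ab * mu_)).
    by nneg.
  rewrite /B_; set X := (_ + _) in X0 *.
  apply: (@le_trans _ _ (X / eps * (C * eps))).
    by apply: ler_wpM2l => //; nneg.
  have -> : X / eps * (C * eps) = X * C by field; rewrite gt_eqF.
  apply: ler_wpM2l => //; apply: ler_peMl; first by nneg.
  have tau01 : 0 < 1 - tau by rewrite subr_gt0.
  by rewrite /beta0 invf_ge1// gerBl ltW.
move=> lt; have := @run_bound R d.+1 gs a b h Bw ab h0 (gs_chain a0 b1) HB.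
have -> : Int a b (gs 0%N) = (w b - w a) + Int a b phi.
  rewrite (w_inc a0 (ltW ab) b1) -IntD; [|exact: l2_locint|exact: l2_locint].
  by apply: eq_Int => x _; rewrite /phi low_high /gs; ring.
have phik : `|Int a b phi| <= kappa * (b - a).
  apply: Int_norm_le; [exact: ltW|exact: l2_locint|].
  by move=> x _; rewrite /phi /low; case: ifP => H; rewrite ?mul1r// mul0r normr0.
move=> H.
have {H} H : `|w b - w a| <= (\sum_(j < d.+1) ((b - a) / h) ^+ j) * (2 * Kq d.+1 * Bw * (b - a)) +
    Num.sqrt (Int a b (fun x => gs d.+1 x ^+ 2) * ((b - a) ^+ d.*2.+3 / acoef d.+1)) + kappa * (b - a).
  have -> : w b - w a = (w b - w a + Int a b phi) - Int a b phi by ring.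
  by apply: (le_trans (ler_normB _ _)); rewrite lerD.
apply: (le_trans H).
have rr : 1 <= (rho ^+ 2)^-1.
  by rewrite invf_ge1 ?exprn_gt0//; apply: exprn_ile1 => //; nneg.
have H1 : (\sum_(j < d.+1) ((b - a) / h) ^+ j) <= d.+1%:R / rho ^+ d.*2.
  apply: (@le_trans _ _ (\sum_(j < d.+1) (rho ^+ d.*2)^-1)); last first.
    by rewrite sumr_const card_ord mulr_natl.
  apply: ler_sum => j _; apply: (@le_trans _ _ ((rho ^+ 2)^-1 ^+ j)).
    apply: lerXn2r; rewrite ?nnegrE; try nneg.
    rewrite ler_pdivrMr// /h mulKf ?expf_neq0 ?gt_eqF//.
    by apply: (le_trans lt); apply: ler_piMl; [nneg|rewrite gerBl ltW].
  have -> : rho ^- d.*2 = (rho ^+ 2)^-1 ^+ d by rewrite exprVn -exprM mul2n.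
  apply: ler_weXn2l => //.
  by rewrite -ltnS.
(* Two of the 2d + 3 powers of l / eps come out of the root as one factor. This keeps the bound
   proportional to the length of the run, so that it can be summed over runs; the remaining 2d + 1
   powers are at most those of 1 - tau. *)
have H2 : Num.sqrt (Int a b (fun x => gs d.+1 x ^+ 2) * ((b - a) ^+ d.*2.+3 / acoef d.+1)) <=
    S_ / eps * (b - a).
  have A0 := acoef_gt0 (R := R) d.+1.
  set l := b - a in l0 lt *.
  have le0 : 0 <= l / eps by nneg.
  have t0 : 0 <= 1 - tau by rewrite subr_ge0 ltW.
  have -> : S_ / eps * l = Num.sqrt ((l / eps) ^+ 2 * (C / (c * acoef d.+1) * (1 - tau) ^+ d.*2.+1)).
    rewrite sqrtrM ?sqr_ge0// sqrtr_sqr ger0_norm// /S_; ring.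
  rewrite ler_sqrt; last first.
    by nneg.
  apply: (@le_trans _ _ (mu_ ^+ 2 / eps ^+ d.*2.+3 * (l ^+ d.*2.+3 / acoef d.+1))).
    by apply: ler_wpM2r; [nneg|exact: gn_sqr a0 (ltW ab) b1].
  rewrite mu_sq.
  have -> : C / c / eps ^+ d.*2.+3 * (l ^+ d.*2.+3 / acoef d.+1) =
     (l / eps) ^+ 2 * (C / (c * acoef d.+1) * (l / eps) ^+ d.*2.+1).
    have -> : (l / eps) ^+ 2 * (C / (c * acoef d.+1) * (l / eps) ^+ d.*2.+1) =
      C / (c * acoef d.+1) * (l / eps) ^+ d.*2.+3.
      by rewrite [(l / eps) ^+ d.*2.+3](exprD _ 2 d.*2.+1); ring.
    have e1 : eps ^+ d.*2.+3 != 0 by rewrite expf_neq0// gt_eqF.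
    rewrite expr_div_n; field; by rewrite e1 !gt_eqF.
  apply: ler_wpM2l; first by nneg.
  apply: ler_wpM2l; first by nneg.
  by apply: lerXn2r; rewrite ?nnegrE ?ler_pdivrMr.
have Kq0 := Kq_ge0 (R := R) d.+1.
have Y0 : 0 <= 2 * Kq d.+1 * Bw * (b - a) by nneg.
apply: (@le_trans _ _ (d.+1%:R / rho ^+ d.*2 * (2 * Kq d.+1 * Bw * (b - a)) + S_ / eps * (b - a) + kappa * (b - a))).
  by rewrite lerD2r lerD// ler_wpM2r.
rewrite kappaE /K1 /Bw /lam [rho ^+ d.*2.+1]exprSr le_eqVlt; apply/orP; left; apply/eqP.
have r1 : rho ^+ d.*2 != 0 by rewrite expf_neq0// gt_eqF.
by field; rewrite r1 gt_eqF.
Qed.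

(** Change of w per unit measure of the high set: |u''| <= [Bw] on white cells, and on short runs
    the rate per unit length times [beta0]. *)
Let eta := Bw + beta0 * ((K1 * (sg / rho ^+ d.*2 + rho * mu_) + sg + S_) / eps).
Let sigma := (1 - tau) ^+ 2 * eps.

Let K1_ge0 : 0 <= K1.
Proof. by have Kq0 := Kq_ge0 (R := R) d.+1; rewrite /K1; nneg. Qed.
Let X_ge0 : 0 <= (K1 * (sg / rho ^+ d.*2 + rho * mu_) + sg + S_) / eps.
Proof.
by rewrite /S_; nneg.
Qed.
Let eta_ge0 : 0 <= eta. Proof. by rewrite /eta; nneg. Qed.
Let B_ge0 : 0 <= B_.
Proof. by rewrite /B_ /Ab; nneg. Qed.

Let prev_white i0 i : white i0 -> (i0 < i)%N -> exists i', [/\ (i0 <= i')%N, (i' < i)%N, white i' &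
  forall l, (i' < l < i)%N -> ~~ white l].
Proof.
move=> w0; elim: i => // i IH; rewrite ltnS leq_eqVlt => /predU1P[<-|i0i].
  by exists i0; split => // l /andP[l1 l2]; move: l2; rewrite ltnS leqNgt l1.
have [wi|nwi] := boolP (white i).
  by exists i; split => //; [exact: ltnW|move=> l /andP[l1]; rewrite ltnS leqNgt l1].
have [i' [h1 h2 h3 h4]] := IH i0i; exists i'; split => //; first exact: ltnW.
move=> l /andP[l1]; rewrite ltnS leq_eqVlt => /predU1P[->//|l2].
by apply: h4; rewrite l1.
Qed.

(** Strong induction along white cells: the scan is carried from the previous white cell across the
    black run in between, if there is one, and then through the white cell i. *)
Let scan_white i0 : white i0 -> forall i, (i0 <= i < L)%N -> white i ->
  exists Y, scanned w mE eta B_ beta0 sigma (cell i0) Y (cell i.+1).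
Proof.
move=> w0; elim/ltn_ind => i IH /andP[i0i iL] wi.
have calm Y : scanned w mE eta B_ beta0 sigma (cell i0) Y (cell i) ->
   scanned w mE eta B_ beta0 sigma (cell i0) Y (cell i.+1).
  move=> sc; apply: (scanned_calm lw mE_mono eta_ge0 B_ge0 (ltW beta_gt0) sc); first exact: cell_le.
  move=> t /andP[t1 t2].
  have ct : t <= 1 by apply: le_trans t2 (cell_le1 iL).
  apply: (@le_trans _ _ (Bw * (mE t - mE (cell i)))).
    apply: w_le => // x /andP[x1 x2].
    have := @white_bound i 0%N x (cell_le1 iL) wi isT.
    by rewrite expr0 mulr1 x1 (le_trans x2 t2); exact.
  apply: (@le_trans _ _ (eta * (mE t - mE (cell i)))).
    apply: ler_wpM2r; first by rewrite subr_ge0 mE_mono.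
    by rewrite /eta lerDl; nneg.
  by rewrite ler_wpM2l// lerD2r mE_mono.
move: i0i; rewrite leq_eqVlt => /predU1P[e|i0i].
  by exists [::]; apply: calm; rewrite -e; exact: scanned0.
have [i' [i1 i2 wi' bl]] := prev_white w0 i0i.
have [|Y sc] := IH i' i2 _ wi'; first by rewrite i1 (ltn_trans i2 iL).
have [e|ne] := eqVneq i'.+1 i; first by exists Y; apply: calm; rewrite -e.
have i3 : (i'.+1 < i)%N by rewrite ltn_neqAle ne.
have ab : cell i'.+1 < cell i by rewrite /cell ltr_pM2r// ltr_nat.
have b1 : cell i <= 1 by exact: cell_le1 (ltnW iL).
have bE := black_run (ltnW i3) bl.
have HB j : (j < d.+1)%N -> `|gs j (cell i'.+1)| * h ^+ j <= Bw /\ `|gs j (cell i)| * h ^+ j <= Bw.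
  move=> jd; split.
    apply: (@white_bound i') => //; last by rewrite lexx cell_le.
    exact: cell_le1 (ltn_trans i2 iL).
  by apply: (@white_bound i) => //; [exact: cell_le1|rewrite lexx cell_le].
have [HBB Hs] := run_short (cell_ge0 _) ab b1 bE HB.
have [lt|lt] := leP (cell i - cell i'.+1) ((1 - tau) * eps).
  exists Y; apply: calm; apply: (scanned_short lw mE_mono eta_ge0 B_ge0 sc) => //; [exact: ltW| |exact: ltW].
  apply: (le_trans (Hs lt)); rewrite /eta; set X := _ / eps; have X0 : 0 <= X := X_ge0.
  apply: (@le_trans _ _ (X * (beta0 * (mE (cell i) - mE (cell i'.+1))))).
    by rewrite ler_wpM2l.
  rewrite mulrA [X * _]mulrC; apply: ler_wpM2r; last by rewrite lerDr.
  by rewrite subr_ge0 mE_mono// ltW.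
exists ((cell i'.+1, w (cell i) - w (cell i'.+1)) :: Y); apply: calm.
apply: (scanned_long lw mE_mono eta_ge0 B_ge0 sc) => //; [exact: ltW| |exact: ltW].
(* One factor 1 - tau comes from the length of the run, the other from the fraction of a black cell
   that the high set fills. *)
rewrite /sigma expr2 -mulrA.
have : (1 - tau) * (cell i - cell i'.+1) <= mE (cell i) - mE (cell i'.+1).
  by rewrite mulrC -ler_pdivlMr ?subr_gt0// mulrC.
by apply: le_trans; apply: ler_wpM2l; [rewrite subr_ge0|]; exact: ltW.
Qed.

Lemma structure_fixed : exists x0 x1 (Y : seq (R * R)) (al be : R),
  [/\ 0 <= x0 <= beta0 * C * eps, 1 - (beta0 * C + 1) * eps <= x1 <= 1,
     (1 - tau) ^+ 2 * eps * (size Y)%:R <= Int 0 1 (high kappa (U 2)),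
     (forall p, p \in Y -> x0 <= p.1 <= x1) &
     forall t, x0 <= t <= x1 ->
       `|U 0%N t - (al + be * t + Int 0 t (SI 0 phi) + ramp Y t)| <=
       C * (Cwd * lam + beta0 * (K1 * (sg / rho ^+ d.*2 + rho * mu_) + sg + S_)) + 2 * B_ * beta0 * C * eps].
Proof.
have [L1 L2] := Lh.
have bk i j : (i <= j)%N -> (j <= L)%N -> (forall l, (i <= l < j)%N -> ~~ white l) ->
    cell j - cell i <= beta0 * C * eps.
  move=> ij jL /(black_run ij)/le_trans; apply; rewrite -mulrA; apply: ler_wpM2l; first by nneg.
  by apply: mE_le => //; [exact: cell_le|exact: cell_le1].
have exw : exists i, (i < L)%N && white i.
  (* Were all cells black, their total length, which exceeds 1 - h, would be at most
     [beta0 * C * eps], against [small]. *)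
  apply: contrapT => /forallNP nw.
  have := bk 0%N L isT (leqnn _).
  have bl l : (0 <= l < L)%N -> ~~ white l.
    by move=> /andP[_ lL]; apply/negP => wl; apply: (nw l); rewrite lL.
  move=> /(_ bl); rewrite /cell mul0r subr0 -/(cell L).
  have : h <= eps := h_eps; move: small; rewrite mulrDl mul1r; lra.
case: (ex_minnP exw) => i0 /andP[i0L w0] min0.
have ub i : (i < L)%N && white i -> (i <= L)%N by move=> /andP[/ltnW].
case: (ex_maxnP exw ub) => i1 /andP[i1L w1] max1.
have i01 : (i0 <= i1)%N by apply: min0; rewrite i1L.
have [|Y [sc0 sc1 sc2 sc3 sc4]] := scan_white w0 _ w1; first by rewrite i01.
pose x0 := cell i0; pose x1 := cell i1.+1.
have x01 : x0 <= x1 by [].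
have x1_1 : x1 <= 1 by exact: cell_le1.
have mEC : mE x1 - mE x0 <= C * eps := mE_le (cell_ge0 i0) x01 x1_1.
have m0 : 0 <= mE x1 - mE x0 by rewrite subr_ge0 mE_mono.
(* The left end of the first white cell and the right end of the last one; only black cells and a
   remainder shorter than h lie outside. The affine part is chosen so that the error is exactly
   [defect]. *)
exists x0, x1, Y, (U 0%N x0 - w x0 * x0 - Int 0 x0 (SI 0 phi)), (w x0); split => //.
- rewrite /x0 cell_ge0/=.
  have := bk 0%N i0 isT (ltnW i0L); rewrite {2}/cell mul0r subr0; apply.
  move=> l /andP[_ l0]; apply/negP => wl; have := min0 l; rewrite (ltn_trans l0 i0L) wl => /(_ isT).
  by rewrite leqNgt l0.
- rewrite x1_1 andbT.
  have bl l : (i1.+1 <= l < L)%N -> ~~ white l.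
    move=> /andP[l0 lL]; apply/negP => wl; have := max1 l; rewrite lL wl => /(_ isT).
    by rewrite leqNgt l0.
  have := bk i1.+1 L i1L (leqnn _) bl.
  rewrite -/x1 mulrDl mul1r; have := h_eps; lra.
- apply: (le_trans sc1); rewrite mE_inc//.
  by apply: Int_sub => // t; exact: high_ge0.
move=> t /andP[t0 t1].
have tle1 : t <= 1 by exact: le_trans x1_1.
have D : U 0%N t - (U 0%N x0 - w x0 * x0 - Int 0 x0 (SI 0 phi) + w x0 * t + Int 0 t (SI 0 phi) + ramp Y t) =
    defect w x0 Y t.
  have lP : locint (SI 0 phi) by apply: l2_locint; exact: SI_l2.
  have -> : U 0%N t = U 0%N x0 + Int x0 t (U 1%N).
    by rewrite -(cU.2 0%N isT x0 t (cell_ge0 i0) t0 tle1); ring.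
  have -> : Int x0 t (U 1%N) = Int x0 t (fun s => w s - w x0) + w x0 * (t - x0) + Int x0 t (SI 0 phi).
    rewrite -Int_cst// -IntD.
    - rewrite -IntD//; first by apply: eq_Int => s _; rewrite /w; ring.
      by apply: locintD; [apply: locintB; [exact: l2_locint|exact: locint_cst]|exact: locint_cst].
    - by apply: locintB; [exact: l2_locint|exact: locint_cst].
    - exact: locint_cst.
  rewrite (Int_chasles lP (cell_ge0 i0) t0) -/x0 /defect; ring.
rewrite D; apply: (le_trans (sc4 t _)); first by rewrite t0.
have Bb : 0 <= 2 * B_ * beta0 by nneg.
apply: lerD.
  apply: (@le_trans _ _ (1 * (eta * (C * eps)))).
    apply: ler_pM => //; [by rewrite subr_ge0|exact: mulr_ge0| |exact: ler_wpM2l].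
    by have := cell_ge0 i0; rewrite -/x0; lra.
  rewrite mul1r /eta /Bw le_eqVlt; apply/orP; left; apply/eqP.
  have E (x y z f : R) : f != 0 -> (x / f + y * (z / f)) * (C * f) = C * (x + y * z).
    by move=> ?; field.
  by apply: E; rewrite gt_eqF.
by rewrite -[leRHS]mulrA; exact: (ler_wpM2l Bb mEC).
Qed.

End fixed.

(** The order of choice matters: [rho] first makes the top derivative negligible on white cells,
    then [sg] absorbs everything that depends on [rho]. The term with [S_] depends on neither and
    stays in the conclusion. *)
Lemma structure (e : R) : 0 < e -> exists2 ebar : R, 0 < ebar &
  forall eps, 0 < eps <= ebar -> structured d c C tau e eps.
Proof.
move=> e0.
have beta_gt0 : 0 < beta0 by rewrite invr_gt0 subr_gt0.
have q0 : 0 < q by rewrite divr_gt0// exprn_gt0.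
have mu0 : 0 <= mu_ by exact: sqrtr_ge0.
have Cw1 : 1 <= Cwd by exact: Cw_ge1.
have Cw0 : 0 <= Cwd by exact: le_trans ler01 Cw1.
have Kq0 := Kq_ge0 (R := R) d.+1.
have K10 : 0 <= K1 by rewrite /K1; nneg.
(* The coefficient of [rho] in the error of [structure_fixed]. *)
pose X := C * Cwd * mu_ + C * beta0 * K1 * mu_.
have X0 : 0 <= X by rewrite /X; nneg.
pose rho := Num.min 1 (e / (2 * (X + 1))).
have rho0 : 0 < rho by rewrite lt_min ltr01 divr_gt0// mulr_gt0// ltr_wpDl.
have rho1 : rho <= 1 by rewrite ge_min lexx.
have rhoX : rho * X <= e / 2.
  apply: (@le_trans _ _ (e / (2 * (X + 1)) * (X + 1))).
    apply: ler_pM => //; [exact: ltW|by rewrite ge_min lexx orbT|by rewrite lerDl].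
  by rewrite le_eqVlt; apply/orP; left; apply/eqP; field; rewrite gt_eqF ?ltr_wpDl.
pose Sb := \sum_(j < d.+1) (beta0 * C / rho ^+ 2) ^+ j.
have bC0 : 0 <= beta0 * C by nneg.
have Sb0 : 0 <= Sb by rewrite /Sb; nneg.
pose B := (Sb * Cwd * (1 + mu_) + (beta0 * C) ^+ d * (Num.sqrt (beta0 * C) * mu_)) * (beta0 * C).
have B0 : 0 <= B by rewrite /B; nneg.
(* The coefficient of [sg] in the same error; it contains negative powers of [rho], which is already
   fixed. *)
pose Y := C * Cwd + C * beta0 * K1 / rho ^+ d.*2 + C * beta0 + 2 * B * beta0 * C.
have Y0 : 0 <= Y by rewrite /Y; nneg.
pose sbar := Num.min 1 (Num.min (e / (2 * (Y + 1))) (Num.min (e / (beta0 * C + 1)) (2 * (beta0 * C + 1))^-1)).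
have bC1 : 0 < beta0 * C + 1 by rewrite ltr_wpDl.
have Y1 : 0 < Y + 1 by rewrite ltr_wpDl.
have sbar0 : 0 < sbar by rewrite !lt_min ltr01 !divr_gt0 ?mulr_gt0//= invr_gt0 mulr_gt0.
exists (sbar ^+ 2); first by rewrite exprn_gt0.
move=> eps /andP[eps0 epsb] U cU kU kappa HE HM.
pose sg := Num.sqrt eps.
have sg0 : 0 < sg by rewrite sqrtr_gt0.
have epsE : eps = sg ^+ 2 by rewrite sqr_sqrtr// ltW.
have sgb : sg <= sbar by rewrite -ler_sqr -?epsE// nnegrE; nneg.
move: sgb; rewrite !le_min => /andP[sg1 /andP[sgY /andP[sge sg2]]].
have eps_sg : sg ^+ 2 <= sg by rewrite expr2; apply: ler_piMl => //; nneg.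
rewrite epsE in HE HM.
have small : (beta0 * C + 1) * sg ^+ 2 < 1.
  apply: (@le_lt_trans _ _ ((beta0 * C + 1) * (2 * (beta0 * C + 1))^-1)).
    by rewrite ler_pM2l// (le_trans eps_sg).
  by rewrite invfM mulrCA mulfV ?gt_eqF// mulr1 invf_lt1// ltr1n.
have small2 : (beta0 * C + 1) * sg ^+ 2 <= e.
  apply: (@le_trans _ _ ((beta0 * C + 1) * (e / (beta0 * C + 1)))).
    by rewrite ler_pM2l// (le_trans eps_sg).
  by rewrite mulrC divfK ?gt_eqF.
have e20 : 0 <= sg ^+ 2 by exact: sqr_ge0.
have [x0 [x1 [Ys [al [be [H1 H2 H3 H4 H5]]]]]] :=
  structure_fixed rho0 rho1 sg0 sg1 cU kU HE HM small.
exists x0, x1, Ys, al, be; split => //.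
- have /andP[-> h] := H1; apply: (le_trans h); apply: le_trans small2.
  by rewrite mulrDl mul1r lerDl.
- by have /andP[h ->] := H2; rewrite andbT; apply: le_trans h; rewrite lerD2l lerN2.
- by rewrite epsE.
move=> t /H5/le_trans; apply.
have sY : sg * Y <= e / 2.
  apply: (@le_trans _ _ (e / (2 * (Y + 1)) * (Y + 1))).
    apply: ler_pM => //; [exact: ltW|by rewrite lerDl].
  by rewrite le_eqVlt; apply/orP; left; apply/eqP; field; rewrite gt_eqF.
rewrite -/B; have -> : C / (1 - tau) * S_ = C * beta0 * S_ by [].
have rd : rho ^+ d.*2.+1 <= rho.
  by rewrite exprS; apply: ler_piMr; [nneg|apply: exprn_ile1 => //; nneg].
have t1 : C * Cwd * (rho ^+ d.*2.+1 * mu_) <= C * Cwd * (rho * mu_).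
  by apply: ler_wpM2l; [nneg|exact: ler_wpM2r].
have t2 : 2 * B * beta0 * C * sg ^+ 2 <= 2 * B * beta0 * C * sg.
  by apply: ler_wpM2l => //; nneg.
have E1 : C * (Cwd * (sg + rho ^+ d.*2.+1 * mu_) + beta0 * (K1 * (sg / rho ^+ d.*2 + rho * mu_) + sg + S_)) =
   C * Cwd * sg + C * Cwd * (rho ^+ d.*2.+1 * mu_) + (C * beta0 * K1 / rho ^+ d.*2 + C * beta0) * sg +
   C * beta0 * K1 * mu_ * rho + C * beta0 * S_ by ring.
rewrite E1; move: rhoX sY; rewrite /X /Y; lra.
Qed.

End structure.

(** * Normal form of piecewise-H^2 functions *)

Section normal_form.
Context {R : realType}.
Notation mu := (@lebesgue_measure R).
Implicit Types (a b x y t : R) (u f g h w : R -> R) (s : seq R) (n m i j k : nat).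

Definition lft s i : R := nth 0 (0 :: s) i.
Definition rgt s i : R := nth 0 s i.

Lemma lftS s i : lft s i.+1 = rgt s i. Proof. by []. Qed.

Section partition.
Variable s : seq R.
Hypothesis ps : itv_partition 0 1 s.

Lemma partition_size : (0 < size s)%N.
Proof. by case: s ps => //= -[_ /eqP /= e]; have := oner_neq0 R; rewrite -e eqxx. Qed.

Lemma partition_lt i j : (i < j <= size s)%N -> lft s i < lft s j.
Proof.
move=> /andP[ij js]; have [p _] := ps.
have ss : sorted <%R (0 :: s) by [].
apply: (sorted_ltn_nth (@lt_trans _ R)) => //; rewrite inE /= ltnS//.
by rewrite ltnW// (leq_trans ij).
Qed.

Lemma partition_le i j : (i <= j <= size s)%N -> lft s i <= lft s j.
Proof.
move=> /andP[]; rewrite leq_eqVlt => /predU1P[->//|ij js].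
by apply/ltW/partition_lt; rewrite ij.
Qed.

Lemma lft_size : lft s (size s) = 1.
Proof. by have [_ /eqP <-] := ps; rewrite /lft (last_nth 0). Qed.

Lemma piece_lt i : (i < size s)%N -> lft s i < rgt s i.
Proof. by move=> is_; rewrite -lftS; apply: partition_lt; rewrite ltnSn. Qed.

Lemma lft_ge0 i : (i <= size s)%N -> 0 <= lft s i.
Proof. by move=> is_; apply: (@partition_le 0 i). Qed.

Lemma rgt_le1 i : (i < size s)%N -> rgt s i <= 1.
Proof. by move=> is_; rewrite -lft_size -lftS; apply: partition_le; rewrite is_ leqnn. Qed.

Lemma locate x : 0 < x <= 1 -> exists2 i, (i < size s)%N & lft s i < x <= rgt s i.
Proof.
move=> /andP[x0 x1]; pose i := find (fun y => x <= y) s.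
have hs : has (fun y => x <= y) s.
  apply/hasP; exists 1 => //; rewrite -lft_size.
  by case: s ps partition_size => // y s' _ _; rewrite /lft /=; exact: mem_nth.
exists i; first by rewrite -has_find.
rewrite /rgt (nth_find 0 hs) andbT /lft.
case E : i => [//|j] /=; rewrite ltNge; apply/negP => /= H.
have ji : (j < i)%N by rewrite E.
by have := before_find 0 ji; rewrite H.
Qed.

Lemma piece_disj i j x y : (i < size s)%N -> (j < size s)%N ->
  lft s i < x < rgt s i -> lft s j < y < rgt s j -> x = y -> i = j.
Proof.
move=> is_ js /andP[x1 x2] /andP[y1 y2] xy; apply/eqP; rewrite eqn_leq.
apply/andP; split; rewrite leqNgt; apply/negP => H.
  have := @partition_le j.+1 i; rewrite H ltnW// => /(_ isT).
  by rewrite lftS leNgt -xy in y2 *; rewrite (lt_trans x1 y2).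
have := @partition_le i.+1 j; rewrite H ltnW// => /(_ isT).
by rewrite lftS leNgt xy in x2 *; rewrite (lt_trans y1 x2).
Qed.

End partition.

Lemma ae_notin s : {ae mu, forall x, x \notin s}.
Proof.
have f : finite_set [set` s] by exact: finite_seq.
exists [set` s]; split.
- by apply: countable_measurable (finite_set_countable f) => x; exact: measurable_set1.
- by apply: countable_lebesgue_measure0; exact: (finite_set_countable f).
- by move=> x /= /negP; rewrite negbK.
Qed.

Lemma ae_forall_lt n (P : nat -> R -> Prop) :
  (forall i, (i < n)%N -> {ae mu, forall x, P i x}) ->
  {ae mu, forall x, forall i, (i < n)%N -> P i x}.
Proof.
elim: n => [|n IH] H; first by apply: ae_all.
have H1 : {ae mu, forall x, forall i, (i < n)%N -> P i x} by apply: IH => i /ltnW; exact: H.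
apply: ae_imp (ae_and H1 (H n (ltnSn n))) => x [h1 h2] i.
by rewrite ltnS leq_eqVlt => /predU1P[->//|]; exact: h1.
Qed.

Lemma L2_sub a b c d u : u \in L2 a b -> a <= c -> d <= b -> u \in L2 c d.
Proof.
move=> uL ac db; rewrite inE /=.
have -> : u \_ `]c, d[%classic = (u \_ `]a, b[%classic) \_ `]c, d[%classic.
  apply/funext => x; rewrite !patchE; case: ifPn => // /set_mem /=; rewrite in_itv/= => /andP[cx xd].
  by rewrite mem_set//= in_itv/= (le_lt_trans ac)//= (lt_le_trans xd).
by have := l2_L2 c d (L2_l2 uL); rewrite inE.
Qed.

Lemma weak_derivative_sub a b c d n u g : u \in L2 a b -> a <= c -> c < d -> d <= b ->
  is_weak_derivative a b n u g -> is_weak_derivative c d n u g.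
Proof.
move=> uL ac cd db; have ab : a < b by exact: le_lt_trans ac (lt_le_trans cd db).
move=> /(is_weak_derivativeP _ _ ab uL)[gL H].
have uL' := L2_sub uL ac db; have gL' := L2_sub gL ac db.
apply/(is_weak_derivativeP _ _ cd uL'); split => // phi tphi.
have tphi' : test_function a b phi.
  have /(test_functionP _ cd)[c' [d' [c1 c2 c3 c4]]] := tphi.
  by apply/(test_functionP _ ab); exists c', d'; split => //; [exact: le_lt_trans c1|exact: lt_le_trans db].
have [c' [d' [c1 c2 c3 c4]]] := (test_functionP phi cd).1 tphi.
have R1 v m : v \in L2 a b ->
    Int c d (fun x => (v \_ `]c, d[%classic) x * derive1n m phi x) =
    Int a b (fun x => (v \_ `]a, b[%classic) x * derive1n m phi x).
  move=> vL; have s4 := supported_derive1n m c4.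
  have l1 := l2_mul (L2_l2 (L2_sub vL ac db)) (supported_l2 m c4).
  have l2_ := l2_mul (L2_l2 vL) (supported_l2 m c4).
  rewrite (Int_supported l1 s4 (ltW c1) c2 (ltW c3)).
  rewrite (Int_supported l2_ s4 (le_trans ac (ltW c1)) c2 (le_trans (ltW c3) db)).
  apply: eq_Int => x /andP[cx xd]; congr (_ * _); rewrite !patchE !mem_set//= in_itv/=.
    by rewrite (le_lt_trans ac) ?(lt_le_trans c1)//= (lt_le_trans _ db)// (le_lt_trans xd).
  by rewrite (lt_le_trans c1)//= (le_lt_trans xd).
by rewrite (R1 u n uL) (H _ tphi') -(R1 g 0%N gL).
Qed.

Lemma weak_derivative_congr a b n u g g' : (forall x, a < x < b -> g x = g' x) ->
  is_weak_derivative a b n u g -> is_weak_derivative a b n u g'.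
Proof.
move=> gg [gL H]; split.
  have E : g' \_ `]a, b[%classic = g \_ `]a, b[%classic.
    apply/funext => x; rewrite !patchE; case: ifPn => // /set_mem /=.
    by rewrite in_itv/= => /gg.
  by move: gL; rewrite !inE /= E.
move=> phi /H ->; congr (_ * _); apply: eq_Rintegral => x /set_mem/=; rewrite in_itv/= => /gg ->//.
Qed.

(** One density g serves all pieces, and its double primitive is continuously differentiable. The
    jumps of u and u' therefore sit in the numbers A and B alone. *)
Definition nform s u g (A B : nat -> R) :=
  [/\ itv_partition 0 1 s, u \in L2 0 1, l2 g & forall i, (i < size s)%N ->
    {ae mu, forall x, lft s i < x < rgt s i -> u x = SI 0 (SI 0 g) x + (A i + B i * x)}].

Lemma affine_l2 (p q : R) : l2 (fun x => p + q * x).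
Proof.
apply: l2D; first exact: l2_cst.
apply: l2Z; apply: continuous_l2 => x; exact: cvg_id.
Qed.

Lemma affine_increment (p q x y : R) : x <= y -> (p + q * y) - (p + q * x) = Int x y (fun=> q).
Proof. by move=> xy; rewrite Int_cst//; ring. Qed.

Definition pieceV g (A B : nat -> R) i n : R -> R :=
  if n is n'.+1 then if n' is _.+1 then g else fun x => SI 0 g x + B i
  else fun x => SI 0 (SI 0 g) x + (A i + B i * x).

Lemma pieceV_chain g A B i a b : l2 g -> chain a b 2 (pieceV g A B i).
Proof.
move=> lg; have lS := SI_l2 0 lg; split.
  move=> [|[|j]] //=; first by apply: l2D; [exact: SI_l2|exact: affine_l2].
  by apply: l2D => //; exact: l2_cst.
move=> [|[|//]] _ /= x y ax xy yb.
  rewrite opprD addrACA SI_sub//; last exact: l2_locint.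
  by rewrite affine_increment// (IntD x y (l2_locint lS) (locint_cst (B i))).
by rewrite opprD addrACA subrr addr0 SI_sub//; exact: l2_locint.
Qed.

Lemma nform_exists s u : u \in L2 0 1 -> pw_H2_on s u -> exists g A B, nform s u g A B.
Proof.
move=> uL [ps Hs].
have ex i : exists U : nat -> R -> R, (i < size s)%N -> chain (lft s i) (rgt s i) 2 U /\
    is_weak_derivative (lft s i) (rgt s i) 0 u (U 0%N).
  case: (ltnP i (size s)) => is_; last by exists (fun _ _ => 0).
  have [U [cU _ dU]] := sobolev_chain (piece_lt ps is_) (Hs i is_).
  by exists U => _; split => //; case: (dU 0%N isT).
have [U HU] := choice ex.
pose g x := \sum_(i < size s) (U i 2 \_ `]lft s i, rgt s i[%classic) x.
have lg : l2 g.
  by apply: l2_sum => i; apply: l2_restrict => //; exact: (HU _ (ltn_ord i)).1.1.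
have gE i x : (i < size s)%N -> lft s i < x < rgt s i -> g x = U i 2 x.
  move=> is_ xi; rewrite /g (bigD1 (Ordinal is_))//= big1 ?addr0.
    by rewrite patchE mem_set//= in_itv.
  move=> j ji; rewrite patchE; case: ifPn => // /set_mem /=; rewrite in_itv/= => xj.
  by move: ji; rewrite -val_eqE/= (piece_disj ps (ltn_ord j) is_ xj xi erefl) eqxx.
exists g, (fun i => U i 0%N (lft s i) - SI 0 (SI 0 g) (lft s i) - (U i 1%N (lft s i) - SI 0 g (lft s i)) * lft s i),
  (fun i => U i 1%N (lft s i) - SI 0 g (lft s i)).
split => // i is_; have [[lU pU] wU] := HU i is_.
have ab := piece_lt ps is_; set a := lft s i in pU wU ab *; set b := rgt s i in pU wU ab *.
have lS := SI_l2 0 lg.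
have E1 x : a <= x <= b -> U i 1%N x = SI 0 g x + (U i 1%N a - SI 0 g a).
  move=> /andP[ax xb]; have := pU 1%N isT a x (lexx _) ax xb.
  rewrite -(@ae_Int _ a x g (U i 2))//; last first.
    by apply: ae_all => t /andP[t1 t2]; apply: gE => //; rewrite t1 (lt_le_trans t2).
  by rewrite -(SI_sub 0 (l2_locint lg) ax) => H; rewrite -(subrK (U i 1%N a) (U i 1%N x)) H; ring.
have E0 x : a <= x <= b -> U i 0%N x = SI 0 (SI 0 g) x + (U i 0%N a - SI 0 (SI 0 g) a -
     (U i 1%N a - SI 0 g a) * a + (U i 1%N a - SI 0 g a) * x).
  move=> /andP[ax xb]; have := pU 0%N isT a x (lexx _) ax xb.
  rewrite (@eq_Int _ a x _ (fun t => SI 0 g t + (U i 1%N a - SI 0 g a))); last first.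
    by move=> t /andP[t1 t2]; apply: E1; rewrite t1 (le_trans t2).
  rewrite IntD; [|exact: l2_locint|exact: locint_cst].
  rewrite -(SI_sub 0 (l2_locint lS) ax) Int_cst// => H.
  rewrite -(subrK (U i 0%N a) (U i 0%N x)) H; ring.
have uL' : u \in L2 a b by apply: L2_sub uL _ _; [exact: (lft_ge0 ps (ltnW is_))|exact: rgt_le1].
have wu : is_weak_derivative a b 0 u u by split => // phi _; rewrite expr0 mul1r.
have := weak_derivative_unique ab wu wU; apply: ae_imp => x /= H xab.
by rewrite H ?in_itv//= E0//; have /andP[/ltW -> /ltW ->] := xab.
Qed.

Section nform.
Variables (s : seq R) (u g : R -> R) (A B : nat -> R).
Hypothesis nf : nform s u g A B.

Let ps : itv_partition 0 1 s. Proof. by case: nf. Qed.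
Let uL : u \in L2 0 1. Proof. by case: nf. Qed.
Let lg : l2 g. Proof. by case: nf. Qed.

Lemma nform_L2 i : (i < size s)%N -> u \in L2 (lft s i) (rgt s i).
Proof. by move=> is_; apply: L2_sub uL _ _; [exact: (lft_ge0 ps (ltnW is_))|exact: rgt_le1]. Qed.

Lemma nform_weak i n : (i < size s)%N -> (n <= 2)%N ->
  is_weak_derivative (lft s i) (rgt s i) n u (pieceV g A B i n).
Proof.
move=> is_; apply: chain_weak; [exact: piece_lt|exact: pieceV_chain|exact: nform_L2|].
by have [_ _ _ /(_ i is_)] := nf; apply: ae_imp => x /= H; rewrite in_itv.
Qed.

Lemma nform_pw_H2 : pw_H2_on s u.
Proof.
split => // i is_.
have := @chain_sobolev _ _ _ 2 _ u (piece_lt ps is_) (@pieceV_chain g A B i _ _ lg) (nform_L2 is_).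
case=> //; by have [_ _ _ /(_ i is_)] := nf; apply: ae_imp => x /= H; rewrite in_itv.
Qed.

Lemma nform_pw_derivative n : (n <= 2)%N -> is_pw_derivative n u (pw_derivative n u).
Proof.
move=> n2; pose w x := \sum_(i < size s) (pieceV g A B i n \_ `]lft s i, rgt s i[%classic) x.
rewrite /pw_derivative; have H : exists g', is_pw_derivative n u g'.
  exists w; exists s; first exact: nform_pw_H2.
  move=> i is_; apply: weak_derivative_congr (nform_weak is_ n2) => x xi.
  rewrite /w (bigD1 (Ordinal is_))//= big1 ?addr0.
    by rewrite patchE mem_set//= in_itv.
  move=> j ji; rewrite patchE; case: ifPn => // /set_mem /=; rewrite in_itv/= => xj.
  by move: ji; rewrite -val_eqE/= (piece_disj ps (ltn_ord j) is_ xj xi erefl) eqxx.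
exact: (xgetPex _ H).
Qed.

(** The derivative picked by [xget] may come with another partition; on the overlap of two pieces
    weak derivatives are unique, and the nodes are negligible. *)
Lemma nform_pw_derivative_ae n i : (n <= 2)%N -> (i < size s)%N ->
  {ae mu, forall x, lft s i < x < rgt s i -> pw_derivative n u x = pieceV g A B i n x}.
Proof.
move=> n2 is_; have [s' [ps' Hs'] Hd] := nform_pw_derivative n2.
have H j : (j < size s')%N -> {ae mu, forall x, lft s i < x < rgt s i ->
    lft s' j < x < rgt s' j -> pw_derivative n u x = pieceV g A B i n x}.
  move=> js; pose a := Num.max (lft s i) (lft s' j); pose b := Num.min (rgt s i) (rgt s' j).
  have [ab|ba] := ltP a b; last first.
    apply: ae_all => x /andP[x1 x2] /andP[x3 x4].
    have xa : a < x by rewrite gt_max x1.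
    by have : x < b; [rewrite lt_min x2|rewrite ltNge (le_trans ba (ltW xa))].
  have ai : lft s i <= a by rewrite le_max lexx.
  have aj : lft s' j <= a by rewrite le_max lexx orbT.
  have bi : b <= rgt s i by rewrite ge_min lexx.
  have bj : b <= rgt s' j by rewrite ge_min lexx orbT.
  have uL' : u \in L2 (lft s' j) (rgt s' j).
    by apply: L2_sub uL _ _; [exact: (lft_ge0 ps' (ltnW js))|exact: rgt_le1].
  have w1 := weak_derivative_sub uL' aj ab bj (Hd j js).
  have w2 := weak_derivative_sub (nform_L2 is_) ai ab bi (nform_weak is_ n2).
  apply: ae_imp (weak_derivative_unique ab w1 w2) => x /= E /andP[x1 x2] /andP[x3 x4].
  by apply: E; rewrite in_itv/= gt_max lt_min x1 x2 x3 x4.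
apply: ae_imp (ae_and (ae_notin s') (ae_forall_lt H)) => x [xs Hx] xi.
have x01 : 0 < x <= 1.
  have /andP[x1 x2] := xi; rewrite (le_lt_trans (lft_ge0 ps (ltnW is_)) x1)/=.
  exact: le_trans (ltW x2) (rgt_le1 ps is_).
have [j js /andP[x1 x2]] := locate ps' x01.
apply: (Hx j js xi); rewrite x1 lt_neqAle x2 andbT; apply: contraNneq xs => ->.
exact: mem_nth.
Qed.

End nform.

(** A representative of w continuous at x agrees almost everywhere with h1 on the left and h2 on the
    right, so both take its value at x; conversely, equal values allow h1 and h2 to be glued. *)
Lemma disc_pieces a b x (h1 h2 w : R -> R) : 0 <= a -> a < x -> x < b -> b <= 1 ->
  continuous h1 -> continuous h2 ->
  {ae mu, forall t, a < t < x -> w t = h1 t} -> {ae mu, forall t, x < t < b -> w t = h2 t} ->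
  disc w x <-> h1 x <> h2 x.
Proof.
move=> a0 ax xb b1 c1 c2 w1 w2; split.
  move=> [_ nw] h12; apply: nw.
  (* Glue h1 and h2 at x, and keep w itself outside []a, b[] so that the function still represents
     w. *)
  exists (fun t => if t <= a then w t else if t <= x then h1 t else if t < b then h2 t else w t); split.
    apply: ae_imp (ae_and (ae_notin [:: x]) (ae_and w1 w2)) => t [tx [H1 H2]] _.
    case: (leP t a) => // at_; case: (leP t x) => tx'.
      by apply: H1; rewrite at_ lt_neqAle tx' andbT; move: tx; rewrite inE.
    by case: (ltP t b) => // tb; apply: H2; rewrite tx'.
  apply/cvgrPdist_lt => e e0 /=; rewrite leNgt ax/= lexx.
  have /cvgrPdist_lt/(_ e e0) n1 := c1 x; have /cvgrPdist_lt/(_ e e0) n2 := c2 x.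
  near=> t; have at_ : a < t by near: t; exact: lt_nbhsr.
  have tb : t < b by near: t; exact: lt_nbhsl.
  rewrite (leNgt t a) at_ /= tb; case: (leP t x) => _; first by near: t.
  by rewrite h12; near: t.
move=> h12; split; first by rewrite (le_lt_trans a0 ax) (lt_le_trans xb b1).
move=> [v [wv cv]]; apply: h12.
have wv' : {ae mu, forall t, 0 < t < 1 -> w t = v t}.
  by apply: ae_imp wv => t /= H; rewrite in_itv/= in H.
pose psi1 t := h1 t - v t; pose psi2 t := h2 t - v t.
have key (h : R -> R) : continuous h ->
  (forall d, 0 < d -> exists t, `|x - t| < d /\ h t = v t) -> h x = v x.
  move=> ch H; apply/eqP; rewrite -subr_eq0 -normr_le0; apply/ler_addgt0Pl => e e0; rewrite addr0.
  have e2 : 0 < e / 2 by rewrite divr_gt0.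
  have /cvgrPdist_lt/(_ _ e2)[d1 /= d10 n1] := ch x.
  have /cvgrPdist_lt/(_ _ e2)[d2 /= d20 n2] := cv.
  have [|t [td E]] := H (Num.min d1 d2); first by rewrite lt_min d10.
  rewrite lt_min in td; have /andP[t1 t2] := td.
  have -> : h x - v x = (h x - h t) - (v x - v t) by rewrite E; ring.
  rewrite (le_trans (ler_normB _ _))// [leRHS]splitr lerD// ltW//; [exact: n1|exact: n2].
rewrite (key h1 c1); last first.
  move=> d d0; pose a' := Num.max a (x - d).
  have a'x : a' < x by rewrite gt_max ax/= ltrBlDr ltrDl.
  have H : {ae mu, forall t, a' < t < x -> h1 t = v t}.
    apply: ae_imp (ae_and wv' w1) => t [H1 H2] /andP[t1 t2].
    have at_ : a < t by apply: le_lt_trans t1; rewrite le_max lexx.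
    rewrite -H2 ?at_// H1// (le_lt_trans a0 at_) (lt_trans t2)//.
    exact: lt_le_trans xb b1.
  have [t [/andP[t1 t2] E]] := ae_exists a'x H; exists t; split => //.
  rewrite gtr0_norm ?subr_gt0// ltrBlDr -ltrBlDl; apply: le_lt_trans t1.
  by rewrite le_max lexx orbT.
rewrite (key h2 c2)// => d d0; pose b' := Num.min b (x + d).
have xb' : x < b' by rewrite lt_min xb/= ltrDl.
have H : {ae mu, forall t, x < t < b' -> h2 t = v t}.
  apply: ae_imp (ae_and wv' w2) => t [H1 H2] /andP[t1 t2].
  have tb : t < b by apply: lt_le_trans t2 _; rewrite ge_min lexx.
  rewrite -H2 ?t1// H1// (lt_le_trans tb b1) (lt_trans _ t1)//.
  exact: le_lt_trans a0 ax.
have [t [/andP[t1 t2] E]] := ae_exists xb' H; exists t; split => //.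
rewrite distrC gtr0_norm ?subr_gt0// ltrBlDl; apply: lt_le_trans t2 _.
by rewrite ge_min lexx orbT.
Unshelve. all: by end_near. Qed.

Lemma counting_seq (t : seq R) : uniq t -> counting [set` t] = ((size t)%:R : R)%:E.
Proof.
move=> ut; rewrite /counting asboolT; last exact: finite_seq.
congr (_%:R%:E); apply: card_fset_set.
rewrite card_eq_sym; apply/card_set_bijP; exists (nth 0 t); split.
- by move=> i /= it; exact: mem_nth.
- move=> i j; by rewrite !inE => it jt /eqP; rewrite nth_uniq// => /eqP.
- by move=> x /= /(nthP 0)[i it <-]; exists i.
Qed.

Lemma counting_nodes s m (p : pred nat) (D : set R) : itv_partition 0 1 s -> (m < size s)%N ->
  (forall x, D x <-> exists i, [/\ (i < m)%N, p i & x = rgt s i]) ->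
  counting D = ((\sum_(i < m) p i)%:R : R)%:E.
Proof.
move=> ps ms HD; pose t := [seq rgt s i | i <- iota 0 m & p i].
have ut : uniq t.
  rewrite map_inj_in_uniq; first by rewrite filter_uniq// iota_uniq.
  move=> i j; rewrite !mem_filter !mem_iota /= !add0n => /andP[_ im] /andP[_ jm] E.
  apply/eqP; rewrite eqn_leq; apply/andP; split; rewrite leqNgt; apply/negP => H.
    have := @partition_lt s ps j.+1 i.+1; rewrite ltnS H (ltn_trans im ms) => /(_ isT).
    by rewrite !lftS E ltxx.
  have := @partition_lt s ps i.+1 j.+1; rewrite ltnS H (ltn_trans jm ms) => /(_ isT).
  by rewrite !lftS E ltxx.
have -> : D = [set` t].
  apply/seteqP; split => x /=.
    move=> /HD[i [im pi ->]]; apply/mapP; exists i => //.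
    by rewrite mem_filter pi mem_iota add0n.
  move=> /mapP[i]; rewrite mem_filter mem_iota add0n => /andP[pi im] ->.
  by apply/HD; exists i.
rewrite counting_seq// size_map size_filter -sum1_count.
by rewrite -(subn0 m) -/(index_iota 0 m) big_mkcond big_mkord /= subn0;
  congr (_%:R%:E); apply: eq_bigr => i _; case: (p i).
Qed.

(** * The limit functional in normal form *)

Section FBZ.
Variables (s : seq R) (u g : R -> R) (A B : nat -> R).
Hypothesis nf : nform s u g A B.

Let ps : itv_partition 0 1 s. Proof. by case: nf. Qed.
Let lg : l2 g. Proof. by case: nf. Qed.

Definition vjump i := A i + B i * rgt s i != A i.+1 + B i.+1 * rgt s i.
Definition sjump i := B i != B i.+1.

Let V := pieceV g A B.

Let cV i n : (n <= 1)%N -> continuous (V i n).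
Proof.
case: n => [|[|//]] _ x.
  apply: cvgD; first exact: (SI_continuous (SI_l2 0 lg)).
  by apply: cvgD; [exact: cvg_cst|apply: cvgMr; exact: cvg_id].
by apply: cvgD; [exact: SI_continuous|exact: cvg_cst].
Qed.

Let disc_nodes (w : R -> R) n : (n <= 1)%N ->
  (forall i, (i < size s)%N -> {ae mu, forall x, lft s i < x < rgt s i -> w x = V i n x}) ->
  forall x, disc w x <->
    exists i, [/\ (i < (size s).-1)%N, V i n (rgt s i) <> V i.+1 n (rgt s i) & x = rgt s i].
Proof.
move=> n1 Hw x; split.
  move=> dx; have [/andP[x0 x1] _] := dx.
  have x01 : 0 < x <= 1 by rewrite x0 ltW.
  have [i is_ /andP[ix]] := locate ps x01; rewrite le_eqVlt => /predU1P[xE|xi]; last first.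
    have w1 : {ae mu, forall t, lft s i < t < x -> w t = V i n t}.
      by apply: ae_imp (Hw i is_) => t H /andP[t1 t2]; apply: H; rewrite t1 (lt_trans t2).
    have w2 : {ae mu, forall t, x < t < rgt s i -> w t = V i n t}.
      by apply: ae_imp (Hw i is_) => t H /andP[t1 t2]; apply: H; rewrite t2 (lt_trans _ t1).
    by have /(_ dx) := (disc_pieces (lft_ge0 ps (ltnW is_)) ix xi (rgt_le1 ps is_)
      (cV (i := i) n1) (cV (i := i) n1) w1 w2).1.
  have is' : (i.+1 < size s)%N.
    rewrite ltn_neqAle is_ andbT; apply/eqP => e.
    by have := x1; rewrite xE -lftS e (lft_size ps) ltxx.
  exists i; split => //; first by rewrite -ltnS prednK//; exact: partition_size.
  have w2 := Hw i.+1 is'; rewrite lftS -xE in w2.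
  have xb : x < rgt s i.+1 by rewrite xE -lftS piece_lt.
  have w1 := Hw i is_; rewrite -xE in w1 *.
  exact: (disc_pieces (lft_ge0 ps (ltnW is_)) ix xb (rgt_le1 ps is') (cV (i := i) n1) (cV (i := i.+1) n1) w1 w2).1.
move=> [i [im vne ->]].
have is' : (i.+1 < size s)%N by rewrite -(prednK (partition_size ps)) ltnS.
have is_ := ltnW is'.
have w2 := Hw i.+1 is'; rewrite lftS in w2.
have xb : rgt s i < rgt s i.+1 by rewrite -lftS piece_lt.
exact: (disc_pieces (lft_ge0 ps (ltnW is_)) (piece_lt ps is_) xb (rgt_le1 ps is') (cV (i := i) n1) (cV (i := i.+1) n1)
  (Hw i is_) w2).2.
Qed.

Let disc0 x : disc u x <-> exists i, [/\ (i < (size s).-1)%N, vjump i & x = rgt s i].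
Proof.
have Hu i : (i < size s)%N -> {ae mu, forall x, lft s i < x < rgt s i -> u x = V i 0%N x}.
  by move=> is_; have [_ _ _] := nf; apply.
rewrite (disc_nodes (n := 0%N) isT Hu); split => -[i [im H ->]]; exists i; split => //.
  by apply/eqP => E; apply: H; rewrite /V/= E.
by move=> /addrI E; move: H; rewrite /vjump E eqxx.
Qed.

Let disc1 x : (disc (pw_derivative 1 u) `\` disc u) x <->
  exists i, [/\ (i < (size s).-1)%N, ~~ vjump i && sjump i & x = rgt s i].
Proof.
have H1 := disc_nodes (n := 1%N) isT (fun i => nform_pw_derivative_ae nf (n := 1) isT (i := i)).
split.
  move=> [/H1[i [im H ->]] nd]; exists i; split => //; apply/andP; split.
    by apply/negP => vj; apply: nd; apply/disc0; exists i.
  by apply/eqP => E; apply: H; rewrite /V/= E.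
move=> [i [im /andP[nv sj] ->]]; split.
  apply/H1; exists i; split => // /addrI E; by move: sj; rewrite /sjump E eqxx.
move=> /disc0[j [jm vj E]]; move: nv; suff -> : i = j by rewrite vj.
have lt k l : (k < l)%N -> (l < (size s).-1)%N -> rgt s k < rgt s l.
  move=> kl ls; rewrite -!lftS; apply: (partition_lt ps).
  by rewrite ltnS kl ltnW// -(prednK (partition_size ps)) ltnS.
case: (ltngtP i j) => // ij; first by have := lt _ _ ij jm; rewrite E ltxx.
by have := lt _ _ ij im; rewrite E ltxx.
Qed.

Lemma pw_derivative2_ae : pw_derivative 2 u = g %[ae mu in `]0%R, 1%R[%classic].
Proof.
have H := ae_forall_lt (fun i => nform_pw_derivative_ae nf (n := 2) isT (i := i)).
apply: ae_imp (ae_and (ae_notin s) H) => x [xs Hx] /=; rewrite in_itv/= => /andP[x0 x1].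
have x01 : 0 < x <= 1 by rewrite x0 ltW.
have [i is_ /andP[x2 x3]] := locate ps x01; apply: (Hx i is_); rewrite x2 lt_neqAle x3 andbT.
by apply: contraNneq xs => ->; exact: mem_nth.
Qed.

(** The chosen derivative is known to be measurable only on each piece of its own partition; the
    half-open pieces cover []0, 1[]. *)
Lemma pw_derivative2_measurable :
  measurable_fun (`]0, 1[%classic : set (measurableTypeR R)) (pw_derivative 2 u).
Proof.
have [s' [ps' Hs'] Hd] := nform_pw_derivative nf (leqnn 2).
pose F i : set (measurableTypeR R) := if (i < size s')%N then `]lft s' i, rgt s' i]%classic else set0.
apply: (@measurable_funS _ _ _ _ (\bigcup_i F i)).
- by apply: bigcupT_measurable => i; rewrite /F; case: ifP.
- move=> x /=; rewrite in_itv/= => /andP[x0 x1].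
  have x01 : 0 < x <= 1 by rewrite x0 ltW.
  have [i is_ xi] := locate ps' x01; exists i => //; by rewrite /F is_ /= in_itv.
apply/measurable_fun_bigcup => i; rewrite /F; case: ifP => // is_; first last.
  exact: measurable_fun_set0.
have lt := piece_lt ps' is_.
rewrite -(setUitv1 true)// ?bnd_simp//; apply/measurable_funU => //; split; last exact: measurable_fun_set1.
by have [/L2_measurable] := Hd i is_.
Qed.

Definition jump_cost : R :=
  2 * (\sum_(i < (size s).-1) vjump i)%:R + (\sum_(i < (size s).-1) (~~ vjump i && sjump i))%:R.

Lemma FBZ_E : FBZ u = (Int 0 1 (fun x => g x ^+ 2) + jump_cost)%:E.
Proof.
have ms : ((size s).-1 < size s)%N by rewrite ltn_predL; exact: partition_size.
rewrite /FBZ asboolT; last by exists s; exact: nform_pw_H2 nf.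
rewrite (counting_nodes ps ms disc0) (counting_nodes ps ms disc1).
have -> : (\int[mu]_(x in `]0%R, 1%R[%classic) ((pw_derivative 2 u x) ^+ 2)%:E)%E =
    (Int 0 1 (fun x => g x ^+ 2))%:E.
  rewrite -EFin_Int; last exact: lg.2.
  apply: ae_eq_integral => //.
  - apply/measurable_EFinP; apply: measurable_funX; exact: pw_derivative2_measurable.
  - by apply/measurable_EFinP; apply: measurable_funX; apply: measurable_funTS; exact: l2_meas.
  - by apply: ae_imp pw_derivative2_ae => x /= H /H ->.
by rewrite -EFinM -!EFinD /jump_cost addrA.
Qed.

End FBZ.
End normal_form.

(** * Weak compactness along an ultrafilter *)

Section weak_limit.
Context {R : realType}.
Notation mu := (@lebesgue_measure R).

(** Along an ultrafilter every bounded sequence converges, so the limits against all test functions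
    exist at once and no subsequence is extracted. *)
Lemma ultra_bounded_cvg (F : set_system nat) (f : nat -> R) (K : R) : UltraFilter F ->
  (\forall k \near F, `|f k| <= K) -> exists l : R, f k @[k --> F] --> l.
Proof.
move=> uF fK.
have FI : (f @ F) `[- K, K]%classic.
  by rewrite /nbhs/=; apply: filterS fK => k; rewrite /= in_itv/= ler_norml.
have [p [_ cp]] := @segment_compact R (- K) K (f @ F) _ FI; exists p => B nB.
have [//|nFB] := in_ultra_setVsetC (f @^-1` B) uF.
by have [x [nBx Bx]] := cp (~` B) B nFB nB; case: (nBx Bx).
Qed.

Lemma cvg_sum_filter (T : Type) (F : set_system T) (I : Type) (s : seq I) (f : I -> T -> R) (l : I -> R) :
  Filter F -> (forall i, f i x @[x --> F] --> l i) ->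
  \sum_(i <- s) f i x @[x --> F] --> \sum_(i <- s) l i.
Proof.
move=> FF H; elim: s => [|i s IH].
  by rewrite big_nil; under eq_fun do rewrite big_nil; exact: cvg_cst.
by rewrite big_cons; under eq_fun do rewrite big_cons; apply: cvgD.
Qed.

Lemma indic_l2 (A : set (measurableTypeR R)) : measurable A -> l2 (\1_A : R -> R).
Proof.
move=> mA; have -> : (\1_A : R -> R) = (fun x => \1_A x * 1) by apply/funext => x; rewrite mulr1.
apply: (@l2_bounded_mul _ _ _ 1); [exact: l2_cst|exact: measurable_indic|].
by move=> x; rewrite indicE; case: (_ \in _); rewrite ?normr1// normr0.
Qed.

Lemma indic_sqr (A : set R) x : (\1_A x : R) ^+ 2 = \1_A x.
Proof. by rewrite indicE; case: (_ \in _); rewrite ?expr1n// expr0n. Qed.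

Section charge.
Variables (F : set_system nat) (g : nat -> R -> R) (M : R).
Hypotheses (uF : UltraFilter F) (lg : forall k, l2 (g k))
  (gM : \forall k \near F, Int 0 1 (fun x => g k x ^+ 2) <= M).

Let I phi k := Int 0 1 (fun x => phi x * g k x).

Let I_sqr phi : l2 phi -> \forall k \near F,
  I phi k ^+ 2 <= Int 0 1 (fun x => phi x ^+ 2) * M.
Proof.
move=> lphi; apply: filterS gM => k Hk; apply: (le_trans (Int_CS _ _ lphi (lg k))).
by apply: ler_wpM2l => //; apply: Int_ge0 => x _; exact: sqr_ge0.
Qed.

Let L phi := lim (I phi k @[k --> F]).

Let L_cvg phi : l2 phi -> I phi k @[k --> F] --> L phi.
Proof.
move=> lphi; have [|l Hl] := @ultra_bounded_cvg F (I phi) (Num.sqrt (Int 0 1 (fun x => phi x ^+ 2) * M)) uF.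
  by apply: filterS (I_sqr lphi) => k; exact: sqr_le_sqrt.
by apply/cvg_ex; exists l.
Qed.

Let L_sqr phi : l2 phi -> L phi ^+ 2 <= Int 0 1 (fun x => phi x ^+ 2) * M.
Proof.
move=> lphi; have H : I phi k ^+ 2 @[k --> F] --> L phi ^+ 2.
  by rewrite expr2; under eq_fun do rewrite expr2; apply: cvgM; exact: L_cvg.
exact: (ler_cvg_to H (cvg_cst _) (I_sqr lphi)).
Qed.

Let L_lin phi psi : l2 phi -> l2 psi -> L (fun x => phi x - psi x) = L phi - L psi.
Proof.
move=> l1 l2_; apply: (cvg_lim (@Rhausdorff R)).
rewrite [X in X @ _](_ : _ = fun k => I phi k - I psi k); first by apply: cvgB; exact: L_cvg.
apply/funext => k; rewrite /I -IntB; [|exact: l2_mul|exact: l2_mul].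
by apply: eq_Int => x _; ring.
Qed.

Let L_sum n (phi : nat -> R -> R) : (forall i, l2 (phi i)) ->
  L (fun x => \sum_(0 <= i < n) phi i x) = \sum_(0 <= i < n) L (phi i).
Proof.
move=> lphi; apply: (cvg_lim (@Rhausdorff R)).
rewrite [X in X @ _](_ : _ = fun k => \sum_(0 <= i < n) I (phi i) k).
  by apply: cvg_sum_filter => i; exact: L_cvg.
apply/funext => k; elim: n => [|n IH].
  rewrite big_geq// /I (@eq_Int _ _ _ _ (fun=> 0)) ?Int_cst// ?mul0r// => x _.
  by rewrite big_geq// mul0r.
rewrite big_nat_recr//= -IH /I -IntD; [| |exact: l2_mul].
  by apply: eq_Int => x _; rewrite big_nat_recr//= mulrDl.
by apply: l2_mul => //; exact: l2_sum.
Qed.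

(* Its density with respect to the Lebesgue measure is the weak limit of g along the
   ultrafilter F. *)
Definition weak_charge (A : set (measurableTypeR R)) : \bar R :=
  (lim (Int 0 1 (fun x => \1_A x * g k x) @[k --> F]))%:E.

Let nuE A : weak_charge A = (L \1_A)%:E. Proof. by []. Qed.

Let nu0 : weak_charge set0 = 0%E.
Proof.
rewrite nuE; congr (_%:E).
have /L_sqr : l2 (\1_set0 : R -> R) by exact: indic_l2.
rewrite (@eq_Int _ _ _ _ (fun=> 0)); last by move=> x _; rewrite indic0 expr0n.
rewrite Int_cst// !mul0r => H; apply/eqP; rewrite -sqrf_eq0.
by rewrite eq_le H sqr_ge0.
Qed.

Let nu_fin A : measurable A -> weak_charge A \is a fin_num.
Proof. by []. Qed.

(** [psi n] is the indicator of the part of the union left over after n sets. The square of its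
    limit [L (psi n)] is at most M times its measure in [0, 1], which tends to 0 by dominated
    convergence. *)
Let nu_sigma : semi_sigma_additive weak_charge.
Proof.
move=> A mA tA mUA.
rewrite nuE (_ : (fun n => _) = EFin \o (fun n => \sum_(0 <= i < n) L \1_(A i))); last first.
  by apply/funext => n /=; rewrite sumEFin.
apply: cvg_EFin; first exact: nearW.
have lA i := indic_l2 (mA i); have lU := indic_l2 mUA.
pose psi n x := \1_(\bigcup_i A i) x - \sum_(0 <= i < n) \1_(A i) x : R.
have lpsi n : l2 (psi n) by apply: l2B => //; exact: l2_sum.
have psiE n : L (psi n) = L \1_(\bigcup_i A i) - \sum_(0 <= i < n) L \1_(A i).
  by rewrite L_lin ?L_sum//; exact: l2_sum.
have psi_in n x j : A j x -> psi n x = 1 - (j < n)%:R.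
  move=> Aj; rewrite /psi indicE mem_set; last by exists j.
  congr (_ - _); elim: n => [|n IH]; first by rewrite big_geq.
  rewrite big_nat_recr//= IH indicE; have [e|nj] := eqVneq j n.
    by rewrite e ltnn ltnSn; move: Aj; rewrite e => /mem_set ->; rewrite add0r.
  rewrite memNset ?addr0.
    by rewrite ltnS [in RHS]leq_eqVlt (negbTE nj).
  move=> An; suff e : j = n by rewrite e eqxx in nj.
    by apply: (tA j n Logic.I Logic.I); exists x.
have psi_out n x : (forall j, ~ A j x) -> psi n x = 0.
  move=> nA; rewrite /psi indicE memNset ?sub0r; last by move=> [j _ /nA].
  by rewrite big1 ?oppr0// => j _; rewrite indicE memNset.
have H : Int 0 1 (fun x => psi n x ^+ 2) @[n --> \oo] --> Int 0 1 (fun=> (0 : R)).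
  apply: (@Int_cvg_dominated _ 0 1 _ _ (fun=> 1)).
  - by move=> n; apply: measurable_funX; exact: l2_meas.
  - exact: measurable_cst.
  - exact: locint_cst.
  - move=> n x; have [[j Aj]|/forallNP nA] := pselect (exists j, A j x).
      by rewrite (psi_in n x j Aj); case: (j < n)%N; rewrite ?subrr ?subr0 ?expr0n ?expr1n ?normr0 ?normr1.
    by rewrite psi_out// expr0n normr0.
  move=> x; have [[j Aj]|/forallNP nA] := pselect (exists j, A j x); apply: cvg_near_cst; last first.
    by apply: nearW => n; rewrite psi_out// expr0n.
  near=> n; rewrite (psi_in n x j Aj).
  have -> : (j < n)%N by near: n; exists j.+1.
  by rewrite subrr expr0n.
rewrite Int_cst// mul0r in H.
have H2 : L (psi n) ^+ 2 @[n --> \oo] --> (0 : R).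
  apply: (@squeeze_cvgr _ _ _ _ (fun=> 0) (fun n => Int 0 1 (fun x => psi n x ^+ 2) * M)).
  - by apply: nearW => n; rewrite sqr_ge0 L_sqr.
  - exact: cvg_cst.
  - rewrite -[X in _ --> X](mul0r M); exact: cvgM H (cvg_cst M).
have H3 : L (psi n) @[n --> \oo] --> (0 : R).
  apply/cvgrPdist_lt => e e0; have e2 : 0 < e ^+ 2 by rewrite exprn_gt0.
  have /cvgrPdist_lt/(_ _ e2) := H2; apply: filterS => n.
  by rewrite !sub0r !normrN normrX ltr_pXn2r ?nnegrE// ltW.
rewrite (_ : (fun n => _) = fun n => L \1_(\bigcup_i A i) - L (psi n)); last first.
  by apply/funext => n; rewrite psiE; ring.
by rewrite -[X in _ --> X]subr0; apply: cvgB => //; exact: cvg_cst.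
Unshelve. all: by end_near. Qed.

HB.instance Definition _ := isCharge.Build _ _ _ weak_charge nu0 nu_fin nu_sigma.

Let nu_dom : weak_charge `<< mu.
Proof.
move=> N N0 A mA AN; rewrite nuE; congr (_%:E).
have lA := indic_l2 mA; have := L_sqr lA.
have -> : Int 0 1 (fun x => \1_A x ^+ 2) = 0 :> R.
  rewrite (@eq_Int _ _ _ _ \1_A); last by move=> x _; exact: indic_sqr.
  rewrite /Int /Rintegral integral_indic//.
  transitivity (fine (0 : \bar R)%E) => //; congr fine; apply: N0; first by apply: measurableI.
  by apply: subset_trans AN => x [].
rewrite mul0r => H; apply/eqP; rewrite -sqrf_eq0.
by rewrite eq_le H sqr_ge0.
Qed.

Let f : R -> R := (fine \o Radon_Nikodym weak_charge mu) \_ `[0, 1]%classic.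

Let f_int : mu.-integrable setT (EFin \o f).
Proof.
have Hi := Radon_Nikodym_integrable nu_dom.
have H : mu.-integrable (`[0, 1]%classic : set (measurableTypeR R)) (Radon_Nikodym weak_charge mu).
  by apply: (integrableS _ _ _ Hi).
have -> : EFin \o f = (Radon_Nikodym weak_charge mu) \_ `[0, 1]%classic.
  apply/funext => x; rewrite /f /= !patchE; case: ifP => // _ /=.
  by rewrite fineK// Radon_Nikodym_fin_num.
by apply/(integrable_mkcond _ _).1.
Qed.

Let lf : locint f.
Proof. by move=> a b; apply: integrableS f_int. Qed.

Let L_indic A : measurable A -> A `<=` (`[0, 1]%classic : set (measurableTypeR R)) -> L \1_A = Int 0 1 (fun x => \1_A x * f x).
Proof.
move=> mA A01.
have E : (L \1_A)%:E = (\int[mu]_(x in A) Radon_Nikodym weak_charge mu x)%E := Radon_Nikodym_integral nu_dom mA.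
rewrite -[L _]/(fine (L \1_A)%:E) E /Int /Rintegral; congr fine.
transitivity (\int[mu]_(x in A) (f x)%:E)%E.
  apply: eq_integral => x /set_mem Ax; rewrite /f patchE mem_set; last exact: A01.
  by rewrite /= fineK// Radon_Nikodym_fin_num.
rewrite [LHS]integral_mkcond [RHS]integral_mkcond; congr (integral _ _ _).
apply/funext => x; rewrite !patchE indicE; have [Ax|nAx] := boolP (x \in A).
  by rewrite mem_set ?mul1r//; apply: A01; exact: set_mem Ax.
by rewrite mul0r; case: ifP.
Qed.

Let mf : measurable_fun [set: measurableTypeR R] f.
Proof. by have /measurable_int/measurable_EFinP := f_int. Qed.

Section level.
Variable m : nat.
Hypothesis m0 : (0 < m)%N.

Let q i : R := i%:R / m%:R - m%:R.
Let A i : set (measurableTypeR R) := (f @^-1` `[q i, q i.+1[%classic) `&` `[0, 1]%classic.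

Let mA i : measurable (A i).
Proof. by apply: measurableI => //; rewrite -[X in measurable X]setTI; exact: mf. Qed.

Let qS i : q i.+1 = q i + m%:R^-1.
Proof. by rewrite /q -natr1 mulrDl mul1r addrAC. Qed.

Let q_le i j : (i <= j)%N -> q i <= q j.
Proof. by move=> ij; rewrite lerD2r ler_wpM2r ?invr_ge0// ler_nat. Qed.

Let sumA n x : 0 <= x <= 1 -> \sum_(0 <= i < n) (\1_(A i) x : R) = (q 0 <= f x < q n)%R%:R.
Proof.
move=> x01; elim: n => [|n IH].
  by rewrite big_geq//; case: leP => //= H; rewrite ltNge H.
have x_in : x \in (`[0, 1]%classic : set (measurableTypeR R)) by rewrite mem_set//= in_itv.
rewrite big_nat_recr//= IH indicE /A in_setI x_in andbT.
have -> : (x \in f @^-1` `[q n, q n.+1[%classic) = (q n <= f x < q n.+1).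
  by apply/idP/idP => [/set_mem/=|H]; [rewrite in_itv|apply/mem_set; rewrite /= in_itv].
have := q_le (leq0n n); have := q_le (leqnSn n).
case: (leP (q n) (f x)) => H1 h1 h2; case: (ltP (f x) (q n.+1)) => H2 /=;
  rewrite ?andbT ?andbF ?addr0//.
- by rewrite (le_trans h2 H1) add0r.
- by have := lt_le_trans H1 h1; rewrite ltNge H2.
Qed.

Let lA i : l2 (\1_(A i) : R -> R). Proof. exact: indic_l2. Qed.

Let lAf i : locint (fun x => \1_(A i) x * f x).
Proof.
apply: (@locint_le _ _ (fun x => `|f x|)); [|exact: locint_norm|].
  by apply: measurable_funM => //; exact: measurable_indic.
by move=> x; rewrite normrM indicE; case: (_ \in _); rewrite ?normr1 ?mul1r ?normr0 ?mul0r.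
Qed.

Let K := \sum_(0 <= i < (2 * (m * m))%N) (2 * q i * L \1_(A i) - q i ^+ 2 * Int 0 1 (\1_(A i))).

Let K_le : K <= M.
Proof.
pose Kk k := \sum_(0 <= i < (2 * (m * m))%N) (2 * q i * I \1_(A i) k - q i ^+ 2 * Int 0 1 (\1_(A i))).
have H : Kk k @[k --> F] --> K.
  apply: cvg_sum_filter => i; apply: cvgB; last exact: cvg_cst.
  by apply: cvgMr; exact: L_cvg.
apply: (ler_cvg_to H (cvg_cst M)); apply: filterS gM => k; apply: le_trans.
have KkE : Kk k = Int 0 1 (fun x => \sum_(0 <= i < (2 * (m * m))%N) \1_(A i) x * (2 * q i * g k x - q i ^+ 2)).
  rewrite /Kk; elim: (2 * (m * m))%N => [|n IH].
    by rewrite big_geq// (@eq_Int _ _ _ _ (fun=> 0)) ?Int_cst ?mul0r// => x _; rewrite big_geq.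
  have l1 i : l2 (fun x => \1_(A i) x * (2 * q i * g k x - q i ^+ 2)).
    apply: (@l2_bounded_mul _ _ _ 1).
    - by apply: l2B; [exact: l2Z|exact: l2_cst].
    - exact: measurable_indic.
    - by move=> x; rewrite indicE; case: (_ \in _); rewrite ?normr1 ?normr0.
  rewrite big_nat_recr//= IH (@eq_Int _ _ _ (fun x => \sum_(0 <= i < n.+1) \1_(A i) x * (2 * q i * g k x - q i ^+ 2))
    (fun x => \sum_(0 <= i < n) \1_(A i) x * (2 * q i * g k x - q i ^+ 2) + \1_(A n) x * (2 * q n * g k x - q n ^+ 2))).
    rewrite IntD; [|by apply: l2_locint; exact: l2_sum|exact: l2_locint].
    congr (_ + _); rewrite /I -!IntZ; [|exact: l2_locint|exact: l2_mul].
    rewrite -IntB; [|by apply: locintZ; exact: l2_mul|by apply: locintZ; exact: l2_locint].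
    by apply: eq_Int => x _; ring.
  by move=> x _; rewrite big_nat_recr.
rewrite KkE; apply: Int_le; [|exact: (lg k).2|].
  apply: l2_locint; apply: l2_sum => i; apply: (@l2_bounded_mul _ _ _ 1).
  - by apply: l2B; [exact: l2Z|exact: l2_cst].
  - exact: measurable_indic.
  - by move=> x; rewrite indicE; case: (_ \in _); rewrite ?normr1 ?normr0.
move=> x x01; apply: (@le_trans _ _ (\sum_(0 <= i < (2 * (m * m))%N) \1_(A i) x * g k x ^+ 2)).
  apply: ler_sum => i _; apply: ler_wpM2l; first by rewrite indicE.
  by rewrite -subr_ge0; apply: le_trans (sqr_ge0 (g k x - q i)) _; rewrite le_eqVlt; apply/orP; left; apply/eqP; ring.
by rewrite -mulr_suml sumA//; case: (_ && _); rewrite ?mul1r// mul0r sqr_ge0.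
Qed.

Let q_top : q (2 * (m * m)) = m%:R.
Proof.
have m1 : m%:R != 0 :> R by rewrite pnatr_eq0 -lt0n.
by rewrite /q !natrM; field.
Qed.

(* Discretize the values of f with step 1 / m and expand (g k - q i)^2 >= 0 on the level set
   A i. *)
Lemma weak_limit_level :
  Int 0 1 (fun x => (- m%:R <= f x < m%:R)%R%:R * f x ^+ 2) <= M + (m%:R ^+ 2)^-1.
Proof.
have m1 : 0 < m%:R :> R by rewrite ltr0n.
have q0E : q 0 = - m%:R by rewrite /q mul0r sub0r.
pose N := (2 * (m * m))%N.
have l1 i : locint (fun x => \1_(A i) x * (2 * q i * f x - q i ^+ 2 + (m%:R ^+ 2)^-1)).
  apply: (@eq_locint _ (fun x => 2 * q i * (\1_(A i) x * f x) + (- q i ^+ 2 + (m%:R ^+ 2)^-1) * \1_(A i) x)).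
    by move=> x; ring.
  by apply: locintD; apply: locintZ => //; exact: l2_locint.
have ls n : locint (fun x => \sum_(0 <= i < n) \1_(A i) x * (2 * q i * f x - q i ^+ 2 + (m%:R ^+ 2)^-1)).
  elim: n => [|n IH].
    by apply: eq_locint (locint_cst 0) => x; rewrite big_geq.
  by apply: eq_locint (locintD IH (l1 n)) => x; rewrite big_nat_recr.
have KE n : Int 0 1 (fun x => \sum_(0 <= i < n) \1_(A i) x * (2 * q i * f x - q i ^+ 2 + (m%:R ^+ 2)^-1)) =
  \sum_(0 <= i < n) (2 * q i * L \1_(A i) - q i ^+ 2 * Int 0 1 (\1_(A i))) +
  (m%:R ^+ 2)^-1 * Int 0 1 (fun x => \sum_(0 <= i < n) \1_(A i) x).
  elim: n => [|n IH].
    have z (h : R -> R) : (forall x, h x = 0) -> Int 0 1 h = 0.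
      by move=> h0; rewrite (@eq_Int _ _ _ _ (fun=> 0))// Int_cst// mul0r.
    by rewrite big_geq// !z ?mulr0 ?addr0// => x; rewrite big_geq.
  rewrite (@eq_Int _ _ _ _ _ (fun x _ => big_nat_recr _ _ _ (leq0n n))) /= IntD// IH.
  rewrite (@eq_Int _ _ _ (fun x => \sum_(0 <= i < n.+1) \1_(A i) x) _ (fun x _ => big_nat_recr _ _ _ (leq0n n))) /=.
  rewrite IntD; [|by apply: l2_locint; exact: l2_sum|exact: l2_locint].
  rewrite big_nat_recr//=.
  have -> : Int 0 1 (fun x => \1_(A n) x * (2 * q n * f x - q n ^+ 2 + (m%:R ^+ 2)^-1)) =
    2 * q n * L \1_(A n) + (- q n ^+ 2 + (m%:R ^+ 2)^-1) * Int 0 1 (\1_(A n)).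
    rewrite L_indic//; last by move=> x [].
    rewrite -!IntZ//; last exact: l2_locint.
    rewrite -IntD; [|exact: locintZ|by apply: locintZ; exact: l2_locint].
    by apply: eq_Int => x _; ring.
  by ring.
apply: (@le_trans _ _ (K + (m%:R ^+ 2)^-1 * Int 0 1 (fun x => \sum_(0 <= i < N) \1_(A i) x))); last first.
  apply: lerD => //; apply: ler_piMr; first by rewrite invr_ge0 sqr_ge0.
  apply: (@le_trans _ _ (Int 0 1 (fun=> (1 : R)))); last by rewrite Int_cst// subr0 mulr1.
  apply: Int_le; [by apply: l2_locint; exact: l2_sum|exact: locint_cst|].
  by move=> x x01; rewrite sumA//; case: (_ && _).
rewrite -KE; apply: Int_le => //.
  apply: (@locint_bounded _ _ (m%:R ^+ 2)).
    apply: measurable_funM; last exact: measurable_funX.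
    rewrite (_ : (fun x => _) = \1_(f @^-1` `[- m%:R, m%:R[%classic)).
      by apply: measurable_indic; rewrite -[X in measurable X]setTI; exact: mf.
    apply/funext => x; rewrite indicE; congr (_%:R); congr nat_of_bool.
    by apply/idP/idP => [H|/set_mem/=]; [apply/mem_set; rewrite /= in_itv|rewrite in_itv].
  move=> x; case: (boolP (_ && _)) => [/andP[h1 h2]|_]; last by rewrite mul0r normr0 sqr_ge0.
  rewrite mul1r ger0_norm ?sqr_ge0// -[leLHS]real_normK ?num_real//.
  by rewrite lerXn2r ?nnegrE ?ler0n// ler_norml h1 ltW.
move=> x x01; have := sumA N x01; rewrite q0E q_top => <-; rewrite mulr_suml.
apply: ler_sum => i _; rewrite indicE; have [/set_mem[/= + _]|_] := boolP (x \in A i); last by rewrite !mul0r.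
rewrite in_itv/= qS => /andP[h1 h2]; rewrite !mul1r -subr_ge0.
(* On [A i] one has f^2 = 2 q f - q^2 + (f - q)^2 with q = [q i], and the last square is at most
   1/m^2. *)
have h3 : `|f x - q i| <= m%:R^-1 by rewrite ger0_norm ?subr_ge0//; move: h2; lra.
have : (f x - q i) ^+ 2 <= (m%:R ^+ 2)^-1.
  rewrite -exprVn -[leLHS]real_normK ?num_real// lerXn2r ?nnegrE// ?invr_ge0 ?ler0n//.
by move=> h4; apply: le_trans (_ : (m%:R ^+ 2)^-1 - (f x - q i) ^+ 2 <= _); [rewrite subr_ge0|
  rewrite le_eqVlt; apply/orP; left; apply/eqP; ring].
Qed.

End level.

Let mf2 : measurable_fun [set: measurableTypeR R] (fun x => f x ^+ 2).
Proof. exact: measurable_funX. Qed.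

(** The Radon-Nikodym density is a priori only integrable. The bound is obtained on the sets where
    -m <= f < m and passes to the limit by monotone convergence. *)
Let f_sqr : (\int[mu]_(x in `[0%R, 1%R]%classic) (f x ^+ 2)%:E <= M%:E)%E.
Proof.
pose h n x : \bar R := ((- n.+1%:R <= f x < n.+1%:R)%R%:R * f x ^+ 2)%:E.
have mh n : measurable_fun [set: measurableTypeR R] (fun x => (- n.+1%:R <= f x < n.+1%:R)%R%:R * f x ^+ 2 : R).
  apply: measurable_funM => //.
  rewrite (_ : (fun x => _) = \1_(f @^-1` `[- n.+1%:R, n.+1%:R[%classic)).
    by apply: measurable_indic; rewrite -[X in measurable X]setTI; exact: mf.
  apply/funext => x; rewrite indicE; congr (_%:R); congr nat_of_bool.
  by apply/idP/idP => [H|/set_mem/=]; [apply/mem_set; rewrite /= in_itv|rewrite in_itv].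
have hlim x : limn (h ^~ x) = (f x ^+ 2)%:E.
  apply: cvg_lim => //; apply: cvg_near_cst; near=> n; rewrite /h.
  have : `|f x| < n.+1%:R.
    near: n; exists (Num.truncn `|f x|) => // n /= nx.
    have /andP[_ h2] := truncn_itv (normr_ge0 (f x)).
    by apply: (lt_le_trans h2); rewrite ler_nat ltnS.
  by rewrite ltr_norml => /andP[/ltW -> ->]; rewrite mul1r.
have -> : (\int[mu]_(x in `[0%R, 1%R]%classic) (f x ^+ 2)%:E =
   \int[mu]_(x in `[0%R, 1%R]%classic) (fun x => limn (h ^~ x)) x)%E.
  by apply: eq_integral => x _; rewrite hlim.
rewrite monotone_convergence//.
- apply/lee_addgt0Pr => e e0; apply: lime_le.
    apply: ereal_nondecreasing_is_cvgn => a b ab; apply: ge0_le_integral => //.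
    + by move=> x _; rewrite lee_fin mulr_ge0 ?sqr_ge0.
    + by apply/measurable_EFinP; apply: measurable_funTS; exact: mh.
    + by apply/measurable_EFinP; apply: measurable_funTS; exact: mh.
    + move=> x _; rewrite lee_fin; apply: ler_wpM2r; first exact: sqr_ge0.
      rewrite ler_nat; case: (boolP (- a.+1%:R <= f x < a.+1%:R)) => // /andP[h1 h2].
      have ab' : a.+1%:R <= b.+1%:R :> R by rewrite ler_nat.
      by rewrite (le_trans _ h1) ?lerN2//= (lt_le_trans h2).
  near=> n; have := @weak_limit_level n.+1 isT.
  rewrite /Int /Rintegral => H.
  have fin : (\int[mu]_(x in `[0%R, 1%R]%classic) h n x)%E \is a fin_num.
    apply: integrable_fin_num => //.
    apply: (@locint_bounded _ _ (n.+1%:R ^+ 2)) => //.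
    move=> x; case: (boolP (_ && _)) => [/andP[h1 h2]|_]; last by rewrite mul0r normr0 sqr_ge0.
    rewrite mul1r ger0_norm ?sqr_ge0// -[leLHS]real_normK ?num_real//.
    by rewrite lerXn2r ?nnegrE ?ler0n// ler_norml h1 ltW.
  rewrite -(fineK fin) -EFinD lee_fin; apply: (le_trans H); rewrite lerD2l.
  have : n.+1%:R^-1 < e by near: n; exact: near_infty_natSinv_lt (PosNum e0).
  move=> /ltW; apply: le_trans; rewrite lef_pV2 ?posrE ?exprn_gt0 ?ltr0n//.
  by rewrite expr2 ler_peMl// ler1n.
- by move=> n; apply/measurable_EFinP; apply: measurable_funTS; exact: mh.
- by move=> n x _; rewrite lee_fin mulr_ge0 ?sqr_ge0.
- move=> x _ a b ab; rewrite lee_fin; apply: ler_wpM2r; first exact: sqr_ge0.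
  rewrite ler_nat; case: (boolP (- a.+1%:R <= f x < a.+1%:R)) => // /andP[h1 h2].
  have ab' : a.+1%:R <= b.+1%:R :> R by rewrite ler_nat.
  by rewrite (le_trans _ h1) ?lerN2//= (lt_le_trans h2).
Unshelve. all: by end_near. Qed.

Let f_l2 : l2 f.
Proof.
split=> // a b; apply: (@integrableS _ _ _ mu setT) => //.
have -> : EFin \o (fun x => f x ^+ 2) = (fun x => (f x ^+ 2)%:E) \_ `[0, 1]%classic.
  apply/funext => x; rewrite /= [RHS]patchE; case: ifP => // nx.
  by rewrite /f patchE nx expr0n.
apply/(integrable_mkcond _ _).1 => //; apply/integrableP; split.
  by apply/measurable_EFinP; exact: measurable_funTS.
under eq_integral do rewrite /= ger0_norm ?sqr_ge0//.
exact: le_lt_trans f_sqr (ltry _).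
Qed.

Lemma weak_limit : exists h, [/\ l2 h, Int 0 1 (fun x => h x ^+ 2) <= M &
  forall x y, 0 <= x -> x <= y -> y <= 1 -> Int x y (g k) @[k --> F] --> Int x y h].
Proof.
exists f; split; first exact: f_l2.
  rewrite -lee_fin /Int /Rintegral fineK; first exact: f_sqr.
  by apply: integrable_fin_num => //; exact: f_l2.2.
move=> x y x0 xy y1.
have mxy : measurable (`[x, y]%classic : set (measurableTypeR R)) by [].
have sub : `[x, y]%classic `<=` (`[0, 1]%classic : set (measurableTypeR R)).
  by move=> t /=; rewrite !in_itv/= => /andP[h1 h2]; rewrite (le_trans x0 h1) (le_trans h2 y1).
have E h : Int 0 1 (fun t => \1_(`[x, y]%classic) t * h t) = Int x y h.
  rewrite /Int /Rintegral; congr fine; rewrite [LHS]integral_mkcond [RHS]integral_mkcond; congr (integral _ _ _).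
  apply/funext => t; rewrite !patchE indicE; have [txy|ntxy] := boolP (t \in `[x, y]%classic).
    by rewrite mem_set ?mul1r//; apply: sub; exact: set_mem txy.
  by rewrite mul0r; case: ifP.
have := L_cvg (indic_l2 mxy); rewrite L_indic// E.
by rewrite (_ : I _ = fun k => Int x y (g k))//; apply/funext => k; rewrite /I E.
Qed.

End charge.
End weak_limit.

(** * Limits of ramps *)

Section compactness.
Context {R : realType}.
Notation mu := (@lebesgue_measure R).
Implicit Types (a b x y t : R).

Lemma near_forall_lt (T : Type) (F : set_system T) n (P : nat -> T -> Prop) : Filter F ->
  (forall i, (i < n)%N -> \forall k \near F, P i k) ->
  \forall k \near F, forall i, (i < n)%N -> P i k.
Proof.
move=> FF; elim: n => [|n IH] H; first exact: nearW.
have H1 := IH (fun i im => H i (ltnW im)).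
apply: filterS2 H1 (H n (ltnSn n)) => k h1 h2 i.
by rewrite ltnS leq_eqVlt => /predU1P[->//|]; exact: h1.
Qed.

(** A three-epsilon argument on a grid of step 1/n, fine enough for the common Hoelder modulus of
    exponent 1/2. *)
Lemma equicontinuous_uniform (F : set_system nat) (h : nat -> R -> R) (h0 : R -> R) (C : R) :
  ProperFilter F -> 0 <= C ->
  (\forall k \near F, forall x y, 0 <= x -> x <= y -> y <= 1 -> (h k y - h k x) ^+ 2 <= (y - x) * C) ->
  (forall x y, 0 <= x -> x <= y -> y <= 1 -> (h0 y - h0 x) ^+ 2 <= (y - x) * C) ->
  (forall x, 0 <= x <= 1 -> h k x @[k --> F] --> h0 x) ->
  forall e : R, 0 < e -> \forall k \near F, forall x, 0 <= x <= 1 -> `|h k x - h0 x| <= e.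
Proof.
move=> PF C0 Hh H0 Hcv e e0.
pose e3 := e / 3; have e30 : 0 < e3 by rewrite divr_gt0.
pose n := (Num.truncn (C / e3 ^+ 2)).+1.
have n0 : 0 < n%:R :> R by rewrite ltr0n.
have Cn : n%:R^-1 * C <= e3 ^+ 2.
  have H : 0 <= C / e3 ^+ 2 by rewrite divr_ge0// sqr_ge0.
  have /andP[_ /ltW] := truncn_itv H; rewrite -/n ler_pdivrMr ?exprn_gt0// => H1.
  by rewrite mulrC ler_pdivrMr// mulrC.
have Hn : \forall k \near F, forall i, (i < n.+1)%N -> `|h k (i%:R / n%:R) - h0 (i%:R / n%:R)| <= e3.
  apply: near_forall_lt => i; rewrite ltnS => im.
  have i01 : 0 <= (i%:R / n%:R : R) <= 1.
    by rewrite divr_ge0//= ler_pdivrMr// mul1r ler_nat.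
  have /cvgrPdist_le/(_ e3 e30) := Hcv _ i01; apply: filterS => k; by rewrite distrC.
apply: filterS2 Hn Hh => k H1 H2 x /andP[x0 x1].
pose i := Num.truncn (n%:R * x).
have /andP[i1 i2] := truncn_itv (mulr_ge0 (ltW n0) x0).
have ix : i%:R / n%:R <= x by rewrite ler_pdivrMr// mulrC.
have xi : x - i%:R / n%:R <= n%:R^-1.
  by rewrite lerBlDl -[X in _ + X]mul1r -mulrDl natr1 ler_pdivlMr// mulrC ltW.
have iN : (i < n.+1)%N.
  by rewrite ltnS -(ler_nat R) (le_trans i1)// ler_piMr// ltW.
have i0 : 0 <= i%:R / n%:R :> R by rewrite divr_ge0.
have small (f : R -> R) : (f x - f (i%:R / n%:R)) ^+ 2 <= (x - i%:R / n%:R) * C ->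
    `|f x - f (i%:R / n%:R)| <= e3.
  move=> H; have : `|f x - f (i%:R / n%:R)| ^+ 2 <= e3 ^+ 2.
    rewrite real_normK ?num_real//; apply: (le_trans H); apply: le_trans Cn.
    exact: ler_wpM2r.
  by rewrite ler_sqr ?nnegrE// ltW.
have a1 := small (h k) (H2 _ _ i0 ix x1).
have a2 := small h0 (H0 _ _ i0 ix x1).
have a3 := H1 i iN.
rewrite (_ : h k x - h0 x = (h k x - h k (i%:R / n%:R)) + (h k (i%:R / n%:R) - h0 (i%:R / n%:R)) -
  (h0 x - h0 (i%:R / n%:R))); last by ring.
apply: (le_trans (ler_normB _ _)); apply: (le_trans (lerD (ler_normD _ _) (lexx _))).
have -> : e = e3 + e3 + e3 by rewrite /e3; field.
by apply: lerD => //; apply: lerD.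
Qed.

Lemma double_primitive_uniform (F : set_system nat) (g : nat -> R -> R) (h : R -> R) (M : R) :
  ProperFilter F -> (forall k, l2 (g k)) -> l2 h ->
  (\forall k \near F, Int 0 1 (fun x => g k x ^+ 2) <= M) -> Int 0 1 (fun x => h x ^+ 2) <= M ->
  (forall x y, 0 <= x -> x <= y -> y <= 1 -> Int x y (g k) @[k --> F] --> Int x y h) ->
  forall e : R, 0 < e -> \forall k \near F, forall x, 0 <= x <= 1 ->
    `|SI 0 (SI 0 (g k)) x - SI 0 (SI 0 h) x| <= e.
Proof.
move=> PF lg lh gM hM cv e e0.
have M0 : 0 <= M by apply: le_trans hM; apply: Int_ge0 => x _; exact: sqr_ge0.
have osc f : l2 f -> Int 0 1 (fun x => f x ^+ 2) <= M ->
    forall x y, 0 <= x -> x <= y -> y <= 1 -> (SI 0 f y - SI 0 f x) ^+ 2 <= (y - x) * M.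
  move=> lf fM x y x0 xy y1.
  have := primitive_sqr lf (@SI_primitive R 0 0 1 f (l2_locint lf)) x0 xy y1 => /le_trans; apply.
  apply: ler_wpM2l; first by rewrite subr_ge0.
  by apply: le_trans fM; apply: Int_sub => //; [exact: lf.2|move=> t; exact: sqr_ge0].
have H : \forall k \near F, forall x, 0 <= x <= 1 -> `|SI 0 (g k) x - SI 0 h x| <= e.
  apply: (@equicontinuous_uniform F (fun k => SI 0 (g k)) (SI 0 h) M PF M0 _ (osc h lh hM)) => //.
    by apply: filterS gM => k Hk; exact: osc.
  move=> x /andP[x0 x1]; rewrite SIE//.
  rewrite (_ : (fun k => SI 0 (g k) x) = fun k => Int 0 x (g k)); first exact: cv.
  by apply/funext => k; rewrite SIE.
apply: filterS H => k H x /andP[x0 x1].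
have l1 := SI_l2 0 (lg k); have l2_ := SI_l2 0 lh.
rewrite !SIE// -IntB; [|exact: l2_locint|exact: l2_locint].
apply: (@le_trans _ _ (e * (x - 0))).
  apply: Int_norm_le => //; first by apply: locintB; exact: l2_locint.
  by move=> t /andP[t0 tx]; apply: H; rewrite t0 (le_trans tx).
by rewrite subr0; apply: ler_piMr => //; exact: ltW.
Qed.

Lemma Int_affine (A B a b : R) : a <= b ->
  Int a b (fun t => A + B * t) = (b - a) * (A + B * ((a + b) / 2)).
Proof.
move=> ab; have D x : is_derive x (1 : R) (fun t => A * t + B * (t ^+ 2 / 2)) (A + B * x).
  by apply: is_derive_eq; rewrite /GRing.scale /=; field.
have C : continuous (fun t : R => A + B * t).
  by move=> x; apply: cvgD; [exact: cvg_cst|apply: cvgMr; exact: cvg_id].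
by rewrite (Int_FTC2 ab C D); field.
Qed.

(** The coefficients of an affine function are linear in its integrals over the two halves of the
    interval, so L1 convergence carries over to them. *)
Lemma affine_limit (F : set_system nat) (A B : nat -> R) (f : R -> R) a b : ProperFilter F ->
  0 <= a -> a < b -> b <= 1 -> locint f ->
  Int a b (fun t => `|A k + B k * t - f t|) @[k --> F] --> (0 : R) ->
  exists A0 B0 : R, [/\ A k @[k --> F] --> A0, B k @[k --> F] --> B0 &
    Int a b (fun t => `|A0 + B0 * t - f t|) = 0].
Proof.
move=> PF a0 ab b1 lf cv.
have laff (p q : R) : locint (fun t => p + q * t) by apply: l2_locint; exact: affine_l2.
have ldiff (p q : R) : locint (fun t => `|p + q * t - f t|).
  by apply: locint_norm; apply: locintB.
have sub c d : a <= c -> c < d -> d <= b -> Int c d (fun t => A k + B k * t) @[k --> F] --> Int c d f.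
  move=> ac cd db; apply/cvgrPdist_le => e e0.
  have /cvgrPdist_le/(_ e e0) := cv; apply: filterS => k; rewrite sub0r normrN => H.
  rewrite distrC -IntB//; apply: (le_trans (Int_norm _ _ (locintB (laff _ _) lf))).
  apply: le_trans (le_trans (ler_norm _) H).
  by apply: Int_sub => //; exact: ltW.
pose m := (a + b) / 2; pose L := b - a.
have L0 : L != 0 by rewrite subr_eq0 gt_eqF.
have am : a < m by rewrite /m; move: ab; lra.
have mb : m < b by rewrite /m; move: ab; lra.
have c1 := sub a m (lexx _) am (ltW mb).
have c2 := sub m b (ltW am) mb (lexx _).
pose B0 := (Int m b f - Int a m f) * (4 / L ^+ 2).
pose A0 := Int a m f * (2 / L) - B0 * ((a + m) / 2).
have BE k : B k = (Int m b (fun t => A k + B k * t) - Int a m (fun t => A k + B k * t)) * (4 / L ^+ 2).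
  by rewrite !Int_affine ?ltW// /m /L; field.
have AE k : A k = Int a m (fun t => A k + B k * t) * (2 / L) - B k * ((a + m) / 2).
  by rewrite !Int_affine ?ltW// /m /L; field.
have cB : B k @[k --> F] --> B0.
  by rewrite (funext BE); apply: cvgMl; apply: cvgB.
have cA : A k @[k --> F] --> A0.
  by rewrite (funext AE); apply: cvgB; apply: cvgMl.
exists A0, B0; split => //; apply/eqP; rewrite eq_le; apply/andP; split; last by apply: Int_ge0.
have H : Int a b (fun t => `|A k + B k * t - f t|) + (`|A k - A0| + `|B k - B0|) @[k --> F] --> 0 + (`|A0 - A0| + `|B0 - B0|).
  apply: cvgD => //; apply: cvgD; apply: cvg_norm; apply: cvgB => //; exact: cvg_cst.
rewrite !subrr normr0 !addr0 in H.
apply: (ler_cvg_to (cvg_cst _) H); apply: nearW => k.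
have -> : `|A k - A0| + `|B k - B0| = (`|A k - A0| + `|B k - B0|) * 1 by rewrite mulr1.
apply: (@le_trans _ _ (Int a b (fun t => `|A k + B k * t - f t|) + Int a b (fun=> `|A k - A0| + `|B k - B0|))).
  rewrite -IntD//; last exact: locint_cst.
  apply: Int_le => //; first by apply: locintD => //; exact: locint_cst.
  move=> t /andP[at_ tb].
  rewrite (_ : A0 + B0 * t - f t = (A k + B k * t - f t) - ((A k - A0) + (B k - B0) * t)); last by ring.
  apply: (le_trans (ler_normB _ _)); rewrite lerD2l; apply: (le_trans (ler_normD _ _)); rewrite lerD2l.
  rewrite normrM; apply: ler_piMr => //; rewrite ger0_norm ?(le_trans a0)//; exact: le_trans b1.
rewrite lerD2l (Int_cst _ (ltW ab)); apply: ler_wpM2l; first by rewrite addr_ge0.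
by move: a0 b1; lra.
Qed.

Section limit.
Variables (F : set_system nat) (v g : nat -> R -> R) (u h : R -> R) (Y : nat -> seq (R * R)).
Variables (al be x0 x1 err : nat -> R) (N : nat).
Hypotheses (uF : UltraFilter F) (lv : forall k, l2 (v k)) (lu : l2 u) (lg : forall k, l2 (g k)) (lh : l2 h).
Hypotheses (YN : \forall k \near F, size (Y k) = N)
  (Y01 : \forall k \near F, forall p, p \in Y k -> 0 <= p.1 <= 1)
  (approx : \forall k \near F, forall t, x0 k <= t <= x1 k ->
    `|v k t - (al k + be k * t + SI 0 (SI 0 (g k)) t + ramp (Y k) t)| <= err k)
  (x0c : x0 k @[k --> F] --> (0 : R)) (x1c : x1 k @[k --> F] --> (1 : R))
  (errc : err k @[k --> F] --> (0 : R))
  (vu : Int 0 1 (fun t => (v k t - u t) ^+ 2) @[k --> F] --> (0 : R))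
  (gh : forall e : R, 0 < e -> \forall k \near F, forall x, 0 <= x <= 1 ->
    `|SI 0 (SI 0 (g k)) x - SI 0 (SI 0 h) x| <= e).

Let yk k i := (nth (0, 0) (Y k) i).1.
Let zk k i := (nth (0, 0) (Y k) i).2.

Let y_ex i : exists l : R, yk k i @[k --> F] --> l /\ 0 <= l <= 1.
Proof.
have H : \forall k \near F, 0 <= yk k i <= 1.
  apply: filterS Y01 => k Hk; rewrite /yk; case: (ltnP i (size (Y k))) => ik.
    by apply: Hk; exact: mem_nth.
  (* Indices beyond the length read the default pair, whose position 0 lies in [0, 1]. *)
  by rewrite nth_default//= lexx ler01.
have [|l Hl] := @ultra_bounded_cvg R F (yk ^~ i) 1 uF.
  by apply: filterS H => k /andP[h0 h1]; rewrite ger0_norm.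
exists l; split => //; apply/andP; split.
  by apply: (ler_cvg_to (cvg_cst _) Hl); apply: filterS H => k /andP[].
by apply: (ler_cvg_to Hl (cvg_cst _)); apply: filterS H => k /andP[].
Qed.

Let y i : R := proj1_sig (cid (y_ex i)).
Let yc i : yk k i @[k --> F] --> y i. Proof. by rewrite /y; case: cid => l []. Qed.
(** Coefficients of the affine function formed by [al + be t] and the ramps whose limit position is
    at most a. These converge, whereas the single slopes [zk] may be unbounded. *)
Let Ak a k := al k - \sum_(0 <= i < N | y i <= a) zk k i * yk k i.
Let Bk a k := be k + \sum_(0 <= i < N | y i <= a) zk k i.

(** On an interval strictly inside a gap between limit positions, every ramp is eventually either
    fully active or zero. *)
Let rampE a a' b' b : a < a' -> b' < b -> (forall i, (i < N)%N -> y i <= a \/ b <= y i) ->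
  \forall k \near F, forall t, a' <= t <= b' -> al k + be k * t + ramp (Y k) t = Ak a k + Bk a k * t.
Proof.
move=> aa bb sep.
have H : \forall k \near F, forall i, (i < N)%N -> forall t, a' <= t <= b' ->
    zk k i * Num.max 0 (t - yk k i) = if y i <= a then zk k i * t - zk k i * yk k i else 0.
  apply: near_forall_lt => i iN; case: (sep i iN) => Hi.
    have : \forall k \near F, yk k i < a'.
      by apply: (cvgr_lt (y i)); [exact: yc|exact: le_lt_trans aa].
    apply: filterS => k Hk t /andP[t1 t2]; rewrite Hi max_r; first by ring.
    by rewrite subr_ge0 (le_trans (ltW Hk)).
  have : \forall k \near F, b' < yk k i.
    by apply: (cvgr_gt (y i)); [exact: yc|exact: lt_le_trans Hi].
  apply: filterS => k Hk t /andP[t1 t2].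
  rewrite max_l ?mulr0; last by rewrite subr_le0 (le_trans t2 (ltW Hk)).
  case: leP => // H; exfalso.
  have ba : b <= a by exact: le_trans Hi H.
  have : a' <= b' by exact: le_trans t1 t2.
  by rewrite leNgt (lt_le_trans bb (le_trans ba (ltW aa))).
apply: filterS2 H YN => k H kN t tab.
rewrite /ramp (big_nth (0, 0)) kN.
rewrite (@eq_big_nat _ _ _ _ _ _ (fun i => if y i <= a then zk k i * t - zk k i * yk k i else 0)); last first.
  by move=> i /andP[_ iN]; apply: H.
by rewrite -big_mkcond /= sumrB -mulr_suml /Ak /Bk; ring.
Qed.

Let Intf a a' b' b : 0 <= a -> a < a' -> a' < b' -> b' < b -> b <= 1 ->
  (forall i, (i < N)%N -> y i <= a \/ b <= y i) ->
  Int a' b' (fun t => `|Ak a k + Bk a k * t - (u t - SI 0 (SI 0 h) t)|) @[k --> F] --> (0 : R).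
Proof.
move=> a0 aa ab bb b1 sep; apply/cvgrPdist_lt => e e0.
have e3 : 0 < e / 4 by rewrite divr_gt0.
have n1 := rampE aa bb sep; have n2 := gh e3.
have n3 : \forall k \near F, x0 k < a' by apply: (cvgr_lt 0) => //; exact: le_lt_trans aa.
have n4 : \forall k \near F, b' < x1 k by apply: (cvgr_gt 1) => //; exact: lt_le_trans bb _.
have n5 : \forall k \near F, err k < e / 4 by exact: (cvgr_lt 0).
have n6 : \forall k \near F, Int 0 1 (fun t => (v k t - u t) ^+ 2) < (e / 4) ^+ 2.
  by apply: (cvgr_lt 0) => //; rewrite exprn_gt0.
near=> k.
have m1 : forall t, a' <= t <= b' -> al k + be k * t + ramp (Y k) t = Ak a k + Bk a k * t by near: k.
have m2 : forall x, 0 <= x <= 1 -> `|SI 0 (SI 0 (g k)) x - SI 0 (SI 0 h) x| <= e / 4 by near: k.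
have m3 : x0 k < a' by near: k.
have m4 : b' < x1 k by near: k.
have m5 : err k < e / 4 by near: k.
have m6 : Int 0 1 (fun t => (v k t - u t) ^+ 2) < (e / 4) ^+ 2 by near: k.
have m7 : forall t, x0 k <= t <= x1 k ->
    `|v k t - (al k + be k * t + SI 0 (SI 0 (g k)) t + ramp (Y k) t)| <= err k by near: k.
have a'0 : 0 <= a' by exact: le_trans (ltW aa).
have b'1 : b' <= 1 by exact: le_trans (ltW bb) b1.
have lPP f : l2 f -> l2 (SI 0 (SI 0 f)) by move=> ?; do 2 apply: SI_l2.
have lD : l2 (fun t => Ak a k + Bk a k * t - (u t - SI 0 (SI 0 h) t)).
  by apply: l2B; [exact: affine_l2|apply: l2B => //; exact: lPP].
have lvu : l2 (fun t => v k t - u t) by exact: l2B.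
rewrite sub0r normrN ger0_norm; last by apply: Int_ge0.
apply: (@le_lt_trans _ _ (Int a' b' (fun t => `|v k t - u t| + (e / 4 + e / 4)))).
  apply: Int_le; [by apply: locint_norm; exact: l2_locint| |].
    by apply: locintD; [by apply: locint_norm; exact: l2_locint|exact: locint_cst].
  move=> t tab; have /andP[t1 t2] := tab; rewrite -(m1 t tab).
  have t01 : 0 <= t <= 1 by rewrite (le_trans a'0 t1) (le_trans t2 b'1).
  have E (p q r w z zz V : R) : p + q + r - (w - zz) = (V - w) - (V - (p + q + z + r)) - (z - zz) by ring.
  rewrite (E _ _ _ _ (SI 0 (SI 0 (g k)) t) _ (v k t)).
  apply: (le_trans (ler_normB _ _)); rewrite [leRHS]addrA; apply: lerD; last exact: m2.
  apply: (le_trans (ler_normB _ _)); rewrite lerD2l; apply: le_trans (ltW m5).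
  by apply: m7; rewrite (le_trans (ltW m3) t1) (le_trans t2 (ltW m4)).
rewrite IntD; [|by apply: locint_norm; exact: l2_locint|exact: locint_cst].
rewrite Int_cst ?ltW//.
have H1 : Int a' b' (fun t => `|v k t - u t|) <= e / 4.
  apply: (@le_trans _ _ (Int 0 1 (fun t => `|v k t - u t|))).
    by apply: Int_sub => //; [by apply: locint_norm; exact: l2_locint|exact: ltW].
  have := Int_norm_sqr_le ler01 lvu; rewrite subr0 mul1r => H.
  have I0 : 0 <= Int 0 1 (fun t => `|v k t - u t|) by exact: Int_ge0.
  by rewrite -ler_sqr ?nnegrE// ?(ltW e3)//; apply: (le_trans H); exact: ltW.
have H2 : (e / 4 + e / 4) * (b' - a') <= e / 4 + e / 4.
  apply: ler_piMr; first by rewrite addr_ge0 ?ltW.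
  by move: a'0 b'1; lra.
by apply: (le_lt_trans (lerD H1 H2)); move: e0; lra.
Unshelve. all: by end_near. Qed.

Let piece a b : 0 <= a -> a < b -> b <= 1 -> (forall i, (i < N)%N -> y i <= a \/ b <= y i) ->
  exists A0 B0 : R, [/\ Ak a k @[k --> F] --> A0, Bk a k @[k --> F] --> B0 &
    {ae mu, forall x, a < x < b -> u x = SI 0 (SI 0 h) x + (A0 + B0 * x)}].
Proof.
move=> a0 ab b1 sep.
have lPP : l2 (SI 0 (SI 0 h)) by do 2 apply: SI_l2.
have luP : locint (fun t => u t - SI 0 (SI 0 h) t) by apply: l2_locint; exact: l2B.
have key c d : a < c -> c < d -> d < b -> exists A0 B0 : R,
    [/\ Ak a k @[k --> F] --> A0, Bk a k @[k --> F] --> B0 &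
    Int c d (fun t => `|A0 + B0 * t - (u t - SI 0 (SI 0 h) t)|) = 0].
  move=> ac cd db; apply: (@affine_limit F (Ak a) (Bk a) (fun t => u t - SI 0 (SI 0 h) t)) => //.
  - exact: le_trans (ltW ac).
  - exact: le_trans (ltW db) b1.
  - exact: Intf a0 ac cd db b1 sep.
(* The limits of the coefficients are the same for all subintervals, so one choice serves the whole
   of []a, b[]. *)
have [||| A0 [B0 [cA cB _]]] := key (a + (b - a) / 4) (a + (b - a) / 2); try lra.
exists A0, B0; split => //.
have H : {ae mu, forall x, a < x < b -> (A0 + B0 * x - (u x - SI 0 (SI 0 h) x)) = 0}.
  have lD : l2 (fun x => A0 + B0 * x - (u x - SI 0 (SI 0 h) x)).
    by apply: l2B; [exact: affine_l2|exact: l2B].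
  apply: ae_eq0_Int => // c d ac cd db; have [A1 [B1 [cA1 cB1 E]]] := key c d ac cd db.
  have eA : A1 = A0 by apply: (cvg_unique _ cA1 cA); exact: Rhausdorff.
  have eB : B1 = B0 by apply: (cvg_unique _ cB1 cB); exact: Rhausdorff.
  by rewrite eA eB in E; have := Int_norm c d (l2_locint lD); rewrite E normr_le0 => /eqP.
apply: ae_imp H => x H xab; have := H xab => /eqP; rewrite subr_eq0 => /eqP ->; ring.
Qed.

(** Ramps that converge to an end point of [0, 1] create no node, and ramps with the same limit
    position share one. *)
Let pts := sort <=%R (undup [seq y i | i <- iota 0 N & 0 < y i < 1]).
Let s := rcons pts 1.

Let pts_in x : x \in pts -> 0 < x < 1.
Proof.
by rewrite mem_sort mem_undup => /mapP[i]; rewrite mem_filter => /andP[H _] ->.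
Qed.

Let in_pts i : (i < N)%N -> 0 < y i < 1 -> y i \in pts.
Proof.
by move=> iN H; rewrite mem_sort mem_undup; apply: map_f; rewrite mem_filter H mem_iota add0n.
Qed.

Let ps : itv_partition 0 1 s.
Proof.
split; last by rewrite last_rcons.
have st : sorted <%R pts by rewrite /pts sort_lt_sorted undup_uniq.
rewrite rcons_path; apply/andP; split.
  rewrite path_min_sorted//; apply/allP => x /pts_in/andP[]//.
by have := mem_last 0 pts; rewrite inE => /predU1P[->//|/pts_in/andP[]].
Qed.

Let sep i : (i < size s)%N -> forall j, (j < N)%N -> y j <= lft s i \/ rgt s i <= y j.
Proof.
move=> is_ j jN; case: (leP (y j) (lft s i)) => H1; first by left.
case: (leP (rgt s i) (y j)) => H2; first by right.
have yp : y j \in pts.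
  apply: in_pts => //; rewrite (le_lt_trans (lft_ge0 ps (ltnW is_)) H1).
  exact: lt_le_trans H2 (rgt_le1 ps is_).
have ys : y j \in s by rewrite mem_rcons inE yp orbT.
pose m := index (y j) s; have ms : (m < size s)%N by rewrite index_mem.
have E : y j = lft s m.+1 by rewrite lftS /rgt nth_index.
exfalso; case: (leqP m.+1 i) => H.
  have := @partition_le _ s ps m.+1 i; rewrite H (ltnW is_) -E => /(_ isT).
  by rewrite leNgt H1.
have := @partition_le _ s ps i.+1 m.+1; rewrite H ms -E lftS => /(_ isT).
by rewrite leNgt H2.
Qed.

Let AB_ex i : exists AB : R * R, (i < size s)%N ->
  [/\ Ak (lft s i) k @[k --> F] --> AB.1, Bk (lft s i) k @[k --> F] --> AB.2 &
    {ae mu, forall x, lft s i < x < rgt s i -> u x = SI 0 (SI 0 h) x + (AB.1 + AB.2 * x)}].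
Proof.
case: (ltnP i (size s)) => is_; last by exists (0, 0).
have [A0 [B0 H]] := piece (lft_ge0 ps (ltnW is_)) (piece_lt ps is_) (rgt_le1 ps is_) (sep is_).
by exists (A0, B0).
Qed.

Let AB i := proj1_sig (cid (AB_ex i)).
Let ABP i : (i < size s)%N -> [/\ Ak (lft s i) k @[k --> F] --> (AB i).1,
    Bk (lft s i) k @[k --> F] --> (AB i).2 &
    {ae mu, forall x, lft s i < x < rgt s i -> u x = SI 0 (SI 0 h) x + ((AB i).1 + (AB i).2 * x)}].
Proof. by rewrite /AB; case: cid. Qed.

Let A i := (AB i).1.
Let B i := (AB i).2.
Let cnt i := (\sum_(0 <= j < N) (y j == rgt s i))%N.

Let pts_rgt i : (i < (size s).-1)%N -> rgt s i \in pts.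
Proof.
rewrite size_rcons /= => im; rewrite /rgt nth_rcons im; exact: mem_nth.
Qed.

Let cnt_gt0 i : (i < (size s).-1)%N -> (0 < cnt i)%N.
Proof.
move=> im; have := pts_rgt im; rewrite mem_sort mem_undup => /mapP[j].
rewrite mem_filter mem_iota add0n => /andP[_ jN] E.
by rewrite /cnt big_mkord (bigD1 (Ordinal jN))//= E eqxx.
Qed.

(** The slope of a lone ramp at x is the difference of the affine slopes on both sides, hence
    converges. The jump at x is the limit of [zk * (x - yk)], a convergent factor times one that
    tends to 0. *)
Let single i : (i < (size s).-1)%N -> cnt i = 1%N -> ~~ vjump s A B i.
Proof.
move=> im c1; have is' : (i.+1 < size s)%N by rewrite -(prednK (partition_size ps)) ltnS.
have is_ := ltnW is'; set x := rgt s i.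
have [cA cB _] := ABP is_; have [cA' cB' _] := ABP is'; rewrite lftS -/x in cA' cB'.
have D k : (Ak x k + Bk x k * x) - (Ak (lft s i) k + Bk (lft s i) k * x) =
    \sum_(0 <= j < N | y j == x) zk k j * (x - yk k j).
  have E (f : nat -> R) : \sum_(0 <= j < N | y j <= x) f j =
      \sum_(0 <= j < N | y j <= lft s i) f j + \sum_(0 <= j < N | y j == x) f j.
    rewrite [LHS]big_mkcond [X in _ = X + _]big_mkcond [X in _ = _ + X]big_mkcond /= -big_split /=.
    apply: eq_big_nat => j /andP[_ jN]; have := piece_lt ps is_; rewrite -/x => lx.
    case: (sep is_ jN) => Hj.
      have jx : y j < x by exact: le_lt_trans lx.
      by rewrite (ltW jx) Hj (lt_eqF jx) addr0.
    rewrite -/x in Hj; rewrite [y j <= lft _ _]leNgt (lt_le_trans lx Hj) add0r.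
    by rewrite [y j == x]eq_le Hj andbT.
  rewrite /Ak /Bk !E.
  have -> : \sum_(0 <= j < N | y j == x) zk k j * (x - yk k j) =
      (\sum_(0 <= j < N | y j == x) zk k j) * x - \sum_(0 <= j < N | y j == x) zk k j * yk k j.
    by rewrite mulr_suml -sumrB; apply: eq_bigr => j _; ring.
  by ring.
have [j0 j0N y0] : exists2 j, (j < N)%N & y j == x.
  have := pts_rgt im; rewrite mem_sort mem_undup => /mapP[j].
  by rewrite mem_filter mem_iota add0n => /andP[_ jN] E; exists j => //; rewrite /x E.
have uniq_j (f : nat -> R) : \sum_(0 <= j < N | y j == x) f j = f j0.
  rewrite big_mkord (bigD1 (Ordinal j0N))//= big1 ?addr0// => j /andP[yj jj].
  move: c1; rewrite /cnt big_mkord (bigD1 (Ordinal j0N))//= y0 (bigD1 j)//= yj.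
  by [].
have cz : zk k j0 @[k --> F] --> B i.+1 - B i.
  rewrite (_ : (fun k => zk k j0) = fun k => Bk x k - Bk (lft s i) k); first exact: cvgB.
  apply/funext => k; rewrite -(uniq_j (zk k)) /Bk.
  rewrite [\sum_(0 <= _ < N | _ <= x) _](_ : _ = \sum_(0 <= j < N | y j <= lft s i) zk k j + \sum_(0 <= j < N | y j == x) zk k j).
    by ring.
  rewrite [LHS]big_mkcond [X in _ = X + _]big_mkcond [X in _ = _ + X]big_mkcond /= -big_split /=.
  apply: eq_big_nat => j /andP[_ jN]; have := piece_lt ps is_; rewrite -/x => lx.
  case: (sep is_ jN) => Hj.
    have jx : y j < x by exact: le_lt_trans lx.
    by rewrite (ltW jx) Hj (lt_eqF jx) addr0.
  rewrite -/x in Hj; rewrite [y j <= lft _ _]leNgt (lt_le_trans lx Hj) add0r.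
  by rewrite [y j == x]eq_le Hj andbT.
have c0 : zk k j0 * (x - yk k j0) @[k --> F] --> (B i.+1 - B i) * (x - y j0).
  by apply: cvgM => //; apply: cvgB; [exact: cvg_cst|exact: yc].
rewrite (eqP y0) subrr mulr0 in c0.
have cD : (Ak x k + Bk x k * x) - (Ak (lft s i) k + Bk (lft s i) k * x) @[k --> F] -->
    (A i.+1 + B i.+1 * x) - (A i + B i * x).
  by apply: cvgB; apply: cvgD => //; apply: cvgMl.
have cD0 : (Ak x k + Bk x k * x) - (Ak (lft s i) k + Bk (lft s i) k * x) @[k --> F] --> (0 : R).
  by rewrite (funext D); under eq_fun do rewrite uniq_j.
have /eqP : (A i.+1 + B i.+1 * x) - (A i + B i * x) = 0.
  by apply: (cvg_unique _ cD cD0); exact: Rhausdorff.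
by rewrite subr_eq0 /vjump -/x negbK eq_sym.
Qed.

Lemma ramp_limit : exists s A B, nform s u h A B /\ jump_cost s A B <= N%:R.
Proof.
exists s, A, B; split.
  by split => //; [exact: l2_L2|move=> i is_; have [] := ABP is_].
rewrite /jump_cost -natrM -natrD ler_nat big_distrr -big_split /=.
(* A node costs at most the number of ramps converging to it: a jump needs two by [single], a mere
   change of slope at least one. Each ramp converges to at most one node. *)
apply: (@leq_trans (\sum_(i < (size s).-1) cnt i)%N).
  apply: leq_sum => i _; have [c1|c1] := eqVneq (cnt i) 1%N.
    by rewrite c1 (negbTE (single (ltn_ord i) c1)) muln0 add0n; case: sjump.
  have c2 : (2 <= cnt i)%N by rewrite ltn_neqAle eq_sym c1 (cnt_gt0 (ltn_ord i)).
  by apply: leq_trans c2; case: vjump; case: sjump.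
rewrite exchange_big /=; apply: (@leq_trans (\sum_(0 <= j < N) 1)%N); last first.
  by rewrite sum_nat_const_nat subn0 muln1.
apply: leq_sum => j _.
have [i0|none] := pickP (fun i : 'I_(size s).-1 => y j == rgt s i); last first.
  by rewrite big1// => i _; rewrite none.
move=> /eqP E; rewrite (bigD1 i0)//= E eqxx big1// => i ii; apply/eqP; rewrite eqb0; apply/eqP => Ei.
have lt (k l : nat) : (k < l)%N -> (l < (size s).-1)%N -> rgt s k < rgt s l.
  move=> kl ls; rewrite -!lftS; apply: (partition_lt ps).
  by rewrite ltnS kl ltnW// -(prednK (partition_size ps)) ltnS.
move: ii; rewrite -val_eqE /=; case: (ltngtP i i0) => // ij _.
  by have := lt _ _ ij (ltn_ord i0); rewrite Ei ltxx.
by have := lt _ _ ij (ltn_ord i); rewrite Ei ltxx.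
Qed.

End limit.
End compactness.

(** * The lower bound *)

Section lower_bound.
Context {R : realType}.
Notation mu := (@lebesgue_measure R).
Implicit Types (a b x y t : R).

Lemma Lnorm2_Int (u : R -> R) : u \in L2 0 1 ->
  ('N[mu]_2%:E[EFin \o (u \_ `]0, 1[%classic)%R])%E =
  (Num.sqrt (Int 0 1 (fun x => (u \_ `]0%R, 1%R[%classic) x ^+ 2)))%:E.
Proof.
move=> uL; have lu := L2_l2 uL; rewrite unlock /Lnorm.
have -> : (\int[mu]_x `|(EFin \o (u \_ `]0%R, 1%R[%classic)) x| `^ 2)%E =
    (Int 0 1 (fun x => (u \_ `]0%R, 1%R[%classic) x ^+ 2))%:E.
  rewrite -EFin_Int ?lu.2//; last by exact: lu.2.
  rewrite [RHS]integral_mkcond; apply: eq_integral => x _; rewrite patchE.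
  have -> : `|(EFin \o u \_ `]0%R, 1%R[) x|%E = `|(u \_ `]0%R, 1%R[%classic) x|%:E by [].
  rewrite poweR_EFin powR_mulrn// real_normK ?num_real//.
  by case: ifPn => // xab; rewrite patchE (negbTE xab) expr0n.
by rewrite poweR_EFin powR12_sqrt// Int_ge0// => x _; exact: sqr_ge0.
Qed.

Lemma L2_sub_in a b (u v : R -> R) : u \in L2 a b -> v \in L2 a b -> u \- v \in L2 a b.
Proof.
move=> uL vL; have := l2_L2 a b (l2B (L2_l2 uL) (L2_l2 vL)).
have E : (u \- v) \_ `]a, b[%classic =
    (fun x => (u \_ `]a, b[%classic) x - (v \_ `]a, b[%classic) x) \_ `]a, b[%classic.
  by apply/funext => x; rewrite !patchE; case: ifP => // xab; rewrite !xab.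
by rewrite !inE /= E.
Qed.

Lemma L2_cvgP (u_ : nat -> R -> R) (u : R -> R) : (forall k, u_ k \in L2 0 1) -> u \in L2 0 1 ->
  L2_cvg u_ u <->
  Int 0 1 (fun x => ((u_ k \- u) \_ `]0%R, 1%R[%classic) x ^+ 2) @[k --> \oo] --> (0 : R).
Proof.
move=> ukL uL; pose I k := Int 0 1 (fun x => ((u_ k \- u) \_ `]0%R, 1%R[%classic) x ^+ 2).
have I0 k : 0 <= I k by apply: Int_ge0 => x _; exact: sqr_ge0.
rewrite /L2_cvg (_ : (fun k => _) = EFin \o (fun k => Num.sqrt (I k))); last first.
  by apply/funext => k; rewrite Lnorm2_Int// L2_sub_in.
rewrite -/I; split => H.
  have {}H : Num.sqrt (I k) @[k --> \oo] --> (0 : R) by exact: (fine_cvg H).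
  have H2 : Num.sqrt (I k) * Num.sqrt (I k) @[k --> \oo] --> (0 : R) * 0 by apply: cvgM.
  rewrite mulr0 in H2; suff <- : (fun k => Num.sqrt (I k) * Num.sqrt (I k)) = I by [].
  by apply/funext => k; rewrite -expr2 sqr_sqrtr.
apply: cvg_EFin; first exact: nearW.
apply/cvgrPdist_lt => e e0; have e2 : 0 < e ^+ 2 by rewrite exprn_gt0.
have /cvgrPdist_lt/(_ _ e2) := H; apply: filterS => k.
rewrite !sub0r !normrN !ger0_norm// ?sqrtr_ge0// => Hk.
have -> : e = Num.sqrt (e ^+ 2) by rewrite sqrtr_sqr gtr0_norm.
by rewrite /= ltr_sqrt.
Qed.

Lemma truncated_square_split (eps : R) (f : R -> R) x : 0 < eps ->
  let kappa := (Num.sqrt eps)^-1 in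
  truncated_square eps (f x) = (low kappa f x * f x) ^+ 2 + eps^-1 * high kappa f x.
Proof.
move=> e0 kappa; have kE : eps^-1 = kappa ^+ 2 by rewrite exprVn sqr_sqrtr// ltW.
have k0 : 0 <= kappa by rewrite invr_ge0 sqrtr_ge0.
rewrite /truncated_square /low /high; case: ifPn => H.
  rewrite mul1r mulr0 addr0 min_l// kE -[leLHS]real_normK ?num_real//.
  by rewrite lerXn2r ?nnegrE.
rewrite mul0r expr0n add0r mulr1 min_r// kE -[leRHS]real_normK ?num_real//.
by rewrite lerXn2r ?nnegrE// ltW// ltNge.
Qed.

Lemma G_chain (c eps : nat -> R) d (u : R -> R) (U : nat -> R -> R) : 0 < eps d.+3 ->
  u \in L2 0 1 -> sobolev 0 1 d.+3 u -> chain 0 1 d.+3 U -> continuous (U 2) ->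
  (forall j, (j <= d.+3)%N ->
    is_weak_derivative 0 1 j u (U j) /\ weak_derivative 0 1 j u = U j %[ae mu in `]0, 1[%classic]) ->
  let kappa := (Num.sqrt (eps d.+3))^-1 in
  G c eps d.+3 u = (Int 0 1 (fun x => (low kappa (U 2) x * U 2 x) ^+ 2) +
    (eps d.+3)^-1 * Int 0 1 (high kappa (U 2)) +
    c d.+2 * eps d.+3 ^+ d.*2.+3 * Int 0 1 (fun x => U d.+3 x ^+ 2))%:E.
Proof.
move=> e0 uL su cU k2 dU kappa; rewrite /G asboolT//.
have [w2 e2] := dU 2 isT; have [wd ed] := dU d.+3 (leqnn _).
have lhigh : locint (high kappa (U 2)) by exact: high_locint.
have llow : l2 (fun x => low kappa (U 2) x * U 2 x).
  by apply: (@l2_bounded_mul _ _ _ 1); [exact: cU.1|exact: measurable_low|exact: low_norm].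
have E x : truncated_square (eps d.+3) (U 2 x) =
    (low kappa (U 2) x * U 2 x) ^+ 2 + (eps d.+3)^-1 * high kappa (U 2) x.
  exact: truncated_square_split.
rewrite (@integral_ae_Int _ 0 1 (truncated_square (eps d.+3)) _ (U 2)).
- rewrite (integral_sqr_ae (weak_derivative_L2 wd) (cU.1 _) ed) -EFinM -EFinD.
  congr (_%:E); rewrite (_ : (2 * d.+3 - 3)%N = d.*2.+3); last by rewrite mul2n !doubleS !subSS subn0.
  congr (_ + _); rewrite -IntZ// -IntD//; [|exact: llow.2|exact: locintZ].
  by apply: eq_Int => x _; rewrite /= E.
- exact: weak_derivative_L2 w2.
- exact: cU.1.
- rewrite /truncated_square; apply: measurable_minr; last exact: measurable_cst.
  by apply: measurable_funX; exact: measurable_id.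
- apply: (@eq_locint _ (fun x => (low kappa (U 2) x * U 2 x) ^+ 2 + (eps d.+3)^-1 * high kappa (U 2) x)).
    by move=> x; rewrite /= E.
  by apply: locintD; [exact: llow.2|exact: locintZ].
- exact: e2.
Qed.

Lemma threshold_min n (P : nat -> R -> Prop) :
  (forall j, exists2 ebar : R, 0 < ebar & forall eps, 0 < eps <= ebar -> P j eps) ->
  exists2 ebar : R, 0 < ebar & forall eps, 0 < eps <= ebar -> forall j, (j <= n)%N -> P j eps.
Proof.
move=> H; elim: n => [|n [e1 e10 He1]].
  have [e1 e10 He1] := H 0%N; exists e1 => // eps He j; rewrite leqn0 => /eqP ->; exact: He1.
have [e2 e20 He2] := H n.+1; exists (Num.min e1 e2); first by rewrite lt_min e10.
move=> eps /andP[e0]; rewrite le_min => /andP[h1 h2] j.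
rewrite leq_eqVlt => /predU1P[->|]; first by apply: He2; rewrite e0.
by rewrite ltnS; apply: He1; rewrite e0.
Qed.

Definition tauj j : R := j.+2%:R^-1.

Lemma tauj_gt0 j : 0 < tauj j. Proof. by rewrite invr_gt0. Qed.
Lemma tauj_lt1 j : tauj j < 1. Proof. by rewrite invf_lt1// ltr1n. Qed.

(* One scale for every energy bound: at step k = d + 3 the structure lemma holds for all
   bounds j <= k, with tau = 1 / (j + 2). *)
Definition admissible_scale (c epsbar : nat -> R) :=
  (forall k, 0 < epsbar k <= k.+1%:R^-1) /\
    forall d j eps, (j <= d.+3)%N -> 0 < eps <= epsbar d.+3 ->
      structured d (c d.+2) j.+1%:R (tauj j) d.+4%:R^-1 eps.

Lemma scale_exists (c : nat -> R) : (forall k, (2 <= k)%N -> 0 < c k) ->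
  exists epsbar, admissible_scale c epsbar.
Proof.
move=> c0.
have H d : exists ebar : R, 0 < ebar /\ forall eps, 0 < eps <= ebar -> forall j, (j <= d.+3)%N ->
    structured d (c d.+2) j.+1%:R (tauj j) d.+4%:R^-1 eps.
  have [|e1 e10 He] := @threshold_min d.+3 (fun j => structured d (c d.+2) j.+1%:R (tauj j) d.+4%:R^-1).
    move=> j; have d0 : 0 < d.+4%:R^-1 :> R by rewrite invr_gt0.
    have j0 : 0 < j.+1%:R :> R by rewrite ltr0n.
    exact: (@structure R d (c d.+2) j.+1%:R (tauj j) (c0 d.+2 isT) j0 (tauj_gt0 j) (tauj_lt1 j) _ d0).
  by exists e1.
have [e He] := choice H.
exists (fun k => Num.min k.+1%:R^-1 (e (k - 3)%N)).
split; first by move=> k; rewrite lt_min invr_gt0 ltr0n (He _).1 ge_min lexx.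
move=> d j eps jd /andP[e0]; rewrite le_min !subSS subn0 => /andP[_ h].
by apply: (He d).2 => //; rewrite e0.
Qed.

(** The cell problem tested at T = 1 - tau/2, strictly between 1 - tau and 1, gives c [acoef] >=
    (tau/2) T^(2d+3). The quantity under the root then decays geometrically with ratio (1 - tau)/T <
    1. *)
Lemma error_vanishes (C tau : R) : 0 < C -> 0 < tau -> tau < 1 -> forall e, 0 < e ->
  exists D, forall d c, (D <= d)%N -> 0 < c -> solves_cell_problem d.+2 c ->
  C / (1 - tau) * Num.sqrt (C / (c * acoef d.+1) * (1 - tau) ^+ d.*2.+1) <= e.
Proof.
move=> C0 t0 t1 e e0; pose T := 1 - tau / 2; pose r := (1 - tau) / T.
have t10 : 0 < 1 - tau by rewrite subr_gt0.
have T0 : 0 < T by rewrite /T; lra.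
have T1 : T < 1 by rewrite /T; lra.
have T2 : 2^-1 <= T by rewrite /T; lra.
have r0 : 0 <= r by rewrite divr_ge0 ?ltW.
have r1 : r < 1 by rewrite ltr_pdivrMr// mul1r /T; lra.
pose K := (C / (1 - tau)) ^+ 2 * (8 * C / tau).
have K0 : 0 <= K by rewrite /K; nneg.
have : K * r ^+ d @[d --> \oo] --> K * 0.
  by apply: cvgMr; apply: cvg_expr; rewrite ger0_norm.
rewrite mulr0 => /cvgrPdist_lt/(_ (e ^+ 2)); rewrite exprn_gt0// => /(_ isT)[D _ HD].
exists D => d c Dd c0 sc.
have Hd : K * r ^+ d < e ^+ 2.
  by have := HD d Dd; rewrite /= sub0r normrN ger0_norm// mulr_ge0// exprn_ge0.
have A0 : 0 < c * acoef d.+1 by rewrite mulr_gt0// acoef_gt0.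
have T3 : 0 < T ^+ d.*2.+3 by rewrite exprn_gt0.
have low : tau / 2 * T ^+ d.*2.+3 <= c * acoef d.+1.
  have := cell_lower sc T0; rewrite mulrA => H.
  by rewrite -ler_pdivlMr//; move: H; rewrite /T; lra.
have X0 : 0 <= C / (c * acoef d.+1) * (1 - tau) ^+ d.*2.+1 by nneg.
set X := C / (c * acoef d.+1) * _ in X0 *.
have XK : X <= 8 * C / tau * r ^+ d.
  apply: (@le_trans _ _ (C / (tau / 2 * T ^+ d.*2.+3) * (1 - tau) ^+ d.*2.+1)).
    apply: ler_wpM2r; first by nneg.
    apply: ler_wpM2l; first by nneg.
    by rewrite lef_pV2 ?posrE// mulr_gt0// divr_gt0.
  have -> : C / (tau / 2 * T ^+ d.*2.+3) * (1 - tau) ^+ d.*2.+1 = (2 * C / tau) * (T ^+ 2)^-1 * r ^+ d.*2.+1.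
    rewrite (_ : d.*2.+3 = (2 + d.*2.+1)%N)// exprD expr_div_n.
    have n1 : T ^+ d.*2.+1 != 0 by rewrite expf_neq0// gt_eqF.
    by field; rewrite n1 !gt_eqF.
  have T4 : (T ^+ 2)^-1 <= 4.
    rewrite -[leRHS]invrK lef_pV2 ?posrE ?invr_gt0 ?exprn_gt0//.
    apply: (@le_trans _ _ (2^-1 ^+ 2)); first by rewrite le_eqVlt; apply/orP; left; apply/eqP; field.
    by rewrite lerXn2r ?nnegrE ?invr_ge0 ?(ltW T0).
  have r2 : r ^+ d.*2.+1 <= r ^+ d.
    apply: ler_wiXn2l => //; first exact: ltW.
    by rewrite -addnn -addnS leq_addr.
  apply: (@le_trans _ _ (2 * C / tau * 4 * r ^+ d)).
    apply: ler_pM => //; [by nneg|by nneg|].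
    by apply: ler_wpM2l => //; nneg.
  by rewrite le_eqVlt; apply/orP; left; apply/eqP; field; rewrite gt_eqF.
have CX0 : 0 <= C / (1 - tau) * Num.sqrt X by nneg.
rewrite -ler_sqr ?nnegrE// ?(ltW e0)// exprMn sqr_sqrtr//.
apply: le_trans (ltW Hd); rewrite /K -mulrA; apply: ler_wpM2l => //; exact: sqr_ge0.
Qed.

Lemma ultra_const (F : set_system nat) (f : nat -> nat) n : UltraFilter F ->
  (\forall k \near F, (f k < n)%N) -> exists N, \forall k \near F, f k = N.
Proof.
move=> uF; elim: n => [|n IH] H.
  by have [k] := filter_ex H.
have [E|E] := in_ultra_setVsetC [set k | f k = n] uF; first by exists n.
apply: IH; apply: filterS2 H E => k /= h1 /eqP h2.
by rewrite ltn_neqAle h2 -ltnS.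
Qed.

Lemma limn_einf_frequently (a : nat -> \bar R) (C : R) : (limn_einf a < C%:E)%E ->
  forall n, exists2 k, (n <= k)%N & (a k < C%:E)%E.
Proof.
move=> H n; apply: contrapT => nH.
have : (C%:E <= einfs a n)%E.
  apply: le_ereal_inf_tmp => _ [k /= nk <-]; rewrite leNgt; apply/negP => h.
  by apply: nH; exists k.
have : (einfs a n <= limn_einf a)%E.
  rewrite limn_einf_lim; apply: lime_ge; first exact: is_cvg_einfs.
  by exists n => // m /= nm; exact: nondecreasing_einfs.
by move=> h1 h2; move: (le_lt_trans (le_trans h2 h1) H); rewrite ltxx.
Qed.

Section bound.
Variables (c epsbar eps : nat -> R) (u_ : nat -> R -> R) (u : R -> R).
Hypotheses (hc : forall k, (2 <= k)%N -> 0 < c k /\ solves_cell_problem k (c k))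
  (sc : admissible_scale c epsbar) (He : forall k, (3 <= k)%N -> 0 < eps k <= epsbar k)
  (uL : u \in L2 0 1) (ukL : forall k, u_ k \in L2 0 1) (cv : L2_cvg u_ u).

Let data := ((R -> R) * (R -> R) * seq (R * R) * (R * R) * (R * R))%type.

Let err d j : R := d.+4%:R^-1 + j.+1%:R / (1 - tauj j) *
  Num.sqrt (j.+1%:R / (c d.+2 * acoef d.+1) * (1 - tauj j) ^+ d.*2.+1).

Let good (C : R) j d (D : data) :=
  let: (v, g, Y, (al, be), (x0, x1)) := D in
  [/\ u_ d.+3 = v %[ae mu in `]0, 1[%classic],
      0 <= x0 <= d.+4%:R^-1 /\ 1 - d.+4%:R^-1 <= x1 <= 1,
      (1 - tauj j) ^+ 2 * (size Y)%:R + Int 0 1 (fun x => g x ^+ 2) <= C,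
      (forall p, p \in Y -> 0 <= p.1 <= 1) &
      forall t, x0 <= t <= x1 ->
       `|v t - (al + be * t + SI 0 (SI 0 g) t + ramp Y t)| <= err d j].

Let data_ok (D : data) := let: (v, g, Y, _, _) := D in l2 v /\ l2 g.

(** Stated for every d, with dummy data where the energy is not below C, so that the axiom of choice
    yields whole sequences. *)
Let data_ex (C : R) j d : exists D : data, data_ok D /\
  (C <= j.+1%:R -> (j <= d.+3)%N -> (G c eps d.+3 (u_ d.+3) < C%:E)%E -> good C j d D).
Proof.
have [[[CJ jd] GC]|nH] := pselect ((C <= j.+1%:R /\ (j <= d.+3)%N) /\ (G c eps d.+3 (u_ d.+3) < C%:E)%E); last first.
  exists (fun=> 0, fun=> 0, [::], (0, 0), (0, 0)); split; first by split; exact: l2_cst.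
  by move=> h1 h2 h3; exfalso; apply: nH.
have /andP[e0 eb] := He (isT : (3 <= d.+3)%N).
have c0 := (hc (isT : (2 <= d.+2)%N)).1.
have su : sobolev 0 1 d.+3 (u_ d.+3).
  by apply: contrapT => ns; move: GC; rewrite /G asboolF.
have [U [cU kU dU]] := sobolev_chain ltr01 su.
have k2 : continuous (U 2) by exact: kU.
move: GC; rewrite (G_chain c e0 (ukL _) su cU k2 dU) lte_fin.
set kappa := (Num.sqrt (eps d.+3))^-1.
set IL := Int 0 1 _; set IH := Int 0 1 (high _ _); set IM := Int 0 1 (fun x => U d.+3 x ^+ 2) => GC.
have IL0 : 0 <= IL by apply: Int_ge0 => x _; exact: sqr_ge0.
have IH0 : 0 <= IH by apply: Int_ge0 => x _; exact: high_ge0.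
have IM0 : 0 <= IM by apply: Int_ge0 => x _; exact: sqr_ge0.
have t1 : 0 <= (eps d.+3)^-1 * IH by nneg.
have t2 : 0 <= c d.+2 * eps d.+3 ^+ d.*2.+3 * IM by nneg.
have H1 : IH <= j.+1%:R * eps d.+3.
  have : (eps d.+3)^-1 * IH <= j.+1%:R by move: GC t2 IL0 CJ; lra.
  by rewrite mulrC ler_pdivrMr.
have H2 : c d.+2 * eps d.+3 ^+ d.*2.+3 * IM <= j.+1%:R by move: GC t1 IL0 CJ; lra.
have [_ /(_ d j (eps d.+3) jd)] := sc; rewrite e0 eb => /(_ isT) st.
have [x0 [x1 [Y [al [be [h1 h2 h3 h4 h5]]]]]] := st U cU kU H1 H2.
exists (U 0%N, fun x => low kappa (U 2) x * U 2 x, Y, (al, be), (x0, x1)).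
have llow : l2 (fun x => low kappa (U 2) x * U 2 x).
  by apply: (@l2_bounded_mul _ _ _ 1); [exact: cU.1|exact: measurable_low|exact: low_norm].
split; first by split => //; exact: cU.1.
have /andP[x00 x0e] := h1; have /andP[x1e x11] := h2.
move=> _ _ _; split => //.
- have [w0 e0'] := dU 0%N isT; have wu : is_weak_derivative 0 1 0 (u_ d.+3) (u_ d.+3).
    by split => // phi _; rewrite expr0 mul1r.
  exact: weak_derivative_unique ltr01 wu w0.
- have : (1 - tauj j) ^+ 2 * (size Y)%:R <= (eps d.+3)^-1 * IH.
    by rewrite [leRHS]mulrC ler_pdivlMr// mulrAC.
  by rewrite -/IL; move: GC t2; lra.
- by move=> p /h4/andP[p1 p2]; rewrite (le_trans x00 p1) (le_trans p2 x11).
move=> t t01; have := h5 t t01; rewrite -(@SIE R 0 (SI 0 _) t)//.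
by have /andP[h _] := t01; exact: le_trans x00 h.
Qed.

(** Here tau is fixed while k tends to infinity; the parameter j both caps the energy and sets the
    loss factor (1 - [tauj j])^2, which is removed only afterwards. *)
Lemma FBZ_bound (C : R) j : 0 < C -> C <= j.+1%:R -> (limn_einf (fun k => G c eps k (u_ k)) < C%:E)%E ->
  exists2 r : R, FBZ u = r%:E & (1 - tauj j) ^+ 2 * r <= C.
Proof.
move=> C0 Cj /limn_einf_frequently fr.
have t0 := tauj_gt0 j; have t1 := tauj_lt1 j.
pose D0 := [set d | (G c eps d.+3 (u_ d.+3) < C%:E)%E].
(* The bound on the lower limit makes [D0] infinite, so some ultrafilter at infinity contains it;
   all limits below are taken along that ultrafilter. *)
have pw : ProperFilter (within D0 \oo).
  split; last exact: within_filter.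
  move=> [n _ Hn]; have [k nk Gk] := fr (n + 3)%N.
  have k3 : (3 <= k)%N by rewrite (leq_trans _ nk)// leq_addl.
  apply: (Hn (k - 3)%N); first by rewrite /= leq_subRL// addnC.
  by rewrite /D0 /= -addn3 subnK.
have [F [uF sF]] := ultraFilterLemma pw.
have FD : F D0 by apply: sF; apply: nearW => d.
have oF : \oo `<=` F by move=> A HA; apply: sF; apply: filterS HA => d Hd _.
have [D HD] := choice (data_ex C j).
pose v d := (D d).1.1.1.1; pose g d := (D d).1.1.1.2; pose Y d := (D d).1.1.2.
pose al d := (D d).1.2.1; pose be d := (D d).1.2.2; pose x0 d := (D d).2.1; pose x1 d := (D d).2.2.
have Deta d : D d = (v d, g d, Y d, (al d, be d), (x0 d, x1 d)).
  by rewrite /v /g /Y /al /be /x0 /x1; case: (D d) => [[[[? ?] ?] [? ?]] [? ?]].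
have lvg d : l2 (v d) /\ l2 (g d) by have [] := HD d; rewrite Deta.
have gd : \forall d \near F, good C j d (D d).
  have jF : \forall d \near F, (j <= d)%N by apply: oF; exact: nbhs_infty_ge.
  by apply: filterS2 FD jF => d h1 h2; apply: (HD d).2 => //; apply: leq_trans h2 _; rewrite -addn3 leq_addr.
have {}gd : \forall d \near F, [/\ u_ d.+3 = v d %[ae mu in `]0, 1[%classic],
      0 <= x0 d <= d.+4%:R^-1 /\ 1 - d.+4%:R^-1 <= x1 d <= 1,
      (1 - tauj j) ^+ 2 * (size (Y d))%:R + Int 0 1 (fun x => g d x ^+ 2) <= C,
      (forall p, p \in Y d -> 0 <= p.1 <= 1) &
      forall t, x0 d <= t <= x1 d ->
       `|v d t - (al d + be d * t + SI 0 (SI 0 (g d)) t + ramp (Y d) t)| <= err d j].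
  by apply: filterS gd => d; rewrite Deta.
have tt0 : 0 < (1 - tauj j) ^+ 2 by rewrite exprn_gt0// subr_gt0.
have [|N HN] := @ultra_const F (fun d => size (Y d)) (Num.truncn (C / (1 - tauj j) ^+ 2)).+1 uF.
  apply: filterS gd => d [_ _ h _ _].
  have : (size (Y d))%:R <= C / (1 - tauj j) ^+ 2.
    rewrite ler_pdivlMr// mulrC; apply: le_trans h; rewrite lerDl.
    by apply: Int_ge0 => x _; exact: sqr_ge0.
  move=> h1; rewrite -(ltr_nat R); apply: (le_lt_trans h1).
  have cc : 0 <= C / (1 - tauj j) ^+ 2 by nneg.
  by have /andP[] := truncn_itv cc.
(* The number of ramps is constant along [F]; M is the part of the energy left for the regular
   second derivative. *)
pose M := C - (1 - tauj j) ^+ 2 * N%:R.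
have gM : \forall d \near F, Int 0 1 (fun x => g d x ^+ 2) <= M.
  by apply: filterS2 gd HN => d [_ _ h _ _] E; rewrite /M -E lerBrDl.
have [h [lh hM hw]] := weak_limit uF (fun d => (lvg d).2) gM.
have gh := double_primitive_uniform (@ultra_proper _ _ uF) (fun d => (lvg d).2) lh gM hM hw.
have inv0 : (d.+4%:R^-1 : R) @[d --> \oo] --> (0 : R).
  by have := @cvg_harmonic R; rewrite -(cvg_shiftn 3) => H; apply: cvg_trans H; apply: near_eq_cvg; apply: nearW => d; rewrite /= addn3.
have toF (f : nat -> R) (l : R) : f d @[d --> \oo] --> l -> f d @[d --> F] --> l.
  by move=> H B /H; exact: oF.
have x0c : x0 d @[d --> F] --> (0 : R).
  apply: (@squeeze_cvgr _ _ _ _ (fun=> 0) (fun d => d.+4%:R^-1)); [|exact: cvg_cst|exact: toF].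
  by apply: filterS gd => d [_ [h1 _] _ _ _].
have x1c : x1 d @[d --> F] --> (1 : R).
  apply: (@squeeze_cvgr _ _ _ _ (fun d => 1 - d.+4%:R^-1) (fun=> 1)); [| |exact: cvg_cst].
    by apply: filterS gd => d [_ [_ h1] _ _ _].
  by rewrite -[X in _ --> X]subr0; apply: cvgB; [exact: cvg_cst|exact: toF].
have errc : err d j @[d --> F] --> (0 : R).
  apply: toF; apply/cvgrPdist_lt => e e0; have e2 : 0 < e / 2 by rewrite divr_gt0.
  have [D1 HD1] := @error_vanishes j.+1%:R (tauj j) (ltr0Sn R j) t0 t1 (e / 2) e2.
  have /cvgrPdist_lt/(_ _ e2) n1 := inv0.
  have n2 : \forall d \near \oo, (D1 <= d)%N by exact: nbhs_infty_ge.
  apply: filterS2 n1 n2 => d h1 h2; have [c0 s0] := hc (isT : (2 <= d.+2)%N).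
  have := HD1 d _ h2 c0 s0; move: h1; rewrite !sub0r !normrN ger0_norm// => h1 h3.
  rewrite ger0_norm; last by rewrite /err addr_ge0// mulr_ge0 ?sqrtr_ge0// divr_ge0// subr_ge0 ltW.
  by rewrite /err [ltRHS](splitr e); apply: ltr_leD.
(* Outside []0, 1[] nothing is known about u, while the limit lemma asks for local square
   integrability on the whole line. *)
pose u0 := u \_ `]0, 1[%classic.
have lu0 : l2 u0 := L2_l2 uL.
have vu : Int 0 1 (fun t => (v d t - u0 t) ^+ 2) @[d --> F] --> (0 : R).
  have /(L2_cvgP ukL uL) := cv; rewrite -(cvg_shiftn 3) => /toF H.
  apply: cvg_trans H; apply: near_eq_cvg; apply: filterS gd => d [E _ _ _ _].
  apply: ae_locint => //; [|exact: (l2B (lvg d).1 lu0).2|].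
    exact: (L2_l2 (L2_sub_in (ukL _) uL)).2.
  apply: ae_imp E => x /= E x01; have xin : x \in `]0, 1[%classic by rewrite inE /= in_itv.
  by rewrite /u0 !patchE !addn3 xin -E ?in_itv.
have Y01 : \forall d \near F, forall p, p \in Y d -> 0 <= p.1 <= 1.
  by apply: filterS gd => d [].
have ap : \forall d \near F, forall t, x0 d <= t <= x1 d ->
    `|v d t - (al d + be d * t + SI 0 (SI 0 (g d)) t + ramp (Y d) t)| <= err d j.
  by apply: filterS gd => d [].
have [s [A [B [nf cost]]]] := ramp_limit uF (fun d => (lvg d).1) lu0 lh HN Y01 ap x0c x1c errc vu gh.
have nf' : nform s u h A B.
  have [ps _ _ Hi] := nf; split => // i is_; apply: ae_imp (Hi i is_) => x E xi.
  rewrite -E// /u0 patchE mem_set//= in_itv/=; have /andP[l1 l2_] := xi.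
  by rewrite (le_lt_trans (lft_ge0 ps (ltnW is_)) l1) (lt_le_trans l2_ (rgt_le1 ps is_)).
exists (Int 0 1 (fun x => h x ^+ 2) + jump_cost s A B); first exact: FBZ_E.
rewrite mulrDr.
have a1 : (1 - tauj j) ^+ 2 * Int 0 1 (fun x => h x ^+ 2) <= Int 0 1 (fun x => h x ^+ 2).
  apply: ler_piMl; first by apply: Int_ge0 => x _; exact: sqr_ge0.
  by apply: exprn_ile1; rewrite ?subr_ge0 ?gerBl ltW.
have a2 : (1 - tauj j) ^+ 2 * jump_cost s A B <= (1 - tauj j) ^+ 2 * N%:R by rewrite ler_wpM2l// ltW.
by apply: (le_trans (lerD a1 a2)); move: hM; rewrite /M lerBrDr.
Qed.

Let G_ge0 k : (3 <= k)%N -> (0 <= G c eps k (u_ k))%E.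
Proof.
move=> k3; have /andP[e0 _] := He k3.
have c0 : 0 < c k.-1 by apply: (hc _).1; rewrite -ltnS prednK// (leq_trans _ k3).
rewrite /G; case: ifP => // _; apply: adde_ge0.
  apply: integral_ge0 => x _; rewrite lee_fin /truncated_square le_min sqr_ge0 invr_ge0.
  exact: ltW.
apply: mule_ge0; first by rewrite lee_fin; nneg.
by apply: integral_ge0 => x _; rewrite lee_fin sqr_ge0.
Qed.

(** [FBZ_bound] is applied twice: once to learn that the limit functional has a finite value r, and
    again with j large in terms of r to remove the loss factor. *)
Lemma FBZ_liminf : (FBZ u <= limn_einf (fun k => G c eps k (u_ k)))%E.
Proof.
set l := limn_einf _.
have key (C : R) : 0 < C -> (l < C%:E)%E -> (FBZ u <= C%:E)%E.
  move=> C0 lC; pose j0 := Num.truncn C.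
  have Cj0 : C <= j0.+1%:R by have /andP[_ /ltW] := truncn_itv (ltW C0).
  have [r rE _] := FBZ_bound C0 Cj0 lC; rewrite rE lee_fin.
  apply/ler_addgt0Pr => e e0; have [r0|r0] := leP r 0.
    by apply: (le_trans r0); rewrite addr_ge0// ltW.
  (* Since (1 - t)^2 r >= r - 2 t r for r >= 0, it suffices that 2 r [tauj j] <= e. *)
  pose j := maxn j0 (Num.truncn (2 * r / e)).
  have Cj : C <= j.+1%:R by apply: (le_trans Cj0); rewrite ler_nat ltnS leq_maxl.
  have [r' rE' Hr] := FBZ_bound C0 Cj lC.
  have rr : r' = r by move: rE'; rewrite rE => -[].
  rewrite rr in Hr.
  have tj : 2 * r * tauj j <= e.
    rewrite /tauj ler_pdivrMr// -ler_pdivrMl// mulrC.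
    have re0 : 0 <= 2 * r / e by nneg.
    have /andP[_ /ltW] := truncn_itv re0 => /le_trans; apply; rewrite ler_nat.
    by rewrite ltnS (leq_trans _ (leqnSn _))// leq_maxr.
  have sq : 0 <= tauj j ^+ 2 * r by apply: mulr_ge0; [exact: sqr_ge0|exact: ltW].
  by move: Hr; rewrite sqrrB expr1n mul1r; move: tj sq; lra.
have l0 : (0 <= l)%E.
  rewrite leNgt; apply/negP => /limn_einf_frequently/(_ 3)[k k3].
  by rewrite ltNge G_ge0.
clearbody l; case: l l0 key => [l l0 key|_ _|//]; last by rewrite leey.
rewrite lee_fin in l0; apply/lee_addgt0Pr => e e0; rewrite -EFinD; apply: key.
  by rewrite ltr_wpDl.
by rewrite lte_fin ltrDl.
Qed.

End bound.
End lower_bound.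

(** * Bernstein and Kantorovich polynomials *)

Section bernstein.
Context {R : realType}.
Implicit Types (N i : nat) (f g : nat -> R) (x : R).

(** Bernstein polynomials by de Casteljau's recursion: at x, the expectation of f at a binomial
    variable with parameters N and x. Every property below becomes an induction on N. *)
Fixpoint Bern N f : {poly R} :=
  if N is N'.+1 then 'X * Bern N' (fun i => f i.+1) + (1 - 'X) * Bern N' f else (f 0%N)%:P.

Lemma BernS N f x : (Bern N.+1 f).[x] = x * (Bern N (fun i => f i.+1)).[x] + (1 - x) * (Bern N f).[x].
Proof. by rewrite /= !hornerE. Qed.

Lemma Bern_lin N f g (a : R) x :
  (Bern N (fun i => a * f i + g i)).[x] = a * (Bern N f).[x] + (Bern N g).[x].
Proof. by elim: N f g => [|N IH] f g; [rewrite /= !hornerE|rewrite !BernS !IH; ring]. Qed.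

Lemma Bern_cst N (a : R) x : (Bern N (fun=> a)).[x] = a.
Proof. by elim: N => [|N IH]; [rewrite /= hornerE|rewrite BernS IH; ring]. Qed.

Lemma Bern_ge0 N f x : 0 <= x <= 1 -> (forall i, (i <= N)%N -> 0 <= f i) -> 0 <= (Bern N f).[x].
Proof.
move=> /andP[x0 x1]; elim: N f => [|N IH] f Hf; first by rewrite /= hornerE Hf.
rewrite BernS addr_ge0// mulr_ge0 ?subr_ge0//; apply: IH => i iN; apply: Hf => //.
exact: leq_trans (leqnSn _).
Qed.

Lemma BernB N f g x : (Bern N (fun i => f i - g i)).[x] = (Bern N f).[x] - (Bern N g).[x].
Proof.
have -> : (fun i => f i - g i) = (fun i => -1 * g i + f i) by apply/funext => i; ring.
by rewrite Bern_lin; ring.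
Qed.

Lemma Bern_le N f g x : 0 <= x <= 1 -> (forall i, (i <= N)%N -> f i <= g i) ->
  (Bern N f).[x] <= (Bern N g).[x].
Proof.
move=> x01 H; rewrite -subr_ge0 -BernB; apply: Bern_ge0 => // i iN.
by rewrite subr_ge0 H.
Qed.

Lemma Bern_norm N f x : 0 <= x <= 1 -> `|(Bern N f).[x]| <= (Bern N (fun i => `|f i|)).[x].
Proof.
move=> x01; rewrite ler_norml; apply/andP; split; last by apply: Bern_le => // i _; exact: ler_norm.
have -> : - (Bern N (fun i => `|f i|)).[x] = (Bern N (fun i => -1 * `|f i| + 0)).[x].
  by rewrite Bern_lin Bern_cst; ring.
by apply: Bern_le => // i _; rewrite addr0 mulN1r lerNl -normrN ler_norm.
Qed.

Lemma Bern_jensen N f x : 0 <= x <= 1 -> (Bern N f).[x] ^+ 2 <= (Bern N (fun i => f i ^+ 2)).[x].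
Proof.
move=> x01; set m := (Bern N f).[x].
have : 0 <= (Bern N (fun i => (f i - m) ^+ 2)).[x] by apply: Bern_ge0 => // i _; exact: sqr_ge0.
have -> : (fun i => (f i - m) ^+ 2) = (fun i => (- 2 * m) * f i + (1 * f i ^+ 2 + m ^+ 2)).
  by apply/funext => i; ring.
by rewrite !Bern_lin Bern_cst -/m => H; rewrite -subr_ge0; apply: le_trans H _; rewrite le_eqVlt; apply/orP; left; apply/eqP; ring.
Qed.

(** The free centre a lets the induction close; a = N x gives the binomial variance. *)
Lemma Bern_variance N (a x : R) :
  (Bern N (fun i => (i%:R - a) ^+ 2)).[x] = (N%:R * x - a) ^+ 2 + N%:R * (x * (1 - x)).
Proof.
elim: N a => [|N IH] a; first by rewrite /= hornerE; ring.
rewrite BernS; have -> : (fun i => (i.+1%:R - a) ^+ 2) = (fun i => (i%:R - (a - 1)) ^+ 2) :> (nat -> R).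
  by apply/funext => i; rewrite -natr1; ring.
by rewrite !IH -natr1; ring.
Qed.

Lemma Bern_deriv N f : (Bern N.+1 f)^`() = N.+1%:R *: Bern N (fun i => f i.+1 - f i).
Proof.
elim: N f => [|N IH] f.
  by rewrite /= derivD !derivM derivB !derivC derivX scale1r polyCB; ring.
have D : Bern N.+1 (fun i => f i.+1) - Bern N.+1 f = Bern N.+1 (fun i => f i.+1 - f i).
  elim: N.+1 f => [|k IHk] f'; first by rewrite /= polyCB.
  by rewrite /= -!IHk; ring.
rewrite [Bern N.+2 f]/= -/(Bern N.+1 f) -/(Bern N.+1 (fun i => f i.+1)).
rewrite derivD !derivM derivB derivX derivC !IH.
transitivity (Bern N.+1 (fun i => f i.+1 - f i) + N.+1%:R *: Bern N.+1 (fun i => f i.+1 - f i)).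
  have E : Bern N.+1 (fun i => f i.+1 - f i) =
    'X * Bern N (fun i => f i.+2 - f i.+1) + (1 - 'X) * Bern N (fun i => f i.+1 - f i) by [].
  by rewrite -[X in _ = X + _]D E -!mul_polyC; ring.
by rewrite -[X in X + _]scale1r -scalerDl addrC natr1.
Qed.

Lemma size_Bern N f : (size (Bern N f) <= N.+1)%N.
Proof.
elim: N f => [|N IH] f; first by rewrite /= size_polyC; case: (_ != 0).
rewrite /=; apply: (leq_trans (size_polyD _ _)); rewrite geq_max; apply/andP; split.
  by rewrite mulrC; apply: (leq_trans (size_polyMleq _ _)); rewrite size_polyX addn2 /= ltnS.
apply: (leq_trans (size_polyMleq _ _)).
have : (size (1 - 'X : {poly R})%R <= 2)%N.
  by apply: (leq_trans (size_polyD _ _)); rewrite size_poly1 size_polyN size_polyX.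
move=> h; apply: (@leq_trans (2 + N.+1).-1); last by [].
by rewrite -!subn1; apply: leq_sub2r; apply: leq_add.
Qed.

Lemma Bern_0 N f : (Bern N f).[0] = f 0%N.
Proof. by elim: N f => [|N IH] f; [rewrite /= hornerE|rewrite BernS !IH; ring]. Qed.

Lemma Bern_1 N f : (Bern N f).[1] = f N.
Proof. by elim: N f => [|N IH] f; [rewrite /= hornerE|rewrite BernS !IH; ring]. Qed.

(** Up to the factor N + 1, the integrand is the derivative of the Bernstein polynomial of the
    partial sums of f, whose end values are 0 and the full sum. *)
Lemma Int_Bern N f : N.+1%:R * Int 0 1 (horner (Bern N f)) = \sum_(0 <= i < N.+1) f i.
Proof.
pose F i := \sum_(0 <= j < i) f j.
have E : Bern N (fun i => F i.+1 - F i) = Bern N f.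
  congr Bern; apply/funext => i; rewrite /F big_nat_recr//=; ring.
have := Int_poly (Bern N.+1 F) ler01.
rewrite Bern_deriv E Bern_0 Bern_1 /F [X in _ - X]big_geq// subr0 => <-.
rewrite -IntZ; last by apply: l2_locint; exact: horner_l2.
by apply: eq_Int => x _; rewrite hornerZ.
Qed.

(* Take the derivatives of the Bernstein polynomials of a primitive of g (Kantorovich
   polynomials). *)
Lemma poly_approx (g : R -> R) : l2 g -> exists K : nat -> {poly R},
  [/\ forall d, (size (K d) <= d.+1)%N,
      forall d, Int 0 1 (fun x => (K d).[x] ^+ 2) <= Int 0 1 (fun x => g x ^+ 2) &
      forall e : R, 0 < e -> exists D, forall d, (D <= d)%N -> forall x, 0 <= x <= 1 ->
        `|SI 0 (horner (K d)) x - SI 0 g x| <= e].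
Proof.
move=> lg; pose S := SI 0 g.
pose f d i := S (i%:R / d.+1%:R).
pose K d := d.+1%:R *: Bern d (fun i => f d i.+1 - f d i).
have KE d : K d = (Bern d.+1 (f d))^`() by rewrite Bern_deriv.
have prim : primitive 0 1 S g by exact: SI_primitive (l2_locint lg).
have node d i : (i <= d.+1)%N -> 0 <= (i%:R / d.+1%:R : R) <= 1.
  by move=> id_; rewrite divr_ge0//= ler_pdivrMr// mul1r ler_nat.
have M0 : 0 <= Int 0 1 (fun x => g x ^+ 2) by apply: Int_ge0 => x _; exact: sqr_ge0.
set M := Int 0 1 _ in M0 *.
exists K; split.
- by move=> d; apply: (leq_trans (size_scale_leq _ _)); exact: size_Bern.
- move=> d; have d0 : 0 < d.+1%:R :> R by rewrite ltr0n.
  pose Df i := f d i.+1 - f d i.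
  (* Jensen's inequality passes to the squared increments of the primitive of g, whose Bernstein
     polynomial integrates to their mean. Each is at most the grid step times the energy of g on its
     grid cell. *)
  apply: (@le_trans _ _ (Int 0 1 (fun x => d.+1%:R ^+ 2 * (Bern d (fun i => Df i ^+ 2)).[x]))).
    apply: Int_le; [exact: (horner_l2 _).2|by apply: locintZ; apply: l2_locint; exact: horner_l2|].
    move=> x x01; rewrite hornerZ exprMn; apply: ler_wpM2l; first exact: sqr_ge0.
    exact: Bern_jensen.
  rewrite IntZ; last by apply: l2_locint; exact: horner_l2.
  rewrite expr2 -mulrA Int_Bern.
  have key n : (n <= d.+1)%N -> d.+1%:R * \sum_(0 <= i < n) Df i ^+ 2 <= Int 0 (n%:R / d.+1%:R) (fun x => g x ^+ 2).
    elim: n => [|n IH] nd; first by rewrite big_geq// mulr0 mul0r Int_xx.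
    rewrite big_nat_recr//= mulrDr.
    have /andP[n0 n1] := node d n (ltnW nd); have /andP[m0 m1] := node d n.+1 nd.
    have nm : n%:R / d.+1%:R <= n.+1%:R / d.+1%:R :> R.
      by rewrite ler_wpM2r ?invr_ge0// ler_nat.
    rewrite (Int_chasles lg.2 n0 nm); apply: lerD; first exact: IH (ltnW nd).
    rewrite -ler_pdivlMl//; apply: le_trans (primitive_sqr lg prim n0 nm m1) _.
    apply: ler_wpM2r; first by apply: Int_ge0 => x _; exact: sqr_ge0.
    by rewrite -natr1 mulrDl mul1r addrAC subrr add0r.
  by have := key d.+1 (leqnn _); rewrite divff ?pnatr_eq0.
move=> e e0; have e20 : 0 < e / 2 by rewrite divr_gt0.
(* A deviation s of the primitive over a distance r satisfies s^4 <= M^2 r^2. If it exceeds e/2,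
   then s (e/2)^3 <= s^4, so s <= Q r^2, and such deviations are controlled by the variance. *)
pose Q := M ^+ 2 / (e / 2) ^+ 3.
have Q0 : 0 <= Q by rewrite /Q; nneg.
exists (Num.truncn (Q / (e / 2))) => d Dd x /andP[x0 x1].
have x01 : 0 <= x <= 1 by rewrite x0.
have d0 : 0 < d.+1%:R :> R by rewrite ltr0n.
have Qd : Q / d.+1%:R <= e / 2.
  rewrite ler_pdivrMr// mulrC -ler_pdivrMr//.
  have H : 0 <= Q / (e / 2) by nneg.
  have /andP[_ /ltW] := truncn_itv H => /le_trans; apply; by rewrite ler_nat ltnS.
have -> : SI 0 (horner (K d)) x = (Bern d.+1 (f d)).[x].
  rewrite KE SIE// Int_poly// Bern_0 /f mul0r /S SIaa subr0//.
have osc a b : 0 <= a <= 1 -> 0 <= b <= 1 -> (S b - S a) ^+ 2 <= `|b - a| * M.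
  wlog ab : a b / a <= b.
    move=> H a01 b01; case: (leP a b) => [|/ltW] ab; first exact: H.
    by rewrite distrC -sqrrN opprB; exact: H.
  move=> /andP[a0 a1] /andP[b0 b1]; rewrite ger0_norm ?subr_ge0//.
  apply: (le_trans (primitive_sqr lg prim a0 ab b1)); apply: ler_wpM2l; first by rewrite subr_ge0.
  by apply: Int_sub => //; [exact: lg.2|move=> t; exact: sqr_ge0].
have dev i : (i <= d.+1)%N -> `|f d i - S x| <= Q / d.+1%:R ^+ 2 * (i%:R - d.+1%:R * x) ^+ 2 + e / 2.
  move=> id_; have := osc x _ x01 (node d i id_); rewrite -/(f d i).
  set s := f d i - S x => H.
  have [se|es] := leP `|s| (e / 2); first by rewrite ler_wpDl// mulr_ge0 ?sqr_ge0// divr_ge0// sqr_ge0.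
  apply: ler_wpDr; first exact: ltW.
  have -> : Q / d.+1%:R ^+ 2 * (i%:R - d.+1%:R * x) ^+ 2 = Q * `|i%:R / d.+1%:R - x| ^+ 2.
    by rewrite real_normK ?num_real//; field; rewrite gt_eqF.
  have H4 : `|s| ^+ 4 <= M ^+ 2 * `|i%:R / d.+1%:R - x| ^+ 2.
    rewrite (exprM _ 2 2) real_normK ?num_real// mulrC -exprMn lerXn2r ?nnegrE ?sqr_ge0//.
    by rewrite mulr_ge0.
  rewrite /Q mulrAC ler_pdivlMr ?exprn_gt0//; apply: le_trans H4.
  rewrite [leRHS]exprS; apply: ler_wpM2l => //.
  by rewrite lerXn2r ?nnegrE// ltW.
have -> : (Bern d.+1 (f d)).[x] - S x = (Bern d.+1 (fun i => f d i - S x)).[x].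
  by rewrite (BernB d.+1 (f d) (fun=> S x)) Bern_cst.
apply: (le_trans (Bern_norm _ _ x01)); apply: (le_trans (Bern_le x01 dev)).
rewrite Bern_lin Bern_cst Bern_variance subrr expr0n add0r.
rewrite [leRHS](splitr e) lerD2r; apply: le_trans Qd.
have -> : Q / d.+1%:R ^+ 2 * (d.+1%:R * (x * (1 - x))) = Q / d.+1%:R * (x * (1 - x)).
  by field; rewrite gt_eqF.
apply: ler_piMr; first by rewrite divr_ge0// ltW.
by apply: mulr_ile1; rewrite ?subr_ge0// gerBl.
Qed.

End bernstein.

(** * The recovery sequence *)

Section kinks.
Context {R : realType}.
Notation mu := (@lebesgue_measure R).
Implicit Types (a b c d p q x y t w : R) (f g h F : R -> R) (n j k : nat).

Definition zext p q h x : R := if p <= x <= q then h x else 0.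

Lemma zextE p q h : zext p q h = h \_ `[p, q]%classic.
Proof.
apply/funext => x; rewrite /zext patchE; case: ifPn => H; first by rewrite mem_set//= in_itv.
by rewrite memNset//= in_itv/=; exact/negP.
Qed.

Lemma zext_l2 p q h : l2 h -> l2 (zext p q h).
Proof. by move=> lh; rewrite zextE; apply: l2_restrict. Qed.

Lemma Int0_open a b f : a <= b -> locint f -> (forall x, a < x < b -> f x = 0) -> Int a b f = 0.
Proof.
move=> ab lf H; rewrite -(mul0r (b - a)) -Int_cst//.
by apply: ae_locint => //; [exact: locint_cst|exact: ae_all].
Qed.

Lemma Int_zext c d p q h : c <= p -> p <= q -> q <= d -> locint h -> locint (zext p q h) ->
  Int c d (zext p q h) = Int p q h.
Proof.
move=> cp pq qd lh lz.
rewrite (Int_chasles lz (le_trans cp pq) qd) (Int_chasles lz cp pq).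
rewrite (Int0_open cp lz) ?(Int0_open qd lz) ?add0r ?addr0.
- by apply: eq_Int => x H; rewrite /zext H.
- by move=> x /andP[qx _]; rewrite /zext leNgt [x <= q]leNgt qx andbF.
- by move=> x /andP[_ xp]; rewrite /zext [p <= x]leNgt xp.
Qed.

Lemma zext_primitive p q F f c d : l2 f -> primitive p q F f ->
  F p = 0 -> F q = 0 -> primitive c d (zext p q F) (zext p q f).
Proof.
move=> lf pF Fp Fq x y _ xy _.
have lz : locint (zext p q f) by apply: l2_locint; exact: zext_l2.
pose a := Num.max x p; pose b := Num.min y q.
have xa : x <= a by rewrite le_max lexx.
have pa : p <= a by rewrite le_max lexx orbT.
have by_ : b <= y by rewrite ge_min lexx.
have bq : b <= q by rewrite ge_min lexx orbT.
have [ab|ba] := leP a b; last first.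
  have out t : x <= t -> t <= y -> zext p q F t = 0 /\ zext p q f t = 0.
    move=> xt ty; rewrite /zext; case: ifP => // /andP[pt tq].
    by move: ba; rewrite ltNge /a /b ge_max !le_min xy (le_trans xt tq) (le_trans pt ty) (le_trans pt tq).
  rewrite (out y xy (lexx y)).1 (out x (lexx x) xy).1 subrr (Int0_open xy lz)//.
  by move=> t /andP[/ltW xt /ltW ty]; rewrite (out t xt ty).2.
rewrite (Int_chasles lz (le_trans xa ab) by_) (Int_chasles lz xa ab).
rewrite (Int0_open xa lz); last first.
  move=> t /andP[xt ta]; rewrite /zext; case: ifP => // /andP[pt _].
  by move: ta; rewrite lt_max ltNge (ltW xt)/= ltNge pt.
rewrite (Int0_open by_ lz); last first.
  move=> t /andP[bt ty]; rewrite /zext; case: ifP => // /andP[_ tq].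
  by move: bt; rewrite gt_min [y < t]ltNge (ltW ty)/= ltNge tq.
rewrite add0r addr0 (@eq_Int _ _ _ _ f); last first.
  by move=> t /andP[at_ tb]; rewrite /zext (le_trans pa at_) (le_trans tb bq).
rewrite -(pF a b)//; congr (_ - _).
  rewrite /zext (le_trans (le_trans pa ab) by_)/= /b.
  by case: (leP y q) => qy; rewrite ?Fq.
rewrite /zext (le_trans (le_trans xa ab) bq) andbT /a.
by case: (leP p x) => xp; rewrite ?Fp.
Qed.

Lemma primitiveZ a b (k : R) F f : locint f -> primitive a b F f ->
  primitive a b (fun x => k * F x) (fun x => k * f x).
Proof. by move=> lf pF x y ax xy yb; rewrite -mulrBr pF// IntZ. Qed.

Lemma primitiveD a b F f H h : locint f -> locint h -> primitive a b F f -> primitive a b H h ->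
  primitive a b (fun x => F x + H x) (fun x => f x + h x).
Proof. by move=> lf lh pF pH x y ax xy yb; rewrite opprD addrACA pF// pH// IntD. Qed.

Lemma primitive_bigsum a b (I : Type) (s : seq I) (F f : I -> R -> R) :
  (forall i, l2 (f i)) -> (forall i, primitive a b (F i) (f i)) ->
  primitive a b (fun x => \sum_(i <- s) F i x) (fun x => \sum_(i <- s) f i x).
Proof.
move=> lf pF; elim: s => [|i s IH] x y ax xy yb.
  rewrite !big_nil subrr (@eq_Int _ _ _ _ (fun=> 0)) ?Int_cst ?mul0r//.
  by move=> t _; rewrite big_nil.
rewrite !big_cons (@eq_Int _ _ _ _ (fun t => f i t + \sum_(i <- s) f i t)); last first.
  by move=> t _; rewrite big_cons.
by rewrite (primitiveD (l2_locint (lf i)) (l2_locint (l2_sum s lf)) (pF i) IH ax xy yb).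
Qed.

Section kink.
Variables (n : nat) (y w : R).
Hypothesis (w0 : 0 < w).

Let J := Int y (y + w) (horner (Vp n y (y + w))).
Let yw : y <= y + w. Proof. by rewrite lerDl ltW. Qed.
Let J0 : J != 0. Proof. by apply: IntVp_neq0; rewrite ltrDl. Qed.

(** The j-th derivative of a bump of mass 1 on [[y, y + w]], the profile of u'' at a unit change of
    slope. It is not cut off at the ends of [0, 1]. *)
Definition kink j := zext y (y + w) (fun x =>
  (Int y (y + w) (horner (Vp n y (y + w))))^-1 * (Vp n y (y + w))^`(j).[x]).

Lemma kink_l2 j : l2 (kink j).
Proof. by apply: zext_l2; apply: l2Z; exact: horner_l2. Qed.

Lemma kink_chain c d : chain c d n kink.
Proof.
split => [j|j jn]; first exact: kink_l2.
apply: zext_primitive.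
- by apply: l2Z; exact: horner_l2.
- by apply: primitiveZ; [apply: l2_locint; exact: horner_l2|exact: horner_derivn_primitive].
- by rewrite Vp_root_a// mulr0.
- by rewrite Vp_root_b// mulr0.
Qed.

Lemma kink_continuous : (0 < n)%N -> continuous (kink 0).
Proof.
move=> n0; have k0 : kink 0 y = 0 by rewrite /kink /zext lexx yw Vp_root_a// mulr0.
have -> : kink 0 = SI y (kink 1).
  apply/funext => x; have [yx|xy] := leP y x.
    have := (kink_chain y x).2 0%N n0 y x (lexx y) yx (lexx x).
    by rewrite k0 subr0 SIE.
  have := (kink_chain x y).2 0%N n0 x y (lexx x) (ltW xy) (lexx y).
  by rewrite k0 sub0r /SI (@Int_gt _ y x _ xy) sub0r => <-; rewrite opprK.
exact: SI_continuous (kink_l2 1).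
Qed.

Lemma kink_ge0 x : 0 <= kink 0 x.
Proof.
rewrite /kink /zext; case: ifP => // /andP[yx xw].
have b0 := beta_gt0 (R := R) n.
rewrite -/J /J Int_Vp// derivn0 /Vp hornerM !horner_exp !hornerXsubC.
move: (beta n) b0 => b b0.
have -> : x - (y + w) = - (y + w - x) by ring.
have s0 : (-1) ^+ n != 0 :> R by rewrite signr_eq0.
rewrite [(- (y + w - x)) ^+ n]exprNn; move: ((-1) ^+ n) s0 => sgn s0.
have W0 : 0 < (y + w - y) ^+ n.*2.+1 by rewrite exprn_gt0// addrAC subrr add0r.
have X0 : 0 <= (x - y) ^+ n by rewrite exprn_ge0// subr_ge0.
have Z0 : 0 <= (y + w - x) ^+ n by rewrite exprn_ge0// subr_ge0.
apply: (@le_trans _ _ ((x - y) ^+ n * (y + w - x) ^+ n / (b * (y + w - y) ^+ n.*2.+1))); first by nneg.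
move: ((x - y) ^+ n) ((y + w - x) ^+ n) ((y + w - y) ^+ n.*2.+1) W0 => X Z W W0.
by rewrite le_eqVlt; apply/orP; left; apply/eqP; field; rewrite s0 !gt_eqF.
Qed.

Lemma kink_mass c d : c <= y -> y + w <= d -> Int c d (kink 0) = 1.
Proof.
move=> cy wd; rewrite Int_zext//.
- rewrite IntZ; last by apply: l2_locint; exact: horner_l2.
  by rewrite derivn0 mulVf.
- by apply: locintZ; apply: l2_locint; exact: horner_l2.
- by apply: l2_locint; exact: kink_l2.
Qed.

Hypothesis y0 : 0 <= y.

Let lk : locint (kink 0). Proof. by apply: l2_locint; exact: kink_l2. Qed.

Let SI_kink01 t : 0 <= t -> 0 <= SI 0 (kink 0) t <= 1.
Proof.
move=> t0; rewrite SIE//; apply/andP; split; first by apply: Int_ge0 => x _; exact: kink_ge0.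
have <- : Int 0 (Num.max t (y + w)) (kink 0) = 1.
  by apply: kink_mass => //; rewrite le_max lexx orbT.
by apply: Int_sub => //; [exact: kink_ge0|rewrite le_max lexx].
Qed.

Let SI_kink_low t : 0 <= t -> t <= y -> SI 0 (kink 0) t = 0.
Proof.
move=> t0 ty; rewrite SIE// (Int0_open t0 lk)// => x /andP[_ xt].
by rewrite /kink /zext [y <= x]leNgt (lt_le_trans xt ty).
Qed.

Let SI_kink_high t : y + w <= t -> SI 0 (kink 0) t = 1.
Proof. by move=> yt; rewrite SIE ?kink_mass// (le_trans y0)// (le_trans yw). Qed.

(** The primitive of the bump lies between 0 and 1 and is a step function off [[y, y + w]], so it
    differs from the step by at most 1 on a set of length w. *)
Lemma kink_ramp t : 0 <= t -> `|SI 0 (SI 0 (kink 0)) t - Num.max 0 (t - y)| <= w.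
Proof.
move=> t0; have lS : locint (SI 0 (kink 0)) by apply: l2_locint; apply: SI_l2; exact: kink_l2.
have [ty|/ltW yt] := leP t y.
  rewrite max_l ?subr_le0// subr0 SIE// (@eq_Int _ _ _ _ (fun=> 0)); last first.
    by move=> x /andP[x0 xt]; rewrite SI_kink_low// (le_trans xt).
  by rewrite Int_cst// mul0r normr0 ltW.
rewrite max_r ?subr_ge0// SIE// (Int_chasles lS y0 yt).
rewrite (@eq_Int _ 0 y _ (fun=> 0)); last by move=> x /andP[x0 xt]; exact: SI_kink_low.
rewrite Int_cst// mul0r add0r.
have E : Int y t (fun x => 1 - SI 0 (kink 0) x) = (t - y) - Int y t (SI 0 (kink 0)).
  by rewrite IntB//; [rewrite Int_cst// mul1r|exact: locint_cst].
rewrite distrC -E.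
have l1 : locint (fun x => 1 - SI 0 (kink 0) x) by apply: locintB => //; exact: locint_cst.
have pos x : y <= x -> 0 <= 1 - SI 0 (kink 0) x <= 1.
  move=> yx; have /andP[h1 h2] := SI_kink01 (le_trans y0 yx).
  by rewrite subr_ge0 h2 gerBl.
rewrite ger0_norm; last by apply: Int_ge0 => x /andP[yx _]; have /andP[] := pos x yx.
have bd z : y <= z -> Int y z (fun x => 1 - SI 0 (kink 0) x) <= z - y.
  move=> yz; rewrite -[leRHS]mul1r -Int_cst//; apply: Int_le => //; first exact: locint_cst.
  by move=> x /andP[yx _]; have /andP[] := pos x yx.
have [tw|/ltW wt] := leP t (y + w).
  by apply: (le_trans (bd t yt)); rewrite lerBlDl.
rewrite (Int_chasles l1 yw wt) [X in _ + X](@eq_Int _ _ _ _ (fun=> 0)); last first.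
  by move=> x /andP[wx _]; rewrite SI_kink_high// subrr.
by rewrite Int_cst// mul0r addr0; apply: (le_trans (bd _ yw)); rewrite addrAC subrr add0r.
Qed.

Lemma kink_energy : Int 0 1 (fun x => kink n x ^+ 2) <= acoef n / w ^+ n.*2.+1.
Proof.
pose h x := (J^-1 * (Vp n y (y + w))^`(n).[x]) ^+ 2.
have lh : locint h by apply: (l2Z J^-1 (horner_l2 _)).2.
have E : (fun x => kink n x ^+ 2) = zext y (y + w) h.
  by apply/funext => x; rewrite /kink /zext; case: ifP => // _; rewrite expr0n.
have lz : locint (zext y (y + w) h) by rewrite -E; exact: (kink_l2 n).2.
(* The transition may stick out of [0, 1]; enlarging the interval only increases the energy. *)
apply: (@le_trans _ _ (Int 0 (Num.max 1 (y + w)) (fun x => kink n x ^+ 2))).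
  apply: Int_sub => //; [exact: (kink_l2 n).2|by move=> x; exact: sqr_ge0|by rewrite le_max lexx].
rewrite E Int_zext//; last by rewrite le_max lexx orbT.
rewrite (@eq_Int _ _ _ _ (fun x => J^-1 ^+ 2 * (Vp n y (y + w))^`(n).[x] ^+ 2)); last first.
  by move=> x _; rewrite /h exprMn.
rewrite IntZ; last exact: (horner_l2 _).2.
rewrite Int_Vp_sqr// /J Int_Vp// (_ : y + w - y = w); last by ring.
have b0 := beta_gt0 (R := R) n; have w1 : 0 < w ^+ n.*2.+1 by rewrite exprn_gt0.
rewrite /acoef; move: (beta n) b0 => b b0.
rewrite exprVn !exprMn sqrr_sign mul1r le_eqVlt; apply/orP; left; apply/eqP.
by field; rewrite !gt_eqF.
Qed.

End kink.

(** Used where transitions or jump layers may overlap: with Z the sum of the |z i|, the square of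
    the sum costs Z times the sum of the squares with weights |z i|. *)
Lemma weighted_CS (I : Type) (s : seq I) (z f : I -> R) :
  (\sum_(i <- s) z i * f i) ^+ 2 <= (\sum_(i <- s) `|z i|) * \sum_(i <- s) `|z i| * f i ^+ 2.
Proof.
elim: s => [|i s IH]; first by rewrite !big_nil expr0n mul0r.
rewrite !big_cons; set S := \sum_(i <- s) z i * f i in IH *.
set Z := \sum_(i <- s) `|z i| in IH *; set T := \sum_(i <- s) `|z i| * f i ^+ 2 in IH *.
have Z0 : 0 <= Z by apply: sumr_ge0 => ? _.
have T0 : 0 <= T by apply: sumr_ge0 => ? _; rewrite mulr_ge0 ?sqr_ge0.
have H : 2 * (`|f i| * `|S|) <= T + Z * f i ^+ 2.
  rewrite -ler_sqr ?nnegrE; [|by rewrite mulr_ge0 ?mulr_ge0|by rewrite addr_ge0// mulr_ge0 ?sqr_ge0].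
  rewrite exprMn exprMn !real_normK ?num_real//.
  apply: (@le_trans _ _ (2 ^+ 2 * (f i ^+ 2 * (Z * T)))).
    by do 2 (apply: ler_wpM2l; first exact: sqr_ge0).
  rewrite -subr_ge0; apply: le_trans (sqr_ge0 (T - Z * f i ^+ 2)) _.
  by rewrite le_eqVlt; apply/orP; left; apply/eqP; ring.
have H2 : 2 * (z i * f i * S) <= `|z i| * (T + Z * f i ^+ 2).
  apply: (@le_trans _ _ (`|z i| * (2 * (`|f i| * `|S|)))); last exact: ler_wpM2l.
  apply: (le_trans (ler_norm _)); rewrite !normrM [`|2|]ger0_norm// le_eqVlt; apply/orP; left; apply/eqP; ring.
have E : `|z i| ^+ 2 = z i ^+ 2 by rewrite real_normK ?num_real.
have -> : (z i * f i + S) ^+ 2 = z i ^+ 2 * f i ^+ 2 + 2 * (z i * f i * S) + S ^+ 2 by ring.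
have -> : (`|z i| + Z) * (`|z i| * f i ^+ 2 + T) =
   z i ^+ 2 * f i ^+ 2 + `|z i| * (T + Z * f i ^+ 2) + Z * T by rewrite -E; ring.
by apply: lerD => //; rewrite lerD2l.
Qed.

Section recovery.
Variables (d : nat) (K : {poly R}) (Y : seq (R * R)) (a0 b0 w : R).
Hypotheses (sK : (size K <= d.+1)%N) (w0 : 0 < w).

Let n := d.+1.

Definition bend j x := K^`(j).[x] + \sum_(p <- Y) p.2 * kink d.+1 p.1 w j x.

Definition recov j : R -> R := match j with
  | 0 => fun x => SI 0 (SI 0 (bend 0)) x + (a0 + b0 * x)
  | 1 => fun x => SI 0 (bend 0) x + b0
  | j'.+2 => bend j' end.

Lemma bend_l2 j : l2 (bend j).
Proof.
apply: l2D; first exact: horner_l2.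
by apply: l2_sum => p; apply: l2Z; exact: kink_l2.
Qed.

Lemma recov_chain : chain 0 1 d.+3 recov.
Proof.
have lb := bend_l2 0; have lS := SI_l2 0 lb; split.
  move=> [|[|j]] /=; [|by apply: l2D => //; exact: l2_cst|exact: bend_l2].
  by apply: l2D; [exact: SI_l2|exact: affine_l2].
move=> [|[|j]] jd.
- move=> x y _ xy _ /=; rewrite opprD addrACA SI_sub//; last exact: l2_locint.
  by rewrite affine_increment// (IntD x y (l2_locint lS) (locint_cst b0)).
- by move=> x y _ xy _ /=; rewrite opprD addrACA subrr addr0 SI_sub//; exact: l2_locint.
apply: primitiveD.
- by apply: l2_locint; exact: horner_l2.
- by apply: l2_locint; apply: l2_sum => p; apply: l2Z; exact: kink_l2.
- exact: horner_derivn_primitive.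
refine (@primitive_bigsum 0 1 _ Y (fun r x => r.2 * kink d.+1 r.1 w j x) (fun r x => r.2 * kink d.+1 r.1 w j.+1 x) _ _).
  by move=> p; apply: l2Z; exact: kink_l2.
move=> p; apply: primitiveZ; first by apply: l2_locint; exact: kink_l2.
exact: ((kink_chain d.+1 p.1 w 0 1).2 j jd).
Qed.

Lemma recov_continuous2 : continuous (recov 2).
Proof.
have H : forall Y', continuous (fun x => \sum_(p <- Y') p.2 * kink d.+1 p.1 w 0 x).
  elim=> [|p Y' IH] x; first by under eq_fun do rewrite big_nil; exact: cvg_cst.
  have -> : (fun x => \sum_(p <- p :: Y') p.2 * kink d.+1 p.1 w 0 x) =
      (fun x => p.2 * kink d.+1 p.1 w 0 x + \sum_(p <- Y') p.2 * kink d.+1 p.1 w 0 x).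
    by apply/funext => t; rewrite big_cons.
  apply: cvgD; last exact: IH.
  by apply: cvgMr; exact: kink_continuous.
by move=> x; apply: cvgD; [exact: continuous_horner|exact: H].
Qed.

Let Z := \sum_(p <- Y) `|p.2|.

Lemma recov_energy (c eps : nat -> R) : 0 < c d.+2 -> eps d.+3 = w -> (forall p : R * R, p \in Y -> 0 <= p.1) ->
  (G c eps d.+3 (recov 0) <=
   (Int 0 1 (fun x => K.[x] ^+ 2) + (size Y)%:R + Z ^+ 2 * (c d.+2 * acoef d.+1))%:E)%E.
Proof.
move=> c0 ew Y0; have cR := recov_chain.
have uL : recov 0 \in L2 0 1 by apply: l2_L2; exact: cR.1.
have E0 : recov 0 = recov 0%N %[ae mu in `]0, 1[%classic] by exact: ae_all.
have [su wd] := chain_sobolev ltr01 cR uL E0.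
have e0 : 0 < eps d.+3 by rewrite ew.
rewrite (G_chain c e0 uL su cR recov_continuous2); last first.
  by move=> j jd; split; [exact: (@chain_weak _ _ _ _ _ _ _ ltr01 cR uL E0 jd)|exact: wd].
rewrite ew lee_fin; set kappa := (Num.sqrt w)^-1.
apply: lerD.
  have llow : l2 (fun x => low kappa (recov 2) x * recov 2 x).
    by apply: (@l2_bounded_mul _ _ _ 1); [exact: cR.1|apply: measurable_low; exact: recov_continuous2|exact: low_norm].
  have lhigh : locint (high kappa (recov 2)) by apply: high_locint; exact: recov_continuous2.
  pose ind (p : R * R) x := zext p.1 (p.1 + w) (fun=> 1 : R) x.
  have lind (p : R * R) : l2 (ind p) by apply: zext_l2; exact: l2_cst.
  rewrite -IntZ// -IntD//; [|exact: llow.2|exact: locintZ].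
  apply: (@le_trans _ _ (Int 0 1 (fun x => K.[x] ^+ 2 + w^-1 * \sum_(p <- Y) ind p x))).
    apply: Int_le.
    - by apply: locintD; [exact: llow.2|exact: locintZ].
    - by apply: locintD; [exact: (horner_l2 K).2|apply: locintZ; apply: l2_locint; exact: l2_sum].
    move=> x _; rewrite -truncated_square_split// /truncated_square.
    have ind0 (p : R * R) : 0 <= ind p x by rewrite /ind /zext; case: ifP.
    (* On the support of a kink the minimum is bounded by 1/eps, over a length of at most w = eps,
       hence at most 1 per kink. Elsewhere the second derivative is the polynomial K. *)
    have [/hasP[p pY px]|/hasPn nY] := boolP (has (fun p : R * R => p.1 <= x <= p.1 + w) Y).
      rewrite ge_min; apply/orP; right; apply: ler_wpDl; first exact: sqr_ge0.
      apply: ler_peMr; first by rewrite invr_ge0 ltW.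
      rewrite (big_rem p pY)/= {1}/ind /zext px lerDl; apply: sumr_ge0 => *; exact: ind0.
    rewrite ge_min; apply/orP; left; rewrite [recov 2]/= /bend derivn0.
    rewrite [\sum_(p <- Y) p.2 * _]big1_seq ?addr0; last first.
      by move=> p /= pY; rewrite /kink /zext (negbTE (nY p pY)) mulr0.
    rewrite lerDl mulr_ge0// ?invr_ge0 ?(ltW w0)//; apply: sumr_ge0 => *; exact: ind0.
  rewrite IntD; [|exact: (horner_l2 K).2|by apply: locintZ; apply: l2_locint; exact: l2_sum].
  rewrite lerD2l IntZ; last by apply: l2_locint; exact: l2_sum.
  rewrite mulrC ler_pdivrMr//.
  elim: Y Y0 => [|p Y' IH] Y0.
    rewrite (@eq_Int _ _ _ _ (fun=> 0)) ?Int_cst ?mul0r//.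
    by move=> t _; rewrite big_nil.
  rewrite (@eq_Int _ _ _ _ (fun x => ind p x + \sum_(p <- Y') ind p x)); last first.
    by move=> t _; rewrite big_cons.
  rewrite IntD; [|exact: l2_locint|by apply: l2_locint; exact: l2_sum].
  rewrite /= -natr1 mulrDl mul1r addrC; apply: lerD.
    by apply: IH => q qY; apply: Y0; rewrite inE qY orbT.
  have p0 : 0 <= p.1 by apply: Y0; rewrite mem_head.
  apply: (@le_trans _ _ (Int 0 (Num.max 1 (p.1 + w)) (ind p))).
    apply: Int_sub => //; [exact: l2_locint| |by rewrite le_max lexx].
    by move=> x; rewrite /ind /zext; case: ifP.
  have pw : p.1 <= p.1 + w by rewrite lerDl ltW.
  rewrite Int_zext//; [|by rewrite le_max lexx orbT|exact: locint_cst|exact: (l2_locint (lind p))].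
  by rewrite Int_cst// mul1r addrAC subrr add0r.
have KZ x : recov d.+3 x = \sum_(p <- Y) p.2 * kink d.+1 p.1 w d.+1 x.
  rewrite /= /bend derivn_poly0 ?horner0 ?add0r//.
have lk p : l2 (kink d.+1 p w d.+1) by exact: kink_l2.
have Z0 : 0 <= Z by apply: sumr_ge0.
have IK : Int 0 1 (fun x => recov d.+3 x ^+ 2) <= Z ^+ 2 * (acoef d.+1 / w ^+ d.*2.+3).
  apply: (@le_trans _ _ (Int 0 1 (fun x => Z * \sum_(p <- Y) `|p.2| * kink d.+1 p.1 w d.+1 x ^+ 2))).
    apply: Int_le; first exact: (cR.1 _).2.
      apply: locintZ; elim: Y => [|p Y' IH].
        by apply: eq_locint (locint_cst 0) => x; rewrite big_nil.
      apply: (@eq_locint _ (fun x => `|p.2| * kink d.+1 p.1 w d.+1 x ^+ 2 + \sum_(p <- Y') `|p.2| * kink d.+1 p.1 w d.+1 x ^+ 2)).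
        by move=> x; rewrite big_cons.
      by apply: locintD => //; apply: locintZ; exact: (lk _).2.
    by move=> x _; rewrite KZ; exact: weighted_CS.
  have H : locint (fun x => \sum_(p <- Y) `|p.2| * kink d.+1 p.1 w d.+1 x ^+ 2) /\
      Int 0 1 (fun x => \sum_(p <- Y) `|p.2| * kink d.+1 p.1 w d.+1 x ^+ 2) <= Z * (acoef d.+1 / w ^+ d.*2.+3).
    rewrite /Z; elim: Y Y0 => [|p Y' IH] Y0.
      split; first by apply: eq_locint (locint_cst 0) => x; rewrite big_nil.
      rewrite big_nil mul0r (@eq_Int _ _ _ _ (fun=> 0)) ?Int_cst ?mul0r//.
      by move=> t _; rewrite big_nil.
    have [|IH1 IH2] := IH; first by move=> q qY; apply: Y0; rewrite inE qY orbT.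
    have l1 : locint (fun x => `|p.2| * kink d.+1 p.1 w d.+1 x ^+ 2) by apply: locintZ; exact: (lk _).2.
    split.
      by apply: eq_locint (locintD l1 IH1) => x; rewrite big_cons.
    rewrite (@eq_Int _ _ _ _ (fun x => `|p.2| * kink d.+1 p.1 w d.+1 x ^+ 2 + \sum_(p <- Y') `|p.2| * kink d.+1 p.1 w d.+1 x ^+ 2)); last first.
      by move=> x _; rewrite big_cons.
    rewrite IntD// big_cons mulrDl; apply: lerD => //.
    rewrite IntZ; last exact: (lk _).2.
    apply: ler_wpM2l => //; apply: kink_energy => //.
    by apply: Y0; rewrite mem_head.
  rewrite IntZ; last exact: H.1.
  by rewrite expr2 -mulrA; apply: ler_wpM2l => //; exact: H.2.
apply: (@le_trans _ _ (c d.+2 * w ^+ d.*2.+3 * (Z ^+ 2 * (acoef d.+1 / w ^+ d.*2.+3)))).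
  by apply: ler_wpM2l => //; nneg.
have w1 : w ^+ d.*2.+3 != 0 by rewrite expf_neq0// gt_eqF.
by rewrite le_eqVlt; apply/orP; left; apply/eqP; field.
Qed.

Lemma recov_approx (g : R -> R) (e : R) : l2 g -> (forall p : R * R, p \in Y -> 0 <= p.1) ->
  (forall x, 0 <= x <= 1 -> `|SI 0 (horner K) x - SI 0 g x| <= e) ->
  forall t, 0 <= t <= 1 ->
  `|recov 0 t - (SI 0 (SI 0 g) t + (a0 + b0 * t) + ramp Y t)| <= e + Z * w.
Proof.
move=> lg Y0 He t /andP[t0 t1].
have lK : l2 (horner K) := horner_l2 K.
pose Q x := \sum_(p <- Y) p.2 * kink d.+1 p.1 w 0 x.
have lQ : l2 Q by apply: l2_sum => p; apply: l2Z; exact: kink_l2.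
have SE x : 0 <= x -> SI 0 (bend 0) x = SI 0 (horner K) x + SI 0 Q x.
  move=> x0; rewrite !SIE// -IntD; [|exact: l2_locint|exact: l2_locint].
  by apply: eq_Int => s _; rewrite /bend derivn0.
have PE : SI 0 (SI 0 (bend 0)) t = SI 0 (SI 0 (horner K)) t + SI 0 (SI 0 Q) t.
  rewrite !(SIE _ t0) -IntD; [|by apply: l2_locint; exact: SI_l2|by apply: l2_locint; exact: SI_l2].
  by apply: eq_Int => x /andP[x0 _]; exact: SE.
have QE : SI 0 (SI 0 Q) t = \sum_(p <- Y) p.2 * SI 0 (SI 0 (kink d.+1 p.1 w 0)) t.
  rewrite /Q; elim: Y => [|p Y' IH].
    have z x : 0 <= x -> SI 0 (fun x => \sum_(p <- [::]) p.2 * kink d.+1 p.1 w 0 x) x = 0.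
      by move=> x0; rewrite SIE// (@eq_Int _ _ _ _ (fun=> 0)) ?Int_cst ?mul0r// => s _; rewrite big_nil.
    rewrite big_nil SIE// (@eq_Int _ _ _ _ (fun=> 0)) ?Int_cst ?mul0r// => s /andP[s0 _]; exact: z.
  have lk := kink_l2 d.+1 p.1 w 0; have lkS := SI_l2 0 lk.
  have lY : l2 (fun x => \sum_(p <- Y') p.2 * kink d.+1 p.1 w 0 x).
    by apply: l2_sum => q; apply: l2Z; exact: kink_l2.
  have lYS := SI_l2 0 lY.
  rewrite big_cons -IH !(SIE _ t0) -IntZ; last exact: l2_locint.
  rewrite -IntD; [|by apply: locintZ; exact: l2_locint|exact: l2_locint].
  apply: eq_Int => x /andP[x0 _]; rewrite !(SIE _ x0) -IntZ; last exact: l2_locint.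
  rewrite -IntD; [|by apply: locintZ; exact: l2_locint|exact: l2_locint].
  by apply: eq_Int => s _; rewrite big_cons.
have -> : recov 0 t - (SI 0 (SI 0 g) t + (a0 + b0 * t) + ramp Y t) =
    (SI 0 (SI 0 (horner K)) t - SI 0 (SI 0 g) t) + (SI 0 (SI 0 Q) t - ramp Y t).
  rewrite /recov PE.
  by move: (SI 0 (SI 0 (horner K)) t) (SI 0 (SI 0 Q) t) (SI 0 (SI 0 g) t) (ramp Y t) => *; ring.
apply: (le_trans (ler_normD _ _)); apply: lerD.
  have l1 := SI_l2 0 lK; have l2_ := SI_l2 0 lg.
  rewrite !SIE// -IntB; [|exact: l2_locint|exact: l2_locint].
  apply: (@le_trans _ _ (e * (t - 0))).
    apply: Int_norm_le => //; first by apply: locintB; exact: l2_locint.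
    by move=> x /andP[x0 xt]; apply: He; rewrite x0 (le_trans xt).
  rewrite subr0; apply: ler_piMr => //.
  by apply: le_trans (He 0 _); rewrite ?normr_ge0// lexx ler01.
rewrite QE /ramp -sumrB /Z mulr_suml; elim: Y Y0 => [|p Y' IH] Y0; first by rewrite !big_nil normr0.
rewrite !big_cons; apply: (le_trans (ler_normD _ _)); apply: lerD.
  rewrite -mulrBr normrM; apply: ler_wpM2l => //; apply: kink_ramp => //.
  by apply: Y0; rewrite mem_head.
by apply: IH => q qY; apply: Y0; rewrite inE qY orbT.
Qed.

End recovery.
End kinks.

(** * The upper bound *)

Section upper_bound.
Context {R : realType}.
Notation mu := (@lebesgue_measure R).
Implicit Types (a b t x : R) (i l : nat).

Lemma sum_flatten (T : Type) (V : nmodType) (f : nat -> seq T) (F : T -> V) (r : seq nat) :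
  \sum_(p <- flatten [seq f i | i <- r]) F p = \sum_(i <- r) \sum_(p <- f i) F p.
Proof.
elim: r => [|i r IH]; first by rewrite /= !big_nil.
by rewrite /= big_cat big_cons IH.
Qed.

Section nodes.
Variables (s : seq R) (u g : R -> R) (A B : nat -> R).
Hypothesis nf : nform s u g A B.

Let m := (size s).-1.
Let ps : itv_partition 0 1 s. Proof. by case: nf. Qed.
Let lg : l2 g. Proof. by case: nf. Qed.

Let msz : m.+1 = size s. Proof. by rewrite prednK//; exact: partition_size. Qed.

Let x_ i := rgt s i.
Let sg i := B i.+1 - B i.
Let et i := (A i.+1 + B i.+1 * x_ i) - (A i + B i * x_ i).

Definition slope_sum : R := \sum_(i <- iota 0 m) `|sg i|.
Definition jump_sum : R := \sum_(i <- iota 0 m) `|et i|.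

(* A jump of height eta is approximated by the slope eta / delta between two kinks at
   distance delta. *)
Definition knots (delta : R) i : seq (R * R) :=
  let sigma := B i.+1 - B i in
  let eta := (A i.+1 + B i.+1 * rgt s i) - (A i + B i * rgt s i) in
  if vjump s A B i then [:: (rgt s i, sigma + eta / delta); (rgt s i + delta, - (eta / delta))]
  else if sjump B i then [:: (rgt s i, sigma)] else [::].

Definition knot_seq delta := flatten [seq knots delta i | i <- iota 0 (size s).-1].

Let et0 i : ~~ vjump s A B i -> et i = 0.
Proof. by rewrite /vjump negbK /et /x_ => /eqP ->; rewrite subrr. Qed.

Let sg0 i : ~~ sjump B i -> sg i = 0.
Proof. by rewrite /sjump negbK /sg => /eqP ->; rewrite subrr. Qed.

Lemma size_knots delta : (size (knot_seq delta))%:R = jump_cost s A B :> R.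
Proof.
rewrite -sum1_size /knot_seq sum_flatten /jump_cost -natrM -natrD; congr (_%:R).
rewrite big_distrr -big_split /= -(big_mkord xpredT (fun i => (2 * vjump s A B i + (~~ vjump s A B i && sjump B i))%N)).
rewrite /index_iota subn0; apply: eq_bigr => i _; rewrite sum1_size /knots.
by case: (vjump s A B i) => //=; case: (sjump B i).
Qed.

Let x_ge0 i : i \in iota 0 m -> 0 <= x_ i.
Proof.
rewrite mem_iota add0n => /andP[_ im]; rewrite /x_ -lftS.
by apply: (lft_ge0 ps); rewrite -msz ltnW.
Qed.

Lemma knots_ge0 delta (p : R * R) : 0 <= delta -> p \in knot_seq delta -> 0 <= p.1.
Proof.
move=> d0 /flattenP[Y /mapP[i im ->]]; have xi := x_ge0 im; rewrite /knots.
case: ifP => _; first by rewrite !inE => /orP[] /eqP -> //=; rewrite addr_ge0.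
by case: ifP => // _; rewrite inE => /eqP ->.
Qed.

Lemma knots_mass delta : 0 < delta ->
  \sum_(p <- knot_seq delta) `|p.2| <= slope_sum + jump_sum * (2 / delta).
Proof.
move=> d0; rewrite /knot_seq sum_flatten /slope_sum /jump_sum mulr_suml -big_split /=.
apply: ler_sum => i _; rewrite /knots -/(x_ i) -/(sg i) -/(et i).
have dn : `|et i / delta| = `|et i| / delta by rewrite normrM normfV (gtr0_norm d0).
case: ifP => [_|/negbT/et0 ->].
  rewrite !big_cons big_nil /= normrN addr0.
  apply: (le_trans (lerD (ler_normD _ _) (lexx _))).
  by rewrite dn le_eqVlt; apply/orP; left; apply/eqP; field; rewrite gt_eqF.
rewrite normr0 mul0r addr0; case: ifP => _; first by rewrite big_cons big_nil addr0.
by rewrite big_nil.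
Qed.

Let pos t := Num.max 0 t : R.

Let rampE delta t : delta != 0 ->
  ramp (knot_seq delta) t =
  \sum_(i <- iota 0 m) (sg i * pos (t - x_ i) + et i * ((pos (t - x_ i) - pos (t - x_ i - delta)) / delta)).
Proof.
move=> d0; rewrite /ramp /knot_seq sum_flatten; apply: eq_bigr => i _.
rewrite /knots -/(x_ i) -/(sg i) -/(et i) -/(pos _).
case: ifP => [_|/negbT/et0 ->].
  rewrite !big_cons big_nil addr0 /= (_ : t - (x_ i + delta) = t - x_ i - delta); last by ring.
  rewrite -/(pos (t - x_ i)) -/(pos (t - x_ i - delta)).
  by move: (sg i) (et i) (pos (t - x_ i)) (pos (t - x_ i - delta)) => *; field.
rewrite mul0r addr0; case: ifP => [_|/negbT/sg0 ->]; first by rewrite big_cons big_nil addr0.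
by rewrite big_nil mul0r.
Qed.

Let step i t : R := \1_(`]x_ i, +oo[%classic) t.

Let stepE i t : step i t = if x_ i < t then 1 else 0.
Proof.
rewrite /step indicE; case: ifP => H; first by rewrite mem_set//= in_itv/= H.
by rewrite memNset//= in_itv/= H.
Qed.

(** The pieces of the normal form as one function on the line: the affine part of the first piece
    plus the slope and height changes at the nodes passed so far. *)
Definition node_target t : R := SI 0 (SI 0 g) t + (A 0%N + B 0%N * t) +
  \sum_(i <- iota 0 m) (sg i * pos (t - x_ i) + et i * step i t).

Lemma node_target_l2 : l2 node_target.
Proof.
apply: l2D; first by apply: l2D; [do 2 apply: SI_l2|exact: affine_l2].
apply: l2_sum => i; apply: l2D; apply: l2Z; last by apply: indic_l2; exact: measurable_itv.
apply: continuous_l2 => x; apply: (@continuous_max _ _ (fun=> 0) (fun t => t - x_ i)).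
  exact: cvg_cst.
by apply: cvgB; [exact: cvg_id|exact: cvg_cst].
Qed.

Let telescope i t : (i <= m)%N -> lft s i < t -> t < rgt s i \/ i = m ->
  \sum_(l <- iota 0 m) (sg l * pos (t - x_ l) + et l * step l t) =
  (A i + B i * t) - (A 0%N + B 0%N * t).
Proof.
move=> im it ti; have below l : (l < i)%N -> x_ l < t.
  move=> li; apply: le_lt_trans it; rewrite /x_ -lftS; apply: (partition_le ps).
  by rewrite li -msz (leq_trans im).
have above l : (i <= l < m)%N -> t < x_ l.
  move=> /andP[il lm]; case: ti => [ti|e]; last by move: lm; rewrite -e ltnNge il.
  apply: lt_le_trans ti _; rewrite /x_ -!lftS; apply: (partition_le ps).
  by rewrite ltnS il -msz ltnS ltnW.
have -> : iota 0 m = iota 0 i ++ iota i (m - i) by rewrite -{2}[i]add0n -iotaD subnKC.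
rewrite big_cat /= [X in _ + X]big1_seq ?addr0; last first.
  move=> l /=; rewrite mem_iota subnKC// => /above tl.
  by rewrite stepE ltNge (ltW tl)/= /pos max_l ?mulr0 ?addr0// subr_le0 ltW.
have -> : \sum_(l <- iota 0 i) (sg l * pos (t - x_ l) + et l * step l t) =
    \sum_(0 <= l < i) ((A l.+1 + B l.+1 * t) - (A l + B l * t)).
  rewrite /index_iota subn0; apply: eq_big_seq => l; rewrite mem_iota add0n => /andP[_ /below xt].
  by rewrite stepE xt /pos max_r ?subr_ge0 ?ltW// /sg /et; ring.
by rewrite telescope_sumr.
Qed.

Lemma node_target_ae : {ae mu, forall t, 0 < t < 1 -> u t = node_target t}.
Proof.
have [_ _ _ Hu] := nf.
apply: ae_imp (ae_and (ae_notin s) (ae_forall_lt Hu)) => t [ts H] /andP[t0 t1].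
have t01 : 0 < t <= 1 by rewrite t0 ltW.
have [i is_ /andP[h1 h2]] := locate ps t01.
have h3 : t < rgt s i.
  by rewrite lt_neqAle h2 andbT; apply: contraNneq ts => ->; exact: mem_nth.
rewrite (H i is_) ?h1// /node_target (@telescope i)//; [ring|by rewrite -ltnS msz|by left].
Qed.

(** The steep ramp that replaces a jump differs from it only on [[x_ i, x_ i + delta]], and there by
    at most the height of the jump. *)
Lemma knots_approx delta t : 0 < delta ->
  `|SI 0 (SI 0 g) t + (A 0%N + B 0%N * t) + ramp (knot_seq delta) t - node_target t| <=
  \sum_(i <- iota 0 m) `|et i| * zext (x_ i) (x_ i + delta) (fun=> 1) t.
Proof.
move=> d0; rewrite rampE ?gt_eqF// /node_target opprD addrACA subrr add0r -sumrB.
apply: (le_trans (ler_norm_sum _ _ _)); apply: ler_sum => i _.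
rewrite opprD addrACA subrr add0r -mulrBr normrM; apply: ler_wpM2l => //.
rewrite stepE /zext /pos; have [xt|tx] := ltP (x_ i) t; last first.
  rewrite max_l ?subr_le0// max_l; last by rewrite -addrA -opprD subr_le0 (le_trans tx)// lerDl ltW.
  by rewrite subrr mul0r subrr normr0; case: ifP.
have tx0 : 0 <= t - x_ i by rewrite subr_ge0 ltW.
rewrite (ltW xt) /= [Num.max 0 (t - x_ i)]max_r//.
have [td|dt] := leP t (x_ i + delta).
  rewrite max_l; last by rewrite -addrA -opprD subr_le0.
  rewrite subr0 ler_norml; apply/andP; split.
    by rewrite lerBrDr addNr divr_ge0// ltW.
  by rewrite lerBlDr (@le_trans _ _ 1) ?lerDr// ler_pdivrMr// mul1r lerBlDl.
rewrite max_r; last by rewrite -addrA -opprD subr_ge0 ltW.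
have -> : (t - x_ i - (t - x_ i - delta)) / delta = 1 by field; rewrite gt_eqF.
by rewrite subrr normr0.
Qed.

Lemma knots_L2 (U : R -> R) (E delta : R) : 0 < delta -> l2 U -> 0 <= E ->
  (forall t, 0 <= t <= 1 ->
    `|U t - (SI 0 (SI 0 g) t + (A 0%N + B 0%N * t) + ramp (knot_seq delta) t)| <= E) ->
  Int 0 1 (fun t => ((U \- u) \_ `]0%R, 1%R[%classic) t ^+ 2) <=
  2 * E ^+ 2 + 2 * (jump_sum ^+ 2 * delta).
Proof.
move=> d0 lU E0 HU; have uL : u \in L2 0 1 by case: nf.
have lq := node_target_l2.
pose z i := zext (x_ i) (x_ i + delta) (fun=> 1 : R).
have lz i : l2 (z i) by apply: zext_l2; exact: l2_cst.
have z2 i t : z i t ^+ 2 = z i t by rewrite /z /zext; case: ifP => _; rewrite ?expr1n ?expr0n.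
have -> : Int 0 1 (fun t => ((U \- u) \_ `]0%R, 1%R[%classic) t ^+ 2) = Int 0 1 (fun t => (U t - node_target t) ^+ 2).
  apply: ae_locint => //; first exact: (L2_l2 (L2_sub_in (l2_L2 0 1 lU) uL)).2.
    exact: (l2B lU lq).2.
  apply: ae_imp node_target_ae => t H t01; rewrite patchE mem_set ?in_itv//=.
  by rewrite H.
pose T t := \sum_(i <- iota 0 m) `|et i| * z i t.
have lT : locint T by apply: l2_locint; apply: l2_sum => i; exact: l2Z.
apply: (@le_trans _ _ (Int 0 1 (fun t => 2 * E ^+ 2 + (2 * jump_sum) * T t))).
  apply: Int_le; [exact: (l2B lU lq).2|by apply: locintD; [exact: locint_cst|exact: locintZ]|].
  move=> t t01; have T0 : 0 <= T t.
    by apply: sumr_ge0 => i _; rewrite mulr_ge0// /z /zext; case: ifP.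
  have H : `|U t - node_target t| <= E + T t.
    rewrite (_ : _ - _ = (U t - (SI 0 (SI 0 g) t + (A 0%N + B 0%N * t) + ramp (knot_seq delta) t)) +
      (SI 0 (SI 0 g) t + (A 0%N + B 0%N * t) + ramp (knot_seq delta) t - node_target t)); last first.
      by rewrite addrA subrK.
    by apply: (le_trans (ler_normD _ _)); apply: lerD; [exact: HU|exact: knots_approx].
  (* The layers may overlap, so T^2 is compared with T through the weighted inequality; indicators
     equal their squares. *)
  have T2 : T t ^+ 2 <= jump_sum * T t.
    apply: le_trans (weighted_CS _ _ _) _; rewrite le_eqVlt; apply/orP; left; apply/eqP.
    by rewrite /jump_sum; congr (_ * _); apply: eq_bigr => i _; rewrite ?normr_id ?z2.
  rewrite -[leLHS]real_normK ?num_real//.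
  apply: (@le_trans _ _ ((E + T t) ^+ 2)); first by rewrite lerXn2r ?nnegrE// addr_ge0.
  apply: (@le_trans _ _ (2 * E ^+ 2 + 2 * T t ^+ 2)); last by rewrite lerD2l -mulrA ler_wpM2l.
  rewrite -subr_ge0; apply: le_trans (sqr_ge0 (E - T t)) _.
  by rewrite le_eqVlt; apply/orP; left; apply/eqP; ring.
rewrite IntD; [|exact: locint_cst|exact: locintZ].
rewrite Int_cst// subr0 mulr1 lerD2l IntZ// -mulrA; apply: ler_wpM2l => //.
rewrite expr2 -mulrA; have H0 : 0 <= jump_sum by apply: sumr_ge0.
apply: ler_wpM2l => //; rewrite /T /jump_sum.
have : forall i, i \in iota 0 m -> 0 <= x_ i by exact: x_ge0.
elim: (iota 0 m) => [|i r IH] xi.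
  rewrite big_nil mul0r (@eq_Int _ _ _ _ (fun=> 0)) ?Int_cst ?mul0r//.
  by move=> t _; rewrite big_nil.
rewrite (@eq_Int _ _ _ _ (fun t => `|et i| * z i t + \sum_(i <- r) `|et i| * z i t)); last first.
  by move=> t _; rewrite big_cons.
rewrite IntD; [|by apply: locintZ; exact: l2_locint|by apply: l2_locint; apply: l2_sum => l; exact: l2Z].
rewrite big_cons mulrDl; apply: lerD; last by apply: IH => l lr; apply: xi; rewrite inE lr orbT.
rewrite IntZ; last exact: l2_locint.
apply: ler_wpM2l => //.
have x0 : 0 <= x_ i by apply: xi; rewrite mem_head.
have xd : x_ i <= x_ i + delta by rewrite lerDl ltW.
apply: (@le_trans _ _ (Int 0 (Num.max 1 (x_ i + delta)) (z i))).
  apply: Int_sub => //; [exact: l2_locint| |by rewrite le_max lexx].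
  by move=> t; rewrite /z /zext; case: ifP.
rewrite /z Int_zext//; [|by rewrite le_max lexx orbT|exact: locint_cst|exact: (l2_locint (lz i))].
by rewrite Int_cst// mul1r addrAC subrr add0r.
Qed.

End nodes.

(** The slopes that replace jumps are of order 1/spread and enter squared, against c [acoef], which
    is at most 1/(d + 2). With spread^4 = 1/(d + 1) the product is of order spread^2. *)
Definition spread d : R := (Num.sqrt (Num.sqrt d.+1%:R))^-1.

Lemma spread_gt0 d : 0 < spread d.
Proof. by rewrite invr_gt0 !sqrtr_gt0. Qed.

Lemma spread4 d : spread d ^+ 4 = d.+1%:R^-1.
Proof. by rewrite /spread exprVn (exprM _ 2 2) !sqr_sqrtr ?sqrtr_ge0. Qed.

Lemma spread_le1 d : spread d <= 1.
Proof.
rewrite -(@ler_pXn2r _ 4) ?nnegrE ?(ltW (spread_gt0 d))// spread4 expr1n invf_le1 ?ltr0n//.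
by rewrite ler1n.
Qed.

Lemma spread_cvg (e : R) : 0 < e -> \forall d \near \oo, spread d <= e.
Proof.
move=> e0; have e4 : 0 < e ^+ 4 by rewrite exprn_gt0.
have := near_infty_natSinv_lt (PosNum e4); apply: filterS => d /= H.
by rewrite -(@ler_pXn2r _ 4) ?nnegrE ?(ltW (spread_gt0 d)) ?(ltW e0)// spread4 ltW.
Qed.

Lemma limn_esup_le (a : nat -> \bar R) (C : R) :
  (forall e : R, 0 < e -> \forall k \near \oo, (a k <= (C + e)%:E)%E) -> (limn_esup a <= C%:E)%E.
Proof.
move=> H; apply/lee_addgt0Pr => e e0; rewrite -EFinD limn_esup_lim.
apply: lime_le; first exact: is_cvg_esups.
have [n _ Hn] := H e e0; exists n => // k /= nk.
by apply: ge_ereal_sup => _ [l /= kl <-]; apply: Hn; exact: leq_trans kl.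
Qed.

Lemma near_infty_shift3 (P : nat -> Prop) :
  (\forall d \near \oo, P d.+3) -> \forall k \near \oo, P k.
Proof.
move=> [n _ Hn]; exists n.+3 => // k nk.
by case: k nk => [|[|[|k]]] //= nk; exact: Hn.
Qed.

Lemma cell_le_spread (ck : R) d : 0 < ck -> solves_cell_problem d.+2 ck ->
  ck * acoef d.+1 <= spread d ^+ 4.
Proof.
move=> c0 sc; apply: (le_trans (cell_upper c0 sc)).
by rewrite spread4 lef_pV2 ?posrE ?ltr0n// ler_nat.
Qed.

Lemma transition_error (Z sp Q e : R) : 0 <= Z -> 0 < sp -> 0 < e -> Z * sp <= Q ->
  sp <= Num.sqrt (e / (Q ^+ 2 + 1)) -> Z ^+ 2 * sp ^+ 4 <= e.
Proof.
move=> Z0 sp0 e0 ZQ sd.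
have -> : Z ^+ 2 * sp ^+ 4 = (Z * sp) ^+ 2 * sp ^+ 2 by ring.
have z0 : 0 <= Z * sp by apply: mulr_ge0 => //; exact: ltW.
apply: (@le_trans _ _ (Q ^+ 2 * (e / (Q ^+ 2 + 1)))).
  apply: ler_pM; [exact: sqr_ge0|exact: sqr_ge0| |].
    by rewrite lerXn2r ?nnegrE// (le_trans z0).
  have q1 : 0 <= e / (Q ^+ 2 + 1) by apply: divr_ge0; [exact: ltW|rewrite addr_ge0 ?sqr_ge0].
  by rewrite -[leRHS](sqr_sqrtr q1) lerXn2r ?nnegrE ?sqrtr_ge0// ltW.
rewrite mulrCA; apply: ler_piMr; first exact: ltW.
by rewrite ler_pdivrMr ?mul1r ?lerDl// ltr_wpDl// sqr_ge0.
Qed.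

Lemma FBZ_limsup (c epsbar eps : nat -> R) (u : R -> R) :
  (forall k, (2 <= k)%N -> 0 < c k /\ solves_cell_problem k (c k)) ->
  (forall k, 0 < epsbar k <= k.+1%:R^-1) ->
  (forall k, (3 <= k)%N -> 0 < eps k <= epsbar k) -> u \in L2 0 1 ->
  exists u_ : nat -> R -> R, [/\ forall k, u_ k \in L2 0 1, L2_cvg u_ u &
    (limn_esup (fun k => G c eps k (u_ k)) <= FBZ u)%E].
Proof.
move=> hc eb He uL; have [pu|npu] := pselect (piecewise_H2 u); last first.
  exists (fun=> u); split => //; last by rewrite /FBZ asboolF// leey.
  apply/(L2_cvgP (fun=> uL) uL); apply: cvg_near_cst; apply: nearW => k.
  rewrite (@eq_Int _ _ _ _ (fun=> 0)) ?Int_cst ?mul0r// => x _.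
  by rewrite patchE /= subrr; case: ifP; rewrite expr0n.
have [s pws] := pu; have [g [A [B nf]]] := nform_exists uL pws.
have lg : l2 g by case: nf.
rewrite (FBZ_E nf); set IG := Int 0 1 _; set jc := jump_cost s A B.
have [K [sK eK aK]] := poly_approx lg.
(* For k < 3 nothing is assumed on [eps k]; the default 1 keeps the width positive. *)
pose w k : R := if (3 <= k)%N then eps k else 1.
have w0 k : 0 < w k by rewrite /w; case: ifP => // k3; have /andP[] := He k k3.
pose Y d := knot_seq s A B (spread d).
pose u_ k := recov (k - 3) (K (k - 3)%N) (Y (k - 3)%N) (A 0%N) (B 0%N) (w k) 0.
pose Q := slope_sum s B + 2 * jump_sum s A B.
have S0 : 0 <= slope_sum s B by apply: sumr_ge0.
have H0 : 0 <= jump_sum s A B by apply: sumr_ge0.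
have Q0 : 0 <= Q by rewrite /Q; nneg.
pose Z d := \sum_(p <- Y d) `|p.2|.
have Z0 d : 0 <= Z d by apply: sumr_ge0.
have ZQ d : Z d * spread d <= Q.
  have sp := spread_gt0 d.
  apply: (@le_trans _ _ ((slope_sum s B + jump_sum s A B * (2 / spread d)) * spread d)).
    by apply: ler_wpM2r; [exact: ltW|exact: knots_mass].
  have -> : (slope_sum s B + jump_sum s A B * (2 / spread d)) * spread d =
      slope_sum s B * spread d + 2 * jump_sum s A B by field; rewrite gt_eqF.
  by rewrite lerD2r; apply: ler_piMr => //; exact: spread_le1.
have Y0 d (p : R * R) : p \in Y d -> 0 <= p.1.
  by move=> pY; apply: (@knots_ge0 s u g A B nf (spread d)) => //; rewrite ltW// spread_gt0.
have lu_ k : l2 (u_ k) by exact: (@recov_chain R (k - 3) (K (k - 3)%N) (Y (k - 3)%N) (A 0%N) (B 0%N) (w k)).1 0%N.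
have uL_ k : u_ k \in L2 0 1 by exact: l2_L2.
exists u_; split => //.
  apply/(L2_cvgP uL_ uL); apply/cvgrPdist_le => e e0.
  pose e1 := Num.sqrt e / 4; have e10 : 0 < e1 by rewrite divr_gt0// sqrtr_gt0.
  have [D HD] := aK e1 e10.
  have n1 : \forall d \near \oo, (D <= d)%N by exact: nbhs_infty_ge.
  have n2 : \forall d \near \oo, spread d <= e1 / (Q + 1).
    by apply: spread_cvg; rewrite divr_gt0// ltr_wpDl.
  have n3 : \forall d \near \oo, spread d <= e / (4 * (jump_sum s A B ^+ 2 + 1)).
    by apply: spread_cvg; rewrite divr_gt0// mulr_gt0// ltr_wpDl// sqr_ge0.
  have key : \forall d \near \oo,
      Int 0 1 (fun x => ((u_ (d + 3)%N \- u) \_ `]0%R, 1%R[%classic) x ^+ 2) <= e.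
    near=> d; have m1 : (D <= d)%N by near: d.
    have m2 : spread d <= e1 / (Q + 1) by near: d.
    have m3 : spread d <= e / (4 * (jump_sum s A B ^+ 2 + 1)) by near: d.
    have sp := spread_gt0 d.
    have Zw : Z d * w (d + 3)%N <= e1.
      (* Here the bound [epsbar k] <= 1/(k + 1) enters: the transitions are so narrow that the total
         slope, of order 1/spread, times their width tends to 0. *)
      have we : w (d + 3)%N <= spread d ^+ 2.
        rewrite /w leq_addl; have /andP[_ h] := He (d + 3)%N (leq_addl _ _).
        have /andP[_ h'] := eb (d + 3)%N; apply: (le_trans h); apply: (le_trans h').
        apply: (@le_trans _ _ (spread d ^+ 4)).
          by rewrite spread4 lef_pV2 ?posrE ?ltr0n// ler_nat ltnS leq_addr.
        by apply: ler_wiXn2l => //; [exact: ltW|exact: spread_le1].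
      apply: (@le_trans _ _ (Z d * spread d ^+ 2)); first exact: ler_wpM2l.
      rewrite expr2 mulrA; apply: (@le_trans _ _ (Q * (e1 / (Q + 1)))).
        by apply: ler_pM => //; [apply: mulr_ge0 => //; exact: ltW|exact: ltW].
      rewrite mulrCA; apply: ler_piMr; first exact: ltW.
      by rewrite ler_pdivrMr ?mul1r ?lerDl// ltr_wpDl.
    have ap t : 0 <= t <= 1 -> `|u_ (d + 3)%N t - (SI 0 (SI 0 g) t + (A 0%N + B 0%N * t) + ramp (Y d) t)| <= e1 + Z d * w (d + 3)%N.
      move=> t01; rewrite /u_ addnK.
      apply: (@recov_approx R d (K d) (Y d) (A 0%N) (B 0%N) (w (d + 3)%N) (w0 _) g e1 lg (Y0 d) _ t t01).
      by move=> x x01; exact: HD.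
    apply: (le_trans (knots_L2 nf sp (lu_ _) _ ap)).
      by apply: addr_ge0; [exact: ltW|apply: mulr_ge0 => //; exact: ltW].
    have b1 : 2 * (e1 + Z d * w (d + 3)%N) ^+ 2 <= e / 2.
      apply: (@le_trans _ _ (2 * (e1 + e1) ^+ 2)).
        apply: ler_wpM2l => //; rewrite lerXn2r ?nnegrE ?lerD2l//.
          by apply: addr_ge0; [exact: ltW|apply: mulr_ge0 => //; exact: ltW].
        by apply: addr_ge0; exact: ltW.
      have -> : 2 * (e1 + e1) ^+ 2 = Num.sqrt e ^+ 2 / 2 by rewrite /e1; field.
      by rewrite sqr_sqrtr// ltW.
    have b2 : 2 * (jump_sum s A B ^+ 2 * spread d) <= e / 2.
      have j2 : 0 <= jump_sum s A B ^+ 2 by exact: sqr_ge0.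
      apply: (@le_trans _ _ (2 * ((jump_sum s A B ^+ 2 + 1) * (e / (4 * (jump_sum s A B ^+ 2 + 1)))))).
        apply: ler_wpM2l => //; apply: ler_pM => //; [exact: ltW|by rewrite lerDl].
      by rewrite le_eqVlt; apply/orP; left; apply/eqP; field; rewrite gt_eqF// ltr_wpDl.
    by rewrite [leRHS]splitr lerD.
  apply: near_infty_shift3; apply: filterS key => d.
  rewrite addn3 sub0r normrN ger0_norm//.
  by apply: Int_ge0 => x _; exact: sqr_ge0.
apply: limn_esup_le => e e0.
have n1 : \forall d \near \oo, spread d <= Num.sqrt (e / (Q ^+ 2 + 1)).
  by apply: spread_cvg; rewrite sqrtr_gt0 divr_gt0// ltr_wpDl// sqr_ge0.
have key : \forall d \near \oo, (G c eps d.+3 (u_ d.+3) <= (IG + jc + e)%:E)%E.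
  apply: filterS n1 => d sd; have sp := spread_gt0 d.
  have [c0 sc] := hc d.+2 isT.
  have uE : u_ d.+3 = recov d (K d) (Y d) (A 0%N) (B 0%N) (w d.+3) 0.
    by rewrite /u_ !subSS subn0.
  have ew : eps d.+3 = w d.+3 by [].
  rewrite uE; apply: (le_trans (@recov_energy R d (K d) (Y d) (A 0%N) (B 0%N) (w d.+3) (sK d) (w0 d.+3) c eps c0 ew (Y0 d))).
  have sY : (size (Y d))%:R = jc :> R by exact: size_knots.
  rewrite lee_fin sY; apply: lerD; first by apply: lerD => //; exact: eK.
  apply: (le_trans (ler_wpM2l (sqr_ge0 _) (cell_le_spread c0 sc))).
  exact: (@transition_error (Z d) (spread d) Q e (Z0 d) sp e0 (ZQ d) sd).
exact: near_infty_shift3 key.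
Unshelve. all: by end_near. Qed.

End upper_bound.

Theorem theorem25 (R : realType) (c : nat -> R)
  (hc : forall k, (2 <= k)%N -> 0 < c k /\ solves_cell_problem k (c k)) :
  exists epsbar : nat -> R,
    [/\ forall k, 0 < epsbar k,
        epsbar k @[k --> \oo] --> (0 : R) &
        forall eps : nat -> R,
          (forall k, (3 <= k)%N -> 0 < eps k <= epsbar k) ->
          Gamma_cvg_L2 (G c eps) FBZ].
Proof.
have [epsbar sc] := scale_exists (fun k k2 => (hc k k2).1).
have [eb _] := sc; exists epsbar; split.
- by move=> k; have /andP[] := eb k.
- apply: (@squeeze_cvgr _ _ _ _ (fun=> 0) (fun k => k.+1%:R^-1)).
  + by apply: nearW => k; have /andP[/ltW -> ->] := eb k.
  + exact: cvg_cst.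
  + exact: cvg_harmonic.
move=> eps He u uL; split; last exact: (FBZ_limsup hc eb He uL).
by move=> u_ ukL cv; exact: (FBZ_liminf hc sc He uL ukL cv).
Qed.
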